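(* Let $n\ge1$, let $\lambda=\{\lambda_0<\lambda_1<\dots<\lambda_n\}$ be a set of distinct real numbers, let $I_j=[\lambda_{j-1},\lambda_j]$ and, for $\sigma\in\Sigma_n$, let $I^n_\sigma=I_{\sigma(1)}\times\cdots\times I_{\sigma(n)}$. The preimage of a single cube $I^n_\sigma$ of the set $\mathcal{R}_n=\bigcup_{\sigma\in\Sigma_n}I^n_\sigma$ under the map $\tilde\mu\colon Q_n\to\mathcal{R}_n$ is diffeomorphic to the polytope $\mathcal{B}^n$. The map $\tilde\mu\colon\tilde\mu^{-1}(I^n_\sigma)\to I^n_\sigma$ is the map $\mathcal{B}^n\to I^n$ which blows down the cut faces. The polytope $\mathcal{B}^n$ is the fundamental domain of the $\Sigma_n$-action on $Q_n$, of the $\mathcal{N}_n$-action on $M_{\mathrm{St}_n,\lambda}$, and of the $\mathcal{N}^{\mathbb{R}}_n$-action on $M^{\mathbb{R}}_{\mathrm{St}_n,\lambda}$.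
   Context: Arrow matrices. Rows and columns are indexed by $0,\dots,n$. A Hermitian arrow matrix is a Hermitian $(n+1)\times(n+1)$-matrix whose entries vanish outside the main diagonal, row $0$ and column $0$; its diagonal entries are $a_0,\dots,a_n\in\mathbb{R}$ and its $(0,i)$-entries are $b_i\in\mathbb{C}$, $i=1,\dots,n$. $M_{\mathrm{St}_n,\lambda}$ is the smooth $2n$-manifold of Hermitian arrow matrices with spectrum $\lambda$, and $M^{\mathbb{R}}_{\mathrm{St}_n,\lambda}$ is the smooth $n$-manifold of real symmetric ones. $T^n=T^{n+1}/\Delta(T^1)$ (diagonal unitary matrices modulo scalars) acts on $M_{\mathrm{St}_n,\lambda}$ by conjugation, and $\mathbb{Z}_2^n$ acts on $M^{\mathbb{R}}_{\mathrm{St}_n,\lambda}$ by conjugation with diagonal $\pm1$ matrices. The actions are locally standard; $Q_n=M_{\mathrm{St}_n,\lambda}/T^n=M^{\mathbb{R}}_{\mathrm{St}_n,\lambda}/\mathbb{Z}_2^n$ is a manifold with corners. It is identified with the subset of matrices with all $b_i\ge0$, which gives a section of the projections to $Q_n$. The map $\tilde\mu\colon Q_n\to\mathcal{R}_n$ is induced by $A\mapsto(a_1,\dots,a_n)$, and its image is $\mathcal{R}_n$. Group actions. $\Sigma_n$ acts on arrow matrices by simultaneously permuting rows and columns $1,\dots,n$; it acts on $M_{\mathrm{St}_n,\lambda}$, $M^{\mathbb{R}}_{\mathrm{St}_n,\lambda}$, $Q_n$, and on $\mathcal{R}_n$ by permuting coordinates. $\mathcal{N}_n=T^n\rtimes\Sigma_n$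 and $\mathcal{N}^{\mathbb{R}}_n=\mathbb{Z}_2^n\rtimes\Sigma_n$, where $\Sigma_n$ permutes coordinates; they act on $M_{\mathrm{St}_n,\lambda}$ and $M^{\mathbb{R}}_{\mathrm{St}_n,\lambda}$ respectively. A fundamental domain is a closed subset meeting every orbit, whose interior points lie in pairwise distinct orbits; $\mathcal{B}^n$ is realized in $Q_n$ as $\tilde\mu^{-1}(I^n_\sigma)$ and in the matrix manifolds $M_{\mathrm{St}_n,\lambda}$ and $M^{\mathbb{R}}_{\mathrm{St}_n,\lambda}$ as the image of this set under the section that sends each point of $Q_n$ (an orbit of $T^n$, respectively of $\mathbb{Z}_2^n$) to its unique representative matrix with all $b_i\ge0$. The polytope $\mathcal{B}^n$. Let $I^n=[-1,1]^n$, with facets $\mathcal{F}_{\delta k}=\{x\in I^n\mid x_k=\delta\}$, $\delta=\pm1$, $k=1,\dots,n$. For $i=1,\dots,n-1$ let $F_{\sigma_i}=\mathcal{F}_{i}\cap\mathcal{F}_{-(i+1)}=\{x_i=1,\ x_{i+1}=-1\}$, a codimension-two face. $\mathcal{B}^n$ is the simple polytope obtained from $I^n$ by consecutively cutting off all faces $F_{\sigma_i}$, $i=1,\dots,n-1$ (the combinatorial type does not depend on the order of cuts). Cutting off a face means intersecting with a half-space whose boundary hyperplane strictly separates the vertices of the face from all other vertices. The new facet $\mathcal{F}_{\sigma_i}$ produced by cutting $F_{\sigma_i}$ has the form $I^1\times G_i$ for a polytope $G_i$; blowing down the cut faces means collapsing the interval factor $I^1$ of each $\mathcal{F}_{\sigma_i}$,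 so as to recover the cube. The cube $I^n_\sigma$ is identified with $I^n$ by ordering the coordinates so that the $k$-th one lies in $[\lambda_{k-1},\lambda_k]$ and rescaling each interval to $[-1,1]$ by the increasing affine map. *)

(* Defs.v *)
From Stdlib Require Export Relation_Operators.
From mathcomp Require Export all_boot all_order all_algebra all_fingroup.
From mathcomp Require Export complex.
From mathcomp Require Export all_classical all_reals all_analysis.

Set Implicit Arguments.
Unset Strict Implicit.
Unset Printing Implicit Defensive.

Export Order.TTheory GRing.Theory Num.Theory numFieldNormedType.Exports.

#[global] Open Scope classical_set_scope.
#[global] Open Scope ring_scope.

(** * Smooth maps between arbitrary subsets of Euclidean spaces *)

Fixpoint Ck {R : realType} {V W : normedModType R} (k : nat)
    (U : set V) (f : V -> W) : Prop :=
  if k is k'.+1 then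
    (forall x, U x -> differentiable f x) /\
    (forall v, Ck k' U (fun x => 'D_v f x))
  else forall x, U x -> {for x, continuous f}.

(* A map defined on an arbitrary subset A is smooth when, near each point of A,
   it is the restriction of a C^oo map defined on an open set. *)
Definition smooth_on {R : realType} {V W : normedModType R}
    (A : set V) (f : V -> W) : Prop :=
  forall x, A x -> exists (U : set V) (g : V -> W),
    [/\ open U, U x, forall k, Ck k U g & forall y, A y -> U y -> f y = g y].

Definition diffeomorphism {R : realType} {V W : normedModType R}
    (A : set V) (B : set W) (f : V -> W) : Prop :=
  [/\ smooth_on A f, f @` A = B &
      exists g : W -> V, [/\ smooth_on B g,
        forall x, A x -> g (f x) = x & forall y, B y -> f (g y) = y]].

(** * The polytope B^n *)

Definition dot {R : realType} {n : nat} (c x : 'rV[R]_n) : R :=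
  \sum_(k < n) c 0 k * x 0 k.

Definition polytope {R : realType} {n : nat} (P : set 'rV[R]_n) : Prop :=
  exists (m : nat) (v : 'I_m -> 'rV[R]_n),
    P = [set x | exists w : 'I_m -> R,
      [/\ forall j, 0 <= w j, \sum_j w j = 1 & x = \sum_j w j *: v j]].

(* A vertex of a polytope is a face consisting of one point. *)
Definition vertex {R : realType} {n : nat} (P : set 'rV[R]_n) (v : 'rV[R]_n) :
    Prop :=
  P v /\ exists c, forall x, P x -> x <> v -> dot c x < dot c v.

Definition cube {R : realType} {n : nat} : set 'rV[R]_n :=
  [set x | forall k, -1 <= x 0 k <= 1].

Definition cube_facet {R : realType} {n : nat} (delta : R) (k : 'I_n) :
    set 'rV[R]_n :=
  [set x | cube x /\ x 0 k = delta].

(* The index i : 'I_n.-1 stands for the simple transposition exchanging the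
   consecutive positions [lo i] and [hi i] of 'I_n. *)
Definition lo {n : nat} (i : 'I_n.-1) : 'I_n := widen_ord (leq_pred n) i.

Lemma hi_subproof {n : nat} (i : 'I_n.-1) : (i.+1 < n)%N.
Proof. by rewrite -ltn_predRL. Qed.

Definition hi {n : nat} (i : 'I_n.-1) : 'I_n := Ordinal (hi_subproof i).

Definition cube_face {R : realType} {n : nat} (i : 'I_n.-1) : set 'rV[R]_n :=
  cube_facet 1 (lo i) `&` cube_facet (-1) (hi i).

(* The cube truncated by the half-spaces dot (c i) x <= d i, for i in l. *)
Definition cut_cube {R : realType} {n : nat} (c : 'I_n.-1 -> 'rV[R]_n)
    (d : 'I_n.-1 -> R) (l : seq 'I_n.-1) : set 'rV[R]_n :=
  [set x | cube x /\ forall i, i \in l -> dot (c i) x <= d i].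

Definition cuts_off {R : realType} {n : nat} (c : 'rV[R]_n) (d : R)
    (F P : set 'rV[R]_n) : Prop :=
  (forall v, vertex P v -> F v -> d < dot c v) /\
  (forall v, vertex P v -> ~ F v -> dot c v < d).

(* The sequence l lists all the faces in the order in which they are cut off;
   each half-space is tested against the polytope produced by the cuts made
   before it.  Then [cut_cube c d l] is a realization of B^n. *)
Definition cut_sequence {R : realType} {n : nat} (c : 'I_n.-1 -> 'rV[R]_n)
    (d : 'I_n.-1 -> R) (l : seq 'I_n.-1) : Prop :=
  perm_eq l (enum 'I_n.-1) /\
  forall l1 i l2, l = l1 ++ i :: l2 ->
    cuts_off (c i) (d i) (cube_face i) (cut_cube c d l1).

Definition cut_facet {R : realType} {n : nat} (c : 'I_n.-1 -> 'rV[R]_n)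
    (d : 'I_n.-1 -> R) (l : seq 'I_n.-1) (i : 'I_n.-1) : set 'rV[R]_n :=
  [set x | cut_cube c d l x /\ dot (c i) x = d i].

(** * Blowing down the cut faces *)

Definition I1_times {R : realType} {n : nat} (G : set 'rV[R]_n) :
    set (R * 'rV[R]_n) :=
  [set x | -1 <= x.1 <= 1 /\ G x.2].

(* A product structure I^1 x G on the i-th cut facet.  The condition on the end
   facets of I^1 x G singles out the interval factor: it is the one joining the
   facets of B^n that come from the two cube facets meeting in the cut face. *)
Definition interval_structure {R : realType} {n : nat}
    (c : 'I_n.-1 -> 'rV[R]_n) (d : 'I_n.-1 -> R) (l : seq 'I_n.-1)
    (i : 'I_n.-1) (G : set 'rV[R]_n) (h : R * 'rV[R]_n -> 'rV[R]_n) : Prop :=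
  [/\ polytope G,
      diffeomorphism (I1_times G) (cut_facet c d l i) h,
      h @` [set x | x.1 = 1 /\ G x.2] =
        cut_facet c d l i `&` cube_facet 1 (lo i) &
      h @` [set x | x.1 = -1 /\ G x.2] =
        cut_facet c d l i `&` cube_facet (-1) (hi i)].

Definition same_interval {R : realType} {n : nat} (G : 'I_n.-1 -> set 'rV[R]_n)
    (h : 'I_n.-1 -> R * 'rV[R]_n -> 'rV[R]_n) (x y : 'rV[R]_n) : Prop :=
  exists i s t g,
    [/\ I1_times (G i) (s, g), I1_times (G i) (t, g),
        x = h i (s, g) & y = h i (t, g)].

(* p presents the cube as the quotient of B^n = [cut_cube c d l] in which
   exactly the interval factors of the cut facets are collapsed, and it matches
   the facets of B^n with the facets and the cut faces of the cube. *)
Definition blows_down {R : realType} {n : nat} (c : 'I_n.-1 -> 'rV[R]_n)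
    (d : 'I_n.-1 -> R) (l : seq 'I_n.-1) (p : 'rV[R]_n -> 'rV[R]_n) : Prop :=
  let B := cut_cube c d l in
  [/\ {within B, continuous p},
      p @` B = cube,
      forall (delta : R) k, delta = 1 \/ delta = -1 ->
        p @` (B `&` cube_facet delta k) = cube_facet delta k,
      forall i, p @` cut_facet c d l i = cube_face i &
      exists (G : 'I_n.-1 -> set 'rV[R]_n)
             (h : 'I_n.-1 -> R * 'rV[R]_n -> 'rV[R]_n),
        (forall i, interval_structure c d l i (G i) (h i)) /\
        (forall x y, B x -> B y ->
           (p x = p y <-> clos_refl_sym_trans _ (same_interval G h) x y))].

(** * Spaces of isospectral arrow matrices *)

Definition complexify {R : realType} {n : nat} (A : 'M[R]_n) : 'M[R[i]]_n :=
  map_mx (real_complex R) A.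

Definition arrow_matrix {K : fieldType} {n : nat} (A : 'M[K]_n.+1) : Prop :=
  forall i j, i != 0 -> j != 0 -> i != j -> A i j = 0.

Definition M_St {R : realType} {n : nat} (lam : 'I_n.+1 -> R) :
    set 'M[R[i]]_n.+1 :=
  [set A | [/\ A \is hermsymmx, arrow_matrix A &
    forall z, eigenvalue A z <-> exists j, z = real_complex R (lam j)]].

Definition M_StR {R : realType} {n : nat} (lam : 'I_n.+1 -> R) :
    set 'M[R]_n.+1 :=
  [set A | M_St lam (complexify A)].

(* The orbit space of both M_St and M_StR, identified with the set of matrices
   all of whose b_i are nonnegative reals; its smooth structure with corners is
   the one it has as a subset of the space of real matrices.  The sections are
   [complexify] into M_St and the inclusion into M_StR. *)
Definition Q_St {R : realType} {n : nat} (lam : 'I_n.+1 -> R) :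
    set 'M[R]_n.+1 :=
  [set A | M_StR lam A /\ forall k : 'I_n, 0 <= A 0 (lift ord0 k)].

Definition mu {R : realType} {n : nat} (A : 'M[R]_n.+1) : 'rV[R]_n :=
  \row_(k < n) A (lift ord0 k) (lift ord0 k).

(* The product of the intervals [lambda_(sigma(k)-1), lambda_(sigma(k))]; with
   positions counted from 0, the j-th interval is [lam j, lam j.+1]. *)
Definition cube_sigma {R : realType} {n : nat} (lam : 'I_n.+1 -> R)
    (sigma : 'S_n) : set 'rV[R]_n :=
  [set x | forall k, lam (widen_ord (leqnSn n) (sigma k)) <= x 0 k
                     <= lam (lift ord0 (sigma k))].

(* The identification of cube_sigma with the standard cube: the coordinate
   lying in the k-th interval is put in position k, then rescaled. *)
Definition cube_chart {R : realType} {n : nat} (lam : 'I_n.+1 -> R)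
    (sigma : 'S_n) (x : 'rV[R]_n) : 'rV[R]_n :=
  \row_(k < n)
    let a := lam (widen_ord (leqnSn n) k) in
    let b := lam (lift ord0 k) in
    (2 * x 0 ((sigma^-1)%g k) - a - b) / (b - a).

Definition mu_preimage {R : realType} {n : nat} (lam : 'I_n.+1 -> R)
    (sigma : 'S_n) : set 'M[R]_n.+1 :=
  Q_St lam `&` mu @^-1` cube_sigma lam sigma.

(** * Group actions and fundamental domains *)

Definition perm_conj {K : fieldType} {n : nat} (tau : 'S_n) (A : 'M[K]_n.+1) :
    'M[K]_n.+1 :=
  let s := lift_perm ord0 ord0 tau in
  \matrix_(i, j) A ((s^-1)%g i) ((s^-1)%g j).

Definition diag_conj {K : fieldType} {n : nat} (t : 'rV[K]_n) (A : 'M[K]_n) :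
    'M[K]_n :=
  diag_mx t *m A *m invmx (diag_mx t).

Definition Sigma_orbit {R : realType} {n : nat} (A B : 'M[R]_n.+1) : Prop :=
  exists tau : 'S_n, B = perm_conj tau A.

(* Elements of T^n are represented by elements t of T^(n+1): scalars act
   trivially, so that the orbits are the same. *)
Definition N_orbit {R : realType} {n : nat} (A B : 'M[R[i]]_n.+1) : Prop :=
  exists (t : 'rV[R[i]]_n.+1) (tau : 'S_n),
    (forall j, `|t 0 j| = 1) /\ B = diag_conj t (perm_conj tau A).

Definition NR_orbit {R : realType} {n : nat} (A B : 'M[R]_n.+1) : Prop :=
  exists (t : 'rV[R]_n.+1) (tau : 'S_n),
    (forall j, t 0 j = 1 \/ t 0 j = -1) /\ B = diag_conj t (perm_conj tau A).

Definition interior_in {V : topologicalType} (X D : set V) : set V :=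
  [set x | D x /\ exists U : set V, [/\ open U, U x & X `&` U `<=` D]].

(* D is a copy of a polytope inside X, and Dint is the copy of the interior of
   that polytope.  When dim D < dim X the topological interior of D in X is
   empty, so the condition on interior points is imposed on Dint as well. *)
Definition fundamental_domain {V : topologicalType} (X : set V)
    (same_orbit : V -> V -> Prop) (D Dint : set V) : Prop :=
  [/\ D `<=` X,
      exists2 C : set V, closed C & D = X `&` C,
      forall x, X x -> exists2 y, D y & same_orbit x y &
      forall x y, (interior_in X D `|` Dint) x ->
        (interior_in X D `|` Dint) y -> same_orbit x y -> x = y].

(* Main.v *)
(** Index the intervals by k, so that lam_k <= a_k <= lam_(k+1).  Comparing the
    values of the characteristic polynomial at the a_k gives
    b_k^2 = P_k Q_k G_k(a) with G_k(a) > 0, where P_k and Q_k stand for the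
    quotients (a_k - lam_k) / (a_k - a_(k-1)) and
    (lam_(k+1) - a_k) / (a_(k+1) - a_k).  They satisfy Q_k + P_(k+1) = 1; on a
    wall a_k = lam_(k+1) = a_(k+1) both quotients become 0/0 and this equation
    is the only constraint left, so that the fibre of the diagonal over it is an
    interval.

    The truncated cube is mapped to the data (a, b) by explicit smooth formulas
    involving, for each wall, a cutoff function of the distance to the cut facet
    which vanishes exactly there.  A vector killed by the derivative of this map
    satisfies a homogeneous linear system indexed by the cuts.  The system is
    nonsingular: its determinant is multilinear in the rows, and for extreme
    values of the weights it is positive by induction on the cuts, since the
    edge of the polytope leaving the last cut face determines, by Cramer's rule,
    the sign of the quotient of two consecutive determinants.  Hence the map is
    an immersion.  On the interior a is a local homeomorphism onto an open box;
    lifting segments shows that all its fibres are as large as those near a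
    vertex, which are points.  Limits extend the bijection to the boundary, and
    the inverse is smooth because the map is an injective immersion.

    For cuts parallel to the obvious hyperplanes x_i - x_(i+1) = const the cut
    facets are products I x G literally; composing with the inverse of one
    parametrization transports this product structure to arbitrary cuts.

    The points of both kinds of interior have pairwise distinct a_k, ordered as
    prescribed by sigma, and b_k >= 0; so only the identity permutation and
    trivial phases can relate two of them. *)

Require Import Defs.
From HB Require Import structures.
From mathcomp Require Import ring lra zify.

Set Implicit Arguments.
Unset Strict Implicit.
Unset Printing Implicit Defensive.

(** * Calculus of C^k maps *)

(** The parametrization has to fit two kinds of boundary. Near a facet of the quotient the natural
    coordinate is [b_k], while [a_k - lam_k] behaves like its square; hence the squared facet
    distances in [left_part] and [right_part], which turn the square root of [P_k Q_k G_k] into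
    distances times a smooth positive factor. Near a cut facet the coordinate is [a_(k+1) - a_k], so
    the cutoff vanishes there to first order. It is constant away from that facet because the
    half-spaces are arbitrary: signs are known only for determinants formed from cuts at a common
    vertex of the cube, which are never consecutive, and no other cuts may enter the linear system.

    Diagonals do not separate the points of a cut facet, so boundary arguments use the triple
    [(a, P, Q)]. Density alone would not preserve injectivity in the limit. What does is that [P]
    and [Q] become weighted means of their end values when two diagonals are joined by a segment: a
    path between approximations of two points with equal triples keeps its triple almost constant,
    against local injectivity where it leaves a small ball. *)

Section Ck_calculus.
Context {R : realType}.
Implicit Types (V W Z : normedModType R).

(** With its converse [eps_differentiable], this trades the little-o definition for an explicit
    inequality, the form in which differentials are identified by hand below. *)
Lemma differentiable_eps V W (f : V -> W) (x : V) :
  differentiable f x -> forall e, 0 < e ->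
  \forall h \near (0 : V), `|f (h + x) - f x - 'd f x h| <= e * `|h|.
Proof.
move=> /diff_locally /eqaddoP df e e0; have := df e e0.
by apply: filter_app; near=> h => /=; rewrite !fctE /= opprD addrA.
Unshelve. all: by end_near. Qed.

Lemma eps_differentiable V W (f : V -> W) (L : {linear V -> W}) (x : V) :
  continuous L ->
  (forall e, 0 < e ->
    \forall h \near (0 : V), `|f (h + x) - f x - L h| <= e * `|h|) ->
  differentiable f x /\ 'd f x = L :> (V -> W).
Proof.
move=> cL H.
have E : f \o shift x = cst (f x) + L +o_ (0 : V) id.
  apply/eqaddoP => e e0; have := H e e0; apply: filter_app.
  by near=> h => /=; rewrite !fctE /= opprD addrA.
have dE := diff_unique cL E; split=> //.
by apply/diff_locallyP; rewrite dE; split.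
Unshelve. all: by end_near. Qed.

Lemma near_eq_differentiable V W (f g : V -> W) (x : V) :
  (\near x, f x = g x) -> differentiable f x -> differentiable g x.
Proof.
move=> fg df.
have fgx : f x = g x := nbhs_singleton fg.
suff [] : differentiable g x /\ 'd g x = 'd f x :> (V -> W) by [].
apply: eps_differentiable; first exact: diff_continuous.
move=> e e0; have := differentiable_eps df e0.
have fg' : \forall h \near (0 : V), f (h + x) = g (h + x).
  move: fg; rewrite (near_shift 0 x).
  by apply: filterS => h /=; rewrite subr0.
apply: filter_app; move: fg'; apply: filterS => h <-; by rewrite fgx.
Qed.

Lemma open_near_eq V W (U : set V) (f g : V -> W) x : open U -> U x ->
  (forall y, U y -> f y = g y) -> \near x, f x = g x.
Proof.
by move=> oU Ux fg; have := open_nbhs_nbhs (conj oU Ux); apply: filterS.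
Qed.

Lemma Ck_eq V W k (U : set V) (f g : V -> W) : open U ->
  (forall x, U x -> f x = g x) -> Ck k U f -> Ck k U g.
Proof.
move=> oU; elim: k f g => [|k IH] f g fg /=.
  move=> cf x Ux; have E := open_near_eq oU Ux fg.
  have cfx : f y @[y --> x] --> f x := cf x Ux.
  change (g y @[y --> x] --> g x); rewrite -(fg x Ux).
  by apply: cvg_trans cfx; exact: near_eq_cvg.
move=> [df Df]; split=> [x Ux|v].
  exact: near_eq_differentiable (open_near_eq oU Ux fg) (df x Ux).
apply: IH (Df v) => x Ux; apply: near_eq_derive.
exact: open_near_eq oU Ux fg.
Qed.

Lemma Ck_sub V W k (U U' : set V) (f : V -> W) :
  U' `<=` U -> Ck k U f -> Ck k U' f.
Proof.
move=> sU; elim: k f => [|k IH] f /=; first by move=> cf x /sU /cf.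
by move=> [df Df]; split=> [x /sU /df //|v]; apply: IH.
Qed.

Lemma CkS V W k (U : set V) (f : V -> W) : Ck k.+1 U f -> Ck k U f.
Proof.
elim: k f => [|k IH] f.
  by move=> [df _] x Ux; apply: differentiable_continuous; apply: df.
by move=> [df Df]; split=> // v; apply: IH.
Qed.

Lemma Ck_continuous V W k (U : set V) (f : V -> W) : Ck k U f ->
  forall x, U x -> {for x, continuous f}.
Proof. by elim: k f => [//|k IH] f /CkS /IH. Qed.

Lemma Ck_cst V W k (U : set V) (a : W) : Ck k U (fun _ : V => a).
Proof.
elim: k a => [|k IH] a /=; first by move=> x _; apply: cvg_cst.
split=> [x _|v]; first exact: differentiable_cst.
have -> : 'D_v (fun=> a) = fun _ : V => (0 : W).
  by apply/funext => x; exact: derive_cst.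
exact: IH.
Qed.

Lemma Ck_linear V W k (U : set V) (L : {linear V -> W}) :
  continuous L -> Ck k U L.
Proof.
move=> cL; case: k => [|k] /=; first by move=> x _; apply: cL.
split=> [x _|v]; first exact: linear_differentiable.
have -> : 'D_v L = fun _ : V => L v.
  apply/funext => x; rewrite deriveE; last exact: linear_differentiable.
  by rewrite diff_lin.
exact: Ck_cst.
Qed.

Lemma derive_linear_comp V W Z (L : {linear W -> Z}) (f : V -> W) x v :
  continuous L -> differentiable f x ->
  'D_v (L \o f) x = L ('D_v f x).
Proof.
move=> cL df; have dL : differentiable L (f x) by exact: linear_differentiable.
rewrite deriveE; last exact: differentiable_comp.
by rewrite diff_comp //= diff_lin // deriveE.
Qed.

Lemma Ck_linear_comp V W Z k (U : set V) (L : {linear W -> Z}) (f : V -> W) :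
  open U -> continuous L -> Ck k U f -> Ck k U (fun x => L (f x)).
Proof.
move=> oU cL; elim: k f => [|k IH] f /=.
  by move=> cf x Ux; apply: (@continuous_comp _ _ _ f L); [exact: cf|exact: cL].
move=> [df Df]; split=> [x Ux|v].
  have dL : differentiable L (f x) by exact: linear_differentiable.
  by apply: (differentiable_comp (df x Ux) dL).
apply: (Ck_eq oU _ (IH _ (Df v))) => x Ux.
by rewrite -derive_linear_comp //; apply: df.
Qed.

Lemma CkD V W k (U : set V) (f g : V -> W) : open U ->
  Ck k U f -> Ck k U g -> Ck k U (fun x => f x + g x).
Proof.
move=> oU; elim: k f g => [|k IH] f g /=.
  by move=> cf cg x Ux; apply: cvgD; [exact: cf|exact: cg].
move=> [df Df] [dg Dg]; split=> [x Ux|v].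
  exact: differentiableD (df x Ux) (dg x Ux).
apply: (Ck_eq oU _ (IH _ _ (Df v) (Dg v))) => x Ux.
by rewrite (@deriveD _ _ _ f g x v) //; apply: diff_derivable; [exact: df|exact: dg].
Qed.

Lemma Ck_sum V W k (U : set V) (I : Type) (r : seq I) (P : pred I)
    (f : I -> V -> W) : open U ->
  (forall i, P i -> Ck k U (f i)) -> Ck k U (fun x => \sum_(i <- r | P i) f i x).
Proof.
move=> oU Hf; elim: r => [|i r IH].
  by apply: (Ck_eq oU _ (Ck_cst k U (0 : W))) => x _; rewrite big_nil.
case Pi : (P i).
  by apply: (Ck_eq oU _ (CkD oU (Hf i Pi) IH)) => x _; rewrite big_cons Pi.
by apply: (Ck_eq oU _ IH) => x _; rewrite big_cons Pi.
Qed.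

Lemma derive_scale V W (f : V -> R) (w : W) x v : differentiable f x ->
  'D_v (fun y => f y *: w) x = 'D_v f x *: w.
Proof.
move=> df; rewrite deriveE; last exact: differentiableZl.
by rewrite diffZl //= deriveE.
Qed.

Lemma CkM V k (U : set V) (f g : V -> R) : open U ->
  Ck k U f -> Ck k U g -> Ck k U (fun x => f x * g x).
Proof.
move=> oU; elim: k f g => [|k IH] f g.
  by move=> cf cg x Ux; apply: cvgM; [exact: cf|exact: cg].
move=> Cf Cg; have [df Df] := Cf; have [dg Dg] := Cg; split=> [x Ux|v].
  exact: differentiableM (df x Ux) (dg x Ux).
have H1 := IH _ _ (CkS Cf) (Dg v); have H2 := IH _ _ (CkS Cg) (Df v).
apply: (Ck_eq oU _ (CkD oU H1 H2)) => x Ux.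
by rewrite (@deriveM _ _ f g x v) //; apply: diff_derivable; [exact: df|exact: dg].
Qed.

Lemma Ck_scale V W k (U : set V) (f : V -> R) (w : W) : open U ->
  Ck k U f -> Ck k U (fun x => f x *: w).
Proof.
move=> oU; elim: k f => [|k IH] f /=.
  by move=> cf x Ux; apply: cvgZr_tmp; apply: cf.
move=> [df Df]; split=> [x Ux|v]; first exact: differentiableZl (df x Ux).
apply: (Ck_eq oU _ (IH _ (Df v))) => x Ux; by rewrite derive_scale //; apply: df.
Qed.

Lemma Ck_prod V k (U : set V) (I : Type) (r : seq I) (P : pred I)
    (f : I -> V -> R) : open U ->
  (forall i, P i -> Ck k U (f i)) ->
  Ck k U (fun x => \prod_(i <- r | P i) f i x).
Proof.
move=> oU Hf; elim: r => [|i r IH].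
  by apply: (Ck_eq oU _ (Ck_cst k U (1 : R))) => x _; rewrite big_nil.
case Pi : (P i).
  by apply: (Ck_eq oU _ (CkM oU (Hf i Pi) IH)) => x _; rewrite big_cons Pi.
by apply: (Ck_eq oU _ IH) => x _; rewrite big_cons Pi.
Qed.

Lemma CkZ V W k (U : set V) (a : V -> R) (b : V -> W) : open U ->
  Ck k U a -> Ck k U b -> Ck k U (fun x => a x *: b x).
Proof.
move=> oU; elim: k a b => [|k IH] a b.
  by move=> ca cb x Ux; apply: cvgZ; [exact: ca|exact: cb].
move=> Ca Cb; have [da Da] := Ca; have [db Db] := Cb.
have dab x : U x -> differentiable (fun x => a x *: b x) x /\
    'd (fun x => a x *: b x) x =
    (fun v => 'd a x v *: b x + a x *: 'd b x v) :> (V -> W).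
  move=> Ux.
  pose L v := 'd a x v *: b x + a x *: 'd b x v.
  have linL : linear L.
    move=> r u w; rewrite /L.
    have -> : 'd a x (r *: u + w) = r * 'd a x u + 'd a x w by rewrite linearP.
    have -> : 'd b x (r *: u + w) = r *: 'd b x u + 'd b x w by rewrite linearP.
    rewrite scalerDl !scalerDr -!scalerA.
    by rewrite (scalerA (a x)) (scalerA r (a x)) (mulrC r) addrACA.
  pose LL : {linear V -> W} := HB.pack L (GRing.isLinear.Build _ _ _ _ _ linL).
  have cL : continuous LL.
    move=> y; apply: cvgD; first by apply: cvgZr_tmp; apply: diff_continuous; apply: da.
    by apply: cvgZl_tmp; apply: diff_continuous; apply: db.
  apply: (@eps_differentiable _ _ _ LL) => // eps eps0.
  have [K K0 HK] := linear_lipschitz (diff_continuous (db x Ux)).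
  have nb := Ck_continuous Cb Ux. have na := Ck_continuous Ca Ux.
  (* The remainder splits into three terms with coefficients [|b x|], at most [|a x| + 1], and [K],
     which bounds the differential of [b]. Their sum is [M], so tolerance [eps / (3 * M)] for each
     factor is enough. *)
  pose M := 1 + `|b x| + `|a x| + K.
  have M0 : 0 < M by rewrite /M; have := normr_ge0 (b x); have := normr_ge0 (a x); lra.
  have M1 : 0 < eps / (3 * M) by rewrite divr_gt0 // mulr_gt0.
  have := differentiable_eps (da x Ux) M1.
  have := differentiable_eps (db x Ux) M1.
  have sh : (h + x) @[h --> (0 : V)] --> x.
    by rewrite -[X in _ --> X]add0r; apply: cvgD; [exact: cvg_id|exact: cvg_cst].
  have a1 : \forall h \near (0 : V), `|a (h + x) - a x| <= Num.min 1 (eps / (3 * M)).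
    have H : a (h + x) @[h --> (0 : V)] --> a x by apply: (cvg_comp _ _ sh na).
    have mp : 0 < Num.min 1 (eps / (3 * M)) by rewrite lt_min ltr01.
    move/cvgrPdist_le : H => /(_ _ mp).
    by apply: filterS => h; rewrite distrC.
  move=> Hb Ha; near=> h.
  have aL : `|a (h + x) - a x| <= Num.min 1 (eps / (3 * M)) by near: h.
  have da' : `|a (h + x) - a x - 'd a x h| <= eps / (3 * M) * `|h| by near: h.
  have db' : `|b (h + x) - b x - 'd b x h| <= eps / (3 * M) * `|h| by near: h.
  have -> : a (h + x) *: b (h + x) - a x *: b x - LL h =
     (a (h + x) - a x - 'd a x h) *: b x +
     a (h + x) *: (b (h + x) - b x - 'd b x h) +
     (a (h + x) - a x) *: 'd b x h.
    rewrite /= /L !scalerBr !scalerBl.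
    set u1 := a (h + x) *: b (h + x). set u2 := a x *: b x.
    set u3 := 'd a x h *: b x. set u4 := a x *: 'd b x h.
    set u5 := a (h + x) *: b x. set u6 := a (h + x) *: 'd b x h.
    rewrite opprD !addrA addrNK (addrC _ (- u5)) !addrA addNr add0r.
    by rewrite (addrC _ u1) !addrA.
  have t1 : `|(a (h + x) - a x - 'd a x h) *: b x| <= eps / (3 * M) * `|h| * `|b x|.
    by rewrite normrZ ler_wpM2r.
  have ah : `|a (h + x)| <= `|a x| + 1.
    have -> : a (h + x) = a x + (a (h + x) - a x) by rewrite addrCA subrr addr0.
    apply: le_trans (ler_normD _ _) _; rewrite lerD2l (le_trans aL) //.
    by rewrite ge_min lexx.
  have t2 : `|a (h + x) *: (b (h + x) - b x - 'd b x h)| <=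
      (`|a x| + 1) * (eps / (3 * M) * `|h|).
    by rewrite normrZ; apply: ler_pM.
  have t3 : `|(a (h + x) - a x) *: 'd b x h| <= eps / (3 * M) * (K * `|h|).
    rewrite normrZ; apply: ler_pM => //.
    by rewrite (le_trans aL) // ge_min lexx orbT.
  apply: le_trans (ler_normD _ _) _; apply: le_trans (lerD (ler_normD _ _) (lexx _)) _.
  apply: le_trans (lerD (lerD t1 t2) t3) _.
  have -> : eps / (3 * M) * `|h| * `|b x| +
     (`|a x| + 1) * (eps / (3 * M) * `|h|) + eps / (3 * M) * (K * `|h|)
     = (eps / (3 * M) * `|h|) * M by rewrite /M; ring.
  have -> : eps / (3 * M) * `|h| * M = eps / 3 * `|h|.
    by field; rewrite gt_eqF.
  by rewrite ler_wpM2r // ler_pdivrMr //; move: eps0; lra.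
split=> [x Ux|v]; first by have [] := dab x Ux.
have C1 := IH _ _ (Da v) (CkS Cb). have C2 := IH _ _ (CkS Ca) (Db v).
apply: (Ck_eq oU _ (CkD oU C1 C2)) => x Ux.
have [d1 d2] := dab x Ux.
by rewrite [in RHS]deriveE // d2 !deriveE //; [exact: db|exact: da].
Unshelve. all: by end_near. Qed.

(* Composition through a finite dimensional space, the only case in which the
   directional derivatives of the outer map determine its differential in the
   form required by Ck. *)
Lemma Ck_comp_basis V W Z (I : finType) (e : I -> W) (p : I -> {linear W -> R})
    k (U : set V) (T : set W) (f : V -> W) (g : W -> Z) :
  (forall i, continuous (p i)) -> (forall w, w = \sum_i p i w *: e i) ->
  open U -> open T -> (forall x, U x -> T (f x)) ->
  Ck k U f -> Ck k T g -> Ck k U (fun x => g (f x)).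
Proof.
move=> cp bas oU oT UT; elim: k g => [|k IH] g Cf Cg.
  move=> x Ux; apply: (@continuous_comp _ _ _ f g); first exact: Cf.
  by apply: Cg; apply: UT.
have [df Df] := Cf; have [dg Dg] := Cg; split=> [x Ux|v].
  exact: (differentiable_comp (df x Ux) (dg _ (UT _ Ux))).
pose h i x := p i ('D_v f x) *: 'D_(e i) g (f x).
have Ch i : Ck k U (h i).
  have C1 : Ck k U (fun x => p i ('D_v f x)) by exact: (Ck_linear_comp oU (cp i) (Df v)).
  have C2 : Ck k U (fun x => 'D_(e i) g (f x)) by exact: IH (CkS Cf) (Dg _).
  exact: CkZ.
apply: (Ck_eq oU _ (Ck_sum (index_enum I) oU (fun i _ => Ch i))) => x Ux.
rewrite [in RHS]deriveE; last exact: (differentiable_comp (df x Ux) (dg _ (UT _ Ux))).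
rewrite (diff_comp (df x Ux) (dg _ (UT _ Ux))) /=.
rewrite -(deriveE v (df x Ux)) [in RHS](bas ('D_v f x)) linear_sum /=.
apply: eq_bigr => i _.
by rewrite linearZ /h /= -deriveE //; apply: dg; apply: UT.
Qed.

Definition mulc (r x : R) : R := r * x.

Lemma linear_mulc (r : R) : linear (mulc r).
Proof. by move=> a x y; rewrite /mulc mulrDr; congr (_ + _); rewrite mulrCA. Qed.

HB.instance Definition _ (r : R) :=
  GRing.isLinear.Build R R R *:%R (mulc r) (linear_mulc r).

Lemma continuous_mulc (r : R) : continuous (mulc r).
Proof. by move=> x; apply: cvgM; [exact: cvg_cst|exact: cvg_id]. Qed.

Definition mxcoord m n (i : 'I_m) (j : 'I_n) (A : 'M[R]_(m, n)) : R := A i j.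

Lemma linear_mxcoord m n (i : 'I_m) (j : 'I_n) : linear (mxcoord i j).
Proof. by move=> a x y; rewrite /mxcoord !mxE. Qed.

HB.instance Definition _ m n (i : 'I_m) (j : 'I_n) :=
  GRing.isLinear.Build R 'M[R]_(m, n) R *:%R (mxcoord i j)
    (@linear_mxcoord m n i j).

Lemma Ck_comp_R V Z k (U : set V) (T : set R) (f : V -> R) (g : R -> Z) :
  open U -> open T -> (forall x, U x -> T (f x)) ->
  Ck k U f -> Ck k T g -> Ck k U (fun x => g (f x)).
Proof.
apply: (@Ck_comp_basis V R Z unit (fun=> 1)
  (fun=> [the {linear R -> R} of mulc 1])).
  by move=> _; exact: continuous_mulc.
by move=> w; rewrite (big_pred1 tt) => [|[]//]; rewrite /= /mulc mul1r -[RHS]/(w * 1) mulr1.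
Qed.

Lemma Ck_comp_mx V Z m n k (U : set V) (T : set 'M[R]_(m, n))
    (f : V -> 'M[R]_(m, n)) (g : 'M[R]_(m, n) -> Z) :
  open U -> open T -> (forall x, U x -> T (f x)) ->
  Ck k U f -> Ck k T g -> Ck k U (fun x => g (f x)).
Proof.
apply: (@Ck_comp_basis V 'M[R]_(m, n) Z ('I_m * 'I_n)%type
  (fun ij => delta_mx ij.1 ij.2)
  (fun ij => [the {linear 'M[R]_(m, n) -> R} of mxcoord ij.1 ij.2])).
  by move=> ij; exact: coord_continuous.
by move=> w; rewrite [LHS]matrix_sum_delta pair_bigA.
Qed.

Lemma Ck_coord V m n k (U : set V) (f : V -> 'M[R]_(m, n)) i j : open U ->
  Ck k U f -> Ck k U (fun x => f x i j).
Proof.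
move=> oU; apply: (@Ck_linear_comp _ _ _ k U
  [the {linear 'M[R]_(m, n) -> R} of mxcoord i j]) => //.
exact: coord_continuous.
Qed.

Lemma Ck_mx V m n k (U : set V) (f : V -> 'M[R]_(m, n)) : open U ->
  (forall i j, Ck k U (fun x => f x i j)) -> Ck k U f.
Proof.
move=> oU H.
have C : Ck k U (fun x => \sum_(ij : 'I_m * 'I_n) f x ij.1 ij.2 *: delta_mx ij.1 ij.2).
  by apply: Ck_sum => // ij _; apply: Ck_scale.
apply: (Ck_eq oU _ C) => x _.
by rewrite [RHS]matrix_sum_delta pair_bigA.
Qed.

(** On the line the derivative in direction [v] is [v] times the one in direction 1, so a single
    formula for the derivative closes the recursion that defines [Ck]. *)
Lemma Ck_is_derive k (U : set R) (f f1 : R -> R) : open U ->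
  (forall x, U x -> is_derive x 1 f (f1 x)) -> Ck k U f1 -> Ck k.+1 U f.
Proof.
move=> oU df Cf1; split=> [x Ux|v].
  by apply/derivable1_diffP; have [] := df x Ux.
apply: (Ck_eq oU _ (CkM oU (Ck_cst k U v) Cf1)) => x Ux.
have [d1 <-] := df x Ux.
have dif : differentiable f x by apply/derivable1_diffP.
rewrite !deriveE // -[in RHS](mulr1 v) -[v * 1]/(v *: (1 : R)).
by rewrite linearZ.
Qed.

Lemma Ck_inv k : Ck k [set x : R | x != 0] (fun x => x^-1).
Proof.
have oU : open [set x : R | x != 0] by exact: open_neq.
elim: k => [|k IH]; first by move=> x x0; exact: inv_continuous.
apply: (@Ck_is_derive _ _ _ (fun x => (-1) * (x^-1 * x^-1))) => //.
  move=> x x0; have := @is_deriveV R id x 1 1 x0 (is_derive_id _ _).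
  by rewrite /= -exprVn expr2 mulN1r /GRing.scale /= mulr1.
by apply: CkM => //; [exact: Ck_cst|exact: CkM].
Qed.

Lemma CkV V k (U : set V) (f : V -> R) : open U -> (forall x, U x -> f x != 0) ->
  Ck k U f -> Ck k U (fun x => (f x)^-1).
Proof.
move=> oU f0 Cf; apply: (Ck_comp_R oU _ f0 Cf (@Ck_inv k)).
exact: open_neq.
Qed.

Lemma Ck_sqrt k : Ck k [set x : R | 0 < x] Num.sqrt.
Proof.
have oU : open [set x : R | 0 < x] by exact: open_gt.
elim: k => [|k IH]; first by move=> x x0; exact: sqrt_continuous.
apply: (@Ck_is_derive _ _ _ (fun x => (2 * Num.sqrt x)^-1)) => //.
apply: CkV => //; first by move=> x /= x0; rewrite mulf_neq0 // gt_eqF // sqrtr_gt0.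
by apply: CkM => //; exact: Ck_cst.
Qed.

End Ck_calculus.

(** * Flat functions on the line *)

Section flat.
Context {R : realType}.

(** The powers of [s^-1] are carried along because differentiating [exp (-1/s)] produces them: the
    linear span of this family is stable under derivation. *)
Definition flat (m : nat) (s : R) : R :=
  if 0 < s then s^-1 ^+ m * expR (- s^-1) else 0.

Lemma flat_ge0 m s : 0 <= flat m s.
Proof.
rewrite /flat; case: ltP => // s0.
by rewrite mulr_ge0 ?expR_ge0 // exprn_ge0 // invr_ge0 ltW.
Qed.

(** The constant is the factorial in the term of degree [m + 2] of the exponential series at [s^-1].
    A quadratic bound is what makes the derivative at the origin vanish. *)
Lemma flat_small m : exists2 C : R, 0 < C & forall s, flat m s <= C * s ^+ 2.
Proof.
exists (m.+2`!%:R); first by rewrite ltr0n fact_gt0.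
move=> s; rewrite /flat; case: ltP => s0; last by rewrite mulr_ge0 ?sqr_ge0.
have t0 : 0 < s^-1 by rewrite invr_gt0.
have := @expR_ge1Dxn R s^-1 m.+1 (ltW t0).
have F : 0 < m.+2`!%:R :> R by rewrite ltr0n fact_gt0.
move: F; set F := m.+2`!%:R => F0 H.
rewrite expRN ler_pdivrMr ?expR_gt0 //.
have H2 : s^-1 ^+ m.+2 / F <= expR s^-1 by apply: le_trans H; rewrite ler_wpDl.
apply: (@le_trans _ _ (F * s ^+ 2 * (s^-1 ^+ m.+2 / F))); last first.
  by rewrite ler_wpM2l // mulr_ge0 ?ltW // exprn_gt0.
have -> : F * s ^+ 2 * (s^-1 ^+ m.+2 / F) = s^-1 ^+ m.
  by rewrite !exprS; field; rewrite !gt_eqF.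
by [].
Qed.

Lemma is_derive_flat m (s : R) :
  is_derive s 1 (flat m) (flat m.+2 s - m%:R * flat m.+1 s).
Proof.
have [s0|s0|s0] := ltgtP s 0.
  have E : \near s, (cst 0 : R -> R) s = flat m s.
    have : \forall t \near s, t < 0 by exact: lt_nbhsl.
    by apply: filterS => t t0; rewrite /flat ltNge ltW.
  apply: (near_eq_is_derive E).
  by rewrite /flat ltNge ltW //= mulr0 subr0; exact: is_derive_cst.
  have E : \near s, (fun t => t^-1 ^+ m * expR (- t^-1)) s = flat m s.
    have : \forall t \near s, 0 < t by exact: lt_nbhsr.
    by apply: filterS => t t0; rewrite /flat t0.
  apply: (near_eq_is_derive E).
  have dV : is_derive s 1 (fun t : R => t^-1) (- (s^-1 ^+ 2)).
    have := @is_deriveV R id s 1 1 (lt0r_neq0 s0) (is_derive_id _ _).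
    by rewrite /= -exprVn /GRing.scale /= mulr1.
  have dN : is_derive s 1 (fun t : R => - t^-1) (s^-1 ^+ 2).
    by rewrite -[s^-1 ^+ 2]opprK; exact: is_deriveN.
  have dE : is_derive s 1 (fun t : R => expR (- t^-1)) (expR (- s^-1) * s^-1 ^+ 2).
    exact: (@is_derive1_comp R expR (fun t => - t^-1)).
  have dX := @is_deriveX R _ (fun t : R => t^-1) m s 1 _ dV.
  have dM := is_deriveM dX dE.
  rewrite (_ : (fun x : R => x^-1 ^+ m * _) =
    (fun t : R => t^-1) ^+ m * (fun t : R => expR (- t^-1))); last first.
    by apply/funext => x; rewrite !fctE.
  apply: (is_derive_eq dM).
  rewrite /flat s0 !fctE /GRing.scale /=.
  case: m {dX dM E} => [|m]; first by rewrite !expr0 mulr0n !mul0r subr0 mulr0 addr0 mul1r mulrC.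
  by rewrite /= !exprS -mulr_natl; ring.
  rewrite s0 /flat ltxx mulr0 subr0.
  have [C C0 HC] := flat_small m.
  suff [d1 d2] : differentiable (flat m) (0 : R) /\
     'd (flat m) (0 : R) = (fun x => 0 * x) :> (R -> R).
    split; first by apply/derivable1_diffP.
    by rewrite deriveE // d2 mul0r.
  apply: (@eps_differentiable _ _ _ _ [the {linear R -> R} of mulc 0]).
    exact: continuous_mulc.
  move=> e e0; have : \forall h \near (0 : R), `|h| < e / C.
    by apply: nbhs0_lt; rewrite divr_gt0.
  apply: filterS => h hC /=; rewrite /mulc addr0 {2}/flat ltxx mul0r !subr0.
  rewrite ger0_norm ?flat_ge0 // (le_trans (HC h)) //.
  rewrite -real_normK ?num_real // expr2 mulrA ler_wpM2r // mulrC.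
  by rewrite -ler_pdivlMr // ltW.
Qed.

Lemma Ck_flat k m : Ck k setT (flat m).
Proof.
elim: k m => [|k IH] m.
  move=> x _; apply: differentiable_continuous; apply/derivable1_diffP.
  by have [] := is_derive_flat m x.
apply: (Ck_is_derive openT (fun x _ => is_derive_flat m x)).
have H := CkD openT (IH m.+2)
  (CkM openT (@Ck_cst R R R k setT (- m%:R)) (IH m.+1)).
by apply: (Ck_eq openT _ H) => x _; rewrite mulNr.
Qed.

End flat.

Section smooth_tools.
Context {R : realType}.
Implicit Types (V W Z : normedModType R).

Lemma linear_mx_continuous W m n (L : {linear 'M[R]_(m, n) -> W}) :
  continuous L.
Proof.
have -> : L = (fun A : 'M[R]_(m, n) =>
    \sum_(ij : 'I_m * 'I_n) A ij.1 ij.2 *: L (delta_mx ij.1 ij.2)) :> (_ -> _).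
  apply/funext => A; rewrite {1}[A]matrix_sum_delta pair_bigA linear_sum /=.
  by apply: eq_bigr => ij _; rewrite linearZ.
move=> A; apply: (@Ck_sum R _ _ 0 setT _ _ _ _ openT _ A I) => ij _.
by apply: (Ck_scale (k := 0)); [exact: openT | move=> B _; exact: coord_continuous].
Qed.

Lemma mulmx_bounded m n p (A : 'M[R]_(n, p)) :
  exists2 C : R, 0 < C & forall v : 'M[R]_(m, n), `|v *m A| <= C * `|v|.
Proof.
have [C C0 HC] := linear_lipschitz (@linear_mx_continuous _ m n (mulmxr A)).
by exists C.
Qed.

Definition smooth_open V W (U : set V) (f : V -> W) := forall k, Ck k U f.

Lemma smooth_on_open V W (A U : set V) (f : V -> W) : open U -> A `<=` U ->
  smooth_open U f -> smooth_on A f.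
Proof. by move=> oU AU Cf x /AU Ux; exists U, f; split. Qed.

Lemma smooth_on_sub V W (A A' : set V) (f : V -> W) :
  A' `<=` A -> smooth_on A f -> smooth_on A' f.
Proof.
move=> sA sf x /sA Ax; have [U [h [oU Ux Ch Eh]]] := sf x Ax.
by exists U, h; split=> // y /sA Ay Uy; apply: Eh.
Qed.

Lemma open_preimage V W (U : set V) (T : set W) (f : V -> W) :
  open U -> open T -> (forall x, U x -> {for x, continuous f}) ->
  open (U `&` f @^-1` T).
Proof.
move=> oU oT cf; rewrite openE => x [Ux Tx]; apply: filterI.
  exact: open_nbhs_nbhs.
by apply: (cf x Ux); exact: open_nbhs_nbhs.
Qed.

Lemma smooth_on_comp_mx V Z m n (A : set V) (B : set 'M[R]_(m, n))
    (f : V -> 'M[R]_(m, n)) (g : 'M[R]_(m, n) -> Z) :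
  (forall x, A x -> B (f x)) -> smooth_on A f -> smooth_on B g ->
  smooth_on A (fun x => g (f x)).
Proof.
move=> AB sf sg x Ax; have [U [f1 [oU Ux Cf Ef]]] := sf x Ax.
have [T [g1 [oT Tx Cg Eg]]] := sg _ (AB x Ax).
have cf y : U y -> {for y, continuous f1} by exact: (Ck_continuous (Cf 0%N)).
exists (U `&` f1 @^-1` T), (fun x => g1 (f1 x)); split.
  exact: open_preimage.
  by split=> //=; rewrite -Ef.
  move=> k; apply: (Ck_comp_mx (open_preimage oU oT cf) oT _ _ (Cg k)).
    by move=> y [].
  by apply: Ck_sub (Cf k) => y [].
  by move=> y Ay [Uy Ty]; rewrite Ef // Eg // -Ef //; exact: AB.
Qed.

Lemma Ck_det V n k (U : set V) (A : V -> 'M[R]_n) : open U ->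
  (forall i j, Ck k U (fun x => A x i j)) -> Ck k U (fun x => \det (A x)).
Proof.
move=> oU CA; apply: Ck_sum => // s _; apply: CkM => //; first exact: Ck_cst.
exact: Ck_prod.
Qed.

Lemma Ck_invmx V n k (U : set V) (A : V -> 'M[R]_n) : open U ->
  (forall x, U x -> A x \in unitmx) ->
  (forall i j, Ck k U (fun x => A x i j)) ->
  forall i j, Ck k U (fun x => invmx (A x) i j).
Proof.
move=> oU uA CA i j.
have CV : Ck k U (fun x => (\det (A x))^-1).
  by apply: CkV => // [x Ux|]; [rewrite -unitfE -unitmxE uA|exact: Ck_det].
have Ccof : Ck k U (fun x => cofactor (A x) j i).
  apply: CkM => //; first exact: Ck_cst.
  apply: Ck_det => // a b.
  by apply: (Ck_eq oU _ (CA (lift j a) (lift i b))) => x _; rewrite !mxE.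
apply: (Ck_eq oU _ (CkM oU CV Ccof)) => x Ux.
by rewrite /invmx uA // !mxE.
Qed.

End smooth_tools.

(** Completeness is needed for the contraction principle in [banach_ball]. *)
HB.instance Definition _ (R : realType) m n :=
  Uniform_isComplete.Build 'M[R]_(m, n) cauchy_cvg.

(** * The inverse function theorem *)

Section inverse_function.
Context {R : realType} {n : nat}.
Local Notation E := 'rV[R]_n.

Lemma is_derive_line (V W : normedModType R) (h : V -> W) (y v : V) (t : R) :
  differentiable h (y + t *: v) ->
  is_derive t 1 (fun s : R => h (y + s *: v)) ('D_v h (y + t *: v)).
Proof.
move=> dh.
have dl : is_diff t (fun s : R => y + s *: v) (0 + ( *:%R^~ v)).
  exact: is_diffD (is_diff_cst _ _) (is_diff_scalel _ _).
have dc := is_diff_comp dl (differentiableP dh).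
have [d1 d2] := dc.
split; first by apply/derivable1_diffP.
by rewrite deriveE // d2 /= deriveE //= !fctE add0r scale1r.
Qed.

(** The norm is a maximum over entries, so the scalar mean value theorem may be applied to each
    entry with its own intermediate point. *)
Lemma mean_value_bound (m : nat) (h : E -> 'rV[R]_m) (A : set E) (K : R) (x y : E) :
  (forall t : R, 0 <= t <= 1 -> A (y + t *: (x - y))) ->
  (forall z, A z -> differentiable h z) ->
  (forall z, A z -> `|'D_(x - y) h z| <= K) ->
  `|h x - h y| <= K.
Proof.
move=> cA dh bh.
have K0 : 0 <= K by apply: le_trans (bh y _) => //; have := cA 0; rewrite scale0r addr0 lexx ler01; apply.
rewrite /Num.norm /= mx_normrE; apply: bigmax_le => // -[i j] _ /=.
pose phi (t : R) := mxcoord i j (h (y + t *: (x - y))).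
have dphi (t : R) : 0 <= t <= 1 ->
    is_derive t 1 phi (mxcoord i j ('D_(x - y) h (y + t *: (x - y)))).
  move=> t01; have dz := dh _ (cA t t01).
  have cc := @coord_continuous R 1 m i j.
  have dc : differentiable (fun z => mxcoord i j (h z)) (y + t *: (x - y)).
    by apply: differentiable_comp => //; exact: differentiable_coord.
  have := is_derive_line dc.
  by rewrite (_ : 'D_(x - y) _ _ = mxcoord i j ('D_(x - y) h (y + t *: (x - y)))) //;
     apply: (@derive_linear_comp _ _ _ _ [the {linear _ -> _} of mxcoord i j] h _ _ cc dz).
have [| |c c01] := @MVT_segment R phi
    (fun t => mxcoord i j ('D_(x - y) h (y + t *: (x - y)))) 0 1 ler01.
  by move=> t /itvP tt; apply: dphi; rewrite !tt.
  apply: continuous_in_subspaceT => t; rewrite inE /= in_itv /= => t01.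
  apply: differentiable_continuous; apply/derivable1_diffP.
  by have [] := dphi t t01.
rewrite subr0 mulr1 /phi scale1r scale0r addr0 (addrC y) subrK => H.
have -> : (h x - h y) i j = mxcoord i j (h x) - mxcoord i j (h y).
  by rewrite /mxcoord !mxE.
rewrite H; apply: le_trans (bh (y + c *: (x - y)) _); last first.
  by apply: cA; move: c01; rewrite in_itv.
by rewrite /Num.norm /= mx_normrE (le_bigmax _ (fun ij => `|_ ij.1 ij.2|) (i, j)).
Qed.

Lemma banach_ball (x0 : E) (r : R) (T : E -> E) : 0 < r ->
  (forall x, `|x0 - x| <= r -> `|x0 - T x| <= r) ->
  (forall x y, `|x0 - x| <= r -> `|x0 - y| <= r -> `|T x - T y| <= 2^-1 * `|x - y|) ->
  exists2 x, `|x0 - x| <= r & T x = x.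
Proof.
move=> r0 Tr cT.
pose A : set E := closed_ball_ Num.norm x0 r.
have fT : isFun _ _ A A T by constructor => x Ax; apply: Tr.
pose TT : {fun A >-> A} := HB.pack T fT.
have cTT : is_contraction TT.
  have h0 : (0 : R) <= 2^-1 by rewrite invr_ge0.
  exists (NngNum h0); split => /=; first by rewrite invf_lt1 // ltr1n.
  by move=> [x y] [/= Ax Ay]; apply: cT.
have [||x Ax xE] := banach_fixed_point cTT.
  exact: closed_closed_ball_.
  by exists x0; rewrite /A /closed_ball_ /= subrr normr0 ltW.
by exists x.
Qed.

(** With [K] the inverse Jacobian at [x0], the Newton map [h x = x - f x K] has zero derivative at
    [x0] and is a contraction on a small ball; a preimage of [y] is a fixed point of [h + y K]. The
    set [N] records that [g] is also a left inverse near [x0], which is the half used for smoothness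
    of inverses later. *)
Theorem inverse_function (f : E -> E) (U : set E) (x0 : E) :
  open U -> U x0 -> smooth_open U f ->
  (forall v, 'D_v f x0 = 0 -> v = 0) ->
  exists (T N : set E) (g : E -> E),
    [/\ [/\ open T, T (f x0), smooth_open T g & forall y, T y -> U (g y) /\ f (g y) = y],
       open N, N x0 & forall x, N x -> [/\ U x, T (f x) & g (f x) = x]].
Proof.
move=> oU Ux0 Cf injD.
have df x : U x -> differentiable f x by move=> Ux; have [H _] := Cf 1%N; apply: H.
have Cf0 := Ck_continuous (Cf 0%N).
have DE x v : U x -> 'D_v f x = v *m jacobian f x.
  by move=> Ux; rewrite deriveEjacobian //; apply: df.
have uJ0 : jacobian f x0 \in unitmx.
  rewrite -row_free_unit; apply: inj_row_free => v; rewrite -DE //; exact: injD.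
pose K := invmx (jacobian f x0).
pose h (x : E) : E := x + f x *m (- K).
have Ch : smooth_open U h.
  move=> k; apply: CkD => //.
    apply: (@Ck_linear _ _ _ k U [the {linear E -> E} of idfun]).
    by move=> x; exact: cvg_id.
  apply: (@Ck_linear_comp _ _ _ _ k U [the {linear E -> E} of mulmxr (- K)]) => //.
  exact: linear_mx_continuous.
have dh x : U x -> differentiable h x by move=> Ux; have [H _] := Ch 1%N; apply: H.
have Dh x v : U x -> 'D_v h x = v - 'D_v f x *m K.
  move=> Ux.
  have d1 : differentiable (fun x : E => x) x.
    exact: (@linear_differentiable _ _ _ [the {linear E -> E} of idfun] _ (fun y => cvg_id)).
  have cm := @linear_mx_continuous R E 1 n [the {linear E -> E} of mulmxr (- K)].
  have d2 : differentiable (fun x : E => f x *m (- K)) x.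
    apply: (@differentiable_comp _ _ _ _ f (mulmxr (- K))); first exact: df.
    exact: linear_differentiable.
  rewrite /h (@deriveD _ _ _ (fun x : E => x) (fun x : E => f x *m (- K))).
  rewrite derive_id (derive_linear_comp v cm (df x Ux)) /=.
  by rewrite mulmxN.
  exact: diff_derivable. exact: diff_derivable.
(* A continuous bound for the operator norm of the derivative of [h]. It vanishes at [x0], hence is
   below 1/2 on a whole ball. *)
pose S (x : E) : R := \sum_(j < n) `|'D_(delta_mx 0 j) h x|.
have S0 : S x0 = 0.
  rewrite /S big1 // => j _; rewrite Dh // DE //.
  by rewrite /K mulmxK // subrr normr0.
have cS : {for x0, continuous S}.
  have Sk : Ck 0 U S.
    apply: Ck_sum => // j _ x Ux.
    have [_ D1] := Ch 1%N.
    have c1 := D1 (delta_mx 0 j) x Ux.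
    exact: (@continuous_comp _ _ _ ('D_(delta_mx 0 j) h) Num.norm _ c1 (@norm_continuous _ _ _)).
  exact: Sk.
have hb x v : U x -> `|'D_v h x| <= S x * `|v|.
  move=> Ux; rewrite deriveE; last exact: dh.
  rewrite [v in 'd h x v]row_sum_delta linear_sum /=.
  apply: le_trans (ler_norm_sum _ _ _) _; rewrite /S mulr_suml.
  apply: ler_sum => j _; rewrite linearZ normrZ mulrC -deriveE; last exact: dh.
  rewrite ler_wpM2l // [leRHS]/Num.norm /= mx_normrE.
  exact: (le_bigmax _ (fun ij => `|v ij.1 ij.2|) (0, j)).
have nU : \forall x \near x0, U x /\ S x < 2^-1.
  apply: filterI; first exact: open_nbhs_nbhs.
  have half : 0 < 2^-1 :> R by rewrite invr_gt0.
  have : S x @[x --> x0] --> (0 : R) by rewrite -S0; exact: cS.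
  move/cvgrPdist_lt => /(_ _ half); apply: filterS => x.
  by rewrite sub0r normrN; apply: le_lt_trans; exact: ler_norm.
have [r0 /= r0pos Hr0] := (nbhs_ballP _ _).1 nU.
pose r := r0 / 2.
have rpos : 0 < r by rewrite divr_gt0.
have Br x : `|x0 - x| <= r -> U x /\ S x < 2^-1.
  move=> xr; apply: Hr0; rewrite -ball_normE /=; apply: le_lt_trans xr _.
  by rewrite ltr_pdivrMr // mulr_natr mulr2n ltrDl.
have hlip x y : `|x0 - x| <= r -> `|x0 - y| <= r -> `|h x - h y| <= 2^-1 * `|x - y|.
  move=> xr yr; apply: (@mean_value_bound _ _ [set z | `|x0 - z| <= r]).
    move=> t /andP[t0 t1] /=.
    have -> : x0 - (y + t *: (x - y)) = t *: (x0 - x) + (1 - t) *: (x0 - y).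
      by apply/rowP => j; rewrite !mxE; ring.
    apply: le_trans (ler_normD _ _) _; rewrite !normrZ (ger0_norm t0).
    rewrite (@ger0_norm _ (1 - t)) ?subr_ge0 //.
    have -> : r = t * r + (1 - t) * r by ring.
    by apply: lerD; apply: ler_wpM2l; rewrite ?subr_ge0.
    by move=> z /Br [Uz _]; exact: dh.
  move=> z /Br [Uz Sz]; apply: le_trans (hb _ _ Uz) _.
  by rewrite ler_wpM2r // ltW.
have finj x y : `|x0 - x| <= r -> `|x0 - y| <= r ->
    `|x - y| <= 2 * `|(f x - f y) *m K|.
  move=> xr yr.
  have : `|x - y| <= `|h x - h y| + `|(f x - f y) *m K|.
    apply: le_trans (ler_normD _ _).
    rewrite /h !mulmxN mulmxBl; move: (f x *m K) (f y *m K) => a b.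
    rewrite le_eqVlt; apply/orP; left; apply/eqP; congr (`|_|).
    by apply/rowP => j; rewrite !mxE; ring.
  have := hlip x y xr yr; lra.
pose T : set E := [set y | `|(y - f x0) *m K| < r / 2].
have cTn : continuous (fun y : E => `|(y - f x0) *m K|).
  move=> y; apply: (@continuous_comp _ _ _ (fun y : E => (y - f x0) *m K) Num.norm); last exact: norm_continuous.
  apply: (@continuous_comp _ _ _ (fun y : E => y - f x0) (mulmxr K)).
    by apply: (@cvgB _ E _ (nbhs y) _ (fun z : E => z) (fun=> f x0)); [exact: cvg_id|exact: cvg_cst].
  exact: (@linear_mx_continuous R E 1 n [the {linear E -> E} of mulmxr K]).
have oT : open T.
  rewrite (_ : T = (fun y : E => `|(y - f x0) *m K|) @^-1` [set z | z < r / 2]) //.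
  by apply: open_comp => //; exact: open_lt.
have ex y : T y -> exists x, `|x0 - x| <= r /\ f x = y.
  move=> Ty.
  pose TT (x : E) : E := h x + y *m K.
  have [x|x z xr zr|x xr xE] := @banach_ball x0 r TT rpos.
    move=> xr.
    have -> : x0 - TT x = (h x0 - h x) - (y - f x0) *m K.
      rewrite /TT /h !mulmxN mulmxBl.
      move: (f x *m K) (f x0 *m K) (y *m K) => a b e.
      by apply/rowP => j; rewrite !mxE; ring.
    apply: le_trans (ler_normB _ _) _.
    have := hlip x0 x; rewrite subrr normr0 => /(_ (ltW rpos) xr).
    move: Ty; rewrite /T /=; move: xr; lra.
    by rewrite /TT opprD addrACA subrr addr0; exact: hlip.
  exists x; split=> //.
  have e : (y - f x) *m K = 0.
    move: xE; rewrite /TT /h mulmxN mulmxBl => /eqP.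
    by rewrite -addrA addrC -subr_eq0 addrK addrC => /eqP.
  have : (y - f x) *m K *m jacobian f x0 = 0 by rewrite e mul0mx.
  by rewrite mulmxKV // => /eqP; rewrite subr_eq0 => /eqP.
pose g y := xget x0 [set x | `|x0 - x| <= r /\ f x = y].
have gP y : T y -> `|x0 - g y| <= r /\ f (g y) = y.
  move=> Ty; exact: (xgetPex x0 (ex y Ty)).
have gx x : `|x0 - x| <= r -> T (f x) -> g (f x) = x.
  move=> xr /gP [gr fg]; apply/eqP; rewrite -subr_eq0 -normr_le0.
  by apply: le_trans (finj _ _ gr xr) _; rewrite fg subrr mul0mx normr0 mulr0.
have [CK CK0 HCK] := @mulmx_bounded R 1 n n K.
have glip y z : T y -> T z -> `|g y - g z| <= 2 * CK * `|y - z|.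
  move=> /gP [gy fy] /gP [gz fz]; apply: le_trans (finj _ _ gy gz) _.
  by rewrite fy fz -mulrA ler_wpM2l.
have uJ x : `|x0 - x| <= r -> jacobian f x \in unitmx.
  move=> /Br [Ux Sx]; rewrite -row_free_unit; apply: inj_row_free => v.
  rewrite -DE // => Dv0; have := hb x v Ux; rewrite Dh // Dv0 mul0mx subr0 => H.
  apply/eqP; rewrite -normr_le0.
  have : S x * `|v| <= 2^-1 * `|v| by rewrite ler_wpM2r // ltW.
  by move: H; move: (S x * `|v|) (`|v|) => a b; clear; lra.
have dg y : T y -> differentiable g y /\ 'd g y = (mulmxr (invmx (jacobian f (g y)))) :> (E -> E).
  move=> Ty; have [gr fg] := gP y Ty; have [Ug _] := Br _ gr.
  pose J := jacobian f (g y).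
  apply: (@eps_differentiable _ _ _ _ [the {linear E -> E} of mulmxr (invmx J)]).
    exact: (@linear_mx_continuous R E 1 n [the {linear E -> E} of mulmxr (invmx J)]).
  move=> e e0.
  have [CJ CJ0 HCJ] := @mulmx_bounded R 1 n n (invmx J).
  (* [CJ] bounds multiplication by the inverse Jacobian and [2 * CK] is a Lipschitz constant of [g].
     The expansion of [f] at [g y], applied to the increment of [g] with this tolerance, leaves an
     error of at most [e] times the norm of [w]. *)
  have e1 : 0 < e / (CJ * (2 * CK)) by rewrite divr_gt0 // !mulr_gt0.
  have fd := differentiable_eps (df _ Ug) e1.
  have Tn : \forall w \near (0 : E), T (w + y).
    have : \forall z \near y, T z by exact: open_nbhs_nbhs.
    by rewrite (near_shift 0 y); apply: filterS => z /=; rewrite subr0.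
  have [s /= s0 Hs] := (nbhs_ballP _ _).1 fd.
  have s1 : 0 < s / (2 * CK) by rewrite divr_gt0 // mulr_gt0.
  have wn : \forall w \near (0 : E), `|w| < s / (2 * CK) by exact: nbhs0_lt.
  near=> w.
  have Tw : T (w + y) by near: w.
  have ws : `|w| < s / (2 * CK) by near: w.
  have := glip _ _ Tw Ty; rewrite addrK => kw.
  pose k := g (w + y) - g y.
  have ks : `|k| < s.
    by apply: le_lt_trans kw _; rewrite mulrC -ltr_pdivlMr // mulr_gt0.
  have := Hs k; rewrite -ball_normE /= sub0r normrN => /(_ ks).
  rewrite /k subrK (gP _ Tw).2 fg addrK -(deriveE (g (w + y) - g y) (df _ Ug)) DE // -/k -/J => H.
  have -> : g (w + y) - g y - w *m invmx J = (k *m J - w) *m invmx J.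
    by rewrite (mulmxBl (k *m J) w) (mulmxK (uJ _ gr)).
  apply: le_trans (HCJ _) _; rewrite -normrN opprB.
  apply: (@le_trans _ _ (CJ * (e / (CJ * (2 * CK)) * (2 * CK * `|w|)))).
    apply: ler_wpM2l; first exact: ltW.
    by apply: le_trans H _; apply: ler_wpM2l => //; exact: ltW.
  have -> : CJ * (e / (CJ * (2 * CK)) * (2 * CK * `|w|)) = e * `|w|.
    by field; rewrite !gt_eqF.
  by [].
(* Bootstrapping: the derivative of [g] is the inverse Jacobian of [f] at [g y], so it has as many
   derivatives as [g] is already known to have. *)
have Cg : smooth_open T g.
  elim=> [|k IH]; first by move=> y Ty; apply: differentiable_continuous; exact: (dg y Ty).1.
  split=> [y Ty|v]; first exact: (dg y Ty).1.
  pose J y := jacobian f (g y).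
  have CJ i j : Ck k T (fun y => J y i j).
    have [_ D1] := Cf k.+1.
    have C1 := Ck_comp_mx oT oU (fun y Ty => (Br _ (gP y Ty).1).1) IH (D1 (delta_mx 0 i)).
    apply: (Ck_eq oT _ (Ck_coord 0 j oT C1)) => y Ty.
    rewrite DE; last exact: (Br _ (gP y Ty).1).1.
    by rewrite -rowE mxE.
  have Ci := Ck_invmx oT (fun y Ty => uJ _ (gP y Ty).1) CJ.
  have CC : Ck k T (fun y => v *m invmx (J y)).
    apply: Ck_mx => // i j.
    apply: (Ck_eq oT _ (Ck_sum (index_enum 'I_n) (P := xpredT) oT (fun l _ => CkM oT (Ck_cst k T (v i l)) (Ci l j)))) => y Ty.
    by rewrite mxE.
  apply: (Ck_eq oT _ CC) => y Ty.
  have [d1 d2] := dg y Ty.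
  by rewrite deriveE // d2.
pose N : set E := [set x | `|x0 - x| < r] `&` (U `&` f @^-1` T).
exists T, N, g; split; first split => //.
  by rewrite /T /= subrr mul0mx normr0 divr_gt0.
  by move=> y Ty; have [gr fg] := gP y Ty; split=> //; exact: (Br _ gr).1.
  apply: openI; last exact: open_preimage.
  have -> : [set x : E | `|x0 - x| < r] = ball x0 r by rewrite -ball_normE.
  exact: ball_open.
  split; first by rewrite /= subrr normr0.
  by split=> //=; rewrite /T /= subrr mul0mx normr0 divr_gt0.
by move=> x [/= xr [Ux Tx]]; split=> //; apply: gx => //; exact: ltW.
Unshelve. all: by end_near. Qed.

End inverse_function.

(** * Polyhedra and corner cuts *)

Section dot_product.
Context {R : realType} {n : nat}.
Implicit Types c x y : 'rV[R]_n.

Lemma dotDr c x y : dot c (x + y) = dot c x + dot c y.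
Proof. by rewrite /dot -big_split; apply: eq_bigr => k _; rewrite mxE mulrDr. Qed.

Lemma dotZr c a x : dot c (a *: x) = a * dot c x.
Proof. by rewrite /dot mulr_sumr; apply: eq_bigr => k _; rewrite mxE mulrCA. Qed.

Lemma dotNr c x : dot c (- x) = - dot c x.
Proof. by rewrite -scaleN1r dotZr mulN1r. Qed.

Lemma dotBr c x y : dot c (x - y) = dot c x - dot c y.
Proof. by rewrite dotDr dotNr. Qed.

Lemma dotr0 c : dot c 0 = 0.
Proof. by rewrite -(scale0r (0 : 'rV[R]_n)) dotZr mul0r. Qed.

Lemma dot_sumr (I : finType) (P : pred I) (x : I -> 'rV[R]_n) c :
  dot c (\sum_(i | P i) x i) = \sum_(i | P i) dot c (x i).
Proof. exact: (big_morph (dot c) (dotDr c) (dotr0 c)). Qed.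

Lemma dotC c x : dot c x = dot x c.
Proof. by apply: eq_bigr => k _; rewrite mulrC. Qed.

Lemma dotNl c x : dot (- c) x = - dot c x.
Proof. by rewrite dotC dotNr dotC. Qed.

Lemma dotDl c x y : dot (x + y) c = dot x c + dot y c.
Proof. by rewrite dotC dotDr !(dotC c). Qed.

Lemma dot_delta k x : dot (delta_mx 0 k) x = x 0 k.
Proof.
rewrite /dot (bigD1 k) //= big1 ?addr0 => [|j jk]; first by rewrite mxE !eqxx mul1r.
by rewrite mxE (negPf jk) andbF mul0r.
Qed.

End dot_product.

Section polyhedra.
Context {R : realType} {n : nat} (T : finType).
Variables (A : T -> 'rV[R]_n) (b : T -> R).
Implicit Types x y z : 'rV[R]_n.

Definition polyhedron : set 'rV[R]_n := [set x | forall t, dot (A t) x <= b t].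

Definition active x : {set T} := [set t | dot (A t) x == b t].

(** Phrased through the active constraints rather than by convexity, so that an extreme point is
    determined by a subset of the finite type [T]. *)
Definition extreme x : Prop :=
  polyhedron x /\ forall z, (forall t, t \in active x -> dot (A t) z = 0) -> z = 0.

(** The sum of the active normals exposes the point: equality at [y] forces every active constraint
    to be tight at [y]. *)
Lemma extreme_vertex x : extreme x -> vertex polyhedron x.
Proof.
move=> [Px ex]; split=> //; exists (\sum_(t in active x) A t) => y Py yx.
have D z : dot (\sum_(t in active x) A t) z = \sum_(t in active x) dot (A t) z.
  by rewrite dotC dot_sumr; apply: eq_bigr => t _; rewrite dotC.
rewrite !D lt_neqAle; apply/andP; split; last first.
  by apply: ler_sum => t; rewrite inE => /eqP ->; exact: Py.
apply/eqP => E; apply: yx; apply/eqP; rewrite -subr_eq0; apply/eqP; apply: ex.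
move=> t tx; rewrite dotBr.
have S0 : \sum_(t in active x) (dot (A t) x - dot (A t) y) = 0.
  by rewrite sumrB E subrr.
have /psumr_eq0P := S0 => H.
have -> : dot (A t) y - dot (A t) x = - (dot (A t) x - dot (A t) y) by rewrite opprB.
rewrite H ?oppr0 // => u; rewrite inE => /eqP ->.
by rewrite subr_ge0; exact: Py.
Qed.

Lemma extreme_unique x y : extreme x -> extreme y -> active x = active y -> x = y.
Proof.
move=> [_ ex] _ E; apply/eqP; rewrite eq_sym -subr_eq0; apply/eqP/ex => t tx.
rewrite dotBr; have := tx; rewrite {1}E !inE => /eqP ->.
by move: tx; rewrite inE => /eqP ->; rewrite subrr.
Qed.

(** Indexing by sets of constraints turns convex combinations of vertices into sums over a finite
    type. The value 0 at sets that belong to no extreme point is harmless: [vertex_weights] gives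
    such sets weight zero. *)
Definition extreme_point (S : {set T}) : 'rV[R]_n :=
  xget 0 [set x | extreme x /\ active x = S].

Lemma extreme_pointE x : extreme x -> extreme_point (active x) = x.
Proof.
move=> ex; have [ey E] : [set y | extreme y /\ active y = active x]
    (extreme_point (active x)) by apply: xgetPex; exists x.
by apply: extreme_unique.
Qed.

Variable M : R.
Hypothesis bounded : forall x, polyhedron x -> forall k, `|x 0 k| <= M.

(** Moving along [z] keeps the active constraints tight. Boundedness provides a constraint that [z]
    increases, and the first such constraint to be met becomes active as well. *)
Lemma polyhedron_move x z : polyhedron x -> z != 0 ->
  (forall t, t \in active x -> dot (A t) z = 0) ->
  exists s, [/\ 0 < s, polyhedron (x + s *: z) & active x \proper active (x + s *: z)].
Proof.
move=> Px z0 hz.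
have [t0 t0z] : exists t, 0 < dot (A t) z.
  apply: contrapT => /forallNP H.
  have Ps s : 0 <= s -> polyhedron (x + s *: z).
    move=> s0 t; rewrite dotDr dotZr.
    have := H t; have := Px t => H1 /negP; rewrite -leNgt => H2.
    have := mulr_ge0_le0 s0 H2; lra.
  have [k zk] : exists k, z 0 k != 0.
    apply: contrapT => /forallNP H3; case/eqP: z0; apply/rowP => k; rewrite mxE.
    by have /negP := H3 k; rewrite negbK => /eqP.
  have M0 : 0 <= M by apply: le_trans (bounded Px k).
  (* This step would displace coordinate [k] by [2 * M + 1], whereas two points of the polyhedron
     differ there by at most [2 * M]. *)
  pose s := (2 * M + 1) / `|z 0 k|.
  have s0 : 0 <= s by rewrite divr_ge0 // addr_ge0 // mulr_ge0.
  have B1 := bounded (Ps s s0) k. have B2 := bounded Px k.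
  have : `|s * z 0 k| <= M + M.
    have -> : s * z 0 k = (x + s *: z) 0 k - x 0 k by rewrite !mxE addrC addKr.
    by apply: le_trans (ler_normB _ _) _; exact: lerD.
  rewrite normrM (ger0_norm s0) /s divfK ?normr_eq0 //.
  by rewrite mulr_natl mulr2n leNgt ltrDl ltr01.
pose F t := (b t - dot (A t) x) / dot (A t) z.
pose t1 := [arg min_(t < t0 | 0 < dot (A t) z) F t]%O.
have [] : 0 < dot (A t1) z /\ forall t, 0 < dot (A t) z -> F t1 <= F t.
  by rewrite /t1; case: arg_minP => // i Pi Hi; split.
move: t1 => t1 t1z min1.
have na : t1 \notin active x.
  by apply/negP => /hz E; rewrite E ltxx in t1z.
have F0 : 0 < F t1.
  apply: divr_gt0 => //; rewrite subr_gt0 lt_neqAle Px andbT.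
  by move: na; rewrite inE.
exists (F t1); split=> //.
  move=> t; rewrite dotDr dotZr; have [tz|tz] := ltP 0 (dot (A t) z).
    have := min1 t tz; rewrite {2}/F ler_pdivlMr //; lra.
  have := Px t; have := mulr_ge0_le0 (ltW F0) tz; lra.
apply/properP; split.
  apply/fintype.subsetP => t tx; rewrite inE dotDr dotZr (hz t tx) mulr0 addr0.
  by move: tx; rewrite inE.
exists t1 => //; rewrite inE dotDr dotZr /F divfK; last by rewrite gt_eqF.
by apply/eqP; ring.
Qed.

Definition vertex_weights x (w : {set T} -> R) : Prop :=
  [/\ forall S, 0 <= w S, \sum_S w S = 1, x = \sum_S w S *: extreme_point S &
      forall S, w S != 0 -> extreme (extreme_point S) /\ active (extreme_point S) = S].

Lemma extreme_weights x : extreme x ->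
  vertex_weights x (fun S => (S == active x)%:R).
Proof.
move=> ex; split.
  by move=> S; rewrite ler0n.
  by rewrite (bigD1 (active x)) //= eqxx big1 ?addr0 // => S /negPf ->.
  rewrite (bigD1 (active x)) //= eqxx scale1r extreme_pointE // big1 ?addr0 //.
  by move=> S /negPf ->; rewrite scale0r.
move=> S; have [->|_] := eqVneq S (active x); last by rewrite eqxx.
by rewrite extreme_pointE.
Qed.

Lemma vertex_weights_conv x y (u v : {set T} -> R) (a : R) : 0 <= a <= 1 ->
  vertex_weights x u -> vertex_weights y v ->
  vertex_weights (a *: x + (1 - a) *: y) (fun S => a * u S + (1 - a) * v S).
Proof.
move=> /andP[a0 a1] [u0 u1 xE uS] [v0 v1 yE vS].
have b0 : 0 <= 1 - a by rewrite subr_ge0.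
split.
  by move=> S; rewrite addr_ge0 // mulr_ge0.
  by rewrite big_split /= -!mulr_sumr u1 v1; ring.
  rewrite xE yE !scaler_sumr -big_split /=; apply: eq_bigr => S _.
  by rewrite !scalerA scalerDl.
move=> S; have [uS0|/uS //] := eqVneq (u S) 0.
have [vS0|/vS //] := eqVneq (v S) 0.
by rewrite uS0 vS0 !mulr0 addr0 eqxx.
Qed.

(** Minkowski's theorem, by induction on the number of inactive constraints: a point that is not
    extreme lies on a segment whose two ends, found by moving along [z] and [- z], have more active
    constraints. *)
Lemma polyhedron_weights x : polyhedron x -> exists w, vertex_weights x w.
Proof.
move: {2}(#|~: active x|) (leqnn #|~: active x|) => m.
elim: m x => [|m IH] x.
  rewrite leqn0 cards_eq0 => /eqP E Px.
  have aT t : t \in active x.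
    by have := finset.in_set0 t; rewrite -E finset.in_setC => /negbFE.
  have ex : extreme x.
    split=> // z hz; apply/eqP; apply: contrapT => /negP z0.
    have [s [s0 _ /properP[_ [t _]]]] := polyhedron_move Px z0 hz.
    by rewrite aT.
  by exists (fun S => (S == active x)%:R); exact: extreme_weights.
move=> le Px.
have [ex|/not_andP[//|nex]] := pselect (extreme x).
  by exists (fun S => (S == active x)%:R); exact: extreme_weights.
have [z /not_implyP[hz /eqP z0]] := (existsNP _).2 nex.
have mz : - z != 0 by rewrite oppr_eq0.
have hmz t : t \in active x -> dot (A t) (- z) = 0.
  by move=> /hz E; rewrite dotNr E oppr0.
have [s [s0 Ps /proper_card As]] := polyhedron_move Px z0 hz.
have [r [r0 Pr /proper_card Ar]] := polyhedron_move Px mz hmz.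
have small y : (#|active x| < #|active y|)%N -> (#|~: active y| <= m)%N.
  move=> lt; rewrite -ltnS; apply: leq_trans le.
  by have := cardsC (active x); have := cardsC (active y); lia.
have [u hu] := IH _ (small _ As) Ps.
have [v hv] := IH _ (small _ Ar) Pr.
have sr : 0 < s + r by exact: addr_gt0.
have a01 : 0 <= r / (s + r) <= 1.
  rewrite (divr_ge0 (ltW r0) (ltW sr)) /= ler_pdivrMr // mul1r.
  by rewrite lerDr ltW.
have := vertex_weights_conv a01 hu hv.
have -> : r / (s + r) *: (x + s *: z) + (1 - r / (s + r)) *: (x + r *: - z) = x.
  apply/rowP => k; rewrite !mxE; field; by rewrite gt_eqF.
by move=> H; eexists; exact: H.
Qed.

Lemma polyhedron_polytope : polytope polyhedron.
Proof.
pose G : {pred {set T}} := fun S => `[< extreme (extreme_point S) >].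
exists #|G|, (fun j => extreme_point (enum_val j)).
apply/seteqP; split=> x.
  move=> /polyhedron_weights[w [w0 w1 xE wS]].
  have wG S : S \notin G -> w S = 0.
    move=> /asboolPn nS; apply/eqP; apply: contrapT => /negP /wS [].
    by [].
  exists (fun j => w (enum_val j)); split=> //.
    rewrite -(big_enum_val (A := G) (fun S => w S)) -w1 [RHS](bigID (mem G)) /=.
    by rewrite [X in _ = _ + X]big1 ?addr0 // => S /wG.
  rewrite -(big_enum_val (A := G) (fun S => w S *: extreme_point S)) {1}xE.
  rewrite [LHS](bigID (mem G)) /= [X in _ + X]big1 ?addr0 // => S /wG ->.
  by rewrite scale0r.
move=> [w [w0 w1 ->]] t; rewrite dot_sumr.
have -> : b t = \sum_j w j * b t by rewrite -mulr_suml w1 mul1r.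
apply: ler_sum => j _; rewrite dotZr; apply: ler_wpM2l => //.
by have := enum_valP j; move=> /asboolP [].
Qed.

(** The weights of a point in the face where [a] is minimal are carried by vertices of that face.
    This extends [cuts_off], which speaks of vertices only, to all points of a face. *)
Lemma polyhedron_face_lt x a m (c : 'rV[R]_n) (d : R) : polyhedron x ->
  (forall y, polyhedron y -> m <= dot a y) -> dot a x = m ->
  (forall v, vertex polyhedron v -> dot a v = m -> dot c v < d) ->
  dot c x < d.
Proof.
move=> Px am ax cv; have [w [w0 w1 xE wS]] := polyhedron_weights Px.
have S0 : \sum_S w S * (dot a (extreme_point S) - m) = 0.
  under eq_bigr do rewrite mulrBr.
  rewrite sumrB -mulr_suml w1 mul1r.
  have -> : m = \sum_S w S * dot a (extreme_point S).
    by rewrite -ax xE dot_sumr; apply: eq_bigr => S _; rewrite dotZr.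
  by rewrite subrr.
have wm S : w S != 0 -> dot c (extreme_point S) < d.
  move=> wS0; have [eS _] := wS S wS0; apply: cv; first exact: extreme_vertex.
  have /psumr_eq0P H := S0.
  have /eqP : w S * (dot a (extreme_point S) - m) = 0.
    apply: H => // S' _; have [->|/wS [[PS' _] _]] := eqVneq (w S') 0.
      by rewrite mul0r.
    by rewrite mulr_ge0 // subr_ge0 am.
  by rewrite mulf_eq0 (negPf wS0) /= subr_eq0 => /eqP.
have [S wS0] : exists S, w S != 0.
  apply: contrapT => /forallNP H; have := oner_neq0 R; rewrite -w1 big1 ?eqxx // => S _.
  by apply/eqP; have /negP := H S; rewrite negbK.
rewrite xE dot_sumr -subr_gt0.
have -> : d - \sum_S dot c (w S *: extreme_point S) =
    \sum_S w S * (d - dot c (extreme_point S)).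
  under [RHS]eq_bigr do rewrite mulrBr.
  by rewrite sumrB -mulr_suml w1 mul1r; congr (_ - _); apply: eq_bigr => S' _; rewrite dotZr.
rewrite (bigD1 S) //=; apply: ltr_pwDl.
  by rewrite mulr_gt0 ?subr_gt0 ?wm // lt0r wS0 w0.
apply: sumr_ge0 => S' _; have [->|/wm lt] := eqVneq (w S') 0; first by rewrite mul0r.
by rewrite mulr_ge0 // subr_ge0 ltW.
Qed.

End polyhedra.

(** * Successive truncations of the cube and their corners *)

Section cuts.
Context {R : realType} {n : nat}.
Variables (c : 'I_n.-1 -> 'rV[R]_n) (d : 'I_n.-1 -> R).
Implicit Types (l : seq 'I_n.-1) (x : 'rV[R]_n) (i j k : 'I_n.-1).

(** Cuts not yet made become the void constraint [0 <= 0], so that the index type of the constraints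
    does not depend on [l]. *)
Definition cut_normal l (t : 'I_n * bool + 'I_n.-1) : 'rV[R]_n :=
  match t with
  | inl (k, true) => delta_mx 0 k
  | inl (k, false) => - delta_mx 0 k
  | inr i => if i \in l then c i else 0
  end.

Definition cut_level l (t : 'I_n * bool + 'I_n.-1) : R :=
  match t with
  | inl _ => 1
  | inr i => if i \in l then d i else 0
  end.

Lemma dot0l x : dot 0 x = 0.
Proof. by rewrite dotC dotr0. Qed.

Lemma cut_cubeE l : cut_cube c d l = polyhedron (cut_normal l) (cut_level l).
Proof.
apply/seteqP; split=> x.
  move=> [cx lx] [[k []]|i] /=.
    by rewrite dot_delta; have /andP[] := cx k.
    by rewrite dotNl dot_delta lerNl; have /andP[] := cx k.
  by case: ifP => [/lx //|_]; rewrite dot0l.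
move=> H; split=> [k|i il].
  have := H (inl (k, true)); have := H (inl (k, false)).
  by rewrite /= dotNl !dot_delta lerNl => -> ->.
by have := H (inr i); rewrite /= il.
Qed.

Lemma cut_cube_bounded l x : cut_cube c d l x -> forall k : 'I_n, `|x 0 k| <= 1.
Proof. by move=> [cx _] k; rewrite ler_norml. Qed.

Lemma cut_face_lt l x (a : 'rV[R]_n) m (e : 'rV[R]_n) (f : R) : cut_cube c d l x ->
  (forall y, cut_cube c d l y -> m <= dot a y) -> dot a x = m ->
  (forall v, vertex (cut_cube c d l) v -> dot a v = m -> dot e v < f) ->
  dot e x < f.
Proof.
rewrite cut_cubeE => Px; apply: (@polyhedron_face_lt _ _ _ _ _ 1) => //.
by move=> y; rewrite -cut_cubeE; exact: cut_cube_bounded.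
Qed.

Definition ell i x : R := d i - dot (c i) x.

Lemma cut_off_gt l k x (a : 'rV[R]_n) m :
  cuts_off (c k) (d k) (cube_face k) (cut_cube c d l) -> cut_cube c d l x ->
  (forall y, cut_cube c d l y -> m <= dot a y) -> dot a x = m ->
  (forall y, cut_cube c d l y -> dot a y = m -> ~ cube_face k y) ->
  0 < ell k x.
Proof.
move=> [_ H] Px am ax nF; rewrite subr_gt0; apply: (cut_face_lt Px am ax) => v Pv av.
by apply: H => //; apply: nF => //; have [] := Pv.
Qed.

Lemma cut_off_face_lt0 l k x :
  cuts_off (c k) (d k) (cube_face k) (cut_cube c d l) -> cut_cube c d l x ->
  cube_face k x -> ell k x < 0.
Proof.
move=> [H _] Px Fx; rewrite subr_lt0 -ltrN2 -dotNl.
(* On the cube this functional is at least -2, with equality exactly on the face to be cut; that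
   face is thus exposed in every intermediate polytope. *)
pose a : 'rV[R]_n := delta_mx 0 (hi k) - delta_mx 0 (lo k).
have aE y : dot a y = y 0 (hi k) - y 0 (lo k) by rewrite dotDl dotNl !dot_delta.
have am y : cut_cube c d l y -> -2 <= dot a y.
  move=> [cy _]; rewrite aE.
  have /andP[h1 _] := cy (hi k); have /andP[_ h2] := cy (lo k).
  by move: h1 h2; lra.
apply: (cut_face_lt Px am).
  by move: Fx => [[_ e1] [_ e2]]; rewrite aE e1 e2; ring.
move=> v Vv; have [[cv _] _] := Vv; rewrite aE => E; rewrite dotNl ltrN2; apply: H => //.
have /andP[h1 _] := cv (hi k); have /andP[_ h2] := cv (lo k).
by split; split=> //; move: h1 h2 E; lra.
Qed.

(** The cutting order read backwards: the head is the last cut and the tail the polytope it was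
    applied to, as suits induction on lists. *)
Fixpoint cut_ok (l : seq 'I_n.-1) : Prop :=
  if l is k :: l' then
    [/\ cut_ok l', k \notin l' &
      cuts_off (c k) (d k) (cube_face k) (cut_cube c d l')]
  else True.

Lemma cut_cube_eq_mem l l' : l =i l' -> cut_cube c d l = cut_cube c d l'.
Proof.
by move=> E; apply/seteqP; split=> x [cx H]; split=> // i il; apply: H; rewrite ?E // -E.
Qed.

Lemma cut_sequence_ok l : cut_sequence c d l -> cut_ok (rev l).
Proof.
move=> [pl H]; have ul : uniq l by rewrite (perm_uniq pl) enum_uniq.
elim/last_ind: l {pl} ul H => [//|l k IH]; rewrite rcons_uniq => /andP[kl ul] H.
rewrite rev_rcons /=; split.
    apply: IH => // l1 i l2 E; apply: (H l1 i (rcons l2 k)).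
    by rewrite E rcons_cat rcons_cons.
  by rewrite mem_rev.
have := H l k [::]; rewrite cats1 => /(_ erefl).
by rewrite (@cut_cube_eq_mem (rev l) l) // => i; rewrite mem_rev.
Qed.

Lemma cut_cube_cons l k x :
  cut_cube c d (k :: l) x <-> cut_cube c d l x /\ 0 <= ell k x.
Proof.
rewrite subr_ge0; split=> [[cx H]|[[cx H] Hk]]; first split.
    by split=> // i il; apply: H; rewrite inE il orbT.
  by apply: H; rewrite inE eqxx.
by split=> // i; rewrite inE => /orP[/eqP ->|/H].
Qed.

(** Lists intersections that are empty in the truncated cube. The clauses are proved together,
    because a new cut avoids its neighbours only thanks to the position of their cut facets. *)
Definition separated_cuts l : Prop := forall x, cut_cube c d l x ->
  [/\ forall i, i \in l -> x 0 (lo i) = 1 -> x 0 (hi i) <> -1,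
      forall i, i \in l -> ell i x = 0 -> x 0 (lo i) <> -1 /\ x 0 (hi i) <> 1 &
      forall i j, i \in l -> j \in l -> j = i.+1 :> nat -> ell i x = 0 -> ell j x <> 0].

Lemma lo_hi i j : j = i.+1 :> nat -> lo j = hi i.
Proof. by move=> E; apply: val_inj. Qed.

(** Each alternative puts [x] on an exposed face disjoint from the [k]-th cube face, so all vertices
    of that face lie on the kept side of the cut. For a neighbouring cut facet the disjointness is
    the second clause of [separated_cuts]. *)
Lemma separated_cut_gt0 l k x : separated_cuts l ->
  cuts_off (c k) (d k) (cube_face k) (cut_cube c d l) -> cut_cube c d l x ->
  [\/ x 0 (lo k) = -1, x 0 (hi k) = 1,
      exists j, [/\ j \in l, k = j.+1 :> nat & ell j x = 0] |
      exists j, [/\ j \in l, j = k.+1 :> nat & ell j x = 0]] ->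
  0 < ell k x.
Proof.
move=> sl ck Px [E|E|[j [jl kj E]]|[j [jl kj E]]].
  apply: (cut_off_gt (a := delta_mx 0 (lo k)) (m := -1) ck Px); rewrite ?dot_delta //.
    by move=> y [cy _]; rewrite dot_delta; have /andP[] := cy (lo k).
  by move=> y _; rewrite dot_delta => e [[_ e1] _]; move: e1; rewrite e; lra.
  apply: (cut_off_gt (a := - delta_mx 0 (hi k)) (m := -1) ck Px); rewrite ?dotNl ?dot_delta ?E //.
    by move=> y [cy _]; rewrite dotNl dot_delta lerN2; have /andP[] := cy (hi k).
  by move=> y _; rewrite dotNl dot_delta => e [_ [_ e1]]; move: e; rewrite e1; lra.
  apply: (cut_off_gt (a := - c j) (m := - d j) ck Px).
    by move=> y [_ H]; rewrite dotNl lerN2; exact: H.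
    by rewrite dotNl; move: E; rewrite /ell; lra.
  move=> y Py; rewrite dotNl => e [[_ e1] _].
  have E' : ell j y = 0 by rewrite /ell; lra.
  have [_ H _] := sl y Py; have [_] := H j jl E'.
  by rewrite -(lo_hi kj).
  apply: (cut_off_gt (a := - c j) (m := - d j) ck Px).
    by move=> y [_ H]; rewrite dotNl lerN2; exact: H.
    by rewrite dotNl; move: E; rewrite /ell; lra.
  move=> y Py; rewrite dotNl => e [_ [_ e1]].
  have E' : ell j y = 0 by rewrite /ell; lra.
  have [_ H _] := sl y Py; have [+ _] := H j jl E'.
  by rewrite (lo_hi kj).
Qed.

Lemma cut_ok_separated l : cut_ok l -> separated_cuts l.
Proof.
elim: l => [|k l IH] /=; first by move=> _ x _; split.
move=> [/IH sl kl ck] x /cut_cube_cons[Px ex].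
have gt := separated_cut_gt0 sl ck Px.
have [S1 S2 S3] := sl x Px.
split.
  move=> i; rewrite inE => /orP[/eqP -> e1 e2|]; last exact: S1.
  have : ell k x < 0 by apply: (cut_off_face_lt0 ck Px); have [cx _] := Px.
  by rewrite ltNge ex.
  move=> i; rewrite inE => /orP[/eqP -> e|]; last exact: S2.
  split=> e1; (suff : 0 < ell k x by rewrite e ltxx); apply: gt.
      by constructor 1.
    by constructor 2.
  move=> i j; rewrite !inE => /orP[/eqP ->|il] /orP[/eqP ->|jl] ij e1 e2.
    by move: ij; lia.
    suff : 0 < ell k x by rewrite e1 ltxx.
    by apply: gt; constructor 4; exists j.
    suff : 0 < ell k x by rewrite e2 ltxx.
    by apply: gt; constructor 3; exists i.
    exact: S3 ij e1 e2.
Qed.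

(** These two vertices of the cube belong to no cut face, since such a face requires a coordinate 1
    followed by a coordinate -1. *)
Lemma const_in_cut_cube l (e : R) : e = 1 \/ e = -1 -> cut_ok l ->
  cut_cube c d l (const_mx e) /\ forall i, i \in l -> 0 < ell i (const_mx e).
Proof.
move=> e1; elim: l => [|k l IH] /=.
  move=> _; split=> //; split=> // k; rewrite mxE; case: e1 => ->; lra.
move=> [ok kl ck]; have [Px gx] := IH ok.
have gk : 0 < ell k (const_mx e).
  apply: (separated_cut_gt0 (cut_ok_separated ok) ck Px).
  by case: e1 => ->; [constructor 2|constructor 1]; rewrite mxE.
split; first by apply/cut_cube_cons; split=> //; exact: ltW.
by move=> i; rewrite inE => /orP[/eqP ->|/gx].
Qed.

Implicit Types (s : 'I_n -> bool) (p : 'I_n -> R) (y : nat -> R).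

Definition sg (b : bool) : R := if b then 1 else -1.

(** A sign vector [s] stands for a vertex of the cube; its descents are the cut faces that contain
    it. Two descents are never consecutive. *)
Definition descent s i := s (lo i) && ~~ s (hi i).

Definition walls (P : pred 'I_n.-1) y := forall w, y w != 0 ->
  exists i : 'I_n.-1, w = i.+1 /\ P i.

(** The number [y i.+1] measures the displacement at cut [i]: it lowers coordinate [lo i] and raises
    [hi i], in the proportion [p (lo i)] to [p (hi i)]. Starting from a vertex with a descent at
    [i], this moves away from the cut face. *)
Definition ray p y : 'rV[R]_n := \row_k (p k * (y k - y k.+1)).

(** Truncation replaces the vertex [s] by a face on which all cuts at its descents are tight; the
    weights [p] select a point of it. *)
Definition corner l s p y x := [/\ cut_cube c d l x,
  walls (fun i => (i \in l) && descent s i) y,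
  x = \row_k sg (s k) + ray p y &
  forall i, i \in l -> descent s i -> ell i x = 0].

Lemma walls0 (P : pred 'I_n.-1) y w : walls P y ->
  (forall i : 'I_n.-1, w = i.+1 -> ~~ P i) -> y w = 0.
Proof.
move=> H N; apply/eqP; apply: contrapT => /negP /H [i [/N + Pi]].
by rewrite Pi.
Qed.

Lemma cornerE l s p y x (k : 'I_n) : corner l s p y x ->
  x 0 k = sg (s k) + p k * (y k - y k.+1).
Proof. by move=> [_ _ -> _]; rewrite !mxE. Qed.

(** Without a descent at [k], either [lo k] has sign -1 or [hi k] has sign 1. That coordinate is
    still on its cube facet unless a neighbouring cut has moved it, and then the corner lies on the
    neighbour's cut facet; both situations are covered by [separated_cut_gt0]. *)
Lemma corner_gt0 l k s p y x : cut_ok (k :: l) -> corner l s p y x ->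
  ~~ descent s k -> 0 < ell k x.
Proof.
move=> [ok kl ck] C nd; have [Px wy xE ex] := C.
apply: (separated_cut_gt0 (cut_ok_separated ok) ck Px).
move: nd; rewrite negb_and negbK => /orP[slo|shi].
  have [[j [jl dj kj]]|H] := pselect (exists j, [/\ j \in l, descent s j & k = j.+1 :> nat]).
    by constructor 3; exists j; split=> //; exact: ex.
  constructor 1; rewrite (cornerE _ C) (negPf slo) /=.
  rewrite (@walls0 _ y k wy) ?(@walls0 _ y k.+1 wy) ?subrr ?mulr0 ?addr0 //.
    move=> i /= [ik]; have -> : i = k by apply: val_inj.
    by rewrite /descent (negPf slo) !andbF.
  move=> i /= ik; apply/negP => /andP[il di]; apply: H; by exists i.
have [[j [jl dj kj]]|H] := pselect (exists j, [/\ j \in l, descent s j & j = k.+1 :> nat]).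
  by constructor 4; exists j; split=> //; exact: ex.
constructor 2; rewrite (cornerE _ C) shi /=.
rewrite (@walls0 _ y k.+1 wy) ?(@walls0 _ y k.+2 wy) ?subrr ?mulr0 ?addr0 //.
  move=> i /= [ik]; apply/negP => /andP[il di]; apply: H; by exists i.
move=> i /= [ik]; have -> : i = k by apply: val_inj.
by rewrite /descent shi !andbF.
Qed.

Definition rays_ok s p :=
  (forall i, descent s i -> 0 < p (lo i) + p (hi i)) /\ forall m, 0 <= p m.

Definition corners l := forall s p, rays_ok s p -> exists y x, corner l s p y x.

(* A point of the truncated cube on the edge leaving the k-th cut face along
   which the coordinate x_(lo k) decreases from 1; the next lemma is its mirror
   image. *)
Lemma corner_lo l k s p : cut_ok (k :: l) -> corners l -> descent s k ->
  rays_ok s p ->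
  exists (u : R) y x, [/\ 0 < u, cut_cube c d l x /\ 0 < ell k x,
    walls (fun i => (i \in l) && descent s i) y,
    x = \row_m sg (s m) + ray p y - u *: delta_mx 0 (lo k) &
    forall i, i \in l -> descent s i -> ell i x = 0].
Proof.
move=> ok IH dk [pp p0]; have [ok' kl ck] := ok.
(* The other end of the cube edge. The sign change at [lo k] may create a descent at the preceding
   cut; the zero weight in [p'] makes that cut move coordinate [lo k] alone, so that the new corner
   stays on the edge in question. *)
pose s' m := (m != lo k) && s m.
pose p' m := if m == lo k then 1 else if (m.+1 == k :> nat) && s m then 0 else p m.
have slo : s (lo k) by case/andP: dk.
have p'0 m : 0 <= p' m by rewrite /p'; case: ifP => // _; case: ifP.
have hilo i : (hi i == lo k) = (i.+1 == k :> nat) by [].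
have lolo i : (lo i == lo k) = (i == k) by [].
have [|y1 [x1 C1]] := IH s' p'.
  split=> // i; rewrite /descent /s' /p' hilo lolo.
  have [-> |ik] := eqVneq i k; first by [].
  have [E|ik'] := eqVneq (i.+1) k.
    by move=> _; case: ifP => _; rewrite ?add0r ?ltr01 // addrC ltr_pwDl.
  rewrite /= => /andP[si shi'].
  have -> : ((hi i).+1 == k :> nat) && s (hi i) = false by rewrite (negPf shi') andbF.
  by apply: pp; rewrite /descent si.
have [Px1 w1 x1E e1] := C1.
have nd : ~~ descent s' k by rewrite /descent /s' eqxx.
have g1 := corner_gt0 ok C1 nd.
have dd' i : i != k -> descent s i -> descent s' i.
  rewrite /descent /s' lolo => -> /andP[s1 s2].
  by rewrite s1 (negPf s2) andbF.
have d'd i : i.+1 != k :> nat -> descent s' i -> descent s i.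
  by rewrite /descent /s' hilo => -> /andP[/andP[_ ->]].
have yk1 : y1 k.+1 = 0.
  apply: (walls0 w1) => i [ik]; have -> : i = k by apply: val_inj.
  by rewrite (negPf nd) andbF.
have x1lo : x1 0 (lo k) = -1 + y1 k.
  by rewrite (cornerE _ C1) /s' /p' eqxx /= yk1 subr0 mul1r.
pose y2 w := if w == k :> nat then 0 else y1 w.
(* Wall [k] moves only coordinate [lo k], so its displacement is absorbed into the distance from 1
   to [-1 + y1 k]. The distance is positive because the cut facet preceding [k] does not meet the
   facet where coordinate [lo k] is 1. *)
exists (2 - y1 k), y2, x1; split=> //.
  have [cx _] := Px1; have /andP[_ x1le] := cx (lo k).
  suff : x1 0 (lo k) != 1 by move=> ne; have := lt_neqAle (x1 0 (lo k)) 1; rewrite ne x1le x1lo => h; lra.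
  have [E|/w1 [i [ki /andP[il di]]]] := eqVneq (y1 k) 0.
    by rewrite x1lo E addr0; apply/eqP; lra.
  have [_ H _] := cut_ok_separated ok' Px1.
  have [_ /eqP] := H i il (e1 i il di).
  by rewrite (lo_hi ki).
  move=> w; rewrite /y2; case: (w =P k :> nat) => [_|wk]; first by rewrite eqxx.
  move=> /w1 [i [wi /andP[il di]]]; exists i; split=> //; rewrite il d'd //.
  by apply/eqP; rewrite -wi.
  apply/rowP => m; rewrite (cornerE _ C1) !mxE eqxx /=.
  have [->|mk] := eqVneq m (lo k).
    rewrite /s' /p' eqxx /= slo /y2 eqxx.
    have -> : (k.+1 == k :> nat) = false by apply/negbTE; rewrite neq_ltn ltnSn orbT.
    by rewrite yk1 /sg; ring.
  rewrite /s' mk /= mulr0 subr0; congr (_ + _).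
  have mk' : (m == k :> nat) = false by apply/negbTE.
  rewrite /p' (negPf mk) /y2 mk'.
  have [mk1|] //= := eqVneq (m.+1) k; case: ifP => sm.
    rewrite (@walls0 _ y1 m w1) ?subrr ?mul0r ?mulr0 // => i mi.
    have E : m = hi i by apply: val_inj.
    by rewrite /descent /s' -E mk sm !andbF.
  rewrite mk1 (@walls0 _ y1 k w1) // => i ki.
  have E : lo i = m by apply: val_inj; have := mk1; rewrite ki => -[].
  by rewrite /descent /s' E sm !andbF.
move=> i il di; apply: e1 => //; apply: dd' => //.
by apply: contraNneq kl => <-.
Qed.

Lemma corner_hi l k s p : cut_ok (k :: l) -> corners l -> descent s k ->
  rays_ok s p ->
  exists (u : R) y x, [/\ 0 < u, cut_cube c d l x /\ 0 < ell k x,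
    walls (fun i => (i \in l) && descent s i) y,
    x = \row_m sg (s m) + ray p y + u *: delta_mx 0 (hi k) &
    forall i, i \in l -> descent s i -> ell i x = 0].
Proof.
move=> ok IH dk [pp p0]; have [ok' kl ck] := ok.
pose s' m := (m == hi k) || s m.
pose p' m := if m == hi k then 1 else if (m == k.+2 :> nat) && ~~ s m then 0 else p m.
have shi : s (hi k) = false by case/andP: dk => _ /negbTE.
have p'0 m : 0 <= p' m by rewrite /p'; case: ifP => // _; case: ifP.
have lohi i : (lo i == hi k) = (i == k.+1 :> nat) by [].
have hihi i : (hi i == hi k) = (i == k) by [].
have [|y1 [x1 C1]] := IH s' p'.
  split=> // i; rewrite /descent /s' /p' hihi lohi.
  have [-> |ik] := eqVneq i k; first by rewrite andbF.
  have [E|ik'] := eqVneq (i : nat) k.+1.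
    by move=> _; case: ifP => _; rewrite ?addr0 ?ltr01 // ltr_pwDl.
  rewrite /= => /andP[si shi'].
  have -> : (lo i == k.+2 :> nat) && ~~ s (lo i) = false by rewrite si andbF.
  have -> : (hi i == k.+2 :> nat) = false by apply/negbTE.
  by apply: pp; rewrite /descent si.
have [Px1 w1 x1E e1] := C1.
have nd : ~~ descent s' k by rewrite /descent /s' eqxx andbF.
have g1 := corner_gt0 ok C1 nd.
have dd' i : i != k -> descent s i -> descent s' i.
  rewrite /descent /s' hihi => /negbTE -> /andP[s1 s2].
  by rewrite s1 (negPf s2) orbT.
have d'd i : i != k.+1 :> nat -> descent s' i -> descent s i.
  rewrite /descent /s' lohi => /negbTE -> /= /andP[-> ].
  by rewrite negb_or => /andP[_ ->].
have yk1 : y1 k.+1 = 0.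
  apply: (walls0 w1) => i [ik]; have -> : i = k by apply: val_inj.
  by rewrite (negPf nd) andbF.
have x1hi : x1 0 (hi k) = 1 - y1 k.+2.
  by rewrite (cornerE _ C1) /s' /p' eqxx /= yk1 sub0r mul1r.
pose y2 w := if w == k.+2 :> nat then 0 else y1 w.
exists (2 - y1 k.+2), y2, x1; split=> //.
  have [cx _] := Px1; have /andP[x1le _] := cx (hi k).
  suff : -1 != x1 0 (hi k) by move=> ne; have := lt_neqAle (-1) (x1 0 (hi k)); rewrite ne x1le x1hi => h; lra.
  have [E|/w1 [i [ki /andP[il di]]]] := eqVneq (y1 k.+2) 0.
    by rewrite x1hi E subr0; apply/eqP; lra.
  have [_ H _] := cut_ok_separated ok' Px1.
  have [/eqP + _] := H i il (e1 i il di).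
  by rewrite eq_sym; have -> : lo i = hi k by apply: lo_hi; case: ki.
  move=> w; rewrite /y2; case: (w =P k.+2) => [_|wk]; first by rewrite eqxx.
  move=> /w1 [i [wi /andP[il di]]]; exists i; split=> //; rewrite il d'd //.
  by apply/eqP => E; apply: wk; rewrite wi E.
  apply/rowP => m; rewrite (cornerE _ C1) !mxE eqxx /=.
  have [->|mk] := eqVneq m (hi k).
    rewrite /s' /p' eqxx /= shi /y2 eqxx.
    have -> : (k.+1 == k.+2 :> nat) = false by apply/negbTE; rewrite neq_ltn ltnSn.
    by rewrite yk1 /sg; ring.
  rewrite /s' (negPf mk) /= mulr0 addr0; congr (_ + _).
  have mk' : (m.+1 == k.+2 :> nat) = false by apply/negbTE.
  rewrite /p' (negPf mk) /y2 mk'.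
  have [mk1|] //= := eqVneq (m : nat) k.+2; case: ifP => sm.
    rewrite (@walls0 _ y1 m.+1 w1) ?subrr ?mul0r ?mulr0 // => i [mi].
    have E : lo i = m by apply: val_inj.
    by rewrite /descent /s' E (negPf mk) (negPf sm) !andbF.
  rewrite mk1 (@walls0 _ y1 k.+2 w1) // => i ki.
  have E : hi i = m by apply: val_inj; rewrite /= -ki mk1.
  move/negbFE: sm => sm.
  by rewrite /descent /s' E sm orbT !andbF.
move=> i il di; apply: e1 => //; apply: dd' => //.
by apply: contraNneq kl => <-.
Qed.

Lemma ray_add p a b y z :
  ray p (fun w => a * y w + b * z w) = a *: ray p y + b *: ray p z.
Proof. by apply/rowP => k; rewrite !mxE; ring. Qed.

Lemma ell_conv i t x z : ell i ((1 - t) *: x + t *: z) = (1 - t) * ell i x + t * ell i z.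
Proof. by rewrite /ell dotDr !dotZr; ring. Qed.

Lemma cut_cube_conv l t x z : 0 <= t <= 1 -> cut_cube c d l x -> cut_cube c d l z ->
  cut_cube c d l ((1 - t) *: x + t *: z).
Proof.
move=> /andP[t0 t1] [cx lx] [cz lz]; have t1' : 0 <= 1 - t by rewrite subr_ge0.
split=> [k|i il]; last first.
  rewrite -subr_ge0 -/(ell i _) ell_conv addr_ge0 // mulr_ge0 // subr_ge0.
    exact: lx.
  exact: lz.
rewrite !mxE; have /andP[a1 a2] := cx k; have /andP[b1 b2] := cz k.
have := ler_wpM2l t1' a1; have := ler_wpM2l t1' a2.
have := ler_wpM2l t0 b1; have := ler_wpM2l t0 b2.
by rewrite !mulr1 !mulrN1 => h1 h2 h3 h4; apply/andP; split; lra.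
Qed.

(** The points supplied by [corner_lo] and [corner_hi] move one coordinate each; a convex
    combination of them moves both in the proportion prescribed by [p], that is, along the ray of
    wall [k.+1]. *)
Lemma corner_edge l k s p : cut_ok (k :: l) -> corners l -> descent s k ->
  rays_ok s p ->
  exists y x, [/\ cut_cube c d l x /\ 0 < ell k x, 0 < y k.+1,
    walls (fun i => (i \in k :: l) && descent s i) y,
    x = \row_m sg (s m) + ray p y &
    forall i, i \in l -> descent s i -> ell i x = 0].
Proof.
move=> ok IH dk rp; have [pp p0] := rp; have [ok' kl ck] := ok.
have [u [ya [xa [u0 [Pa ga] wa xaE ea]]]] := corner_lo ok IH dk rp.
have [v [yb [xb [v0 [Pb gb] wb xbE eb]]]] := corner_hi ok IH dk rp.
set a := p (lo k); set b := p (hi k).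
have ab : 0 < a + b by exact: pp.
have a0 : 0 <= a by exact: p0. have b0 : 0 <= b by exact: p0.
have q0 : 0 < a * v + b * u.
  have [E|an] := eqVneq a 0; first by move: ab; rewrite E add0r mul0r add0r => bp; exact: mulr_gt0.
  by apply: ltr_pwDl; [rewrite mulr_gt0 // lt0r an | rewrite mulr_ge0 // ltW].
(* With [e] below, this solves [(1 - t) * u = a * e] and [t * v = b * e]. *)
pose t := b * u / (a * v + b * u).
have t01 : 0 <= t <= 1.
  rewrite divr_ge0 ?(ltW q0) ?mulr_ge0 ?(ltW u0) //= ler_pdivrMr // mul1r lerDr.
  by rewrite mulr_ge0 // ltW.
have t0 : 0 <= t by case/andP: t01. have t1 : 0 <= 1 - t by rewrite subr_ge0; case/andP: t01.
pose e := u * v / (a * v + b * u).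
have e0 : 0 < e by rewrite divr_gt0 // mulr_gt0.
have yk (y : nat -> R) : walls (fun i => (i \in l) && descent s i) y -> y k.+1 = 0.
  move=> wy; apply: (walls0 wy) => i [ik]; have -> : i = k by apply: val_inj.
  by rewrite (negPf kl).
exists (fun w => (1 - t) * ya w + t * yb w + (w == k.+1)%:R * e).
exists ((1 - t) *: xa + t *: xb); split.
  split; first exact: cut_cube_conv.
  rewrite ell_conv; have [->|tn] := eqVneq t 0; first by rewrite mul0r subr0 addr0 mul1r.
  apply: ltr_wpDl; first by rewrite mulr_ge0 // ltW.
  by rewrite mulr_gt0 // lt0r tn.
  by rewrite (yk _ wa) (yk _ wb) eqxx !mulr0 add0r add0r mul1r.
  move=> w; have [-> _|wk] := eqVneq w k.+1.
    by exists k; rewrite inE eqxx.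
  rewrite mul0r addr0 => ne.
  have [E|/wa [i [wi /andP[il di]]]] := eqVneq (ya w) 0; last first.
    by exists i; rewrite inE il orbT.
  have [E'|/wb [i [wi /andP[il di]]]] := eqVneq (yb w) 0; last first.
    by exists i; rewrite inE il orbT.
  by case/eqP: ne; rewrite E E' !mulr0 addr0.
  rewrite xaE xbE; apply/rowP => m; rewrite !mxE !eqxx /=.
  have tR : true%:R = 1 :> R by []. have fR : false%:R = 0 :> R by [].
  have E1 : (1 - t) * u = a * e by rewrite /t /e; field; rewrite gt_eqF.
  have E2 : t * v = b * e by rewrite /t /e; field; rewrite gt_eqF.
  have -> : (m == lo k) = (m.+1 == k.+1 :> nat) by [].
  have -> : (m == hi k) = (m == k.+1 :> nat) by [].
  have [mlo|mlo] := eqVneq (m.+1 : nat) k.+1.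
    have -> : (m == k.+1 :> nat) = false by apply/negbTE; rewrite neq_ltn -mlo ltnSn.
    have -> : p m = a by rewrite /a; congr p; apply: val_inj; case: mlo.
    rewrite tR fR; apply: subr0_eq; transitivity (a * e - (1 - t) * u); first by ring.
    by rewrite E1 subrr.
  have [mhi|mhi] := eqVneq (m : nat) k.+1.
    have -> : p m = b by rewrite /b; congr p; apply: val_inj.
    rewrite tR fR; apply: subr0_eq; transitivity (t * v - b * e); first by ring.
    by rewrite E2 subrr.
  by rewrite /= fR; ring.
move=> i il di; rewrite ell_conv ea // eb //; ring.
Qed.

(** At a descent [k] the corner of the previous polytope lies in the face about to be cut off, where
    [ell k] is negative, while [corner_edge] gives a point with [ell k] positive and the same other
    cuts tight. The zero of [ell k] between them is the new corner. *)
Lemma cut_ok_corners l : cut_ok l -> corners l.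
Proof.
elim: l => [|k l IH].
  move=> _ s p _; exists (fun=> 0), (\row_k sg (s k)); split=> //.
    split=> // k; rewrite mxE /sg; case: (s k); lra.
    by move=> w; rewrite eqxx.
  by apply/rowP => k; rewrite !mxE subrr mulr0 addr0.
move=> ok s p rp; have [ok' kl ck] := ok.
have [y0 [x0 C0]] := IH ok' s p rp; have [P0 w0 x0E e0] := C0.
have [dk|nd] := boolP (descent s k); last first.
  exists y0, x0; have g0 := corner_gt0 ok C0 nd; split=> //.
    by apply/cut_cube_cons; split=> //; exact: ltW.
    by move=> w /w0 [i [wi /andP[il di]]]; exists i; rewrite inE il orbT.
  move=> i; rewrite inE => /orP[/eqP ->|]; last exact: e0.
  by rewrite (negPf nd).
have [y1 [x1 [[P1 g1] yk w1 x1E e1]]] := corner_edge ok (IH ok') dk rp.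
have l0 : ell k x0 < 0.
  apply: (cut_off_face_lt0 ck P0); have [cx _] := P0; have /andP[slo shi] := dk.
  have yk1 : y0 k.+1 = 0.
    apply: (walls0 w0) => i [ik]; have -> : i = k by apply: val_inj.
    by rewrite (negPf kl).
  split; split=> //; rewrite (cornerE _ C0).
    rewrite slo (@walls0 _ y0 k w0) ?yk1 /sg; first by ring.
    move=> i ki; have E : hi i = lo k by rewrite -(lo_hi ki).
    by rewrite /descent E slo !andbF.
  rewrite (negPf shi) yk1 (@walls0 _ y0 k.+2 w0) /sg; first by ring.
  move=> i [ki]; have E : lo i = hi k by apply: lo_hi; case: ki.
  by rewrite /descent E (negPf shi) !andbF.
have g01 : 0 < ell k x1 - ell k x0 by lra.
pose t := - ell k x0 / (ell k x1 - ell k x0).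
have t01 : 0 <= t <= 1.
  rewrite divr_ge0 ?(ltW g01) ?oppr_ge0 ?(ltW l0) //= ler_pdivrMr // mul1r; lra.
have ek : ell k ((1 - t) *: x0 + t *: x1) = 0.
  by rewrite ell_conv /t; field; rewrite gt_eqF.
exists (fun w => (1 - t) * y0 w + t * y1 w), ((1 - t) *: x0 + t *: x1); split.
  by apply/cut_cube_cons; rewrite ek; split=> //; exact: cut_cube_conv.
  move=> w ne; have [E|/w1 //] := eqVneq (y1 w) 0.
  have [E'|/w0 [i [wi /andP[il di]]]] := eqVneq (y0 w) 0; last first.
    by exists i; rewrite inE il orbT.
  by case/eqP: ne; rewrite E E' !mulr0 addr0.
  by rewrite ray_add x0E x1E; apply/rowP => m; rewrite !mxE; ring.
move=> i; rewrite inE => /orP[/eqP -> //|il di].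
by rewrite ell_conv e0 // e1 //; ring.
Qed.

End cuts.

Section wall_functions.
Context {R : realType} {n : nat}.
Implicit Types (tau : 'I_n.-1 -> R) (p : 'I_n -> R).

(** Indexed by natural numbers so that the first and the last coordinate, which have a cut on one
    side only, need no separate formulas: the missing walls get the value 0. *)
Definition wallfun tau (w : nat) : R :=
  if w is w'.+1 then oapp tau 0 (insub w') else 0.

Lemma wallfunS tau (i : 'I_n.-1) : wallfun tau i.+1 = tau i.
Proof. by rewrite /wallfun valK. Qed.

Lemma wallfun_eq0 tau w : (forall i : 'I_n.-1, w = i.+1 -> tau i = 0) ->
  wallfun tau w = 0.
Proof.
case: w => [//|w] H; rewrite /wallfun; case: insubP => //= i _ iw.
by apply: H; rewrite iw.
Qed.

Lemma walls_wallfun (P : pred 'I_n.-1) y : walls P y ->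
  y =1 wallfun (fun i => y i.+1).
Proof.
move=> wy w; have [yw|/wy [i [-> _]]] := eqVneq (y w) 0; last by rewrite wallfunS.
by rewrite yw; apply/esym/wallfun_eq0 => i <-.
Qed.

Definition rho p (j : 'I_n.-1) : 'rV[R]_n := ray p (fun w => (w == j.+1)%:R).

Lemma wallfun_sum tau w : wallfun tau w = \sum_j tau j * (w == j.+1)%:R.
Proof.
have [[i iw]|H] := pselect (exists i : 'I_n.-1, w = i.+1).
  rewrite iw wallfunS (bigD1 i) //= eqxx mulr1 big1 ?addr0 // => j ji.
  have -> : (i.+1 == j.+1) = false by apply/negbTE; rewrite eqSS eq_sym.
  by rewrite mulr0.
rewrite wallfun_eq0 => [|i iw]; last by case: H; exists i.
rewrite big1 // => j _; case: eqP => [E|_]; last by rewrite mulr0.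
by case: H; exists j.
Qed.

Lemma ray_wallfun p tau : ray p (wallfun tau) = \sum_j tau j *: rho p j.
Proof.
apply/rowP => k; rewrite summxE !mxE !wallfun_sum -sumrB mulr_sumr.
by apply: eq_bigr => j _; rewrite !mxE; ring.
Qed.

End wall_functions.

(** * Positivity of the determinants attached to the cuts *)

Section cut_kernel.
Context {R : realType} {n : nat}.
Variables (c : 'I_n.-1 -> 'rV[R]_n) (d : 'I_n.-1 -> R).
Implicit Types (l : seq 'I_n.-1) (i j k : 'I_n.-1) (p : 'I_n -> R).
Implicit Types (P : pred 'I_n.-1) (s : 'I_n -> bool).

(** Rows outside [P] are unit vectors, so the determinant is the principal minor on [P] while the
    size of the matrix stays fixed during the induction. *)
Definition cut_gram p P : 'M[R]_n.-1 :=
  \matrix_(i, j) if P i then - dot (c i) (rho p j) else (i == j)%:R.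

Lemma cut_gram_mul p P (tau : 'I_n.-1 -> R) i :
  \sum_j cut_gram p P i j * tau j =
  if P i then - dot (c i) (ray p (wallfun tau)) else tau i.
Proof.
case: ifP => Pi.
  rewrite ray_wallfun dot_sumr -sumrN; apply: eq_bigr => j _.
  by rewrite mxE Pi dotZr; ring.
rewrite (bigD1 i) //= big1 ?addr0 => [|j ji]; first by rewrite mxE Pi eqxx mul1r.
by rewrite mxE Pi eq_sym (negPf ji) mul0r.
Qed.

(* The edge of the truncated cube leaving the k-th cut face solves a linear
   system with matrix the Gram matrix, so that Cramer's rule gives its sign. *)
Lemma cut_gram_det_gt0 l s p : cut_ok c d l -> rays_ok s p ->
  0 < \det (cut_gram p (fun i => (i \in l) && descent s i)).
Proof.
move=> ok rp; elim: l ok => [|k l IH].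
  move=> _; rewrite (_ : cut_gram _ _ = 1%:M) ?det1 //.
  by apply/matrixP => i j; rewrite !mxE.
move=> ok; have [ok' kl ck] := ok; have IHl := IH ok'.
have [dk|nd] := boolP (descent s k); last first.
  rewrite (_ : cut_gram _ _ = cut_gram p (fun i => (i \in l) && descent s i)) //.
  apply/matrixP => i j; rewrite !mxE inE.
  by have [->|] //= := eqVneq i k; rewrite (negPf nd) !andbF.
have [y0 [x0 C0]] := cut_ok_corners ok' rp; have [P0 w0 x0E e0] := C0.
have [y1 [x1 [[P1 g1] yk w1 x1E e1]]] := corner_edge ok (cut_ok_corners ok') dk rp.
have y0k : y0 k.+1 = 0.
  apply: (walls0 w0) => i [ik]; have -> : i = k by apply: val_inj.
  by rewrite (negPf kl).
have l0 : ell c d k x0 < 0.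
  apply: (cut_off_face_lt0 ck P0); have [cx _] := P0; have /andP[slo shi] := dk.
  split; split=> //; rewrite (cornerE _ C0).
    rewrite slo (@walls0 R n _ y0 k w0) ?y0k /sg; first by ring.
    move=> i ki; have E : hi i = lo k by rewrite -(lo_hi ki).
    by rewrite /descent E slo !andbF.
  rewrite (negPf shi) y0k (@walls0 R n _ y0 k.+2 w0) /sg; first by ring.
  move=> i [ki]; have E : lo i = hi k by apply: lo_hi; case: ki.
  by rewrite /descent E (negPf shi) !andbF.
set P := (fun i => (i \in k :: l) && descent s i).
set P' := (fun i => (i \in l) && descent s i) in IHl w0 *.
pose tau i := y1 i.+1 - y0 i.+1.
have rtau : ray p (wallfun tau) = x1 - x0.
  have -> : x1 - x0 = ray p y1 - ray p y0 by rewrite x1E x0E opprD addrACA subrr add0r.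
  apply/rowP => m; rewrite !mxE.
  have E w : wallfun tau w = y1 w - y0 w.
    rewrite (walls_wallfun w1) (walls_wallfun w0) !wallfun_sum -sumrB.
    by apply: eq_bigr => j _; rewrite -mulrBl.
  by rewrite !E; ring.
pose v : 'cV[R]_n.-1 := \col_i tau i.
pose K := ell c d k x1 - ell c d k x0.
have K0 : 0 < K by rewrite /K; lra.
(* Between the corner and the end of the edge only the slack of cut [k] changes, and it increases by
   [K]. *)
have Mv : cut_gram p P *m v = K *: delta_mx k 0.
  apply/colP => i; rewrite !mxE eqxx andbT.
  under eq_bigr do rewrite [v _ _]mxE.
  rewrite cut_gram_mul rtau /P inE.
  have [->|ik] := eqVneq i k.
    by rewrite dk /K /ell dotBr mulr1; ring.
  rewrite /= mulr0; case: ifP => [/andP[il di]|nP].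
    have := e0 i il di; have := e1 i il di; rewrite /ell dotBr; lra.
  rewrite /tau (@walls0 R n _ y0 i.+1 w0) ?(@walls0 R n _ y1 i.+1 w1) ?subrr //.
    by move=> j [ij]; rewrite -(val_inj ij) /= inE (negPf ik) /= nP.
  by move=> j [ij]; rewrite -(val_inj ij) /P' nP.
have D : \det (cut_gram p P) * tau k = K * cofactor (cut_gram p P) k k.
  have := congr1 (fun A => (\adj (cut_gram p P) *m A) k 0) Mv.
  rewrite mulmxA mul_adj_mx mul_scalar_mx -scalemxAr -colE !mxE.
  by rewrite /cofactor.
(* Before the cut, row [k] is a unit vector; expanding along it gives the cofactor of the new
   matrix, whose sign is known by induction. *)
have C : \det (cut_gram p P') = cofactor (cut_gram p P) k k.
  rewrite (expand_det_row _ k) (bigD1 k) //= big1 ?addr0 => [|j jk]; last first.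
    by rewrite mxE /P' (negPf kl) /= eq_sym (negPf jk) mul0r.
  rewrite mxE /P' (negPf kl) /= eqxx mul1r /cofactor; congr (_ * \det _).
  apply/matrixP => i j; rewrite !mxE /P inE.
  by rewrite [lift k i == k]eq_sym (negPf (neq_lift k i)).
have tk : 0 < tau k by rewrite /tau y0k subr0.
have : 0 < \det (cut_gram p P) * tau k by rewrite D -C mulr_gt0.
by rewrite pmulr_lgt0.
Qed.

(** Induction on the number of rows in which both weights are nonzero: such a row splits the
    determinant into two with fewer mixed rows. Without mixed rows the matrix is a positive diagonal
    matrix times [cut_gram]. *)
Lemma cut_gram_mixed_det_gt0 l p (t e : 'I_n.-1 -> R) :
  cut_ok c d l -> (forall i, i \in l) -> (forall m, 0 <= p m) ->
  (forall i, 0 <= t i) -> (forall i, 0 <= e i) -> (forall i, 0 < t i + e i) ->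
  (forall i, t i != 0 -> 0 < p (lo i) + p (hi i)) ->
  (forall i j, t i != 0 -> t j != 0 -> j <> i.+1 :> nat) ->
  0 < \det (\matrix_(i, j) (t i * - dot (c i) (rho p j) + e i * (i == j)%:R)).
Proof.
move=> ok al p0; move: {2}(#|_|) (leqnn #|[pred i | (t i != 0) && (e i != 0)]|) => m.
elim: m t e => [|m IH] t e le t0 e0 te pt adj.
  pose P i := t i != 0.
  (* The vertex with sign 1 exactly at the positions [lo i], for [i] in [P]. Its descents are
     exactly [P] because [P] has no two consecutive elements. *)
  pose s m := [exists i, P i && (lo i == m)].
  have sP i : descent s i = P i.
    apply/andP/idP => [[/existsP[j /andP[Pj /eqP ji]] _]|Pi].
      by have -> : i = j by apply: val_inj; have := congr1 val ji.
    split; first by apply/existsP; exists i; rewrite Pi eqxx.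
    apply/negP => /existsP[j /andP[Pj /eqP ji]].
    by apply: (adj i j Pi Pj); have := congr1 val ji.
  rewrite (_ : (\matrix_(i, j) _) = diag_mx (\row_i (t i + e i)) *m
      cut_gram p (fun i => (i \in l) && descent s i)).
    rewrite det_mulmx det_diag mulr_gt0 //.
      by apply: prodr_gt0 => i _; rewrite mxE.
    apply: cut_gram_det_gt0 => //; split=> // i; rewrite sP; exact: pt.
  apply/matrixP => i j; rewrite mul_diag_mx !mxE al sP /P /=.
  case: ifPn => [ti|]; last by rewrite negbK => /eqP ->; rewrite mul0r !add0r.
  have -> : e i = 0; last by rewrite mul0r !addr0.
  apply/eqP; apply: contraTT le => ei; rewrite -ltnNge; apply/card_gt0P; exists i.
  by rewrite inE ti ei.
have [/existsP[k /andP[tk ek]]|/existsPn N] := boolP [exists i, (t i != 0) && (e i != 0)]; last first.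
  apply: IH => //; rewrite (eq_card0 (A := [pred i | _])) // => i.
  by rewrite inE; exact/negbTE/N.
pose t1 i := if i == k then 0 else t i. pose e1 i := if i == k then 0 else e i.
have smaller (t' e' : 'I_n.-1 -> R) : (forall i, (t' i != 0) && (e' i != 0) -> i != k /\ (t i != 0) && (e i != 0)) ->
   (#|[pred i | (t' i != 0%R) && (e' i != 0%R)]| <= m)%N.
  move=> H; rewrite -ltnS; apply: leq_trans le; apply: proper_card; apply/properP; split.
    by apply/fintype.subsetP => i; rewrite !inE => /H [].
  by exists k; rewrite inE ?tk ?ek //; apply/negP => /H []; rewrite eqxx.
rewrite (@determinant_multilinear _ _ _
   (\matrix_(i, j) (t i * - dot (c i) (rho p j) + e1 i * (i == j)%:R))
   (\matrix_(i, j) (t1 i * - dot (c i) (rho p j) + e i * (i == j)%:R)) k 1 1).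
  rewrite !mul1r; apply: addr_gt0; apply: IH => //.
    apply: smaller => i; rewrite /e1; case: (i =P k) => [_|/eqP ik ->//]; by rewrite eqxx andbF.
    by move=> i; rewrite /e1; case: ifP.
    by move=> i; rewrite /e1; case: (i =P k) => [->|//]; rewrite addr0 lt0r tk t0.
    apply: smaller => i; rewrite /t1; case: (i =P k) => [_|/eqP ik ->//]; by rewrite eqxx.
    by move=> i; rewrite /t1; case: ifP.
    by move=> i; rewrite /t1; case: (i =P k) => [->|//]; rewrite add0r lt0r ek e0.
    move=> i; rewrite /t1; case: ifP => [_|_]; first by rewrite eqxx. exact: pt.
    move=> i j; rewrite /t1; case: ifP => [_|_]; first by rewrite eqxx.
    case: ifP => [_ _|_]; first by rewrite eqxx. exact: adj.
  by apply/rowP => j; rewrite !mxE /t1 /e1 eqxx; ring.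
  by apply/matrixP => i j; rewrite !mxE /e1 [lift k i == k]eq_sym (negPf (neq_lift k i)).
  by apply/matrixP => i j; rewrite !mxE /t1 [lift k i == k]eq_sym (negPf (neq_lift k i)).
Qed.

End cut_kernel.

Section good_cuts.
Context {R : realType} {n : nat}.
Implicit Types (c : 'I_n.-1 -> 'rV[R]_n) (d : 'I_n.-1 -> R) (l : seq 'I_n.-1).

(** The interface between polytopes and analysis. It is met by every cut sequence and, by a direct
    check, by the standard cuts. The last field says that the linear system for a vector killed by
    the derivative has only the zero solution. *)
Record good_cuts c d l : Prop := GoodCuts {
  good_mem : forall i, i \in l ;
  good_const : forall e, e = 1 \/ e = -1 -> forall i, 0 < ell c d i (const_mx e) ;
  good_face : forall x, cut_cube c d l x -> forall i,
    x 0 (lo i) = 1 -> x 0 (hi i) <> -1 ;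
  good_facet : forall x, cut_cube c d l x -> forall i,
    ell c d i x = 0 -> x 0 (lo i) <> -1 /\ x 0 (hi i) <> 1 ;
  good_adjacent : forall x, cut_cube c d l x -> forall i j : 'I_n.-1, j = i.+1 :> nat ->
    ell c d i x = 0 -> ell c d j x <> 0 ;
  good_kernel : forall (p : 'I_n -> R) (t e tau : 'I_n.-1 -> R),
    (forall m, 0 <= p m) -> (forall i, 0 <= t i) -> (forall i, 0 <= e i) ->
    (forall i, 0 < t i + e i) ->
    (forall i, t i != 0 -> 0 < p (lo i) + p (hi i)) ->
    (forall i j : 'I_n.-1, t i != 0 -> t j != 0 -> j <> i.+1 :> nat) ->
    (forall i, t i * dot (c i) (ray p (wallfun tau)) = e i * tau i) ->
    forall i, tau i = 0 }.

Lemma cut_sequence_good c d l : cut_sequence c d l -> good_cuts c d l.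
Proof.
move=> cs; have ok := cut_sequence_ok cs.
have al i : i \in l by have [/perm_mem -> _] := cs; rewrite mem_enum.
have alr i : i \in rev l by rewrite mem_rev.
have E : cut_cube c d l = cut_cube c d (rev l).
  by apply: cut_cube_eq_mem => i; rewrite mem_rev.
have S := cut_ok_separated ok.
split=> //.
  by move=> e e1 i; have [_] := const_in_cut_cube e1 ok; apply.
  by move=> x; rewrite E => /S [H _ _] i; apply: H.
  by move=> x; rewrite E => /S [_ H _] i; apply: H.
  by move=> x; rewrite E => /S [_ _ H] i j; apply: H.
move=> p t e tau p0 t0 e0 te pt adj H i.
have := cut_gram_mixed_det_gt0 ok alr p0 t0 e0 te pt adj.
set A := (\matrix_(i, j) _) => dA.
have uA : A \in unitmx by rewrite unitmxE unitfE gt_eqF.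
have : A *m (\col_i tau i) = 0.
  apply/colP => j; rewrite !mxE.
  transitivity (e j * tau j - t j * dot (c j) (ray p (wallfun tau))); last by rewrite H subrr.
  rewrite ray_wallfun dot_sumr mulr_sumr (bigD1 j) //= [in RHS](bigD1 j) //=.
  rewrite /A !mxE eqxx -[true%:R]/(1 : R) dotZr opprD addrA; congr (_ + _); first by ring.
  rewrite -sumrN; apply: eq_bigr => k kj.
  by rewrite /A !mxE eq_sym (negPf kj) -[false%:R]/(0 : R) dotZr; ring.
by move/(congr1 (mulmx (invmx A))); rewrite mulKmx // mulmx0 => /colP /(_ i); rewrite !mxE.
Qed.

Definition std_normal (i : 'I_n.-1) : 'rV[R]_n := delta_mx 0 (lo i) - delta_mx 0 (hi i).
(** On the cut facet this level forces coordinate [lo i] to be at least 1/2 and [hi i] at most -1/2,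
    so the neighbouring cuts keep a slack of at least 1 there and do not interfere with the interval
    factor. *)
Definition std_level (i : 'I_n.-1) : R := 3 / 2.

Lemma std_ell i x : ell std_normal std_level i x = 3 / 2 - x 0 (lo i) + x 0 (hi i).
Proof. by rewrite /ell /std_normal dotDl dotNl !dot_delta /std_level; ring. Qed.

Lemma std_good : good_cuts std_normal std_level (enum 'I_n.-1).
Proof.
split.
  by move=> i; rewrite mem_enum.
  by move=> e e1 i; rewrite std_ell !mxE; lra.
  move=> x [cx lx] i xl xh; have := lx i; rewrite mem_enum -subr_ge0 -/(ell _ _ _ _) std_ell.
  by move=> /(_ isT); lra.
  move=> x [cx lx] i; rewrite std_ell => E.
  have := cx (lo i); have := cx (hi i) => /andP[? ?] /andP[? ?]; split; lra.
  move=> x [cx lx] i j ij; rewrite !std_ell (lo_hi ij) => E1 E2.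
  have := cx (lo i); have := cx (hi i); have := cx (hi j).
  by clear ij; move=> /andP[? ?] /andP[? ?] /andP[? ?]; lra.
move=> p t e tau p0 t0 e0 te pt adj H.
have Z i : t i = 0 -> tau i = 0.
  move=> ti; have := H i; have := te i; rewrite ti mul0r add0r => ei /eqP.
  by rewrite eq_sym mulf_eq0 (gt_eqF ei) => /eqP.
move=> i; have [/Z //|ti] := eqVneq (t i) 0.
(* Cuts with nonzero weight are never consecutive, so both neighbouring unknowns vanish and the
   equation at [i] involves [tau i] alone. *)
have w1 : wallfun tau i = 0.
  apply: wallfun_eq0 => j ij; apply: Z; apply/eqP; apply: contrapT => /negP tj.
  exact: adj tj ti ij.
have w2 : wallfun tau i.+2 = 0.
  apply: wallfun_eq0 => j [ij]; apply: Z; apply/eqP; apply: contrapT => /negP tj.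
  by apply: (adj i j ti tj).
have := H i; rewrite /std_normal dotDl dotNl !dot_delta !mxE.
rewrite -[nat_of_ord (lo i)]/(nat_of_ord i) -[nat_of_ord (hi i)]/(i.+1).
rewrite w1 w2 wallfunS => E.
have : (t i * (p (lo i) + p (hi i)) + e i) * tau i = 0 by move: E; lra.
move/eqP; rewrite mulf_eq0 => /orP[|/eqP //].
have := pt i ti => pp; have tp : 0 < t i by rewrite lt0r ti t0.
by rewrite gt_eqF //; apply: ltr_pwDl => //; exact: mulr_gt0.
Qed.

End good_cuts.

(** * Spectra of arrow matrices *)

Section arrow_char_poly.

(* Multiplying by the block triangular matrix N below clears the first column
   under the diagonal. *)
Lemma det_arrow (D : idomainType) n (x : D) (u : 'rV[D]_n) (v : 'cV[D]_n) (e : 'rV[D]_n) :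
  (forall k, e 0 k != 0) ->
  \det (block_mx x%:M u v (diag_mx e) : 'M[D]_(1 + n)) =
  x * \prod_k e 0 k - \sum_k (u 0 k * v k 0) * \prod_(j | j != k) e 0 j.
Proof.
move=> e0; pose P := \prod_k e 0 k; pose f k := \prod_(j | j != k) e 0 j.
have Pf k : e 0 k * f k = P by rewrite /P (bigD1 k).
have P0 : P != 0 by apply/prodf_neq0 => k _.
pose w : 'cV[D]_n := \col_k (- (f k * v k 0)).
pose N : 'M[D]_(1 + n) := block_mx P%:M 0 w 1%:M.
have dN : \det N = P by rewrite det_lblock det1 mulr1 det_scalar1.
apply: (mulIf P0); rewrite -{1}dN -det_mulmx mulmx_block.
have -> : v *m P%:M + diag_mx e *m w = 0.
  apply/colP => k; rewrite mul_diag_mx !mxE big_ord1 !mxE eqxx mulr1n -(Pf k).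
  by ring.
rewrite !mulmx0 !mulmx1 !add0r det_ublock det_diag -/P; congr (_ * _).
rewrite det_mx11 mxE -scalar_mxM !mxE eqxx mulr1n; congr (_ + _).
rewrite -sumrN; apply: eq_bigr => k _; rewrite !mxE /f; ring.
Qed.

Lemma char_poly_arrow (K : fieldType) n (A : 'M[K]_n.+1) : arrow_matrix A ->
  char_poly A =
  ('X - (A 0 0)%:P) * \prod_(k < n) ('X - (A (lift ord0 k) (lift ord0 k))%:P) -
  \sum_(k < n) (A 0 (lift ord0 k) * A (lift ord0 k) 0)%:P *
     \prod_(j | j != k) ('X - (A (lift ord0 j) (lift ord0 j))%:P).
Proof.
move=> arr; pose e : 'rV[{poly K}]_n := \row_k ('X - (A (lift ord0 k) (lift ord0 k))%:P).
pose u : 'rV[{poly K}]_n := \row_k - (A 0 (lift ord0 k))%:P.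
pose v : 'cV[{poly K}]_n := \col_k - (A (lift ord0 k) 0)%:P.
have -> : char_poly A = \det (block_mx ('X - (A 0 0)%:P)%:M u v (diag_mx e) : 'M[{poly K}]_(1 + n)).
  rewrite /char_poly; congr (\det _); apply/matrixP => i j.
  case: (@split_ordP 1 n i) => i' ->; case: (@split_ordP 1 n j) => j' ->.
    transitivity ((('X - (A 0 0)%:P)%:M : 'M[{poly K}]_1) i' j'); last exact/esym/block_mxEul.
    rewrite !ord1 !mxE.
    have -> : lshift n (0 : 'I_1) = 0 :> 'I_n.+1 by apply: val_inj.
    by rewrite !eqxx !mulr1n.
    transitivity (u i' j'); last exact/esym/block_mxEur.
    rewrite !ord1 !mxE.
    have -> : rshift 1 j' = lift ord0 j' by apply: val_inj.
    have -> : lshift n (0 : 'I_1) = 0 :> 'I_n.+1 by apply: val_inj.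
    by rewrite -[0 == _]/false mulr0n sub0r.
    transitivity (v i' j'); last exact/esym/block_mxEdl.
    rewrite !ord1 !mxE.
    have -> : rshift 1 i' = lift ord0 i' by apply: val_inj.
    have -> : lshift n (0 : 'I_1) = 0 :> 'I_n.+1 by apply: val_inj.
    by rewrite -[_ == 0]/false mulr0n sub0r.
    transitivity (diag_mx e i' j'); last exact/esym/block_mxEdr.
    rewrite !mxE.
    have -> : rshift 1 i' = lift ord0 i' by apply: val_inj.
    have -> : rshift 1 j' = lift ord0 j' by apply: val_inj.
    rewrite (inj_eq lift_inj); have [->|ij] := eqVneq i' j'; first by rewrite !mulr1n.
    have -> : A (lift ord0 i') (lift ord0 j') = 0.
      by apply: arr => //; rewrite (inj_eq lift_inj).
    by rewrite !mulr0n subr0.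
rewrite det_arrow => [|k]; last by rewrite mxE polyXsubC_eq0.
congr (_ * _ - _); first by apply: eq_bigr => k _; rewrite mxE.
apply: eq_bigr => k _; rewrite !mxE polyCM mulrNN; congr (_ * _).
by apply: eq_bigr => j _; rewrite mxE.
Qed.

End arrow_char_poly.

Section spectrum.
Context {R : realType} {n : nat}.
Variable lam : 'I_n.+1 -> R.
Hypothesis lam_mono : forall i j : 'I_n.+1, (i < j)%N -> lam i < lam j.

Lemma lam_inj : injective lam.
Proof.
move=> i j E; case: (ltngtP i j) => [/lam_mono|/lam_mono|/val_inj //];
  by rewrite E ltxx.
Qed.

(** [n + 1] distinct eigenvalues exhaust the roots of a monic polynomial of degree [n + 1]. The
    morphism [f] is kept general because the criterion is needed for complex matrices. *)
Lemma spectrumP (K : fieldType) (f : {rmorphism R -> K}) (A : 'M[K]_n.+1) :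
  (forall z, eigenvalue A z <-> exists j, z = f (lam j)) <->
  char_poly A = \prod_j ('X - (f (lam j))%:P).
Proof.
pose rs := [seq f (lam j) | j <- enum 'I_n.+1].
have rsE : \prod_(z <- rs) ('X - z%:P) = \prod_j ('X - (f (lam j))%:P).
  by rewrite big_map big_enum.
split=> [H|E z]; last first.
  rewrite eigenvalue_root_char E -rsE root_prod_XsubC; split.
    by case/mapP => j _ ->; exists j.
  by case=> j ->; apply: map_f; rewrite mem_enum.
have sz : size (char_poly A) = (size rs).+1.
  by rewrite size_char_poly size_map size_enum_ord.
have rt : all (root (char_poly A)) rs.
  apply/allP => z /mapP[j _ ->]; rewrite -eigenvalue_root_char; apply/H.
  by exists j.
have ur : uniq_roots rs.
  rewrite uniq_rootsE map_inj_uniq ?enum_uniq // => i j.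
  by move/fmorph_inj; exact: lam_inj.
have := all_roots_prod_XsubC sz rt ur.
by rewrite (monicP (char_poly_monic A)) scale1r rsE.
Qed.

Definition lam_poly : {poly R} := \prod_j ('X - (lam j)%:P).

Lemma M_StRP (A : 'M[R]_n.+1) : M_StR lam A <->
  [/\ A^T = A, arrow_matrix A & char_poly A = lam_poly].
Proof.
have cE : char_poly (complexify A) = map_poly (real_complex R) (char_poly A).
  by rewrite /complexify map_char_poly.
have pE : map_poly (real_complex R) lam_poly = \prod_j ('X - ((real_complex R) (lam j))%:P).
  rewrite rmorph_prod; apply: eq_bigr => j _.
  by rewrite rmorphB /= map_polyX map_polyC.
have symE : (complexify A \is hermsymmx) <-> A^T = A.
  split.
    move/is_hermitianmxP; rewrite expr0 scale1r => H; apply/matrixP => i j.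
    have := congr1 (fun B : 'M[R[i]]_n.+1 => B j i) H; rewrite !mxE => h.
    by have := congr1 (@complex.Re R) h.
  move=> H; apply/is_hermitianmxP; rewrite expr0 scale1r; apply/matrixP => i j.
  by rewrite !mxE -{1}H mxE; apply/esym; exact: conjc_real.
split.
  move=> [h arr sp]; split; first exact/symE.
    move=> i j i0 j0 ij; have := arr i j i0 j0 ij; rewrite mxE.
    by move/(congr1 (@complex.Re R)).
  apply: (@map_poly_inj _ _ (real_complex R)).
  by rewrite -cE pE; apply/spectrumP.
move=> [s arr cp]; split; first exact/symE.
  by move=> i j i0 j0 ij; rewrite mxE arr.
by apply/spectrumP; rewrite cE cp pE.
Qed.

Definition arrow_mx (a0 : R) (a b : 'I_n -> R) : 'M[R]_n.+1 :=
  \matrix_(i, j) match unlift ord0 i, unlift ord0 j with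
    | None, None => a0
    | Some k, None | None, Some k => b k
    | Some k, Some m => if k == m then a k else 0
    end.

Lemma arrow_mx00 a0 a b : arrow_mx a0 a b 0 0 = a0.
Proof. by rewrite mxE unlift_none. Qed.

Lemma arrow_mx0S a0 a b k : arrow_mx a0 a b 0 (lift ord0 k) = b k.
Proof. by rewrite mxE unlift_none liftK. Qed.

Lemma arrow_mxS0 a0 a b k : arrow_mx a0 a b (lift ord0 k) 0 = b k.
Proof. by rewrite mxE unlift_none liftK. Qed.

Lemma arrow_mxSS a0 a b k m :
  arrow_mx a0 a b (lift ord0 k) (lift ord0 m) = if k == m then a k else 0.
Proof. by rewrite mxE !liftK. Qed.

Lemma lift0P (i : 'I_n.+1) : i = 0 \/ exists k, i = lift ord0 k.
Proof. by case: (unliftP ord0 i) => [k|] ->; [right; exists k|left]. Qed.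

Lemma arrow_mx_arrow a0 a b : arrow_matrix (arrow_mx a0 a b).
Proof.
move=> i j; case: (lift0P i) => [->|[k ->]]; first by rewrite eqxx.
case: (lift0P j) => [->|[m ->]]; first by rewrite eqxx.
by rewrite (inj_eq lift_inj) arrow_mxSS => _ _ /negPf ->.
Qed.

Lemma arrow_mx_sym a0 a b : (arrow_mx a0 a b)^T = arrow_mx a0 a b.
Proof.
apply/matrixP => i j; rewrite mxE.
case: (lift0P i) => [->|[k ->]]; case: (lift0P j) => [->|[m ->]] //.
  by rewrite arrow_mx0S arrow_mxS0.
  by rewrite arrow_mx0S arrow_mxS0.
by rewrite !arrow_mxSS eq_sym; case: eqP => // ->.
Qed.

Lemma arrow_mxE (A : 'M[R]_n.+1) : A^T = A -> arrow_matrix A ->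
  A = arrow_mx (A 0 0) (fun k => A (lift ord0 k) (lift ord0 k)) (fun k => A 0 (lift ord0 k)).
Proof.
move=> sA arr; apply/matrixP => i j.
case: (lift0P i) => [->|[k ->]]; case: (lift0P j) => [->|[m ->]].
  by rewrite arrow_mx00.
  by rewrite arrow_mx0S.
  by rewrite arrow_mxS0 -{1}sA mxE.
rewrite arrow_mxSS; have [->//|km] := eqVneq k m.
by rewrite arr // (inj_eq lift_inj).
Qed.

Definition arrow_eq (a0 : R) (a b : 'I_n -> R) : Prop :=
  lam_poly = ('X - a0%:P) * \prod_k ('X - (a k)%:P) -
    \sum_k (b k ^+ 2)%:P * \prod_(j | j != k) ('X - (a j)%:P).

Lemma arrow_mx_char_poly a0 a b : char_poly (arrow_mx a0 a b) =
  ('X - a0%:P) * \prod_k ('X - (a k)%:P) -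
    \sum_k (b k ^+ 2)%:P * \prod_(j | j != k) ('X - (a j)%:P).
Proof.
rewrite (char_poly_arrow (@arrow_mx_arrow a0 a b)) arrow_mx00; congr (_ * _ - _).
  by apply: eq_bigr => k _; rewrite arrow_mxSS eqxx.
apply: eq_bigr => k _; rewrite arrow_mx0S arrow_mxS0 expr2; congr (_ * _).
by apply: eq_bigr => j _; rewrite arrow_mxSS eqxx.
Qed.

Lemma arrow_mx_M_StR a0 a b : M_StR lam (arrow_mx a0 a b) <-> arrow_eq a0 a b.
Proof.
rewrite M_StRP arrow_mx_char_poly /arrow_eq; split=> [[_ _ //]|E].
by split=> //; [exact: arrow_mx_sym|exact: arrow_mx_arrow].
Qed.

Lemma arrow_eq_reindex a0 a b (s : 'S_n) :
  arrow_eq a0 a b <-> arrow_eq a0 (a \o s) (b \o s).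
Proof.
have E1 : \prod_k ('X - (a k)%:P) = \prod_k ('X - ((a \o s) k)%:P).
  by rewrite (reindex_inj (@perm_inj _ s)).
have E2 : \sum_k (b k ^+ 2)%:P * \prod_(j | j != k) ('X - (a j)%:P) =
    \sum_k ((b \o s) k ^+ 2)%:P * \prod_(j | j != k) ('X - ((a \o s) j)%:P).
  rewrite (reindex_inj (@perm_inj _ s)) /=; apply: eq_bigr => k _.
  rewrite (reindex_inj (@perm_inj _ s)) /=; congr (_ * _).
  by apply: eq_bigl => j; rewrite (inj_eq perm_inj).
by rewrite /arrow_eq E1 E2.
Qed.

(** At [a k] every summand except the [k]-th contains the factor ['X - a k]. *)
Lemma arrow_eq_at a0 a b k : arrow_eq a0 a b ->
  \prod_j (a k - lam j) = - (b k ^+ 2 * \prod_(j | j != k) (a k - a j)).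
Proof.
move=> /(congr1 (fun p => p.[a k])).
rewrite /lam_poly horner_prod hornerD hornerN hornerM !horner_prod horner_sum.
under eq_bigr do rewrite hornerXsubC.
have Z : \prod_i ('X - (a i)%:P).[a k] = 0.
  by rewrite (bigD1 k) //= hornerXsubC subrr mul0r.
move=> ->; rewrite Z mulr0 sub0r (bigD1 k) //= [X in _ + X]big1 ?addr0 => [|m mk].
  rewrite hornerM hornerC horner_prod; congr (- (_ * _)).
  by apply: eq_bigr => j _; rewrite hornerXsubC.
rewrite hornerM horner_prod (bigD1 k) 1?eq_sym //= hornerXsubC subrr.
by rewrite mul0r mulr0.
Qed.

Lemma lam_poly_char : lam_poly = char_poly (diag_mx (\row_j lam j)).
Proof.
rewrite char_poly_trig ?diag_mx_is_trig //; apply: eq_bigr => j _.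
by rewrite !mxE eqxx mulr1n.
Qed.

Lemma arrow_eq_trace a0 a b : arrow_eq a0 a b -> a0 = \sum_j lam j - \sum_k a k.
Proof.
move=> E; have T1 : lam_poly`_n = - \sum_j lam j.
  rewrite lam_poly_char -[n in LHS]/(n.+1.-1) char_poly_trace // mxtrace_diag.
  by congr (- _); apply: eq_bigr => j _; rewrite mxE.
have T2 : lam_poly`_n = - (a0 + \sum_k a k).
  rewrite E -arrow_mx_char_poly -[n in LHS]/(n.+1.-1) char_poly_trace //.
  rewrite /mxtrace big_ord_recl arrow_mx00; congr (- (_ + _)).
  by apply: eq_bigr => j _; rewrite arrow_mxSS eqxx.
by have : \sum_j lam j = a0 + \sum_k a k; [apply: oppr_inj; rewrite -T1 T2 | move=> ->; rewrite addrK].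
Qed.

(** Both sides are monic of degree [n + 1], and the choice of [a0] by the trace makes their
    coefficients of degree [n] agree. The difference has degree below [n] and vanishes at the [n]
    distinct points [a k]. *)
Lemma arrow_eq_interpolation a b : injective a ->
  (forall k, \prod_j (a k - lam j) = - (b k ^+ 2 * \prod_(j | j != k) (a k - a j))) ->
  arrow_eq (\sum_j lam j - \sum_k a k) a b.
Proof.
set a0 := _ - _ => ia H; rewrite /arrow_eq -arrow_mx_char_poly lam_poly_char.
set p := char_poly _; set q := char_poly _.
have pn : p`_n = - \sum_j lam j.
  rewrite -[n in LHS]/(n.+1.-1) char_poly_trace // mxtrace_diag.
  by congr (- _); apply: eq_bigr => j _; rewrite mxE.
have qn : q`_n = - (a0 + \sum_k a k).
  rewrite -[n in LHS]/(n.+1.-1) char_poly_trace //.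
  rewrite /mxtrace big_ord_recl arrow_mx00; congr (- (_ + _)).
  by apply: eq_bigr => j _; rewrite arrow_mxSS eqxx.
have szp : size p = n.+2 by exact: size_char_poly.
have szq : size q = n.+2 by exact: size_char_poly.
have lp : p`_n.+1 = 1 by have /monicP := char_poly_monic (diag_mx (\row_j lam j)); rewrite /lead_coef -/p szp.
have lq : q`_n.+1 = 1 by have /monicP := char_poly_monic (arrow_mx a0 a b); rewrite /lead_coef -/q szq.
apply/eqP; rewrite -subr_eq0; apply/eqP.
apply: (@roots_geq_poly_eq0 _ _ [seq a k | k <- enum 'I_n]).
  apply/allP => z /mapP[k _ ->]; rewrite /root hornerD hornerN.
  rewrite /p -lam_poly_char /lam_poly horner_prod.
  under eq_bigr do rewrite hornerXsubC.
  rewrite H /q arrow_mx_char_poly hornerD hornerN hornerM !horner_prod horner_sum.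
  have Z : \prod_i ('X - (a i)%:P).[a k] = 0.
    by rewrite (bigD1 k) //= hornerXsubC subrr mul0r.
  rewrite Z mulr0 add0r opprK.
  rewrite [X in _ + X](bigD1 k) //= [X in _ + (_ + X)]big1 ?addr0 => [|m mk]; last first.
    rewrite hornerM horner_prod (bigD1 k) 1?eq_sym //= hornerXsubC subrr.
    by rewrite mul0r mulr0.
  rewrite hornerM hornerC horner_prod.
  by under [X in _ + _ * X]eq_bigr do rewrite hornerXsubC; rewrite addNr.
  by rewrite map_inj_uniq ?enum_uniq.
rewrite size_map size_enum_ord; apply/leq_sizeP => i ni; rewrite coefB.
have [->|ni1] := eqVneq i n; first by rewrite pn qn /a0 subrK subrr.
have [->|ni2] := eqVneq i n.+1; first by rewrite lp lq subrr.
by rewrite !nth_default ?subrr // ?szp ?szq; lia.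
Qed.

(** Evaluating at a double diagonal entry gives only [0 = 0]. The identity is divisible by
    ['X - lam w]; cancelling this factor before evaluating leaves information about the sum of the
    two squares. *)
Lemma arrow_eq_double a0 a b p q w : p != q -> a p = lam w -> a q = lam w ->
  arrow_eq a0 a b ->
  \prod_(j | j != w) (lam w - lam j) =
    - ((b p ^+ 2 + b q ^+ 2) * \prod_(j | (j != p) && (j != q)) (lam w - a j)).
Proof.
move=> pq ap aq E; set z := lam w.
pose P := \prod_(j | (j != p) && (j != q)) ('X - (a j)%:P).
pose S := \sum_(k | (k != p) && (k != q)) (b k ^+ 2)%:P *
  \prod_(j | [&& j != k, j != p & j != q]) ('X - (a j)%:P).
have F k : k != p -> k != q -> \prod_(j | j != k) ('X - (a j)%:P) =
   ('X - z%:P) * (('X - z%:P) * \prod_(j | [&& j != k, j != p & j != q]) ('X - (a j)%:P)).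
  move=> kp kq; rewrite (bigD1 p) 1?eq_sym //= ap; congr (_ * _).
  rewrite (bigD1 q) ?aq /=; last by rewrite eq_sym kq eq_sym.
  by congr (_ * _); apply: eq_bigl => j; rewrite andbA.
have Fp : \prod_(j | j != p) ('X - (a j)%:P) = ('X - z%:P) * P.
  by rewrite (bigD1 q) 1?eq_sym //= aq.
have Fq : \prod_(j | j != q) ('X - (a j)%:P) = ('X - z%:P) * P.
  rewrite (bigD1 p) //= ap; congr (_ * _).
  by apply: eq_bigl => j; rewrite andbC.
have C : ('X - z%:P) * \prod_(j | j != w) ('X - (lam j)%:P) = ('X - z%:P) *
    (('X - a0%:P) * ('X - z%:P) * P - ((b p ^+ 2 + b q ^+ 2)%:P * P + ('X - z%:P) * S)).
  transitivity lam_poly; first by rewrite /lam_poly [RHS](bigD1 w).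
  rewrite E (bigD1 p) //= Fp ap -/z.
  rewrite [X in _ - X](bigD1 p) //= Fp [X in _ - (_ + X)](bigD1 q) 1?eq_sym //= Fq.
  have -> : \sum_(i < n | (i != p) && (i != q)) (b i ^+ 2)%:P *
      \prod_(j | j != i) ('X - (a j)%:P) = ('X - z%:P) * (('X - z%:P) * S).
    rewrite /S !mulr_sumr; apply: eq_bigr => k /andP[kp kq]; rewrite F //; ring.
  by rewrite polyCD; ring.
have nz : 'X - z%:P != 0 :> {poly R} by rewrite polyXsubC_eq0.
move/(mulfI nz)/(congr1 (fun r => r.[z])): C.
rewrite !(hornerD, hornerN, hornerM, hornerC, hornerX, horner_prod).
rewrite subrr !(mulr0, mul0r) addr0 sub0r => C.
have E1 : \prod_(j | j != w) ('X - (lam j)%:P).[z] = \prod_(j | j != w) (z - lam j).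
  by apply: eq_bigr => j _; rewrite hornerXsubC.
rewrite -E1 C; congr (- (_ * _)).
by apply: eq_bigr => j _; rewrite hornerXsubC.
Qed.

Lemma left_kernel (C : 'M[R]_(n.+1, n)) : exists2 x : 'rV[R]_n.+1, x != 0 & x *m C = 0.
Proof.
have : kermx C != 0.
  by rewrite -mxrank_eq0 mxrank_ker -lt0n subn_gt0 (leq_ltn_trans (rank_leq_col C)).
by case/rowV0Pn => x /sub_kermxP xC x0; exists x.
Qed.

Lemma arrow_quad a0 (a b : 'I_n -> R) (u : 'rV[R]_n.+1) : u 0 0 = 0 ->
  (u *m arrow_mx a0 a b *m u^T) 0 0 = \sum_k a k * u 0 (lift ord0 k) ^+ 2.
Proof.
move=> u0; rewrite mxE big_ord_recl !mxE u0 mulr0 add0r.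
apply: eq_bigr => k _; rewrite !mxE big_ord_recl u0 mul0r add0r (bigD1 k) //=.
rewrite arrow_mxSS eqxx big1 ?addr0 => [|m mk]; first by ring.
by rewrite arrow_mxSS (negPf mk) mulr0.
Qed.

Lemma row_sq (u : 'rV[R]_n.+1) : u 0 0 = 0 ->
  (u *m u^T) 0 0 = \sum_k u 0 (lift ord0 k) ^+ 2.
Proof.
move=> u0; rewrite mxE big_ord_recl !mxE u0 mulr0 add0r.
by apply: eq_bigr => k _; rewrite !mxE expr2.
Qed.

(** Eigenvectors of a symmetric matrix for distinct eigenvalues are orthogonal. They are not
    normalized; [e j] is the squared length of the [j]-th one. *)
Lemma eigenbasis a0 a b : arrow_eq a0 a b ->
  exists (v : 'M[R]_n.+1) (e : 'I_n.+1 -> R), [/\ forall j, 0 < e j,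
    forall x : 'rV_n.+1, (x *m v *m (x *m v)^T) 0 0 = \sum_j e j * x 0 j ^+ 2 &
    forall x : 'rV_n.+1, (x *m v *m arrow_mx a0 a b *m (x *m v)^T) 0 0 =
      \sum_j lam j * (e j * x 0 j ^+ 2)].
Proof.
move=> E; set A := arrow_mx a0 a b.
have ev j : eigenvalue A (lam j).
  rewrite eigenvalue_root_char /A arrow_mx_char_poly -E /lam_poly rootE horner_prod.
  by rewrite (bigD1 j) //= hornerXsubC subrr mul0r.
have H j : exists u : 'rV[R]_n.+1, u *m A = lam j *: u /\ u != 0.
  by have /eigenvalueP[u uA u0] := ev j; exists u.
pose w j := projT1 (cid (H j)).
have wA j : w j *m A = lam j *: w j by rewrite /w; case: cid => u [].
have w0 j : w j != 0 by rewrite /w; case: cid => u [].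
pose v : 'M[R]_n.+1 := \matrix_j w j.
pose e j := (w j *m (w j)^T) 0 0.
have orth i j : i != j -> (w i *m (w j)^T) 0 0 = 0.
  move=> ij; have : lam i * (w i *m (w j)^T) 0 0 = lam j * (w i *m (w j)^T) 0 0.
    transitivity ((w i *m A *m (w j)^T) 0 0); first by rewrite wA -scalemxAl [RHS]mxE.
    have -> : w i *m A *m (w j)^T = w i *m (w j *m A)^T.
      by rewrite trmx_mul arrow_mx_sym mulmxA.
    by rewrite wA linearZ /= -scalemxAr [LHS]mxE.
  move/eqP; rewrite -subr_eq0 -mulrBl mulf_eq0 subr_eq0 (inj_eq lam_inj) (negPf ij) /=.
  by move/eqP.
have vv : v *m v^T = diag_mx (\row_j e j).
  apply/matrixP => i j; rewrite !mxE.
  have -> : \sum_j0 v i j0 * v^T j0 j = (w i *m (w j)^T) 0 0.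
    by rewrite [RHS]mxE; apply: eq_bigr => m _; rewrite !mxE.
  have [->|ij] := eqVneq i j; first by rewrite mulr1n.
  by rewrite orth // mulr0n.
have vA : v *m A = diag_mx (\row_j lam j) *m v.
  apply/row_matrixP => j; rewrite row_mul rowK wA; apply/rowP => m.
  by rewrite mxE mxE mul_diag_mx !mxE.
exists v, e; split.
  move=> j; rewrite /e mxE lt_neqAle sumr_ge0 ?andbT => [|m _]; last first.
    by rewrite !mxE -expr2 sqr_ge0.
  apply/eqP => /esym/eqP; rewrite psumr_eq0 => [/allP H0|m _]; last first.
    by rewrite !mxE -expr2 sqr_ge0.
  case/eqP: (w0 j); apply/rowP => m; have := H0 m; rewrite mem_index_enum.
  by move=> /(_ isT)/=; rewrite !mxE -expr2 sqrf_eq0 => /eqP.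
  move=> x; rewrite trmx_mul mulmxA -(mulmxA x) vv mul_mx_diag mxE.
  by apply: eq_bigr => j _; rewrite !mxE; ring.
move=> x; rewrite trmx_mul -[x *m v *m A]mulmxA vA !mulmxA -(mulmxA _ v) vv.
rewrite !mul_mx_diag mxE.
by apply: eq_bigr => j _; rewrite !mxE; ring.
Qed.

(** Cauchy interlacing by a dimension count. On vectors whose zeroth entry is 0 the quadratic form
    is diagonal with coefficients [a]; a nonzero vector lying both in a span of eigenvectors and in
    a coordinate subspace compares the two descriptions of the form. *)
Lemma interlacing a0 a b (s : 'S_n) :
  arrow_eq a0 a b -> (forall k m : 'I_n, (k <= m)%N -> a (s k) <= a (s m)) ->
  forall k, lam (widen_ord (leqnSn n) k) <= a (s k) <= lam (lift ord0 k).
Proof.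
move=> E srt k; have [v [e [e0 vv vA]]] := eigenbasis E.
have lamle (i j : 'I_n.+1) : (i <= j)%N -> lam i <= lam j.
  rewrite leq_eqVlt => /orP[/eqP/val_inj->//|/lam_mono/ltW//].
have sub (x : 'rV[R]_n.+1) i : (x *m v) 0 i = \sum_j x 0 j * v j i by rewrite mxE.
have pos (x : 'rV[R]_n.+1) : x != 0 -> 0 < (x *m v *m (x *m v)^T) 0 0.
  move=> x0; rewrite vv lt_neqAle sumr_ge0 ?andbT => [|m _]; last first.
    by apply: mulr_ge0; [apply: ltW|apply: sqr_ge0].
  apply/eqP => /esym/eqP; rewrite psumr_eq0 => [/allP H0|m _]; last first.
    by apply: mulr_ge0; [apply: ltW|apply: sqr_ge0].
  case/eqP: x0; apply/rowP => m; have := H0 m; rewrite mem_index_enum.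
  by move=> /(_ isT)/=; rewrite mxE mulf_eq0 sqrf_eq0 (gt_eqF (e0 m)) => /eqP.
apply/andP; split.
  (* The columns are [n] conditions on [n + 1] coefficients: no eigenvector of index below [k],
     zeroth entry 0, and no component at [s m] for [m > k]. The form is then at least [lam_k] and at
     most [a (s k)] times the squared length. *)
  pose C : 'M[R]_(n.+1, n) := \matrix_(j, m) (if (m < k)%N then (j == widen_ord (leqnSn n) m)%:R
     else if m == k then v j 0 else v j (lift ord0 (s m))).
  have [x x0 xC] := left_kernel C.
  have K m : \sum_j x 0 j * C j m = 0.
    by have := congr1 (fun z : 'rV[R]_n => z 0 m) xC; rewrite !mxE.
  have x1 (j : 'I_n.+1) : (j < k)%N -> x 0 j = 0.
    move=> jk; have jn : (j < n)%N by apply: ltn_trans jk _.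
    have := K (Ordinal jn); rewrite (bigD1 j) //= mxE /= jk.
    have -> : j == widen_ord (leqnSn n) (Ordinal jn) by apply/eqP; apply: val_inj.
    rewrite mulr1 big1 ?addr0 // => i ij; rewrite mxE /= jk.
    case: eqP => [Ei|_]; last by rewrite mulr0.
    by case/eqP: ij; rewrite Ei; apply: val_inj.
  have u0 : (x *m v) 0 0 = 0.
    rewrite sub; transitivity (\sum_j x 0 j * C j k); last exact: K.
    apply: eq_bigr => j _.
    by rewrite mxE ltnn eqxx.
  have u1 (m : 'I_n) : (k < m)%N -> (x *m v) 0 (lift ord0 (s m)) = 0.
    move=> km; rewrite sub; transitivity (\sum_j x 0 j * C j m); last exact: K.
    apply: eq_bigr => j _.
    rewrite mxE ltnNge (ltnW km) /=; case: eqP => [mk|//].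
    by rewrite mk ltnn in km.
  have := pos x x0; set y := (_ *m _ *m _) 0 0 => y0.
  suff : lam (widen_ord (leqnSn n) k) * y <= a (s k) * y by rewrite ler_pM2r.
  apply: (@le_trans _ _ ((x *m v *m arrow_mx a0 a b *m (x *m v)^T) 0 0)).
    rewrite vA /y vv mulr_sumr; apply: ler_sum => j _.
    have [jk|kj] := ltnP j k; first by rewrite x1 // expr0n /= !mulr0.
    apply: ler_wpM2r; last exact: lamle.
    by apply: mulr_ge0; [apply: ltW|apply: sqr_ge0].
  rewrite arrow_quad // /y row_sq // mulr_sumr.
  rewrite [X in X <= _](reindex_inj (@perm_inj _ s)) [X in _ <= X](reindex_inj (@perm_inj _ s)) /=.
apply: ler_sum => m _.
  have [mk|km] := leqP m k; last by rewrite u1 // expr0n /= !mulr0.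
  by apply: ler_wpM2r; [apply: sqr_ge0|apply: srt].
(* The dual count: no eigenvector of index above [k.+1], zeroth entry 0, and no component at [s m]
   for [m < k]. *)
pose C : 'M[R]_(n.+1, n) := \matrix_(j, m) (if (m < k)%N then v j (lift ord0 (s m))
   else if m == k then v j 0 else (j == lift ord0 m)%:R).
have [x x0 xC] := left_kernel C.
have K m : \sum_j x 0 j * C j m = 0.
  by have := congr1 (fun z : 'rV[R]_n => z 0 m) xC; rewrite !mxE.
have x1 (j : 'I_n.+1) : (k.+1 < j)%N -> x 0 j = 0.
  case: (lift0P j) => [->//|[m ->]]; rewrite lift0 ltnS => km.
  have := K m; rewrite (bigD1 (lift ord0 m)) //= mxE ltnNge (ltnW km) /=.
  rewrite -[m == k]/(val m == val k) gtn_eqF // eqxx mulr1.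
  rewrite big1 ?addr0 // => i im; rewrite mxE ltnNge (ltnW km) /=.
  by rewrite -[m == k]/(val m == val k) gtn_eqF // (negPf im) mulr0.
have u0 : (x *m v) 0 0 = 0.
  rewrite sub; transitivity (\sum_j x 0 j * C j k); last exact: K.
    apply: eq_bigr => j _.
  by rewrite mxE ltnn eqxx.
have u1 (m : 'I_n) : (m < k)%N -> (x *m v) 0 (lift ord0 (s m)) = 0.
  move=> km; rewrite sub; transitivity (\sum_j x 0 j * C j m); last exact: K.
    by apply: eq_bigr => j _; rewrite mxE km.
have := pos x x0; set y := (_ *m _ *m _) 0 0 => y0.
suff : a (s k) * y <= lam (lift ord0 k) * y by rewrite ler_pM2r.
apply: (@le_trans _ _ ((x *m v *m arrow_mx a0 a b *m (x *m v)^T) 0 0)); last first.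
  rewrite vA /y vv mulr_sumr; apply: ler_sum => j _.
  have [jk|kj] := ltnP k.+1 j; first by rewrite x1 // expr0n /= !mulr0.
  apply: ler_wpM2r; last by apply: lamle; rewrite lift0.
  by apply: mulr_ge0; [apply: ltW|apply: sqr_ge0].
rewrite arrow_quad // /y row_sq // mulr_sumr.
rewrite [X in X <= _](reindex_inj (@perm_inj _ s)) [X in _ <= X](reindex_inj (@perm_inj _ s)) /=.
apply: ler_sum => m _.
have [mk|km] := leqP k m; last by rewrite u1 // expr0n /= !mulr0.
by apply: ler_wpM2r; [apply: sqr_ge0|apply: srt].
Qed.

End spectrum.

Lemma sorting_perm {R : realType} {n : nat} (a : 'I_n -> R) :
  exists s : 'S_n, forall k m : 'I_n, (k <= m)%N -> a (s k) <= a (s m).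
Proof.
pose t := [tuple a k | k < n].
have sz : size (sort <=%O t) == n by rewrite size_sort size_tuple.
pose t' : n.-tuple R := Tuple sz.
have /tuple_permP[s E] : perm_eq t' t by rewrite perm_sort.
exists s => k m km.
have nthE i : a (s i) = nth 0 t' i by rewrite E -tnth_nth !tnth_mktuple.
rewrite !nthE; apply: (@sorted_leq_nth _ <=%O (@le_trans _ _) (@lexx _ _) 0) => //.
  by apply: sort_sorted; apply: le_total.
  by rewrite inE size_tuple.
by rewrite inE size_tuple.
Qed.

(** * Resolved diagonals *)

Section walls_of_the_cube.
Context {R : realType} {n : nat}.

(** A quantity attached to walls, with a prescribed value at the two outer ones. The value 1 makes
    them neutral in products, and 0 is used for derivatives. *)
Definition wallo (F : 'I_n.-1 -> R) (x : R) (w : nat) : R :=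
  if w is w'.+1 then oapp F x (insub w') else x.

Lemma walloS F x (i : 'I_n.-1) : wallo F x i.+1 = F i.
Proof. by rewrite /wallo valK. Qed.

Lemma wallP (w : nat) : (exists i : 'I_n.-1, w = i.+1) \/
  (forall F x, wallo F x w = x).
Proof.
case: w => [|w]; first by right.
have [wn|nw] := ltnP w n.-1; first by left; exists (Ordinal wn).
by right=> F x; rewrite /wallo insubF // ltnNge nw.
Qed.

Lemma leftP (k : 'I_n) : (exists i : 'I_n.-1, k = hi i) \/
  ((forall F x, wallo F x k = x) /\ forall m : 'I_n, m.+1 <> k :> nat).
Proof.
case: (wallP k) => [[i ki]|H]; first by left; exists i; apply: val_inj.
right; split=> // m mk; have mn : (m < n.-1)%N by have := ltn_ord k; lia.
have := H (fun=> 1) 0; rewrite -mk (walloS _ _ (Ordinal mn)).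
by move/eqP; rewrite oner_eq0.
Qed.

Lemma rightP (k : 'I_n) : (exists i : 'I_n.-1, k = lo i) \/
  ((forall F x, wallo F x k.+1 = x) /\ forall m : 'I_n, m <> k.+1 :> nat).
Proof.
case: (wallP k.+1) => [[i [ki]]|H]; first by left; exists i; apply: val_inj.
right; split=> // m mk; have kn : (k < n.-1)%N by have := ltn_ord m; lia.
have := H (fun=> 1) 0; rewrite (walloS _ _ (Ordinal kn)).
by move/eqP; rewrite oner_eq0.
Qed.

Lemma wallo_hi F x i : wallo F x (hi i) = F i.
Proof. by rewrite -[nat_of_ord (hi i)]/(i.+1) walloS. Qed.

Lemma wallo_lo F x i : wallo F x (lo i).+1 = F i.
Proof. by rewrite -[nat_of_ord (lo i)]/(nat_of_ord i) walloS. Qed.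

Lemma wallo_ind (P : R -> Prop) F x w : P x -> (forall i, P (F i)) -> P (wallo F x w).
Proof. by move=> Px PF; case: (wallP w) => [[i ->]|->] //; rewrite walloS. Qed.

Lemma prod_left (P : pred 'I_n) F (k : 'I_n) : (forall m : 'I_n, m.+1 = k :> nat -> P m) ->
  \prod_(m | P m) (if m.+1 == k :> nat then wallo F 1 k else 1) = wallo F 1 k.
Proof.
move=> PP; case: (leftP k) => [[i ki]|[-> H]]; last first.
  by rewrite big1 // => m _; case: ifP.
have ik : (lo i).+1 = k :> nat by rewrite ki.
rewrite (bigD1 (lo i)) /=; last exact: PP.
rewrite ik eqxx big1 ?mulr1 // => m /andP[_ mi]; case: eqP => // mk.
by case/eqP: mi; apply: val_inj; move: mk ik => /= <- [].
Qed.

Lemma prod_right (P : pred 'I_n) F (k : 'I_n) : (forall m : 'I_n, m = k.+1 :> nat -> P m) ->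
  \prod_(m | P m) (if m == k.+1 :> nat then wallo F 1 k.+1 else 1) = wallo F 1 k.+1.
Proof.
move=> PP; case: (rightP k) => [[i ki]|[-> H]]; last first.
  by rewrite big1 // => m _; case: ifP.
have ik : hi i = k.+1 :> nat by rewrite ki.
rewrite (bigD1 (hi i)) /=; last exact: PP.
rewrite [X in if X then _ else _](_ : _ = true); last by rewrite -ik eqxx.
rewrite big1 ?mulr1 // => m /andP[_ mi]; case: eqP => // mk.
by case/eqP: mi; apply: val_inj; rewrite /= mk -ik.
Qed.

End walls_of_the_cube.

Section isospectral_data.
Context {R : realType} {n : nat}.
Variable lam : 'I_n.+1 -> R.
Hypothesis lam_mono : forall i j : 'I_n.+1, (i < j)%N -> lam i < lam j.
Implicit Types (a b P Q : 'I_n -> R) (k m : 'I_n).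

Definition lft k := lam (widen_ord (leqnSn n) k).
Definition rgt k := lam (lift ord0 k).

Definition in_cells a : Prop := forall k, lft k <= a k <= rgt k.

Lemma lft_rgt k : lft k < rgt k.
Proof. by apply: lam_mono; rewrite lift0. Qed.

Lemma rgt_lft k m : m = k.+1 :> nat -> rgt k = lft m.
Proof. by move=> mk; congr lam; apply: val_inj; rewrite /= mk. Qed.

Lemma rgt_lo i : rgt (lo i) = lft (hi i).
Proof. exact: rgt_lft. Qed.

Lemma rgt_le_lft k m : (k < m)%N -> rgt k <= lft m.
Proof.
move=> km; have [E|NE] := eqVneq (m : nat) k.+1; first by rewrite (rgt_lft E).
apply/ltW/lam_mono; rewrite lift0 /=.
by rewrite ltn_neqAle eq_sym NE.
Qed.

Lemma rgt_lt_lft k m : (k.+1 < m)%N -> rgt k < lft m.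
Proof. by move=> km; apply: lam_mono; rewrite lift0. Qed.

Lemma in_cells_le a k m : in_cells a -> (k < m)%N -> a k <= a m.
Proof.
move=> ca km; have /andP[_ h1] := ca k; have /andP[h2 _] := ca m.
by apply: le_trans h1 _; apply: le_trans h2; apply: rgt_le_lft.
Qed.

Lemma in_cells_lt a k m : in_cells a -> (k.+1 < m)%N -> a k < a m.
Proof.
move=> ca km; have /andP[_ h1] := ca k; have /andP[h2 _] := ca m.
by apply: le_lt_trans h1 _; apply: lt_le_trans h2; apply: rgt_lt_lft.
Qed.

Arguments wallo : simpl never.

Lemma cells_lt a k m : in_cells a -> (forall i : 'I_n.-1, a (lo i) < a (hi i)) ->
  (k < m)%N -> a k < a m.
Proof.
move=> ca H; rewrite leq_eqVlt => /orP[/eqP km|km]; last exact: (in_cells_lt ca km).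
have kn : (k < n.-1)%N by have := ltn_ord m; lia.
have := H (Ordinal kn); have -> : lo (Ordinal kn) = k by apply: val_inj.
by have -> : hi (Ordinal kn) = m by apply: val_inj.
Qed.

Lemma cells_inj a : in_cells a -> (forall i : 'I_n.-1, a (lo i) < a (hi i)) ->
  injective a.
Proof.
move=> ca H k m E; case: (ltngtP k m) => [|| /val_inj //] /(cells_lt ca H).
  by rewrite E ltxx.
by rewrite E ltxx.
Qed.

(** The denominators of the quotients [P] and [Q]. At the outer walls there is no neighbouring
    diagonal entry, and the denominator is 1. *)
Definition sd a (w : nat) := wallo (fun i => a (hi i) - a (lo i)) 1 w.

Lemma sd_ge0 a w : in_cells a -> 0 <= sd a w.
Proof.
move=> ca; apply: (@wallo_ind _ _ (fun z => 0 <= z)) => // i; rewrite subr_ge0.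
exact: in_cells_le.
Qed.

(** The part of [a k - a m] that never vanishes. For neighbours, whose difference may be zero, only
    the sign is kept; the difference itself is collected in [sd]. *)
Definition den a k m :=
  if m.+1 == k :> nat then 1 else if m == k.+1 :> nat then -1 else a k - a m.

Definition Gfactor a k :=
  \prod_(m | m != k) ((a k - lam (lift (widen_ord (leqnSn n) k) m)) / den a k m).

Lemma ord_cases k m : m != k -> [\/ m.+1 = k :> nat, m = k.+1 :> nat,
  (m.+1 < k)%N | (k.+1 < m)%N].
Proof.
move=> mk; have {}mk : m <> k :> nat by move=> /val_inj E; rewrite E eqxx in mk.
have [H|H|H] := ltngtP m.+1 k; [by apply: Or43| |by apply: Or41].
have [H2|H2|H2] := ltngtP m k.+1; [lia|by apply: Or44|by apply: Or42].
Qed.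

Lemma den_neq0 a k m : in_cells a -> m != k -> den a k m != 0.
Proof.
move=> ca mk; rewrite /den; case: (m.+1 =P k :> nat) => [_|h1]; first by rewrite oner_eq0.
case: (m =P k.+1 :> nat) => [_|h2]; first by rewrite oppr_eq0 oner_eq0.
case: (ord_cases mk) => // h; rewrite subr_eq0.
  by rewrite gt_eqF // in_cells_lt.
by rewrite lt_eqF // in_cells_lt.
Qed.

(** The index [lift (widen_ord _ k) m] pairs [a m] with [lam_m] when [m < k] and with [lam_(m+1)]
    when [m > k]. Numerator and denominator of each factor then have the same sign. *)
Lemma Gfactor_gt0 a k : in_cells a -> 0 < Gfactor a k.
Proof.
move=> ca; apply: prodr_gt0 => m mk; have /andP[ka1 ka2] := ca k.
have [lt|gt] : (m < k)%N \/ (k < m)%N.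
    by case: (ltngtP m k) => [||/val_inj E]; [left|right|rewrite E eqxx in mk].
  rewrite divr_gt0 //.
    rewrite subr_gt0; apply: lt_le_trans ka1; apply: lam_mono.
    by rewrite /= /bump; lia.
  rewrite /den; case: eqP => // h1; case: eqP => [h2|_]; first lia.
  by rewrite subr_gt0 in_cells_lt //; lia.
rewrite -mulrNN -invrN divr_gt0 ?oppr_gt0 //.
  rewrite subr_lt0; apply: le_lt_trans ka2 _; apply: lam_mono.
  by rewrite /= /bump; lia.
rewrite /den; case: eqP => [h1|_]; first lia.
case: eqP => [_|h1]; first by rewrite ltrN10.
by rewrite subr_lt0 in_cells_lt //; lia.
Qed.

Lemma prod_lam k z : \prod_j (z - lam j) =
  (z - lft k) * (z - rgt k) * \prod_(m | m != k) (z - lam (lift (widen_ord (leqnSn n) k) m)).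
Proof.
rewrite (bigD1_ord (widen_ord (leqnSn n) k)) //= (bigD1 k) //= mulrA.
congr (_ * (_ - lam _) * _); apply: val_inj => /=.
by rewrite /bump leqnn.
Qed.

Lemma Gfactor_den a k : in_cells a ->
  \prod_(m | m != k) (a k - lam (lift (widen_ord (leqnSn n) k) m)) =
  Gfactor a k * \prod_(m | m != k) den a k m.
Proof.
move=> ca; rewrite -big_split; apply: eq_bigr => m mk /=.
by rewrite divfK // den_neq0.
Qed.

Lemma sub_den a k m : m != k -> a k - a m = den a k m *
  ((if m.+1 == k :> nat then sd a k else 1) *
   (if m == k.+1 :> nat then sd a k.+1 else 1)).
Proof.
move=> mk; rewrite /den; case: eqP => [h|h].
  have -> : (m == k.+1 :> nat) = false by apply/eqP; lia.
  rewrite mul1r mulr1; case: (@leftP R n k) => [[i ki]|[_ H]]; last by case: (H m h).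
  rewrite ki /sd wallo_hi; congr (_ - a _); apply: val_inj => /=.
  by move: h; rewrite ki /=; lia.
case: eqP => h2; last by rewrite !mulr1.
rewrite mul1r; case: (@rightP R n k) => [[i ki]|[_ H]]; last by case: (H m h2).
rewrite ki /sd wallo_lo; have -> : m = hi i by apply: val_inj; rewrite /= h2 ki.
by rewrite mulN1r opprB.
Qed.

Lemma prod_den a k : \prod_(m | m != k) (a k - a m) =
  sd a k * sd a k.+1 * \prod_(m | m != k) den a k m.
Proof.
rewrite (eq_bigr _ (@sub_den a k)) !big_split /= mulrC; congr (_ * _ * _).
  by apply: prod_left => m mk; apply/eqP => E; move: mk; rewrite E; lia.
by apply: prod_right => m mk; apply/eqP => E; move: mk; rewrite E; lia.
Qed.

Lemma prod_den_lo a i : \prod_(m | (m != lo i) && (m != hi i)) (a (lo i) - a m) =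
  sd a (lo i) * \prod_(m | (m != lo i) && (m != hi i)) den a (lo i) m.
Proof.
have E m : (m != lo i) && (m != hi i) -> a (lo i) - a m = den a (lo i) m *
   (if m.+1 == lo i :> nat then sd a (lo i) else 1).
  case/andP => m1 m2; rewrite sub_den //; congr (_ * _).
  case: (m =P _.+1 :> nat) => [h|_]; last by rewrite mulr1.
  by case/eqP: m2; apply: val_inj.
rewrite (eq_bigr _ E) big_split /= mulrC; congr (_ * _).
apply: (@prod_left _ _ _ (fun j => a (hi j) - a (lo j)) (lo i)) => m /= mk; apply/andP; split; apply/eqP => E'.
  by move: mk; rewrite E' /=; lia.
by move: mk; rewrite E' /=; lia.
Qed.

Lemma prod_den_hi a i : \prod_(m | (m != lo i) && (m != hi i)) (a (hi i) - a m) =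
  sd a (hi i).+1 * \prod_(m | (m != lo i) && (m != hi i)) den a (hi i) m.
Proof.
have E m : (m != lo i) && (m != hi i) -> a (hi i) - a m = den a (hi i) m *
   (if m == (hi i).+1 :> nat then sd a (hi i).+1 else 1).
  case/andP => m1 m2; rewrite sub_den //; congr (_ * _).
  case: (m.+1 =P _ :> nat) => [h|_]; last by rewrite mul1r.
  by case/eqP: m1; apply: val_inj; case: h.
rewrite (eq_bigr _ E) big_split /= mulrC; congr (_ * _).
apply: (@prod_right _ _ _ (fun j => a (hi j) - a (lo j)) (hi i)) => m /= mk; apply/andP; split; apply/eqP => E'.
  by move: mk; rewrite E' /=; lia.
by move: mk; rewrite E' /=; lia.
Qed.

Lemma arrow_eq_square (a0 : R) a b k : in_cells a -> arrow_eq lam a0 a b ->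
  (a k - lft k) * (rgt k - a k) * Gfactor a k = b k ^+ 2 * (sd a k * sd a k.+1).
Proof.
move=> ca /(@arrow_eq_at R n lam a0 a b k).
rewrite (prod_lam k) Gfactor_den // prod_den => H.
have D0 : \prod_(m | m != k) den a k m != 0.
  by apply/prodf_neq0 => m mk; apply: den_neq0.
apply: (mulIf D0); apply: oppr_inj.
transitivity ((a k - lft k) * (a k - rgt k) * (Gfactor a k * \prod_(m | m != k) den a k m)).
  by ring.
by rewrite H; ring.
Qed.

Lemma square_arrow_eq a b : in_cells a -> injective a ->
  (forall k, (a k - lft k) * (rgt k - a k) * Gfactor a k = b k ^+ 2 * (sd a k * sd a k.+1)) ->
  arrow_eq lam (\sum_j lam j - \sum_k a k) a b.
Proof.
move=> ca ia H; apply: arrow_eq_interpolation => // k.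
rewrite (prod_lam k) Gfactor_den // prod_den.
have -> : b k ^+ 2 * (sd a k * sd a k.+1 * \prod_(m | m != k) den a k m) =
  (b k ^+ 2 * (sd a k * sd a k.+1)) * \prod_(m | m != k) den a k m by ring.
by rewrite -H; ring.
Qed.

Lemma sd_eq0 a (i : 'I_n.-1) : in_cells a -> sd a i.+1 = 0 ->
  a (lo i) = rgt (lo i) /\ a (hi i) = lft (hi i).
Proof.
move=> ca; rewrite /sd walloS => /eqP; rewrite subr_eq0 => /eqP E.
have /andP[_ h1] := ca (lo i); have /andP[h2 _] := ca (hi i).
have := rgt_lo i; split; lra.
Qed.

(** The two walls of a cell cannot both collapse: [a k] would be equal to both ends of an interval
    of positive length. *)
Lemma sd_left_right a k : in_cells a -> sd a k = 0 ->
  a k = lft k /\ sd a k.+1 != 0.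
Proof.
move=> ca; case: (@leftP R n k) => [[i ki]|[H _]]; last first.
  by rewrite /sd H => /eqP; rewrite oner_eq0.
move=> s0; have s0' : sd a i.+1 = 0 by move: s0; rewrite ki.
have [_ h] := sd_eq0 ca s0'; rewrite -ki in h.
split=> //; rewrite /sd; case: (@rightP R n k) => [[j kj]|[-> _]]; last by rewrite oner_eq0.
have -> : wallo (fun i => a (hi i) - a (lo i)) 1 k.+1 = a (hi j) - a k by rewrite kj wallo_lo.
rewrite h subr_eq0 gt_eqF //.
apply: lt_le_trans (lft_rgt k) _; rewrite [k in rgt k]kj rgt_lo.
by have /andP[] := ca (hi j).
Qed.

Lemma sd_right_left a k : in_cells a -> sd a k.+1 = 0 ->
  a k = rgt k /\ sd a k != 0.
Proof.
move=> ca; case: (@rightP R n k) => [[i ki]|[H _]]; last first.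
  by rewrite /sd H => /eqP; rewrite oner_eq0.
move=> s0; have s0' : sd a i.+1 = 0 by move: s0; rewrite ki.
have [h _] := sd_eq0 ca s0'; rewrite -ki in h.
split=> //; rewrite /sd; case: (@leftP R n k) => [[j kj]|[-> _]]; last by rewrite oner_eq0.
have -> : wallo (fun i => a (hi i) - a (lo i)) 1 k = a k - a (lo j) by rewrite kj wallo_hi.
rewrite h subr_eq0 gt_eqF //.
apply: le_lt_trans (lft_rgt k); rewrite [k in lft k]kj -rgt_lo.
by have /andP[] := ca (lo j).
Qed.

(* [P k] and [Q k] resolve the quotients [(a k - lft k) / sd a k] and
   [(rgt k - a k) / sd a k.+1] where they become [0 / 0]. *)
Record valid a P Q : Prop := Valid {
  valid_cells : in_cells a ;
  valid_P0 : forall k, 0 <= P k ;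
  valid_Q0 : forall k, 0 <= Q k ;
  valid_P : forall k, P k * sd a k = a k - lft k ;
  valid_Q : forall k, Q k * sd a k.+1 = rgt k - a k ;
  valid_sum : forall i, Q (lo i) + P (hi i) = 1 }.

(** A quotient with nonzero denominator is determined by [a]. If one wall of a cell has collapsed,
    the quotient at the other wall is determined and nonzero, and the product yields the missing
    one. Hence the matrix determines [P] and [Q]. *)
Lemma valid_unique a P Q P' Q' : valid a P Q -> valid a P' Q' ->
  (forall k, P k * Q k = P' k * Q' k) -> P =1 P' /\ Q =1 Q'.
Proof.
move=> [ca _ _ vP vQ _] [_ _ _ vP' vQ' _] PQ.
have E1 k : sd a k != 0 -> P k = P' k.
  by move=> s0; apply: (mulIf s0); rewrite vP vP'.
have E2 k : sd a k.+1 != 0 -> Q k = Q' k.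
  by move=> s0; apply: (mulIf s0); rewrite vQ vQ'.
split=> k.
  have [s0|s0] := eqVneq (sd a k) 0; last exact: E1.
  have [h s1] := sd_left_right ca s0; have := PQ k; rewrite (E2 k s1).
  apply: mulIf; apply/eqP => Q0; have := vQ' k; rewrite Q0 mul0r h.
  by move/eqP; rewrite eq_sym subr_eq0 gt_eqF // lft_rgt.
have [s0|s0] := eqVneq (sd a k.+1) 0; last exact: E2.
have [h s1] := sd_right_left ca s0; have := PQ k; rewrite (E1 k s1).
apply: mulfI; apply/eqP => P0; have := vP' k; rewrite P0 mul0r h.
by move/eqP; rewrite eq_sym subr_eq0 gt_eqF // lft_rgt.
Qed.

Lemma valid_square a P Q k : valid a P Q ->
  (a k - lft k) * (rgt k - a k) * Gfactor a k =
  (P k * Q k * Gfactor a k) * (sd a k * sd a k.+1).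
Proof. by move=> v; rewrite -(valid_P v) -(valid_Q v); ring. Qed.

Lemma valid_arrow_eq a P Q b : injective a -> valid a P Q ->
  (forall k, b k ^+ 2 = P k * Q k * Gfactor a k) ->
  arrow_eq lam (\sum_j lam j - \sum_k a k) a b.
Proof.
move=> ia v H; apply: square_arrow_eq => // [|k]; first exact: valid_cells v.
by rewrite (valid_square _ v) H.
Qed.

(** One application of [arrow_eq_double], read once from the left entry and once from the right one.
    Comparing the two readings is what later gives [Q + P = 1] at the collapsed wall. *)
Lemma arrow_eq_collision (a0 : R) a b (i : 'I_n.-1) : in_cells a -> arrow_eq lam a0 a b ->
  sd a i.+1 = 0 ->
  (a (lo i) - lft (lo i)) * Gfactor a (lo i) =
    (b (lo i) ^+ 2 + b (hi i) ^+ 2) * sd a (lo i) /\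
  (rgt (hi i) - a (hi i)) * Gfactor a (hi i) =
    (b (lo i) ^+ 2 + b (hi i) ^+ 2) * sd a (hi i).+1.
Proof.
move=> ca E s0; have [ap aq] := sd_eq0 ca s0.
have pq : lo i != hi i by apply/eqP => /(congr1 val) /=; lia.
have qp : hi i != lo i by rewrite eq_sym.
set w := lift ord0 (lo i); have apw : a (lo i) = lam w by [].
have wE : w = widen_ord (leqnSn n) (hi i) by apply: val_inj.
have aqw : a (hi i) = lam w by rewrite aq wE.
have D := arrow_eq_double pq apw aqw E.
split.
  have D1 : \prod_(j | j != w) (lam w - lam j) = (lam w - lft (lo i)) *
      \prod_(m | m != lo i) (lam w - lam (lift (widen_ord (leqnSn n) (lo i)) m)).
    rewrite (bigD1_ord (widen_ord (leqnSn n) (lo i))) /=; last first.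
      by apply/eqP => /(congr1 val) /=; rewrite /bump; lia.
    congr (_ * _); apply: eq_bigl => m; congr negb; apply/eqP/eqP => [|->].
      by move/(congr1 val) => /= H; apply: val_inj; move: H; rewrite /= /bump; lia.
    by apply: val_inj; rewrite /= /bump leqnn leq0n.
  rewrite -apw in D D1; rewrite D1 (Gfactor_den _ ca) prod_den_lo in D.
  rewrite (bigD1 (hi i)) //= {1}/den in D.
  have h1 : ((hi i).+1 == lo i :> nat) = false by apply/eqP => /=; lia.
  rewrite h1 eqxx in D.
  have E0 : \prod_(j | (j != lo i) && (j != hi i)) den a (lo i) j != 0.
    by apply/prodf_neq0 => m /andP[mk _]; apply: den_neq0.
  apply: (mulIf E0); apply: oppr_inj.
  transitivity ((a (lo i) - lft (lo i)) * (Gfactor a (lo i) *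
    (-1 * \prod_(j | (j != lo i) && (j != hi i)) den a (lo i) j))); first by ring.
  rewrite D -[sd a i]/(sd a (lo i)); ring.
have D1 : \prod_(j | j != w) (lam w - lam j) = (lam w - rgt (hi i)) *
    \prod_(m | m != hi i) (lam w - lam (lift (widen_ord (leqnSn n) (hi i)) m)).
  have w0 : lam w - lam w = 0 by rewrite subrr.
  rewrite wE (bigD1_ord (lift ord0 (hi i))) /=; last first.
    by apply/eqP => /(congr1 val) /=; rewrite /bump; lia.
  congr (_ * _).
  pose f m := lift (lift ord0 (hi i)) m.
  transitivity (\prod_(m | m != hi i) (lam (widen_ord (leqnSn n) (hi i)) - lam (f m))).
    apply: eq_bigl => m; congr negb; apply/eqP/eqP => [|->].
      by move/(congr1 val) => /= H; apply: val_inj; move: H; rewrite /= /bump; lia.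
    by apply: val_inj; rewrite /= /bump; lia.
  apply: eq_bigr => m mh; congr (_ - lam _); apply: val_inj; rewrite /= /bump.
  have : (m : nat) <> (hi i : nat) by move=> /val_inj E'; rewrite E' eqxx in mh.
  by rewrite /=; lia.
rewrite -aqw in D D1; rewrite D1 (Gfactor_den _ ca) prod_den_hi in D.
rewrite (bigD1 (lo i)) //= {1}/den eqxx mul1r in D.
have E0 : \prod_(j | (j != lo i) && (j != hi i)) den a (hi i) j != 0.
  by apply/prodf_neq0 => m /andP[_ mk]; apply: den_neq0.
have E1 : \prod_(j | (j != hi i) && (j != lo i)) den a (hi i) j =
    \prod_(j | (j != lo i) && (j != hi i)) den a (hi i) j.
  by apply: eq_bigl => j; rewrite andbC.
rewrite E1 in D; apply: (mulIf E0); apply: oppr_inj.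
transitivity ((a (hi i) - rgt (hi i)) * (Gfactor a (hi i) *
   \prod_(j | (j != lo i) && (j != hi i)) den a (hi i) j)); first by ring.
by rewrite D; ring.
Qed.

(** At a collapsed wall the quotient is recovered from [b k ^+ 2] by dividing by the other quotient
    of the same cell and by [Gfactor]. *)
Lemma arrow_eq_valid (a0 : R) a b : in_cells a -> arrow_eq lam a0 a b ->
  exists P Q, valid a P Q /\ forall k, b k ^+ 2 = P k * Q k * Gfactor a k.
Proof.
move=> ca E; have G0 k := Gfactor_gt0 k ca.
pose P k := if sd a k == 0 then b k ^+ 2 / ((rgt k - a k) / sd a k.+1 * Gfactor a k)
  else (a k - lft k) / sd a k.
pose Q k := if sd a k.+1 == 0 then b k ^+ 2 / ((a k - lft k) / sd a k * Gfactor a k)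
  else (rgt k - a k) / sd a k.+1.
have sd0 w := sd_ge0 w ca.
have al k : 0 <= a k - lft k by rewrite subr_ge0; case/andP: (ca k).
have ar k : 0 <= rgt k - a k by rewrite subr_ge0; case/andP: (ca k).
exists P, Q; split.
  split=> // [k|k|k|k|i].
  rewrite /P; case: ifP => _; apply: divr_ge0 => //; first exact: sqr_ge0.
  by apply: mulr_ge0; [apply: divr_ge0|apply: ltW].
  rewrite /Q; case: ifP => _; apply: divr_ge0 => //; first exact: sqr_ge0.
  by apply: mulr_ge0; [apply: divr_ge0|apply: ltW].
  rewrite /P; case: eqP => [s0|/eqP s0]; last by rewrite divfK.
  by rewrite s0 mulr0; have [-> _] := sd_left_right ca s0; rewrite subrr.
  rewrite /Q; case: eqP => [s0|/eqP s0]; last by rewrite divfK.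
  by rewrite s0 mulr0; have [-> _] := sd_right_left ca s0; rewrite subrr.
  rewrite /P /Q -[nat_of_ord (hi i)]/((lo i).+1).
  have [s0|s0] := eqVneq (sd a (lo i).+1) 0; last first.
    have sE : sd a (lo i).+1 = a (hi i) - a (lo i) by rewrite /sd wallo_lo.
    rewrite -mulrDl sE.
    have -> : rgt (lo i) - a (lo i) + (a (hi i) - lft (hi i)) = a (hi i) - a (lo i).
      by rewrite rgt_lo; ring.
    by rewrite divff // -sE.
  have [C1 C2] := arrow_eq_collision ca E s0.
  have [h1 s1] := sd_right_left ca s0.
  have s0' : sd a (hi i) = 0 by [].
  have [h2 s2] := sd_left_right ca s0'.
  have -> : (a (lo i) - lft (lo i)) / sd a (lo i) * Gfactor a (lo i) = b (lo i) ^+ 2 + b (hi i) ^+ 2.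
    by rewrite mulrAC C1 mulfK.
  have -> : (rgt (hi i) - a (hi i)) / sd a (hi i).+1 * Gfactor a (hi i) = b (lo i) ^+ 2 + b (hi i) ^+ 2.
    by rewrite mulrAC C2 mulfK.
  rewrite -mulrDl divff //; apply/eqP => Z.
  move: C1; rewrite Z mul0r => /eqP; rewrite mulf_eq0 (gt_eqF (G0 _)) orbF h1.
  by rewrite subr_eq0 gt_eqF // lft_rgt.
move=> k; have S := arrow_eq_square k ca E; rewrite /P /Q.
have [s0|s0] := eqVneq (sd a k) 0.
  have [h s1] := sd_left_right ca s0; rewrite (negPf s1).
  set c := (rgt k - a k) / _; set g := Gfactor a k.
  have c0 : c != 0 by rewrite mulf_neq0 ?invr_neq0 // h subr_eq0 gt_eqF // lft_rgt.
  have g0 : g != 0 by rewrite /g gt_eqF // G0.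
  by field; rewrite c0 g0.
have [s1|s1] := eqVneq (sd a k.+1) 0.
  have [h _] := sd_right_left ca s1.
  set c := (a k - lft k) / _; set g := Gfactor a k.
  have c0 : c != 0 by rewrite mulf_neq0 ?invr_neq0 // h subr_eq0 gt_eqF // lft_rgt.
  have g0 : g != 0 by rewrite /g gt_eqF // G0.
  by field; rewrite c0 g0.
apply: (mulIf (mulf_neq0 s0 s1)); rewrite -S; field.
by rewrite s0 s1.
Qed.

End isospectral_data.

(** * Cutoff functions *)

Section cutoff.
Context {R : realType}.
Variable eta : R.
Hypothesis eta0 : 0 < eta.

(** Smooth on the whole line, zero at 0 and equal to 1 from [eta] on, with positive slope to the
    left of [eta]. The positive slope at 0 makes it usable as a boundary coordinate on a cut
    facet. *)
Definition cutoff (t : R) : R := 1 - (flat 0 1)^-1 * flat 0 (1 - eta^-1 * t).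
Definition dcutoff (t : R) : R :=
  (flat 0 1)^-1 * eta^-1 * flat 2 (1 - eta^-1 * t).

Lemma flat_gt0 m (s : R) : 0 < s -> 0 < flat m s.
Proof. by move=> s0; rewrite /flat s0 mulr_gt0 ?expR_gt0 // exprn_gt0 // invr_gt0. Qed.

Lemma flat_le0 m (s : R) : s <= 0 -> flat m s = 0.
Proof. by move=> s0; rewrite /flat ltNge s0. Qed.

Lemma cutoff_ge t : eta <= t -> cutoff t = 1.
Proof.
move=> et; rewrite /cutoff (@flat_le0 0 (1 - _)) ?mulr0 ?subr0 // subr_le0.
by rewrite mulrC ler_pdivlMr // mul1r.
Qed.

Lemma cutoff0 : cutoff 0 = 0.
Proof. by rewrite /cutoff mulr0 subr0 mulVf ?subrr // gt_eqF // flat_gt0. Qed.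

Lemma dcutoff_ge0 t : 0 <= dcutoff t.
Proof.
apply: mulr_ge0; last exact: flat_ge0.
by rewrite mulr_ge0 // invr_ge0 ?flat_ge0 // ltW.
Qed.

Lemma dcutoff_gt0 t : t < eta -> 0 < dcutoff t.
Proof.
move=> te; rewrite mulr_gt0 ?mulr_gt0 ?invr_gt0 ?flat_gt0 //.
by rewrite subr_gt0 mulrC ltr_pdivrMr // mul1r.
Qed.

Lemma dcutoff_neq0 t : dcutoff t != 0 -> t < eta.
Proof.
apply: contra_neqT; rewrite -leNgt => et; rewrite /dcutoff (@flat_le0 2) ?mulr0 // subr_le0.
by rewrite mulrC ler_pdivlMr // mul1r.
Qed.

Lemma is_derive_cutoff (t : R) : is_derive t 1 cutoff (dcutoff t).
Proof.
have h : is_derive t 1 (fun t : R => 1 - eta^-1 * t) (- eta^-1).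
  have H := is_deriveB (is_derive_cst (1 : R) t 1) (is_deriveZ eta^-1 (is_derive_id t (1 : R))).
  by apply: is_derive_eq; rewrite /GRing.scale /= mulr1 sub0r.
have := @is_derive1_comp _ (flat 0) (fun t : R => 1 - eta^-1 * t) t _ _ (is_derive_flat 0 _) h.
move=> H; apply: is_derive_eq; rewrite /dcutoff /GRing.scale /=; ring.
Qed.

Lemma cutoff_gt0 t : 0 < t -> 0 < cutoff t.
Proof.
move=> t0; rewrite subr_gt0 mulrC ltr_pdivrMr ?flat_gt0 // mul1r /flat ltr01 !expr0 !mul1r.
case: ifP => s0; last exact: expR_gt0.
rewrite ltr_expR ltrN2 ltf_pV2 ?posrE // gtrBl mulr_gt0 // invr_gt0 //.
Qed.

Lemma Ck_cutoff k : Ck k setT cutoff.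
Proof.
apply: CkD; first exact: openT; first exact: Ck_cst.
apply: (Ck_eq (f := fun x => mulc (- (flat 0 1)^-1) (flat 0 (1 + mulc (- eta^-1) x)))).
  exact: openT.
  by move=> x _; rewrite /mulc !mulNr.
apply: Ck_linear_comp; first exact: openT; first exact: continuous_mulc.
apply: (@Ck_comp_R _ _ _ _ _ setT); first exact: openT; first exact: openT; first by [].
  apply: CkD; first exact: openT; first exact: Ck_cst.
  by apply: Ck_linear; exact: continuous_mulc.
exact: Ck_flat.
Qed.

End cutoff.

Section open_conditions.
Context {R : realType} {V : normedModType R}.

Lemma open_forall (I : finType) (F : I -> set V) : (forall i, open (F i)) ->
  open [set x | forall i, F i x].
Proof.
move=> oF; rewrite openE => x Fx; apply: filter_forall => i.
by apply: open_nbhs_nbhs; split.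
Qed.

Lemma open_positive (I : finType) (U : set V) (f : I -> V -> R) : open U ->
  (forall i, Ck 0 U (f i)) -> open (U `&` [set x | forall i, 0 < f i x]).
Proof.
move=> oU cf; have -> : U `&` [set x | forall i, 0 < f i x] =
    U `&` [set x | forall i, (U `&` f i @^-1` [set t | 0 < t]) x].
  by apply/seteqP; split=> x [Ux H]; split=> // i; have := H i => // -[].
apply: openI => //; apply: open_forall => i; apply: open_preimage => //.
exact: cf.
Qed.

End open_conditions.

(** * The truncated cube *)

Section truncated_cube.
Context {R : realType} {n : nat}.
Variables (c : 'I_n.-1 -> 'rV[R]_n) (d : 'I_n.-1 -> R) (l : seq 'I_n.-1).
Hypothesis gd : good_cuts c d l.
Local Notation E := 'rV[R]_n.
Local Notation B := (cut_cube c d l).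
Implicit Types (x : E) (k m : 'I_n).

Lemma ell_ge0 x i : B x -> 0 <= ell c d i x.
Proof. by move=> [_ H]; rewrite subr_ge0; apply/H/(good_mem gd). Qed.

Lemma cut_cubeP x : B x <-> cube x /\ forall i, 0 <= ell c d i x.
Proof.
split=> [Bx|[cx H]]; first by split; [case: Bx|move=> i; apply: ell_ge0].
by split=> // i _; rewrite -subr_ge0; apply: H.
Qed.

Lemma Ck_x (q : nat) m : Ck q (@setT E) (fun x => x 0 m).
Proof.
have -> : (fun x : E => x 0 m) = mxcoord 0 m by [].
by apply: Ck_linear; exact: linear_mx_continuous.
Qed.

Lemma Ck_ell (q : nat) i : Ck q (@setT E) (ell c d i).
Proof.
have oT := @openT E.
apply: (Ck_eq (f := fun x => d i + \sum_k mulc (- c i 0 k) (x 0 k))) => //.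
  move=> x _; rewrite /ell /dot -sumrN; congr (_ + _).
  by apply: eq_bigr => m _; rewrite /mulc mulNr.
apply: CkD => //; first exact: Ck_cst.
apply: Ck_sum => // m _; apply: Ck_linear_comp => //; first exact: continuous_mulc.
exact: Ck_x.
Qed.

Lemma continuous_x m : continuous (fun x : E => x 0 m).
Proof. by move=> x; have H := Ck_continuous (@Ck_x 0 m); exact: (H x I). Qed.

Lemma continuous_ell i : continuous (ell c d i).
Proof. by move=> x; have H := Ck_continuous (@Ck_ell 0 i); exact: (H x I). Qed.

Lemma cut_cube_closed : closed B.
Proof.
have cx := continuous_x.
have ce := continuous_ell.
have -> : B = \bigcap_(k in [set: 'I_n]) ([set x : E | -1 <= x 0 k] `&` [set x : E | x 0 k <= 1]) `&`
   \bigcap_(i in [set: 'I_n.-1]) [set x : E | 0 <= ell c d i x].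
  apply/seteqP; split=> x.
    move=> /cut_cubeP[cux lx]; split=> [k _|i _] /=; last exact: lx.
    by have /andP[] := cux k.
  move=> [cux lx]; apply/cut_cubeP; split=> [k|i]; last exact: lx.
  by apply/andP; exact: cux.
apply: closedI; apply: closed_bigI => k _.
  apply: closedI.
    by apply: (@preimage_closed _ _ (fun x : E => x 0 k) [set t | -1 <= t]) => //; apply: closed_ge.
  by apply: (@preimage_closed _ _ (fun x : E => x 0 k) [set t | t <= 1]) => //; apply: closed_le.
by apply: (@preimage_closed _ _ (ell c d k) [set t | 0 <= t]) => //; apply: closed_ge.
Qed.

Lemma mx_norm_le (m p : nat) (A : 'M[R]_(m, p)) (M : R) : 0 <= M ->
  (forall i j, `|A i j| <= M) -> `|A| <= M.
Proof. by move=> M0 H; rewrite [`|_|]mx_normrE; apply: bigmax_le => // -[i j] _. Qed.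

Lemma cut_cube_compact : compact B.
Proof.
apply: bounded_closed_compact; last exact: cut_cube_closed.
exists 1; split=> // M M1 x Bx; apply: (@le_trans _ _ 1); last exact: ltW.
by apply: mx_norm_le => // i j; rewrite ord1; apply: (cut_cube_bounded Bx).
Qed.

Lemma cut_cube0 : B 0.
Proof.
apply/cut_cubeP; split=> [k|i]; first by rewrite mxE; lra.
have h1 := good_const gd (or_introl erefl) i.
have h2 := good_const gd (or_intror erefl) i.
have -> : (0 : E) = (1 - 2^-1) *: const_mx 1 + 2^-1 *: const_mx (-1).
  by apply/rowP => k; rewrite !mxE; lra.
rewrite ell_conv; lra.
Qed.

Lemma positive_lower_bound (I : finType) (f : I -> E -> R) :
  (forall i, continuous (f i)) -> (forall i x, B x -> 0 < f i x) ->
  exists2 e, 0 < e & forall i x, B x -> e <= f i x.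
Proof.
move=> cf pf; have m i : exists e, 0 < e /\ forall x, B x -> e <= f i x.
  have B0 : B !=set0 by exists 0; exact: cut_cube0.
  have [y By H] := compact_EVT_min B0 cut_cube_compact (continuous_subspaceT (cf i)).
  exists (f i y); split=> [|x Bx]; first by apply: pf; rewrite inE in By.
  by apply: H; rewrite inE.
pose e i := projT1 (cid (m i)).
have e0 i : 0 < e i by rewrite /e; case: cid => ? [].
have eP i x : B x -> e i <= f i x by rewrite /e; case: cid => ? [_ H] /=; exact: H.
exists (\big[Order.min/1]_i e i).
  by apply: lt_bigmin => // i _.
by move=> i x Bx; apply: le_trans (eP i x Bx); apply: bigmin_le_cond.
Qed.

(** By compactness: two nonnegative functions without a common zero on the polytope have a sum
    bounded below by a positive constant. The pairs are those excluded by [good_facet] and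
    [good_adjacent]. *)
Lemma cut_separation : exists2 eta : R, 0 < eta &
  (forall x i, B x -> ell c d i x < eta -> -1 < x 0 (lo i) /\ x 0 (hi i) < 1) /\
  (forall x (i j : 'I_n.-1), B x -> ell c d i x < eta -> ell c d j x < eta -> j <> i.+1 :> nat).
Proof.
pose f (t : 'I_n.-1 * 'I_n.-1 * bool) x := if t.1.2 == t.1.1.+1 :> nat
  then ell c d t.1.1 x + ell c d t.1.2 x
  else if t.2 then ell c d t.1.1 x + (1 + x 0 (lo t.1.1))
  else ell c d t.1.1 x + (1 - x 0 (hi t.1.1)).
have cx := continuous_x.
have ce := continuous_ell.
have [e e0 eP] : exists2 e, 0 < e & forall t x, B x -> e <= f t x.
  apply: positive_lower_bound => [[[i j] b]|[[i j] b] x Bx]; rewrite /f /=.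
    case: (j == i.+1 :> nat) => x; first by apply: continuousD; exact: ce.
    case: b; apply: continuousD; try exact: ce.
      by apply: continuousD; [exact: cst_continuous|exact: cx].
    by apply: continuousB; [exact: cst_continuous|exact: cx].
  have li := ell_ge0 i Bx; have lj := ell_ge0 j Bx.
  case: eqP => [ij|_].
    rewrite lt_neqAle addr_ge0 // andbT eq_sym paddr_eq0 //.
    apply/negP => /andP[/eqP h1 /eqP h2]; exact: (good_adjacent gd Bx ij h1).
  have [cux _] := Bx; have /andP[a1 a2] := cux (lo i); have /andP[b1 b2] := cux (hi i).
  case: b; rewrite lt_neqAle eq_sym; apply/andP; split; try lra.
    rewrite paddr_eq0 //; last lra.
    by apply/negP => /andP[/eqP h1 /eqP h2]; have [h _] := good_facet gd Bx h1; apply: h; lra.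
  rewrite paddr_eq0 //; last lra.
  by apply/negP => /andP[/eqP h1 /eqP h2]; have [_ h] := good_facet gd Bx h1; apply: h; lra.
(* If one summand is below half of the bound, the other is above half of it. *)
exists (e / 2); first by rewrite divr_gt0.
split=> [x i Bx h|x i j Bx h1 h2 ij].
  have := eP (i, i, true) x Bx; have := eP (i, i, false) x Bx; rewrite /f /=.
  have -> : (i == i.+1 :> nat) = false by apply/eqP; lia.
  by move=> h3 h4; split; lra.
have := eP (i, j, true) x Bx; rewrite /f /= ij eqxx => h3.
by clear ij; lra.
Qed.

Definition cut_interior : set E :=
  [set x : E | (forall k, -1 < x 0 k < 1) /\ forall i, 0 < ell c d i x].

Lemma cut_interior0 : cut_interior 0.
Proof.
split=> [k|i]; first by rewrite mxE; lra.
have h1 := good_const gd (or_introl erefl) i.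
have h2 := good_const gd (or_intror erefl) i.
have -> : (0 : E) = (1 - 2^-1) *: const_mx 1 + 2^-1 *: const_mx (-1).
  by apply/rowP => k; rewrite !mxE; lra.
rewrite ell_conv; lra.
Qed.

Lemma cut_interior_sub : cut_interior `<=` B.
Proof.
move=> x [h1 h2]; apply/cut_cubeP; split=> [k|i]; last exact: ltW.
by have /andP[a1 a2] := h1 k; rewrite !ltW.
Qed.

Lemma cut_interior_conv x z (t : R) : 0 < t <= 1 -> B x -> cut_interior z ->
  cut_interior ((1 - t) *: x + t *: z).
Proof.
move=> /andP[t0 t1] /cut_cubeP[cx lx] [cz lz]; split=> [k|i].
  rewrite !mxE; have /andP[a1 a2] := cx k; have /andP[b1 b2] := cz k.
  have h1 : 0 <= (1 - t) * (x 0 k + 1) by rewrite mulr_ge0 //; lra.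
  have h2 : 0 < t * (z 0 k + 1) by rewrite mulr_gt0 //; lra.
  have h3 : 0 <= (1 - t) * (1 - x 0 k) by rewrite mulr_ge0 //; lra.
  have h4 : 0 < t * (1 - z 0 k) by rewrite mulr_gt0 //; lra.
  by lra.
rewrite ell_conv; apply: ltr_wpDl; last exact: mulr_gt0.
by apply: mulr_ge0; [lra|exact: lx].
Qed.

Lemma cut_interior_open : open cut_interior.
Proof.
have cx := continuous_x.
have ce := continuous_ell.
apply: openI.
  apply: (@open_forall _ E _ (fun k => [set x : E | -1 < x 0 k < 1])) => k.
  have -> : [set x : E | -1 < x 0 k < 1] = [set x : E | -1 < x 0 k] `&` [set x : E | x 0 k < 1].
    by apply/seteqP; split=> x /=; [move/andP|move=> H; apply/andP].
  apply: openI.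
    by apply: (@open_comp _ _ (fun x : E => x 0 k) [set t | -1 < t]) => //; apply: open_gt.
  by apply: (@open_comp _ _ (fun x : E => x 0 k) [set t | t < 1]) => //; apply: open_lt.
apply: (@open_forall _ E _ (fun i => [set x : E | 0 < ell c d i x])) => i.
by apply: (@open_comp _ _ (ell c d i) [set t | 0 < t]) => //; apply: open_gt.
Qed.

Lemma segment_cvg (x z : E) : (1 - t) *: x + t *: z @[t --> (0 : R)] --> x.
Proof.
have -> : (fun t : R => (1 - t) *: x + t *: z) = (fun t : R => x + t *: (z - x)).
  by apply/funext => t; rewrite scalerBl scale1r scalerBr addrAC addrA.
rewrite -[X in _ --> X](addr0 x); apply: cvgD; first exact: cvg_cst.
rewrite -[X in _ --> X](scale0r (z - x)); apply: cvgZ; first exact: cvg_id.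
exact: cvg_cst.
Qed.

Lemma cut_interior_dense x (W : set E) : B x -> nbhs x W ->
  exists2 y, cut_interior y & W y.
Proof.
move=> Bx Wx; have := @segment_cvg x 0 W Wx => /nbhs_ballP[e /= e0 H].
pose t := Num.min (e / 2) 1.
have t0 : 0 < t by rewrite lt_min divr_gt0 ?ltr01.
exists ((1 - t) *: x + t *: 0).
  by apply: cut_interior_conv cut_interior0 => //; rewrite t0 /= ge_min lexx orbT.
apply: H; rewrite /ball /= sub0r normrN gtr0_norm //.
by apply: le_lt_trans (_ : t <= e / 2) _; [rewrite ge_min lexx|lra].
Qed.

Lemma cut_interior_closure (T : topologicalType) (f : E -> T) (K : set T) : closed K ->
  (forall x, B x -> {for x, continuous f}) -> (forall x, cut_interior x -> K (f x)) ->
  forall x, B x -> K (f x).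
Proof.
move=> cK cf H x Bx; apply: cK => W Wx.
have [y iy Wy] := cut_interior_dense Bx (cf x Bx W Wx).
by exists (f y); split => //; apply: H.
Qed.

End truncated_cube.

(** * The explicit parametrization *)

Section spectral_map.
Context {R : realType} {n : nat}.
Variable lam : 'I_n.+1 -> R.
Hypothesis lam_mono : forall i j : 'I_n.+1, (i < j)%N -> lam i < lam j.
Variables (c : 'I_n.-1 -> 'rV[R]_n) (d : 'I_n.-1 -> R) (l : seq 'I_n.-1).
Hypothesis gd : good_cuts c d l.
Variable eta : R.
Hypothesis eta0 : 0 < eta.
Local Notation E := 'rV[R]_n.
Local Notation B := (cut_cube c d l).
Implicit Types (x : E) (k m : 'I_n).

Definition cell_gap k := rgt lam k - lft lam k.
Definition wall_cutoff x (w : nat) := wallo (fun i => cutoff eta (ell c d i x)) 1 w.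
Definition xl x k := 1 + x 0 k.
Definition xr x k := 1 - x 0 k.
(** The normalization that makes [wall_cutoff x k * left_part x k] and
    [wall_cutoff x k.+1 * right_part x k] add up to the length of the cell: they are the two pieces
    into which [diag_map] divides it. *)
Definition cell_weight x k := xr x k ^+ 2 * wall_cutoff x k.+1 + xl x k ^+ 2 * wall_cutoff x k.
(** The square of the distance to the facet lets the square root of [P * Q] be taken smoothly across
    that facet. *)
Definition left_part x k := xl x k ^+ 2 * cell_gap k / cell_weight x k.
Definition right_part x k := xr x k ^+ 2 * cell_gap k / cell_weight x k.
Definition diag_map x k := lft lam k + wall_cutoff x k * left_part x k.
(** The difference of the two neighbouring diagonal entries divided by the cutoff of their wall. It
    is positive on the cut facet as well, so the resolved quotients are [left_part] and [right_part]
    divided by slopes. *)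
Definition wall_slope x (w : nat) := wallo (fun i => right_part x (lo i) + left_part x (hi i)) 1 w.
(** The square of the off-diagonal entry with the squares of both facet distances removed. The rest
    is positive on the polytope, so its square root is smooth. *)
Definition off_sq x k := (cell_gap k / cell_weight x k) ^+ 2 / (wall_slope x k * wall_slope x k.+1) *
  Gfactor lam (diag_map x) k.
Definition off_map x k := xl x k * xr x k * Num.sqrt (off_sq x k).

Lemma gap_gt0 k : 0 < cell_gap k.
Proof. by rewrite subr_gt0 lft_rgt. Qed.

Lemma cutw_ge0 x w : B x -> 0 <= wall_cutoff x w.
Proof.
move=> Bx; apply: (@wallo_ind _ _ (fun z => 0 <= z)) => // i.
have := ell_ge0 gd i Bx; rewrite le_eqVlt => /orP[/eqP <-|h].
  by rewrite cutoff0 // lexx.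
by rewrite ltW // cutoff_gt0.
Qed.

Lemma cutw_eq0 x w : B x -> wall_cutoff x w = 0 -> exists i : 'I_n.-1, w = i.+1 /\ ell c d i x = 0.
Proof.
move=> Bx; rewrite /wall_cutoff; case: (@wallP R n w) => [[i ->]|->]; last first.
  by move=> /eqP; rewrite oner_eq0.
rewrite walloS => h; exists i; split=> //; apply/eqP; apply: contraT => l0.
have : 0 < ell c d i x by rewrite lt_neqAle eq_sym l0 (ell_ge0 gd).
by move/(cutoff_gt0 eta0); rewrite h ltxx.
Qed.

Lemma cutw_gt0 x w : cut_interior c d x -> 0 < wall_cutoff x w.
Proof.
move=> [_ H]; apply: (@wallo_ind _ _ (fun z => 0 < z)) => // i.
exact: cutoff_gt0.
Qed.

Lemma xl_ge0 x k : B x -> 0 <= xl x k.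
Proof. by move=> [cx _]; have /andP[h1 h2] := cx k; rewrite /xl; lra. Qed.

Lemma xr_ge0 x k : B x -> 0 <= xr x k.
Proof. by move=> [cx _]; have /andP[h1 h2] := cx k; rewrite /xr; lra. Qed.

Lemma cutw_left x k : B x -> wall_cutoff x k = 0 ->
  [/\ exists i, k = hi i, xr x k != 0 & wall_cutoff x k.+1 != 0].
Proof.
move=> Bx /(cutw_eq0 Bx)[i [ki h]]; have kE : k = hi i by apply: val_inj.
split; first by exists i.
  have [_ h1] := good_facet gd Bx h; apply/eqP => h2; apply: h1.
  by rewrite -kE; move: h2; rewrite /xr; lra.
apply/eqP => /(cutw_eq0 Bx)[j [kj h2]].
by apply: (good_adjacent gd Bx _ h h2); move: kj; rewrite ki => -[].
Qed.

Lemma cutw_right x k : B x -> wall_cutoff x k.+1 = 0 ->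
  [/\ exists i, k = lo i, xl x k != 0 & wall_cutoff x k != 0].
Proof.
move=> Bx /(cutw_eq0 Bx)[i [[ki] h]]; have kE : k = lo i by apply: val_inj.
split; first by exists i.
  have [h1 _] := good_facet gd Bx h; apply/eqP => h2; apply: h1.
  by rewrite -kE; move: h2; rewrite /xl; lra.
apply/eqP => /(cutw_eq0 Bx)[j [kj h2]].
by apply: (good_adjacent gd Bx _ h2 h); rewrite -kj.
Qed.

(** The cutoffs at the two walls of a cell do not vanish together, and where one of them does, the
    facet distance multiplied by the other is nonzero by [good_facet]. *)
Lemma nrm_gt0 x k : B x -> 0 < cell_weight x k.
Proof.
move=> Bx; have r0 := cutw_ge0 k Bx; have r1 := cutw_ge0 k.+1 Bx.
have h1 : 0 <= xr x k ^+ 2 * wall_cutoff x k.+1 by rewrite mulr_ge0 // sqr_ge0.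
have h2 : 0 <= xl x k ^+ 2 * wall_cutoff x k by rewrite mulr_ge0 // sqr_ge0.
rewrite lt_neqAle addr_ge0 // andbT eq_sym /cell_weight paddr_eq0 //.
rewrite !mulf_eq0 !orbb; apply/negP => /andP[].
have [z1|z1] := eqVneq (wall_cutoff x k) 0; rewrite ?orbT ?orbF.
  by have [_ /negPf -> /negPf ->] := cutw_left Bx z1.
have [z2|z2] := eqVneq (wall_cutoff x k.+1) 0; rewrite ?orbT ?orbF.
  by have [_ /negPf -> _] := cutw_right Bx z2.
by rewrite /xr /xl => /eqP a /eqP b; lra.
Qed.

Lemma wl_ge0 x k : B x -> 0 <= left_part x k.
Proof.
move=> Bx; rewrite divr_ge0 ?(ltW (nrm_gt0 _ Bx)) // mulr_ge0 ?sqr_ge0 //.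
by rewrite ltW // gap_gt0.
Qed.

Lemma wr_ge0 x k : B x -> 0 <= right_part x k.
Proof.
move=> Bx; rewrite divr_ge0 ?(ltW (nrm_gt0 _ Bx)) // mulr_ge0 ?sqr_ge0 //.
by rewrite ltW // gap_gt0.
Qed.

Lemma wl_eq0 x k : B x -> (left_part x k == 0) = (xl x k == 0).
Proof.
move=> Bx; rewrite !mulf_eq0 invr_eq0 orbb (gt_eqF (gap_gt0 k)).
by rewrite (gt_eqF (nrm_gt0 _ Bx)) !orbF.
Qed.

Lemma wr_eq0 x k : B x -> (right_part x k == 0) = (xr x k == 0).
Proof.
move=> Bx; rewrite !mulf_eq0 invr_eq0 orbb (gt_eqF (gap_gt0 k)).
by rewrite (gt_eqF (nrm_gt0 _ Bx)) !orbF.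
Qed.

Lemma slope_gt0 x w : B x -> 0 < wall_slope x w.
Proof.
move=> Bx; apply: (@wallo_ind _ _ (fun z => 0 < z)) => // i.
have h1 := wr_ge0 (lo i) Bx; have h2 := wl_ge0 (hi i) Bx.
rewrite lt_neqAle addr_ge0 // andbT eq_sym paddr_eq0 // wr_eq0 // wl_eq0 //.
rewrite /xr /xl; apply/negP => /andP[/eqP a /eqP b].
by apply: (good_face gd Bx (i := i)); lra.
Qed.

Lemma diag_rgt x k : cell_weight x k != 0 -> rgt lam k - diag_map x k = wall_cutoff x k.+1 * right_part x k.
Proof.
move=> N0; rewrite /diag_map.
have -> : rgt lam k - (lft lam k + wall_cutoff x k * left_part x k) = cell_gap k - wall_cutoff x k * left_part x k.
  by rewrite /cell_gap; ring.
apply: (mulIf N0); rewrite mulrBl -!mulrA !mulVf // !mulr1 /cell_weight; ring.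
Qed.

Lemma diag_valid x : B x ->
  valid lam (diag_map x) (fun k => left_part x k / wall_slope x k) (fun k => right_part x k / wall_slope x k.+1).
Proof.
move=> Bx; have N0 k : cell_weight x k != 0 by rewrite gt_eqF // nrm_gt0.
have S0 w : wall_slope x w != 0 by rewrite gt_eqF // slope_gt0.
have sdE k : sd (diag_map x) k = wall_cutoff x k * wall_slope x k.
  rewrite /sd /wall_cutoff /wall_slope; case: (@leftP R n k) => [[i ki]|[H _]]; last first.
    by rewrite !H mulr1.
  rewrite ki !wallo_hi; have h1 := diag_rgt (N0 (lo i)); have h2 := rgt_lo lam i.
  have -> : diag_map x (hi i) - diag_map x (lo i) =
      (rgt lam (lo i) - diag_map x (lo i)) + (diag_map x (hi i) - lft lam (hi i)).
    by rewrite h2; ring.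
  rewrite h1 /diag_map /wall_cutoff ?wallo_lo ?wallo_hi; ring.
have sdE' k : sd (diag_map x) k.+1 = wall_cutoff x k.+1 * wall_slope x k.+1.
  case: (@rightP R n k) => [[i ki]|[H _]].
    by have := sdE (hi i); rewrite ki.
  by rewrite /sd /wall_cutoff /wall_slope !H mulr1.
split=> [k|k|k|k|k|i].
  have r0 := cutw_ge0 k Bx; have r1 := cutw_ge0 k.+1 Bx.
  have h1 : 0 <= wall_cutoff x k * left_part x k by rewrite mulr_ge0 // wl_ge0.
  have h2 : 0 <= rgt lam k - diag_map x k by rewrite diag_rgt // mulr_ge0 // wr_ge0.
  by rewrite -subr_ge0 /diag_map addrAC subrr add0r h1 -subr_ge0.
  by rewrite divr_ge0 ?wl_ge0 // ltW // slope_gt0.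
  by rewrite divr_ge0 ?wr_ge0 // ltW // slope_gt0.
  rewrite sdE mulrCA divfK // /diag_map; ring.
  by rewrite sdE' mulrCA divfK // diag_rgt.
rewrite -[nat_of_ord (hi i)]/((lo i).+1) -mulrDl /wall_slope wallo_lo divff //.
by have := S0 (lo i).+1; rewrite /wall_slope wallo_lo.
Qed.

Lemma diag_cells x : B x -> in_cells lam (diag_map x).
Proof. by move=> Bx; apply: valid_cells (diag_valid Bx). Qed.

Lemma off2_gt0 x k : B x -> 0 < off_sq x k.
Proof.
move=> Bx; rewrite mulr_gt0 ?Gfactor_gt0 //; last exact: diag_cells.
apply: divr_gt0; last by apply: mulr_gt0; apply: slope_gt0.
by apply: exprn_gt0; apply: divr_gt0; [exact: gap_gt0|exact: nrm_gt0].
Qed.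

Lemma off_ge0 x k : B x -> 0 <= off_map x k.
Proof. by move=> Bx; rewrite !mulr_ge0 ?sqrtr_ge0 ?xl_ge0 ?xr_ge0. Qed.

Lemma off_square x k : B x -> off_map x k ^+ 2 =
  left_part x k / wall_slope x k * (right_part x k / wall_slope x k.+1) * Gfactor lam (diag_map x) k.
Proof.
move=> Bx; rewrite /off_map !exprMn sqr_sqrtr ?(ltW (off2_gt0 k Bx)) // /off_sq /left_part /right_part.
have N0 : cell_weight x k != 0 by rewrite gt_eqF // nrm_gt0.
have S0 w : wall_slope x w != 0 by rewrite gt_eqF // slope_gt0.
field; by rewrite !S0 N0.
Qed.

Lemma diag_sd x i : B x -> diag_map x (hi i) - diag_map x (lo i) = wall_cutoff x i.+1 * wall_slope x i.+1.
Proof.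
move=> Bx; have N0 k : cell_weight x k != 0 by rewrite gt_eqF // nrm_gt0.
have h1 := diag_rgt (N0 (lo i)); have h2 := rgt_lo lam i.
have -> : diag_map x (hi i) - diag_map x (lo i) =
    (rgt lam (lo i) - diag_map x (lo i)) + (diag_map x (hi i) - lft lam (hi i)).
  by rewrite h2; ring.
rewrite h1 /diag_map /wall_cutoff /wall_slope ?wallo_lo ?wallo_hi ?walloS; ring.
Qed.

Lemma diag_lt x i : B x -> 0 < ell c d i x -> diag_map x (lo i) < diag_map x (hi i).
Proof.
move=> Bx li; rewrite -subr_gt0 diag_sd // mulr_gt0 ?slope_gt0 //.
by rewrite /wall_cutoff walloS cutoff_gt0.
Qed.

Lemma arrow_eq_interior x : cut_interior c d x ->
  arrow_eq lam (\sum_j lam j - \sum_k diag_map x k) (diag_map x) (off_map x).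
Proof.
move=> ix; have Bx := cut_interior_sub gd ix.
apply: (valid_arrow_eq lam_mono _ (diag_valid Bx)) => [|k]; last exact: off_square.
by apply: (cells_inj lam_mono (diag_cells Bx)) => i; apply: diag_lt => //; case: ix.
Qed.

(* The formulas for [diag_map] and [off_map] still make sense, and are smooth, on an
   open neighbourhood of the polytope. *)
Definition dom1 := [set: E] `&` [set x | forall k, 0 < cell_weight x k].
Definition dom2 := dom1 `&` [set x | forall i, 0 < right_part x (lo i) + left_part x (hi i)].
Definition dom3 := dom2 `&` [set x | forall t : 'I_n * 'I_n,
  0 < (if (t.1.+1 < t.2)%N then diag_map x t.2 - diag_map x t.1 else 1)].
Definition smooth_dom := dom3 `&` [set x | forall k, 0 < Gfactor lam (diag_map x) k].

Lemma B_dom : B `<=` smooth_dom.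
Proof.
move=> x Bx; split; last by move=> k; exact: (Gfactor_gt0 lam_mono k (diag_cells Bx)).
split.
  split; first by split=> // k; apply: nrm_gt0.
  by move=> i; have := slope_gt0 i.+1 Bx; rewrite /wall_slope walloS.
move=> [k m] /=; case: ifP => // km; rewrite subr_gt0.
exact: (in_cells_lt lam_mono (diag_cells Bx) km).
Qed.

Lemma Ck_wallo q (U : set E) (F : E -> 'I_n.-1 -> R) w : open U ->
  (forall i, Ck q U (fun x => F x i)) -> Ck q U (fun x => wallo (F x) 1 w).
Proof.
move=> oU CF; case: (@wallP R n w) => [[i ->]|H].
  by apply: (Ck_eq (f := fun x => F x i)) => // x _; rewrite walloS.
by apply: (Ck_eq (f := fun _ : E => 1 : R)) => //; try (by move=> x _; rewrite H); exact: Ck_cst.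
Qed.

Lemma Ck_cutw q w : Ck q setT (fun x => wall_cutoff x w).
Proof.
apply: Ck_wallo => [|i]; first exact: openT.
apply: (@Ck_comp_R _ _ _ _ _ setT) => //; first exact: openT; first exact: openT.
  exact: Ck_ell.
exact: Ck_cutoff.
Qed.

Lemma Ck_xl q k : Ck q setT (xl^~ k).
Proof. by apply: CkD; [exact: openT|exact: Ck_cst|exact: Ck_x]. Qed.

Lemma Ck_xr q k : Ck q setT (xr^~ k).
Proof.
apply: CkD; [exact: openT|exact: Ck_cst|].
apply: (Ck_eq (f := fun x => mulc (-1) (x 0 k))); first exact: openT.
  by move=> x _; rewrite /mulc mulN1r.
apply: Ck_linear_comp; [exact: openT|exact: continuous_mulc|exact: Ck_x].
Qed.

Lemma Ck_nrm q k : Ck q setT (cell_weight^~ k).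
Proof.
have oT := @openT E.
by apply: CkD => //; apply: CkM => //; try exact: Ck_cutw;
   apply: CkM => //; try exact: Ck_xl; exact: Ck_xr.
Qed.

Lemma dom1_open : open dom1.
Proof. by apply: open_positive; [exact: openT|move=> k; exact: Ck_nrm]. Qed.

Lemma Ck_wl q k : Ck q dom1 (left_part^~ k).
Proof.
have o1 := dom1_open.
apply: CkM => //; last first.
  apply: CkV => //; first by move=> x [_ H]; rewrite gt_eqF // H.
  by apply: Ck_sub (Ck_nrm q k) => x.
apply: CkM => //; last exact: Ck_cst.
by apply: CkM => //; apply: Ck_sub (Ck_xl q k) => x.
Qed.

Lemma Ck_wr q k : Ck q dom1 (right_part^~ k).
Proof.
have o1 := dom1_open.
apply: CkM => //; last first.
  apply: CkV => //; first by move=> x [_ H]; rewrite gt_eqF // H.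
  by apply: Ck_sub (Ck_nrm q k) => x.
apply: CkM => //; last exact: Ck_cst.
by apply: CkM => //; apply: Ck_sub (Ck_xr q k) => x.
Qed.

Lemma Ck_diag1 q k : Ck q dom1 (diag_map^~ k).
Proof.
have o1 := dom1_open.
apply: CkD => //; first exact: Ck_cst.
by apply: CkM => //; [apply: Ck_sub (Ck_cutw q k) => x|exact: Ck_wl].
Qed.

Lemma dom2_open : open dom2.
Proof.
apply: open_positive => [|i]; first exact: dom1_open.
by apply: CkD; [exact: dom1_open|exact: Ck_wr|exact: Ck_wl].
Qed.

Lemma CkN q (U : set E) (f : E -> R) : open U -> Ck q U f -> Ck q U (fun x => - f x).
Proof.
move=> oU Cf; apply: (Ck_eq (f := fun x => mulc (-1) (f x))) => //.
  by move=> x _; rewrite /mulc mulN1r.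
by apply: Ck_linear_comp => //; exact: continuous_mulc.
Qed.

Lemma dom3_open : open dom3.
Proof.
apply: open_positive => [|[k m]]; first exact: dom2_open.
suff : Ck 0 dom2 (fun x => if (k.+1 < m)%N then diag_map x m - diag_map x k else 1) by [].
case: (k.+1 < m)%N; last exact: Ck_cst.
apply: CkD; first exact: dom2_open.
  by apply: Ck_sub (Ck_diag1 0 m) => x [].
by apply: CkN; [exact: dom2_open|apply: Ck_sub (Ck_diag1 0 k) => x []].
Qed.

Lemma Ck_Gfactor q k : Ck q dom3 (fun x => Gfactor lam (diag_map x) k).
Proof.
have o3 := dom3_open; have Cd m : Ck q dom3 (diag_map^~ m).
  by apply: Ck_sub (Ck_diag1 q m) => x [[]].
apply: Ck_prod => // m mk; apply: CkM => //.
  by apply: CkD => //; exact: Ck_cst.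
rewrite /den; case: (m.+1 =P k :> nat) => h1; first exact: Ck_cst.
case: (m =P k.+1 :> nat) => h2; first exact: Ck_cst.
apply: CkV => // [x [_ H]|]; last by apply: CkD => //; apply: CkN.
rewrite subr_eq0; case: (ord_cases mk) => // h.
  by have := H (m, k); rewrite /= h subr_gt0 => h3; rewrite gt_eqF.
by have := H (k, m); rewrite /= h subr_gt0 => h3; rewrite lt_eqF.
Qed.

Lemma dom_open : open smooth_dom.
Proof. by apply: open_positive => [|k]; [exact: dom3_open|exact: Ck_Gfactor]. Qed.

Lemma Ck_diag q k : Ck q smooth_dom (diag_map^~ k).
Proof. by apply: Ck_sub (Ck_diag1 q k) => x [[[]]]. Qed.

Lemma dom_slope x w : smooth_dom x -> 0 < wall_slope x w.
Proof.
move=> [[[_ H] _] _]; exact: (@wallo_ind _ _ (fun z => 0 < z)).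
Qed.

Lemma Ck_slope q w : Ck q smooth_dom (wall_slope^~ w).
Proof.
have od := dom_open.
apply: Ck_wallo => // i.
by apply: CkD => //; [apply: Ck_sub (Ck_wr q _)|apply: Ck_sub (Ck_wl q _)] => x [[[]]].
Qed.

Lemma Ck_off2 q k : Ck q smooth_dom (off_sq^~ k).
Proof.
have od := dom_open.
have CS w := Ck_slope q w.
have CG : Ck q smooth_dom (fun x => cell_gap k / cell_weight x k).
  apply: CkM => //; first exact: Ck_cst.
  apply: CkV => //; first by move=> x [[[[_ H] _] _] _]; rewrite gt_eqF // H.
  by apply: Ck_sub (Ck_nrm q k) => x.
apply: CkM => //; last by apply: Ck_sub (Ck_Gfactor q k) => x [].
apply: CkM => //; first exact: CkM.
apply: CkV => //; last exact: CkM.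
by move=> x dx; rewrite mulf_neq0 // gt_eqF // dom_slope.
Qed.

Lemma Ck_sqrt_off2 q k : Ck q smooth_dom (fun x => Num.sqrt (off_sq x k)).
Proof.
apply: (@Ck_comp_R _ _ _ _ _ [set t : R | 0 < t]).
  exact: dom_open.
  exact: open_gt.
  move=> x dx /=; rewrite mulr_gt0 //; last by case: dx => _; exact.
  rewrite divr_gt0 //; last by rewrite mulr_gt0 // dom_slope.
  rewrite exprn_gt0 // divr_gt0 ?gap_gt0 //.
  by move: dx => [[[[_ H] _] _] _]; exact: H.
  exact: Ck_off2.
exact: Ck_sqrt.
Qed.

Lemma Ck_off q k : Ck q smooth_dom (off_map^~ k).
Proof.
have od := dom_open; apply: CkM => //; last exact: Ck_sqrt_off2.
by apply: CkM => //; [apply: Ck_sub (Ck_xl q k)|apply: Ck_sub (Ck_xr q k)] => x.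
Qed.

Lemma arrow_eq_B x : B x ->
  arrow_eq lam (\sum_j lam j - \sum_k diag_map x k) (diag_map x) (off_map x).
Proof.
move=> Bx; rewrite /arrow_eq.
set q := (X in _ = X); apply/eqP.
rewrite -subr_eq0; apply/eqP.
pose F t (y : E) := (t - (\sum_j lam j - \sum_k diag_map y k)) * \prod_k (t - diag_map y k) -
  \sum_k off_map y k ^+ 2 * \prod_(j | j != k) (t - diag_map y j).
have horn t y : (('X - (\sum_j lam j - \sum_k diag_map y k)%:P) * \prod_k ('X - (diag_map y k)%:P) -
    \sum_k (off_map y k ^+ 2)%:P * \prod_(j | j != k) ('X - (diag_map y j)%:P)).[t] = F t y.
  rewrite hornerD hornerN hornerM hornerXsubC horner_prod horner_sum /F.
  congr (_ * _ - _); first by apply: eq_bigr => k _; rewrite hornerXsubC.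
  apply: eq_bigr => k _; rewrite hornerM hornerC horner_prod; congr (_ * _).
  by apply: eq_bigr => j _; rewrite hornerXsubC.
have od := dom_open.
have CF t : Ck 0 smooth_dom (F t).
  have Cs k : Ck 0 smooth_dom (fun y => t - diag_map y k).
    by apply: CkD => //; [exact: Ck_cst|apply: CkN => //; exact: Ck_diag].
  apply: CkD => //.
    apply: CkM => //; last by apply: Ck_prod.
    apply: CkD => //; first exact: Ck_cst.
    apply: CkN => //; apply: CkD => //; first exact: Ck_cst.
    by apply: CkN => //; apply: Ck_sum => // k _; exact: Ck_diag.
  apply: CkN => //; apply: Ck_sum => // k _; apply: CkM => //; last exact: Ck_prod.
  by apply: CkM => //; exact: Ck_off.
have FE t : F t x = (lam_poly lam).[t].
  have := @cut_interior_closure _ _ _ _ _ gd R (F t) [set (lam_poly lam).[t]].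
  apply=> //.
    by move=> y By; apply: (Ck_continuous (CF t)); apply: B_dom.
  by move=> y iy /=; rewrite (arrow_eq_interior iy) horn.
(* The difference vanishes everywhere; as many natural numbers as its size suffice to conclude that
   it is the zero polynomial. *)
apply: (@roots_geq_poly_eq0 _ _ [seq i%:R | i <- iota 0 (size (lam_poly lam - q)%R)]).
  apply/allP => t _; rewrite /root hornerD hornerN /q horn FE subrr //.
  by rewrite map_inj_uniq ?iota_uniq // => i j /eqP; rewrite eqr_nat => /eqP.
by rewrite size_map size_iota.
Qed.

End spectral_map.

Section directional_derivatives.
Context {R : realType} {V : normedModType R}.
Implicit Types (f g : V -> R) (x v : V).

Lemma is_derive_unique f x v (a b : R) : is_derive x v f a -> is_derive x v f b -> a = b.
Proof. by move=> [_ <-] [_ <-]. Qed.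

Lemma is_derive_mul f g x v (df dg : R) : is_derive x v f df -> is_derive x v g dg ->
  is_derive x v (fun y => f y * g y) (df * g x + f x * dg).
Proof.
move=> Df Dg; have H := is_deriveM Df Dg.
by apply: is_derive_eq; rewrite /GRing.scale /=; ring.
Qed.

Lemma is_derive_add f g x v (df dg : R) : is_derive x v f df -> is_derive x v g dg ->
  is_derive x v (fun y => f y + g y) (df + dg).
Proof. by move=> Df Dg; exact: is_deriveD. Qed.

Lemma is_derive_const (a : R) x v : is_derive x v (fun=> a) 0.
Proof. exact: is_derive_cst. Qed.

Lemma is_derive_opp f x v (df : R) : is_derive x v f df -> is_derive x v (fun y => - f y) (- df).
Proof. by move=> Df; exact: is_deriveN. Qed.

Lemma is_derive_inv f x v (df : R) : f x != 0 -> is_derive x v f df ->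
  is_derive x v (fun y => (f y)^-1) (- df / f x ^+ 2).
Proof.
move=> f0 [Df fE]; apply: DeriveDef; first exact: derivableV.
by rewrite deriveV // fE /GRing.scale /= -exprVn; ring.
Qed.

Lemma is_derive_prod0 (I : Type) (r : seq I) (P : pred I) (f : I -> V -> R) x v :
  (forall i, P i -> is_derive x v (f i) 0) ->
  is_derive x v (fun y => \prod_(i <- r | P i) f i y) 0.
Proof.
move=> H; elim: r => [|i r IH].
  have -> : (fun y => \prod_(i <- [::] | P i) f i y) = fun=> 1.
    by apply/funext => y; rewrite big_nil.
  exact: is_derive_const.
have [Pi|Pi] := boolP (P i); last first.
  have -> // : (fun y => \prod_(i <- i :: r | P i) f i y) =
     (fun y => \prod_(i <- r | P i) f i y).
  by apply/funext => y; rewrite big_cons (negPf Pi).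
have -> : (fun y => \prod_(i <- i :: r | P i) f i y) =
   (fun y => f i y * \prod_(i <- r | P i) f i y).
  by apply/funext => y; rewrite big_cons Pi.
have D := is_derive_mul (H i Pi) IH.
by apply: is_derive_eq; rewrite mul0r mulr0 addr0.
Qed.

Lemma is_derive_outer f (g : R -> R) x v (df dg : R) : differentiable f x ->
  is_derive x v f df -> is_derive (f x) 1 g dg -> is_derive x v (fun y => g (f y)) (dg * df).
Proof.
move=> Df [_ fE] [Dg gE]; have {}Dg : differentiable g (f x) by apply/derivable1_diffP.
have D : differentiable (g \o f) x by apply: differentiable_comp.
apply: DeriveDef; first exact: diff_derivable.
have e1 : 'd f x v = df by rewrite -deriveE.
have e2 : 'd g (f x) 1 = dg by rewrite -deriveE.
rewrite -[fun y => _]/(g \o f) deriveE // diff_comp //= e1.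
by rewrite -[df]mulr1 -[df * 1]/(df *: (1 : R)) linearZ /= e2 /GRing.scale /= mulr1 mulrC.
Qed.

Lemma Ck_is_derive_at k (U : set V) f x v : U x -> Ck k.+1 U f -> is_derive x v f ('D_v f x).
Proof. by move=> Ux [H _]; apply: DeriveDef => //; apply: diff_derivable; apply: H. Qed.

End directional_derivatives.

(** * Injectivity of the derivative *)

Section immersion.
Context {R : realType} {n : nat}.
Variable lam : 'I_n.+1 -> R.
Hypothesis lam_mono : forall i j : 'I_n.+1, (i < j)%N -> lam i < lam j.
Variables (c : 'I_n.-1 -> 'rV[R]_n) (d : 'I_n.-1 -> R) (l : seq 'I_n.-1).
Hypothesis gd : good_cuts c d l.
Variable eta : R.
Hypothesis eta0 : 0 < eta.
Local Notation E := 'rV[R]_n.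
Local Notation B := (cut_cube c d l).
Hypothesis eta_face : forall x i, B x -> ell c d i x < eta ->
  -1 < x 0 (lo i) /\ x 0 (hi i) < 1.
Hypothesis eta_adjacent : forall x (i j : 'I_n.-1), B x ->
  ell c d i x < eta -> ell c d j x < eta -> j <> i.+1 :> nat.
Local Notation cutw := (wall_cutoff c d eta).
Local Notation nrm := (cell_weight c d eta).
Local Notation wl := (left_part lam c d eta).
Local Notation wr := (right_part lam c d eta).
Local Notation diag := (diag_map lam c d eta).
Local Notation slope := (wall_slope lam c d eta).
Local Notation off2 := (off_sq lam c d eta).
Local Notation off := (off_map lam c d eta).
Local Notation gap := (cell_gap lam).
Implicit Types (k m : 'I_n).

Variables (x v : E).
Hypothesis Bx : B x.
Hypothesis diag_stationary : forall k, 'D_v (diag^~ k) x = 0.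
Hypothesis off_stationary : forall k, 'D_v (off^~ k) x = 0.

(** A name with prefix [d] denotes the derivative at [x] in direction [v] of the quantity without
    the prefix; the lemmas [D_] justify the formulas. *)
Let X k := xl x k.
Let Z k := xr x k.
Let r w := cutw x w.
Let dr (w : nat) := wallo (fun i => - dcutoff eta (ell c d i x) * dot (c i) v) 0 w.
Let N k := nrm x k.
Let dN k := - (2 * Z k * v 0 k) * r k.+1 + Z k ^+ 2 * dr k.+1 +
  (2 * X k * v 0 k * r k + X k ^+ 2 * dr k).
Let h k := gap k / N k.
Let dh k := - gap k * dN k / N k ^+ 2.
Let dwl k := 2 * X k * v 0 k * h k + X k ^+ 2 * dh k.
Let dwr k := - (2 * Z k * v 0 k) * h k + Z k ^+ 2 * dh k.
Let dS (w : nat) := wallo (fun i => dwr (lo i) + dwl (hi i)) 0 w.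

Let N0 k : N k != 0.
Proof. by rewrite gt_eqF // (nrm_gt0 gd eta0). Qed.

Let S0 w : slope x w != 0.
Proof. by rewrite gt_eqF // (slope_gt0 lam_mono gd eta0). Qed.

Let gap0 k : gap k != 0.
Proof. by rewrite gt_eqF // gap_gt0. Qed.

Let h0 k : h k != 0.
Proof. by rewrite mulf_neq0 // invr_neq0. Qed.

Let D_x k : is_derive x v (fun y : E => y 0 k) (v 0 k).
Proof.
have dx : differentiable (fun y : E => y 0 k) x.
  by have [H _] := @Ck_x R n 1 k; exact: H.
apply: DeriveDef; first exact: diff_derivable.
have -> : (fun y : E => y 0 k) = mxcoord 0 k \o id by [].
rewrite derive_linear_comp ?derive_id //; first exact: linear_mx_continuous.
Qed.

Let D_xl k : is_derive x v (xl^~ k) (v 0 k).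
Proof. by have H := is_derive_add (is_derive_const 1 x v) (D_x k); apply: is_derive_eq; rewrite add0r. Qed.

Let D_xr k : is_derive x v (xr^~ k) (- v 0 k).
Proof.
have H := is_derive_add (is_derive_const 1 x v) (is_derive_opp (D_x k)).
by apply: is_derive_eq; rewrite add0r.
Qed.

Let D_ell i : is_derive x v (ell c d i) (- dot (c i) v).
Proof.
have [de _] := @Ck_ell R n c d 1 i.
apply: DeriveDef; first by apply: diff_derivable; exact: de.
have E0 t : ell c d i (x + t *: v) = ell c d i x - t * dot (c i) v.
  by rewrite /ell dotDr dotZr; ring.
have H := is_derive_line (h := ell c d i) (y := x) (v := v) (t := 0).
rewrite scale0r addr0 in H; have {}H := H (de x I).
have H' : is_derive (0 : R) (1 : R) (fun s : R => ell c d i (x + s *: v)) (- dot (c i) v).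
  have -> : (fun s : R => ell c d i (x + s *: v)) = (fun s => ell c d i x + - (s * dot (c i) v)).
    by apply/funext => s; rewrite E0.
  have H1 := is_derive_mul (is_derive_id (0 : R) (1 : R)) (is_derive_const (dot (c i) v) (0 : R) (1 : R)).
  have H2 := is_derive_add (is_derive_const (ell c d i x) (0 : R) (1 : R)) (is_derive_opp H1).
  by apply: is_derive_eq; rewrite mul1r mulr0 addr0 add0r.
exact: is_derive_unique H H'.
Qed.

Let D_wallo (F : E -> 'I_n.-1 -> R) dF (w : nat) :
  (forall i, is_derive x v (fun y => F y i) (dF i)) ->
  is_derive x v (fun y => wallo (F y) 1 w) (wallo dF 0 w).
Proof.
move=> H; case: (@wallP R n w) => [[i ->]|H0].
  by rewrite walloS; have -> : (fun y => wallo (F y) 1 i.+1) = (F^~ i);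
    [apply/funext => y; rewrite walloS|exact: H].
rewrite H0; have -> : (fun y => wallo (F y) 1 w) = fun=> 1.
  by apply/funext => y; rewrite H0.
exact: is_derive_const.
Qed.

Let D_cutw w : is_derive x v (fun y => cutw y w) (dr w).
Proof.
apply: D_wallo => i.
have [de _] := @Ck_ell R n c d 1 i.
have H := is_derive_outer (de x I) (D_ell i) (is_derive_cutoff _ _).
by apply: is_derive_eq; rewrite mulrN mulNr.
Qed.

Let D_nrm k : is_derive x v (nrm^~ k) (dN k).
Proof.
have H1 := is_derive_mul (is_derive_mul (D_xr k) (D_xr k)) (D_cutw k.+1).
have H2 := is_derive_mul (is_derive_mul (D_xl k) (D_xl k)) (D_cutw k).
have H := is_derive_add H1 H2.
by apply: is_derive_eq; rewrite /dN /r /X /Z; ring.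
Qed.

Let D_h k : is_derive x v (fun y => gap k / nrm y k) (dh k).
Proof.
have H := is_derive_mul (is_derive_const (gap k) x v) (is_derive_inv (f := nrm^~ k) (N0 k) (D_nrm k)).
by apply: is_derive_eq; rewrite /dh /N; ring.
Qed.

Let D_wl k : is_derive x v (wl^~ k) (dwl k).
Proof.
have -> : wl^~ k = fun y => xl y k * xl y k * (gap k / nrm y k).
  by apply/funext => y; rewrite mulrA.
have H := is_derive_mul (is_derive_mul (D_xl k) (D_xl k)) (D_h k).
by apply: is_derive_eq; rewrite /dwl /h /X /N; ring.
Qed.

Let D_wr k : is_derive x v (wr^~ k) (dwr k).
Proof.
have -> : wr^~ k = fun y => xr y k * xr y k * (gap k / nrm y k).
  by apply/funext => y; rewrite mulrA.
have H := is_derive_mul (is_derive_mul (D_xr k) (D_xr k)) (D_h k).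
by apply: is_derive_eq; rewrite /dwr /h /Z /N; ring.
Qed.

Let D_slope w : is_derive x v (fun y => slope y w) (dS w).
Proof. by apply: D_wallo => i; apply: is_derive_add. Qed.

Lemma diag_is_derive0 k : is_derive x v (diag^~ k) 0.
Proof.
rewrite -(diag_stationary k).
have H : Ck 1 (smooth_dom lam c d eta) (diag^~ k) by apply: Ck_diag.
exact: (Ck_is_derive_at v (B_dom lam_mono gd eta0 Bx) H).
Qed.

Let wl_stationary k : dr k * wl x k + r k * dwl k = 0.
Proof.
have H := is_derive_add (is_derive_const (lft lam k) x v) (is_derive_mul (D_cutw k) (D_wl k)).
by have := is_derive_unique H (diag_is_derive0 k); rewrite add0r.
Qed.

Let NE k : N k = Z k ^+ 2 * r k.+1 + X k ^+ 2 * r k. Proof. by []. Qed.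

(** The two pieces of a cell add up to its constant length, so their derivatives are opposite. *)
Let wr_stationary k : dr k.+1 * wr x k + r k.+1 * dwr k = 0.
Proof.
have : dr k.+1 * wr x k + r k.+1 * dwr k = - (dr k * wl x k + r k * dwl k).
  rewrite /wr /wl -/(N k) /dwr /dwl /h /dh -/(Z k) -/(X k).
  apply/eqP; rewrite -addr_eq0; apply/eqP.
  transitivity (gap k / N k ^+ 2 * ((- (2 * Z k * v 0 k) * r k.+1 + Z k ^+ 2 * dr k.+1 +
    (2 * X k * v 0 k * r k + X k ^+ 2 * dr k)) * N k -
    dN k * (Z k ^+ 2 * r k.+1 + X k ^+ 2 * r k))).
    by field; exact: N0.
  by rewrite -/(dN k) -NE subrr mulr0.
by rewrite wl_stationary oppr0.
Qed.

Let slope_stationary w : dr w * slope x w + r w * dS w = 0.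
Proof.
rewrite /dr /r /slope /dS /cutw; case: (@wallP R n w) => [[i ->]|H]; last first.
  by rewrite !H; ring.
have h1 := wr_stationary (lo i); have h2 := wl_stationary (hi i).
move: h1 h2; rewrite /r /dr /cutw wallo_lo wallo_hi !walloS => h1 h2.
rewrite -[RHS](addr0 0) -{1}h1 -h2; ring.
Qed.

Lemma Gfactor_is_derive0 k : is_derive x v (fun y => Gfactor lam (diag y) k) 0.
Proof.
apply: is_derive_prod0 => m mk.
have d1 : is_derive x v (fun y => diag y k - lam (lift (widen_ord (leqnSn n) k) m)) 0.
  have H := is_derive_add (diag_is_derive0 k) (is_derive_const (- lam (lift (widen_ord (leqnSn n) k) m)) x v).
  by apply: is_derive_eq; rewrite addr0.
have d2 : is_derive x v (fun y => den (diag y) k m) 0.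
  rewrite /den; case: (m.+1 =P k :> nat) => h1; first exact: is_derive_const.
  case: (m =P k.+1 :> nat) => h2; first exact: is_derive_const.
  have H := is_derive_add (diag_is_derive0 k) (is_derive_opp (diag_is_derive0 m)).
  by apply: is_derive_eq; rewrite subr0.
have dn0 : den (diag x) k m != 0 by apply: (den_neq0 lam_mono (diag_cells lam_mono gd eta0 Bx)).
have H := is_derive_mul d1 (is_derive_inv dn0 d2).
by apply: is_derive_eq; rewrite oppr0 !(mul0r, mulr0) addr0.
Qed.

Let off2E k : off2 x k = h k ^+ 2 / (slope x k * slope x k.+1) * Gfactor lam (diag x) k.
Proof. by []. Qed.

Let doff2 k := (2 * h k * dh k / (slope x k * slope x k.+1) -
  h k ^+ 2 * (dS k * slope x k.+1 + slope x k * dS k.+1) / (slope x k * slope x k.+1) ^+ 2) *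
  Gfactor lam (diag x) k.

Let D_off2 k : is_derive x v (off2^~ k) (doff2 k).
Proof.
have s0 : slope x k * slope x k.+1 != 0 by rewrite mulf_neq0.
have H1 := is_derive_inv (f := fun y => slope y k * slope y k.+1) s0 (is_derive_mul (D_slope k) (D_slope k.+1)).
have H2 := is_derive_mul (is_derive_mul (D_h k) (D_h k)) H1.
have H := is_derive_mul H2 (Gfactor_is_derive0 k).
by apply: is_derive_eq; rewrite mulr0 addr0 /doff2 /h /N; ring.
Qed.

Let off_relation k :
  2 * (Z k - X k) * v 0 k * off2 x k + X k * Z k * doff2 k = 0.
Proof.
have o0 := off2_gt0 lam_mono gd eta0 k Bx.
have s0 : Num.sqrt (off2 x k) != 0 by rewrite gt_eqF // sqrtr_gt0.
have dB := B_dom lam_mono gd eta0 Bx.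
have [dof _] : Ck 1 (smooth_dom lam c d eta) (off2^~ k) by apply: Ck_off2.
have H1 := is_derive_outer (dof x dB) (D_off2 k) (is_derive1_sqrt o0).
have H := is_derive_mul (is_derive_mul (D_xl k) (D_xr k)) H1.
have Ho : is_derive x v (off^~ k) 0.
  rewrite -(off_stationary k).
  have H2 : Ck 1 (smooth_dom lam c d eta) (off^~ k) by apply: Ck_off.
  exact: (Ck_is_derive_at v dB H2).
have := is_derive_unique H Ho; rewrite -/(X k) -/(Z k) => e.
have so : Num.sqrt (off2 x k) * Num.sqrt (off2 x k) = off2 x k.
  by rewrite -expr2 sqr_sqrtr // ltW.
rewrite -(mulr0 (2 * Num.sqrt (off2 x k))) -e -{1}so.
by field.
Qed.

(** On a cube facet the product of the two distances vanishes, its derivative is a nonzero multiple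
    of [v 0 k], and the remaining factor of the off-diagonal entry is positive. *)
Let facet_fixed k : X k * Z k = 0 -> v 0 k = 0.
Proof.
move=> XZ; have := off_relation k; rewrite XZ mul0r addr0.
have o0 : off2 x k != 0 by rewrite gt_eqF // (off2_gt0 lam_mono gd).
move/eqP; rewrite mulf_eq0 (negPf o0) orbF !mulf_eq0.
move: XZ => /eqP; rewrite mulf_eq0 /X /Z /xl /xr => XZ.
move/orP => [/orP[|/eqP z]|/eqP //]; first by rewrite pnatr_eq0.
by case/orP: XZ => /eqP; lra.
Qed.

(** Where both cutoffs are nonzero it reads: [v 0 k] is [X k * Z k / 4] times the difference of the
    logarithmic derivatives of the two cutoffs. Hence the weights [p] below; the factor 4 comes from
    [X k + Z k = 2]. *)
Let wall_relation k :
  4 * v 0 k * r k * r k.+1 = X k * Z k * (r k * dr k.+1 - r k.+1 * dr k).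
Proof.
have [XZ|XZ] := eqVneq (X k * Z k) 0; first by rewrite facet_fixed // XZ; ring.
apply: (mulfI XZ).
have e : dr k * (X k ^+ 2) * N k + r k * (2 * X k * v 0 k * N k - X k ^+ 2 * dN k) = 0.
  have -> : dr k * (X k ^+ 2) * N k + r k * (2 * X k * v 0 k * N k - X k ^+ 2 * dN k) =
    N k ^+ 2 / gap k * (dr k * wl x k + r k * dwl k).
    rewrite /wl -/(N k) /dwl /h /dh -/(X k); field.
    by rewrite N0 gap0.
  by rewrite wl_stationary mulr0.
have XZ2 : X k + Z k = 2 by rewrite /X /Z /xl /xr; ring.
apply/eqP; rewrite -subr_eq0; apply/eqP; rewrite -[RHS]e /dN NE.
have -> : 4 = 2 * (X k + Z k) by rewrite XZ2; ring.
ring.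
Qed.

Let p k := X k * Z k / 4.

Let p_ge0 k : 0 <= p k.
Proof.
by rewrite /p divr_ge0 // mulr_ge0 //; [apply: (xl_ge0 k Bx)|apply: (xr_ge0 k Bx)].
Qed.

Let p_face (i : 'I_n.-1) : ell c d i x < eta -> 0 < p (lo i) + p (hi i).
Proof.
move=> /(eta_face Bx)[h1 h2]; rewrite lt_neqAle addr_ge0 // andbT eq_sym paddr_eq0 //.
rewrite /p !mulf_eq0 /X /Z /xl /xr !invr_eq0 !pnatr_eq0 !orbF.
apply/negP => /andP[/orP[/eqP a|/eqP a] /orP[/eqP b|/eqP b]]; try lra.
by apply: (good_face gd Bx (i := i)); lra.
Qed.

Let r_ge0 w : 0 <= r w. Proof. exact: (cutw_ge0 gd eta0). Qed.

(** If [dr i.+1] were nonzero, [wall_relation] on the two sides of the wall would give coordinate 1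
    at [lo i] and -1 at [hi i], a face that has been cut off. *)
Let collision (i : 'I_n.-1) : r i.+1 = 0 -> [/\ dr i.+1 = 0, r (lo i) != 0, r (hi i).+1 != 0,
  X (lo i) != 0 & Z (hi i) != 0].
Proof.
move=> r0; have [_ x1 rl] := cutw_right gd eta0 Bx (k := lo i) r0.
have [_ z1 rr] := cutw_left gd eta0 Bx (k := hi i) r0.
split=> //; have := wall_relation (lo i); have := wall_relation (hi i).
rewrite -[nat_of_ord (hi i)]/(i.+1) -[nat_of_ord (lo i)]/(nat_of_ord i) r0.
rewrite !(mulr0, mul0r, sub0r, subr0) => /esym/eqP e2 /esym/eqP e1.
apply/eqP; apply: contraT => dr0.
move: e1 e2; rewrite mulrN oppr_eq0 !mulf_eq0 (negPf dr0) (negPf x1) (negPf z1) ?orbF /=.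
have rl' : (r i == 0) = false by apply/negbTE.
have rr' : (r i.+2 == 0) = false by apply/negbTE.
rewrite rl' rr' ?orbF /= /X /Z /xl /xr => /eqP a /eqP b.
by case: (good_face gd Bx (i := i)); lra.
Qed.

(** On a cut facet the diagonal is blind to the interval factor. Stationarity of the off-diagonal
    entry at [lo i] supplies the missing equation: the ratio in which the interval is divided is
    stationary. *)
Let collision_relation (i : 'I_n.-1) : r i.+1 = 0 -> Z (lo i) != 0 ->
  dwr (lo i) * wl x (hi i) = wr x (lo i) * dwl (hi i).
Proof.
move=> r0 z0; have [_ rl _ x0 _] := collision r0; set k := lo i.
have G0 : Gfactor lam (diag x) k != 0.
  by rewrite gt_eqF //; apply: (Gfactor_gt0 lam_mono); exact: (diag_cells lam_mono gd eta0 Bx).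
have e1 : dwl k * slope x k = wl x k * dS k.
  apply: (mulfI (rl : r k != 0)); have a := wl_stationary k; have b := slope_stationary k.
  have a' : r k * dwl k = - (dr k * wl x k) by apply/eqP; rewrite -addr_eq0 addrC a.
  have b' : r k * dS k = - (dr k * slope x k) by apply/eqP; rewrite -addr_eq0 addrC b.
  transitivity (wl x k * (r k * dS k)); last by ring.
  by rewrite b' mulrA a'; ring.
have e2 := off_relation k.
have e3 : 2 * (Z k - X k) * v 0 k * h k * (slope x k * slope x k.+1) + X k * Z k *
    (2 * dh k * (slope x k * slope x k.+1) - h k * (dS k * slope x k.+1 + slope x k * dS k.+1)) = 0.
  have -> : 2 * (Z k - X k) * v 0 k * h k * (slope x k * slope x k.+1) + X k * Z k *
    (2 * dh k * (slope x k * slope x k.+1) - h k * (dS k * slope x k.+1 + slope x k * dS k.+1)) =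
    (slope x k * slope x k.+1) ^+ 2 / (h k * Gfactor lam (diag x) k) *
    (2 * (Z k - X k) * v 0 k * off2 x k + X k * Z k * doff2 k).
    by rewrite off2E /doff2; field; rewrite !S0 h0 G0.
  by rewrite e2 mulr0.
have wlE : wl x k = X k ^+ 2 * h k by rewrite /wl /h /N mulrA.
have wrE : wr x k = Z k ^+ 2 * h k by rewrite /wr /h /N mulrA.
have e4 : dwr k * slope x k.+1 = wr x k * dS k.+1.
  have m0 : X k ^+ 2 * slope x k != 0 by rewrite mulf_neq0 // expf_neq0.
  apply: (mulfI m0); apply/eqP; rewrite -subr_eq0; apply/eqP.
  transitivity (X k * Z k * (2 * (Z k - X k) * v 0 k * h k * (slope x k * slope x k.+1) + X k * Z k *
    (2 * dh k * (slope x k * slope x k.+1) - h k * (dS k * slope x k.+1 + slope x k * dS k.+1)))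
    - Z k ^+ 2 * slope x k.+1 * (dwl k * slope x k - wl x k * dS k)).
    by rewrite wlE wrE /dwr /dwl; ring.
  by rewrite e3 e1 subrr !mulr0 subr0.
have sE : slope x k.+1 = wr x k + wl x (hi i) by rewrite /slope wallo_lo.
have dE : dS k.+1 = dwr k + dwl (hi i) by rewrite /dS wallo_lo.
apply: (@addrI _ (wr x k * dwr k)); rewrite -mulrDr -dE -e4 sE; ring.
Qed.

(** The logarithmic derivative of the cutoff. On a cut facet it would be [0 / 0], and it is chosen
    so that [velocity] holds at [lo i], or at [hi i] when [lo i] is on its cube facet. In the first
    case the other side follows from [collision_relation]. *)
Let tau (i : 'I_n.-1) := if r i.+1 != 0 then dr i.+1 / r i.+1
  else if Z (lo i) != 0 then v 0 (lo i) / p (lo i) + dr (lo i) / r (lo i)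
  else dr (hi i).+1 / r (hi i).+1 - v 0 (hi i) / p (hi i).

Let velocity k : v 0 k = p k * (wallfun tau k.+1 - wallfun tau k).
Proof.
have four : (4 : R) != 0 by rewrite pnatr_eq0.
have [XZ|XZ] := eqVneq (X k * Z k) 0.
  by rewrite facet_fixed // /p XZ !mul0r.
have p0 : p k != 0 by rewrite /p mulf_neq0 // invr_neq0.
have T w : r w != 0 -> wallfun tau w = dr w / r w.
  case: (@wallP R n w) => [[i ->]|H] rw; first by rewrite wallfunS /tau rw.
  by rewrite -[wallfun tau w]/(wallo tau 0 w) /dr !H mul0r.
have [rk|rk] := eqVneq (r k) 0.
  have [[i ki] _ rk1] := cutw_left gd eta0 Bx rk.
  have r0 : r i.+1 = 0 by rewrite -rk ki.
  have [d0 rl rr x0 z0] := collision r0.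
  have wk : wallfun tau k = tau i by rewrite -(wallfunS tau i) ki.
  rewrite (T k.+1) // wk /tau r0 eqxx -[~~ true]/false.
  have [zl|zl] := eqVneq (Z (lo i)) 0; rewrite -?[~~ true]/false -?[~~ false]/true.
    by rewrite -ki; field; rewrite p0 rk1.
  have zx : Z k != 0 /\ X k != 0.
    by apply/andP; move: XZ; rewrite mulf_eq0 negb_or andbC.
  have e := collision_relation r0 zl; rewrite -ki in e.
  have NL : N (lo i) = X (lo i) ^+ 2 * r (lo i).
    by rewrite NE -[nat_of_ord (lo i)]/(nat_of_ord i) r0 mulr0 add0r.
  have dNL : dN (lo i) = 2 * X (lo i) * v 0 (lo i) * r (lo i) + X (lo i) ^+ 2 * dr (lo i).
    by rewrite /dN -[nat_of_ord (lo i)]/(nat_of_ord i) r0 d0 !mulr0 !add0r.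
  have drk : dr k = 0 by rewrite -d0 ki.
  have NR : N k = Z k ^+ 2 * r k.+1 by rewrite NE rk mulr0 addr0.
  have dNR : dN k = - (2 * Z k * v 0 k) * r k.+1 + Z k ^+ 2 * dr k.+1.
    by rewrite /dN rk drk !mulr0 !addr0.
  have XZL : Z (lo i) + X (lo i) = 2 by rewrite /X /Z /xl /xr; ring.
  have XZR : Z k + X k = 2 by rewrite /X /Z /xl /xr; ring.
  have gl := gap0 (lo i); have gk := gap0 k.
  have a1 : dwr (lo i) = wr x (lo i) * (- (v 0 (lo i) / p (lo i)) - dr (lo i) / r (lo i)).
    rewrite /dwr /wr -/(N (lo i)) /h /dh -/(Z (lo i)) dNL NL /p.
    have -> : - (v 0 (lo i) / (X (lo i) * Z (lo i) / 4)) =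
      - (2 * (Z (lo i) + X (lo i)) * v 0 (lo i) / (X (lo i) * Z (lo i))).
      by rewrite XZL; field; rewrite x0 zl.
    by field; rewrite x0 zl rl.
  have a2 : dwl k = wl x k * (v 0 k / p k - dr k.+1 / r k.+1).
    rewrite /dwl /wl -/(N k) /h /dh -/(X k) dNR NR /p.
    have -> : v 0 k / (X k * Z k / 4) = 2 * (Z k + X k) * v 0 k / (X k * Z k).
      by rewrite XZR; field; case: zx => -> ->.
    by field; case: zx => -> ->; rewrite rk1.
  move: e; rewrite a1 a2.
  have wr0 : wr x (lo i) != 0 by rewrite (wr_eq0 lam_mono gd eta0).
  have wl0 : wl x k != 0 by rewrite (wl_eq0 lam_mono gd eta0) //; case: zx.
  rewrite -mulrA => /(mulfI wr0); rewrite mulrC => /(mulfI wl0) => e.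
  have -> : v 0 (lo i) / p (lo i) + dr (lo i) / r (lo i) =
     - (- (v 0 (lo i) / p (lo i)) - dr (lo i) / r (lo i)) by ring.
  by rewrite e; field; rewrite p0 rk1.
have [rk1|rk1] := eqVneq (r k.+1) 0.
  have [[i ki] _ _] := cutw_right gd eta0 Bx rk1.
  have r0 : r i.+1 = 0 by rewrite -rk1 ki.
  have wk : wallfun tau k.+1 = tau i by rewrite -(wallfunS tau i) ki.
  rewrite (T k) // wk /tau r0 eqxx -[~~ true]/false.
  have zl : Z (lo i) != 0 by move: XZ; rewrite ki mulf_eq0 negb_or => /andP[].
  rewrite zl -ki; field; by rewrite p0 rk.
rewrite !T //; apply: (mulfI four); apply: (mulIf rk); apply: (mulIf rk1).
rewrite wall_relation /p; field; by rewrite rk rk1.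
Qed.

Lemma immersion : v = 0.
Proof.
have rayE : ray p (wallfun tau) = - v.
  by apply/rowP => k; rewrite !mxE velocity; ring.
have T0 : forall i, tau i = 0.
  (* The system is the identity [dr = r * tau] at each cut, with the slope of the cutoff and the
     cutoff itself as weights. The slope is nonzero only closer than [eta] to the cut facet, which
     gives the conditions on weights. *)
  apply: (good_kernel gd (p := p) (t := fun i => dcutoff eta (ell c d i x)) (e := fun i => r i.+1)) => //.
    by move=> i; apply: dcutoff_ge0.
    move=> i; have [rk|rk] := eqVneq (r i.+1) 0; last first.
      by rewrite addrC ltr_pwDl ?dcutoff_ge0 // lt_neqAle eq_sym rk r_ge0.
    have [j [[ij] h1]] := cutw_eq0 gd eta0 Bx rk.
    rewrite rk addr0 dcutoff_gt0 //; have <- : j = i by apply: val_inj.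
    by rewrite h1.
    by move=> i /(dcutoff_neq0 eta0)/p_face.
    by move=> i j /(dcutoff_neq0 eta0) h1 /(dcutoff_neq0 eta0) h2; apply: eta_adjacent h1 h2.
  move=> i; rewrite rayE.
  have -> : dcutoff eta (ell c d i x) * dot (c i) (- v) = dr i.+1.
    by rewrite /dr walloS dotNr; ring.
  rewrite /tau; case: ifP => [rk|/negbFE/eqP rk]; first by rewrite mulrC divfK.
  by have [-> _ _ _ _] := collision rk; rewrite rk mul0r.
apply/rowP => k; rewrite velocity mxE !wallfun_eq0 ?subrr ?mulr0 // => i _; exact: T0.
Qed.

End immersion.

Section interior_immersion.
Context {R : realType} {n : nat}.
Variable lam : 'I_n.+1 -> R.
Hypothesis lam_mono : forall i j : 'I_n.+1, (i < j)%N -> lam i < lam j.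
Variables (c : 'I_n.-1 -> 'rV[R]_n) (d : 'I_n.-1 -> R) (l : seq 'I_n.-1).
Hypothesis gd : good_cuts c d l.
Variable eta : R.
Hypothesis eta0 : 0 < eta.
Local Notation diag := (diag_map lam c d eta).
Local Notation off := (off_map lam c d eta).

Lemma diag_interior x k : cut_interior c d x -> lft lam k < diag x k < rgt lam k.
Proof.
move=> ix; have Bx := cut_interior_sub gd ix.
have r0 w := cutw_gt0 eta0 w ix.
have [h _] := ix; have /andP[h1 h2] := h k.
have N0 : cell_weight c d eta x k != 0 by rewrite gt_eqF // (nrm_gt0 gd eta0).
apply/andP; split.
  rewrite -subr_gt0 /diag addrAC subrr add0r mulr_gt0 // lt_neqAle eq_sym.
  rewrite (wl_eq0 lam_mono gd eta0) // (wl_ge0 lam_mono gd eta0) // andbT /xl.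
  by apply/eqP; lra.
rewrite -subr_gt0 diag_rgt // mulr_gt0 // lt_neqAle eq_sym.
rewrite (wr_eq0 lam_mono gd eta0) // (wr_ge0 lam_mono gd eta0) // andbT /xr.
by apply/eqP; lra.
Qed.

(** In the interior the square of the off-diagonal entry is a smooth function of the diagonal alone.
    The diagonal map is therefore an immersion there by itself. *)
Lemma interior_off_stationary x v : cut_interior c d x ->
  (forall k, 'D_v (diag^~ k) x = 0) -> forall k, 'D_v (off^~ k) x = 0.
Proof.
move=> ix ds k; have Bx := cut_interior_sub gd ix.
have Dd := diag_is_derive0 lam_mono gd eta0 Bx ds.
have DG := Gfactor_is_derive0 lam_mono gd eta0 Bx ds.
have Dsd w : is_derive x v (fun y => sd (diag y) w) 0.
  rewrite /sd; case: (@wallP R n w) => [[i ->]|H].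
    have -> : (fun y => wallo (fun i => diag y (hi i) - diag y (lo i)) 1 i.+1) =
      (fun y => diag y (hi i) + - diag y (lo i)) by apply/funext => y; rewrite walloS.
    have H := is_derive_add (Dd (hi i)) (is_derive_opp (Dd (lo i))).
    by apply: is_derive_eq; rewrite subr0.
  have -> : (fun y => wallo (fun i => diag y (hi i) - diag y (lo i)) 1 w) = fun=> 1.
    by apply/funext => y; rewrite H.
  exact: is_derive_const.
have sd0 y w : cut_interior c d y -> sd (diag y) w != 0.
  move=> iy; apply: (@wallo_ind _ _ (fun z => z != 0)) => [|i]; first exact: oner_neq0.
  rewrite subr_eq0 gt_eqF // (diag_lt lam_mono gd eta0) //; first exact: (cut_interior_sub gd).
  by case: iy.
pose f y := (diag y k - lft lam k) * (rgt lam k - diag y k) * Gfactor lam (diag y) k /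
  (sd (diag y) k * sd (diag y) k.+1).
have Df : is_derive x v f 0.
  have H1 := is_derive_add (Dd k) (is_derive_const (- lft lam k) x v).
  have H2 := is_derive_add (is_derive_const (rgt lam k) x v) (is_derive_opp (Dd k)).
  have s0 : sd (diag x) k * sd (diag x) k.+1 != 0 by rewrite mulf_neq0 // sd0.
  have H3 := is_derive_inv (f := fun y => sd (diag y) k * sd (diag y) k.+1) s0
    (is_derive_mul (Dsd k) (Dsd k.+1)).
  have H := is_derive_mul (is_derive_mul (is_derive_mul H1 H2) (DG k)) H3.
  by apply: is_derive_eq; rewrite !(mul0r, mulr0, addr0, add0r, oppr0).
have fE y : cut_interior c d y -> f y = off y k * off y k.
  move=> iy; have By := cut_interior_sub gd iy.
  have s0 : sd (diag y) k * sd (diag y) k.+1 != 0 by rewrite mulf_neq0 // sd0.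
  apply: (mulIf s0); rewrite /f divfK // -expr2 (off_square lam_mono gd eta0) //.
  by rewrite (valid_square k (diag_valid lam_mono gd eta0 By)).
have Do : is_derive x v (fun y => off y k * off y k) 0.
  apply: near_eq_is_derive Df; exact: open_near_eq (@cut_interior_open _ _ c d) ix fE.
have H2 : Ck 1 (smooth_dom lam c d eta) (off^~ k) by apply: Ck_off.
have H := Ck_is_derive_at v (B_dom lam_mono gd eta0 Bx) H2.
have := is_derive_unique (is_derive_mul H H) Do.
have o0 : off x k != 0.
  have [h _] := ix; have /andP[h1 h2] := h k.
  rewrite /off /xl /xr !mulf_neq0 //; try (by apply/eqP; lra).
  by rewrite gt_eqF // sqrtr_gt0 (off2_gt0 lam_mono gd eta0).
move=> e; apply: (mulIf o0); rewrite mul0r; lra.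
Qed.

Lemma interior_diag_immersion x v :
  (forall x (i : 'I_n.-1), cut_cube c d l x -> ell c d i x < eta ->
    -1 < x 0 (lo i) /\ x 0 (hi i) < 1) ->
  (forall x (i j : 'I_n.-1), cut_cube c d l x -> ell c d i x < eta ->
    ell c d j x < eta -> j <> i.+1 :> nat) ->
  cut_interior c d x -> (forall k, 'D_v (diag^~ k) x = 0) -> v = 0.
Proof.
move=> ef ea ix ds; apply: (immersion lam_mono gd eta0 ef ea (cut_interior_sub gd ix) ds).
exact: interior_off_stationary.
Qed.

End interior_immersion.

(** * Bijectivity *)

Section local_left_inverse.
Context {R : realType} {n m : nat}.

Lemma continuous_mulmxr (H : 'M[R]_(m, n)) : continuous (fun y : 'rV[R]_m => y *m H).
Proof.
have -> : (fun y : 'rV[R]_m => y *m H) = mulmxr H by [].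
exact: linear_mx_continuous.
Qed.

(* Composing with a linear left inverse of the derivative reduces this to the
   inverse function theorem. *)
Lemma local_left_inverse (F : 'rV[R]_n -> 'rV[R]_m) (U : set 'rV[R]_n) (x0 : 'rV[R]_n) :
  open U -> U x0 -> smooth_open U F -> (forall v, 'D_v F x0 = 0 -> v = 0) ->
  exists (T : set 'rV[R]_m) (G : 'rV[R]_m -> 'rV[R]_n) (N : set 'rV[R]_n),
    [/\ open T, smooth_open T G, open N, N x0 &
        forall x, N x -> [/\ U x, T (F x) & G (F x) = x]].
Proof.
move=> oU Ux0 sF inj; have [dF _] := sF 1%N.
pose J := lin1_mx ('d F x0).
have JE v : v *m J = 'D_v F x0 by rewrite mul_rV_lin1 deriveE //; exact: dF.
have fJ : row_free J by apply: inj_row_free => v; rewrite JE; exact: inj.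
pose f x := mulmxr (pinvmx J) (F x).
have sf : smooth_open U f.
  by move=> q; apply: Ck_linear_comp => //; exact: linear_mx_continuous.
have [T [N [g [[oT Tx sg gP] oN Nx NP]]]] : exists (T N : set 'rV[R]_n) (g : 'rV[R]_n -> 'rV[R]_n),
    [/\ [/\ open T, T (f x0), smooth_open T g & forall y, T y -> U (g y) /\ f (g y) = y],
       open N, N x0 & forall x, N x -> [/\ U x, T (f x) & g (f x) = x]].
  apply: (inverse_function oU Ux0 sf) => v Dv; rewrite -[v]mulmx1 -(mulmxVp fJ) mulmxA JE.
  rewrite -Dv -[RHS]/('D_v (mulmxr (pinvmx J) \o F) x0) derive_linear_comp //.
    exact: linear_mx_continuous.
  exact: dF.
have oT' : open ((fun y : 'rV[R]_m => y *m pinvmx J) @^-1` T).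
  by apply: open_comp => // y _; exact: continuous_mulmxr.
exists ((fun y : 'rV[R]_m => y *m pinvmx J) @^-1` T), (fun y => g (y *m pinvmx J)), N.
split=> //.
  move=> q; apply: (@Ck_comp_mx _ _ _ _ _ _ _ T) => //.
  have -> : (fun y : 'rV[R]_m => y *m pinvmx J) = mulmxr (pinvmx J) by [].
  by apply: Ck_linear; exact: linear_mx_continuous.
Qed.

End local_left_inverse.

Section unique_fibers.
Context {R : realType} {E F : normedModType R}.
Variables (B : set E) (f : E -> F) (y : R -> F).
Hypothesis compB : compact B.
Hypothesis contf : {within B, continuous f}.
Hypothesis conty : continuous y.
Let I01 := `[0%R, 1%R]%classic : set R.
Hypothesis fopen : forall s x (W : set E), I01 s -> B x -> f x = y s -> nbhs x W ->
  \forall z \near y s, exists x', [/\ B x', W x' & f x' = z].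
Hypothesis finj : forall s x, I01 s -> B x -> f x = y s ->
  exists2 N : set E, open N & N x /\ (forall x1 x2, N x1 -> N x2 -> B x1 -> B x2 ->
    f x1 = f x2 -> x1 = x2).

Let single (s : R) := exists2 x, B x /\ f x = y s & forall x', B x' -> f x' = y s -> x' = x.

Let image_closed (K : set E) : closed K -> closed (f @` (B `&` K)).
Proof.
move=> cK; apply: compact_closed; first exact: norm_hausdorff.
apply: continuous_compact.
  by apply: continuous_subspaceW contf => x [].
by apply: compact_closedI.
Qed.

(** Near the unique preimage the map is open and injective; the image of the rest of the compact set
    is closed and misses [y s], hence also nearby values. *)
Let single_open s : I01 s -> single s -> \forall s' \near s, single s'.
Proof.
move=> s01 [x [Bx fx] xu]; have [N oN [Nx Ninj]] := finj s01 Bx fx.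
have cK : closed (f @` (B `&` ~` N)) by apply: image_closed; apply: open_closedC.
have nK : (~` (f @` (B `&` ~` N))) (y s).
  by move=> [x' [Bx' Nx']] /(xu _ Bx') xx; apply: Nx'; rewrite xx.
have h1 : \forall z \near y s, (~` (f @` (B `&` ~` N))) z.
  by apply: open_nbhs_nbhs; split=> //; apply: closed_openC.
have h2 := fopen s01 Bx fx (open_nbhs_nbhs (conj oN Nx)).
have h3 : \forall z \near y s, (~` (f @` (B `&` ~` N))) z /\ exists x', [/\ B x', N x' & f x' = z].
  by near=> z; split; near: z.
have h4 : \forall s' \near s, (~` (f @` (B `&` ~` N))) (y s') /\ exists x', [/\ B x', N x' & f x' = y s'].
  exact: (conty h3).
near=> s'; have [nz [x' [Bx' Nx' fx']]] : (~` (f @` (B `&` ~` N))) (y s') /\ exists x', [/\ B x', N x' & f x' = y s'] by near: s'.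
exists x' => // x2 Bx2 fx2; apply: Ninj => //; last by rewrite fx' fx2.
apply: contrapT => nN; apply: nz; exists x2 => //.
Unshelve. all: by end_near. Qed.

(** An empty fibre persists nearby because the image is closed. Two distinct preimages persist
    because the map is open on disjoint neighbourhoods of them. *)
Let single_closed s : I01 s -> ~ single s -> \forall s' \near s, ~ single s'.
Proof.
move=> s01 ns; have [[x [Bx fx]]|nx] := pselect (exists x, B x /\ f x = y s); last first.
  have cK : closed (f @` (B `&` setT)) by apply: image_closed; exact: closedT.
  have : \forall z \near y s, (~` (f @` (B `&` setT))) z.
    apply: open_nbhs_nbhs; split; first exact: closed_openC.
    by move=> [x' [Bx' _]] fx'; apply: nx; exists x'.
  move=> h; have h4 : \forall s' \near s, (~` (f @` (B `&` setT))) (y s').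
    exact: (conty h).
  near=> s'; have nz : (~` (f @` (B `&` setT))) (y s') by near: s'.
  by move=> [x' [Bx' fx'] _]; apply: nz; exists x'.
have [x2 [Bx2 fx2 xx]] : exists x2, [/\ B x2, f x2 = y s & x2 != x].
  apply: contrapT => H; apply: ns; exists x => // x' Bx' fx'.
  by apply: contrapT => /eqP nx; apply: H; exists x'.
have := @norm_hausdorff _ E; rewrite open_hausdorff => /(_ _ _ xx).
move=> [[W W']] /= [x2W xW'] [oW oW' WW'].
rewrite inE in x2W; rewrite inE in xW'.
have h1 := fopen s01 Bx2 fx2 (open_nbhs_nbhs (conj oW x2W)).
have h2 := fopen s01 Bx fx (open_nbhs_nbhs (conj oW' xW')).
have h3 : \forall z \near y s, (exists x', [/\ B x', W x' & f x' = z]) /\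
    exists x', [/\ B x', W' x' & f x' = z].
  by near=> z; split; near: z.
have h4 : \forall s' \near s, (exists x', [/\ B x', W x' & f x' = y s']) /\
    exists x', [/\ B x', W' x' & f x' = y s'].
  exact: (conty h3).
near=> s'; have [[a [Ba Wa fa]] [b [Bb Wb fb]]] : (exists x', [/\ B x', W x' & f x' = y s']) /\
    exists x', [/\ B x', W' x' & f x' = y s'] by near: s'.
move=> [u _ uu].
have ab : a = b by rewrite (uu a) // (uu b).
have : (W `&` W') a by split => //; rewrite ab.
by move/eqP: WW' => ->.
Unshelve. all: by end_near. Qed.

(** The parameters with exactly one preimage form a nonempty open and closed subset of the
    segment. *)
Lemma unique_fiber : single 0 -> single 1.
Proof.
move=> s0; pose S := I01 `&` single.
have SI : S = I01.
  apply: (@segment_connected R 0 1).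
    by exists 0; split => //; rewrite /I01 /= in_itv /= lexx ler01.
    exists ([set s | I01 s -> single s]°); first exact: open_interior.
    apply/seteqP; split=> s [s01 H]; split=> //; last by apply: (interior_subset H).
    by apply: (@filterS _ (nbhs s) _ single) (single_open s01 H) => s' h _.
  exists (~` [set s | I01 s -> ~ single s]°); first by apply: open_closedC; exact: open_interior.
  apply/seteqP; split=> s [s01 H]; split=> //; first by move/interior_subset/(_ s01).
  apply: contrapT => ns; apply: H.
  by apply: (@filterS _ (nbhs s) _ (fun s => ~ single s)) (single_closed s01 ns) => s' h _.
have [] // : S 1 by rewrite SI /I01 /= in_itv /= lexx ler01.
Qed.

End unique_fibers.

Section chart_data.
Context {R : realType} {n : nat}.
Variable lam : 'I_n.+1 -> R.
Variables (c : 'I_n.-1 -> 'rV[R]_n) (d : 'I_n.-1 -> R) (l : seq 'I_n.-1).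
Local Notation E := 'rV[R]_n.
Local Notation B := (cut_cube c d l).
Local Notation B0 := (cut_interior c d).

(* [wp] and [wq] are the resolved quotients [P] and [Q] of [valid]. *)
Record chart_data (diag off wp wq : E -> 'I_n -> R) (dom : set E) : Prop := ChartData {
  chart_open : open dom ;
  chart_dom : B `<=` dom ;
  chart_diag : forall q k, Ck q dom (diag^~ k) ;
  chart_off : forall q k, Ck q dom (off^~ k) ;
  chart_wp : forall k, Ck 0 dom (wp^~ k) ;
  chart_wq : forall k, Ck 0 dom (wq^~ k) ;
  chart_immersion : forall x v, B x -> (forall k, 'D_v (diag^~ k) x = 0) ->
    (forall k, 'D_v (off^~ k) x = 0) -> v = 0 ;
  chart_immersion0 : forall x v, B0 x -> (forall k, 'D_v (diag^~ k) x = 0) -> v = 0 ;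
  chart_valid : forall x, B x -> valid lam (diag x) (wp x) (wq x) ;
  chart_square : forall x k, B x -> off x k ^+ 2 = wp x k * wq x k * Gfactor lam (diag x) k ;
  chart_off_ge0 : forall x k, B x -> 0 <= off x k ;
  chart_arrow : forall x, B x ->
    arrow_eq lam (\sum_j lam j - \sum_k diag x k) (diag x) (off x) ;
  chart_interior : forall x k, B0 x -> lft lam k < diag x k < rgt lam k ;
  chart_cells : forall x, B x -> (forall k, lft lam k < diag x k < rgt lam k) -> B0 x ;
  chart_corner : forall k, diag (const_mx (-1)) k = lft lam k ;
  chart_corner_fiber : forall x, B x -> (forall k, diag x k = lft lam k) -> x = const_mx (-1) ;
  chart_wall : forall x i, B x -> (diag x (lo i) == diag x (hi i)) = (ell c d i x == 0) ;
  chart_left : forall x k, B x -> (wp x k == 0) = (x 0 k == -1) ;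
  chart_right : forall x k, B x -> (wq x k == 0) = (x 0 k == 1) }.

End chart_data.

Section chart_existence.
Context {R : realType} {n : nat}.
Variable lam : 'I_n.+1 -> R.
Hypothesis lam_mono : forall i j : 'I_n.+1, (i < j)%N -> lam i < lam j.
Variables (c : 'I_n.-1 -> 'rV[R]_n) (d : 'I_n.-1 -> R) (l : seq 'I_n.-1).
Hypothesis gd : good_cuts c d l.
Variable eta : R.
Hypothesis eta0 : 0 < eta.
Local Notation E := 'rV[R]_n.
Local Notation B := (cut_cube c d l).
Local Notation B0 := (cut_interior c d).
Local Notation cutw := (wall_cutoff c d eta).
Local Notation wl := (left_part lam c d eta).
Local Notation wr := (right_part lam c d eta).
Local Notation diag := (diag_map lam c d eta).
Local Notation slope := (wall_slope lam c d eta).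
Local Notation off := (off_map lam c d eta).
Implicit Types (k m : 'I_n) (x : E).

Lemma interior_cells x : B x -> (forall k, lft lam k < diag x k < rgt lam k) -> B0 x.
Proof.
move=> Bx H.
have N0 k : cell_weight c d eta x k != 0 by rewrite gt_eqF // (nrm_gt0 gd eta0).
have L k : cutw x k * wl x k != 0.
  have /andP[h _] := H k; move: h; rewrite -subr_gt0 /diag addrAC subrr add0r.
  by move/lt0r_neq0.
have Q k : cutw x k.+1 * wr x k != 0.
  have /andP[_ h] := H k; move: h; rewrite -subr_gt0 diag_rgt //.
  by move/lt0r_neq0.
have [cx _] := Bx; split=> [k|i].
  have := L k; rewrite mulf_eq0 negb_or (wl_eq0 lam_mono gd eta0) // /xl => /andP[_ h2].
  have := Q k; rewrite mulf_eq0 negb_or (wr_eq0 lam_mono gd eta0) // /xr => /andP[_ h1].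
  have /andP[a b] := cx k; rewrite !lt_neqAle a b !andbT.
  apply/andP; split; apply/eqP => h; [move/eqP: h2|move/eqP: h1]; lra.
rewrite lt_neqAle (ell_ge0 gd) // andbT eq_sym; apply/eqP => h.
have := L (hi i); rewrite mulf_eq0 negb_or => /andP[/eqP h3 _]; apply: h3.
by rewrite /wall_cutoff wallo_hi h cutoff0.
Qed.

(* The vertex (-1, ..., -1) is the only point of its fibre: going from left to
   right, a coordinate is -1 because the wall on its left is not cut. *)
Lemma diag_corner_fiber x : B x -> (forall k, diag x k = lft lam k) -> x = const_mx (-1).
Proof.
move=> Bx ed.
have L k : cutw x k * wl x k = 0.
  have h := ed k; rewrite /diag_map in h.
  by apply: (@addrI _ (lft lam k)); rewrite h addr0.
suff H k : x 0 k = -1 by apply/rowP => k; rewrite H mxE.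
have xk m : cutw x m != 0 -> x 0 m = -1.
  move=> r0; have /eqP := L m; rewrite mulf_eq0 (negPf r0) (wl_eq0 lam_mono gd eta0) //=.
  by rewrite /xl => /eqP; lra.
case: k => j; elim: j => [|j IH] jn; apply: xk; first by rewrite /wall_cutoff /= oner_eq0.
have [r0|//] := eqVneq (cutw x (Ordinal jn)) 0.
have [i [ij h]] := cutw_eq0 gd eta0 Bx r0.
have [h1 _] := good_facet gd Bx h; case: h1.
have jn' : (j < n)%N := ltn_trans (ltnSn j) jn.
have -> : lo i = Ordinal jn' by apply: val_inj; case: ij => /= ->.
exact: IH.
Qed.

Lemma exists_chart_with :
  (forall x i, B x -> ell c d i x < eta -> -1 < x 0 (lo i) /\ x 0 (hi i) < 1) ->
  (forall x (i j : 'I_n.-1), B x -> ell c d i x < eta -> ell c d j x < eta -> j <> i.+1 :> nat) ->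
  chart_data lam c d l diag off (fun x k => wl x k / slope x k)
    (fun x k => wr x k / slope x k.+1) (smooth_dom lam c d eta).
Proof.
move=> ef ea; have od : open (smooth_dom lam c d eta) by exact: dom_open.
have Bd := B_dom lam_mono gd eta0.
have Cs w : Ck 0 (smooth_dom lam c d eta) (fun x => (slope x w)^-1).
  apply: CkV => //; last exact: Ck_slope.
  by move=> x dx; rewrite gt_eqF //; exact: dom_slope dx.
have s0 x w : B x -> slope x w != 0.
  by move=> Bx; rewrite gt_eqF // (slope_gt0 lam_mono gd eta0).
split.
  exact: od.
  exact: Bd.
  by move=> q k; exact: Ck_diag.
  by move=> q k; exact: Ck_off.
  move=> k; apply: CkM => //; by apply: Ck_sub (Ck_wl _ _ _ _ 0 k) => x [[[]]].
  move=> k; apply: CkM => //; by apply: Ck_sub (Ck_wr _ _ _ _ 0 k) => x [[[]]].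
  move=> x v Bx; exact: (immersion lam_mono gd eta0 ef ea Bx).
  move=> x v; exact: (interior_diag_immersion lam_mono gd eta0 ef ea).
  move=> x Bx; exact: (diag_valid lam_mono gd eta0 Bx).
  move=> x k; exact: (off_square lam_mono gd eta0).
  move=> x k; exact: off_ge0.
  move=> x; exact: (arrow_eq_B lam_mono gd eta0).
  move=> x k; exact: (diag_interior lam_mono gd eta0).
  exact: interior_cells.
  by move=> k; rewrite /diag_map /left_part /xl mxE; ring.
  exact: diag_corner_fiber.
  move=> x i Bx; rewrite eq_sym -subr_eq0 (diag_sd lam gd eta0) //.
  rewrite mulf_eq0 (negPf (s0 x i.+1 Bx)) orbF /wall_cutoff walloS.
  have := ell_ge0 gd i Bx; rewrite le_eqVlt => /orP[/eqP <-|h].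
    by rewrite cutoff0 // !eqxx.
  by rewrite !gt_eqF // cutoff_gt0.
  move=> x k Bx; rewrite mulf_eq0 invr_eq0 (negPf (s0 x k Bx)) orbF (wl_eq0 lam_mono gd eta0) //.
  by rewrite /xl addrC addr_eq0.
move=> x k Bx; rewrite mulf_eq0 invr_eq0 (negPf (s0 x k.+1 Bx)) orbF (wr_eq0 lam_mono gd eta0) //.
by rewrite /xr subr_eq0 eq_sym.
Qed.

End chart_existence.

Lemma exists_chart {R : realType} {n : nat} (lam : 'I_n.+1 -> R)
    (c : 'I_n.-1 -> 'rV[R]_n) (d : 'I_n.-1 -> R) (l : seq 'I_n.-1) :
  (forall i j : 'I_n.+1, (i < j)%N -> lam i < lam j) -> good_cuts c d l ->
  exists diag off wp wq dom, chart_data lam c d l diag off wp wq dom.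
Proof.
move=> lam_mono gd; have [eta eta0 [ef ea]] := cut_separation gd.
by do 5 eexists; exact: (exists_chart_with lam_mono gd eta0 ef ea).
Qed.

Section bijection.
Context {R : realType} {n : nat}.
Variable lam : 'I_n.+1 -> R.
Hypothesis lam_mono : forall i j : 'I_n.+1, (i < j)%N -> lam i < lam j.
Variables (c : 'I_n.-1 -> 'rV[R]_n) (d : 'I_n.-1 -> R) (l : seq 'I_n.-1).
Hypothesis gd : good_cuts c d l.
Variables (diag off wp wq : 'rV[R]_n -> 'I_n -> R) (dom : set 'rV[R]_n).
Hypothesis cd : chart_data lam c d l diag off wp wq dom.
Local Notation E := 'rV[R]_n.
Local Notation B := (cut_cube c d l).
Local Notation B0 := (cut_interior c d).
Implicit Types (k m : 'I_n) (x : E).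

Definition diag_row x : E := \row_k diag x k.
Definition off_row x : E := \row_k off x k.
Definition data x : 'rV[R]_(n + n) := row_mx (diag_row x) (off_row x).

Lemma diag_rowE x k : diag_row x 0 k = diag x k.
Proof. by rewrite /diag_row mxE. Qed.

Lemma off_rowE x k : off_row x 0 k = off x k.
Proof. by rewrite /off_row mxE. Qed.

Lemma data_lshift x k : data x 0 (lshift n k) = diag x k.
Proof. by rewrite /data row_mxEl diag_rowE. Qed.

Lemma data_rshift x k : data x 0 (rshift n k) = off x k.
Proof. by rewrite /data row_mxEr off_rowE. Qed.

Lemma diag_row_eq x x' : diag_row x = diag_row x' -> diag x = diag x'.
Proof. by move=> e; apply/funext => k; rewrite -!diag_rowE e. Qed.

Let Bdom := chart_dom cd.
Let odom : open dom. Proof. exact: chart_open cd. Qed.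
Lemma Ck_diag_row q : Ck q dom diag_row.
Proof.
apply: Ck_mx => // i k; apply: (Ck_eq (f := diag^~ k)) => //.
  by move=> x _; rewrite ord1 diag_rowE.
exact: (chart_diag cd).
Qed.

Lemma Ck_data q : Ck q dom data.
Proof.
apply: Ck_mx => // i k; case: (split_ordP k) => j ->.
  apply: (Ck_eq (f := diag^~ j)) => //; last exact: (chart_diag cd).
  by move=> x _; rewrite ord1 data_lshift.
apply: (Ck_eq (f := off^~ j)) => //; last exact: (chart_off cd).
by move=> x _; rewrite ord1 data_rshift.
Qed.

Lemma diag_row_continuous : {within B, continuous diag_row}.
Proof.
apply: continuous_in_subspaceT => x; rewrite inE => Bx.
exact: (Ck_continuous (Ck_diag_row 0) (Bdom Bx)).
Qed.

Lemma derive_coord (p : nat) (f : E -> 'rV[R]_p) x v (k : 'I_p) : differentiable f x ->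
  'D_v f x = 0 -> 'D_v (fun y => f y 0 k) x = 0.
Proof.
move=> df D0; have -> : (fun y => f y 0 k) = mxcoord 0 k \o f by [].
rewrite derive_linear_comp //; last exact: linear_mx_continuous.
by rewrite D0 linear0.
Qed.

Lemma data_immersion x v : B x -> 'D_v data x = 0 -> v = 0.
Proof.
move=> Bx D0; have [dd _] := Ck_data 1.
have H (j : 'I_(n + n)) := derive_coord j (dd x (Bdom Bx)) D0.
apply: (chart_immersion cd Bx) => k.
  rewrite -(H (lshift n k)); congr ('D_v _ x); apply/funext => y.
  by rewrite data_lshift.
rewrite -(H (rshift n k)); congr ('D_v _ x); apply/funext => y.
by rewrite data_rshift.
Qed.

Lemma data_left_inverse x0 : B x0 ->
  exists (T : set 'rV[R]_(n + n)) (G : 'rV[R]_(n + n) -> E) (N : set E),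
    [/\ open T, smooth_open T G, open N, N x0 &
        forall x, N x -> [/\ dom x, T (data x) & G (data x) = x]].
Proof.
move=> Bx; apply: local_left_inverse => //; first exact: Bdom.
  by move=> q; exact: Ck_data.
by move=> v; exact: data_immersion.
Qed.

Definition corner0 : E := const_mx (-1).

Lemma corner0B : B corner0.
Proof.
apply/(cut_cubeP gd); split=> [k|i]; first by rewrite mxE; lra.
by apply/ltW/(good_const gd); right.
Qed.

Lemma data_eq x x' : B x -> B x' -> diag x = diag x' -> wp x = wp x' -> wq x = wq x' ->
  data x = data x'.
Proof.
move=> Bx Bx' ed ep eq; apply/rowP => j; case: (split_ordP j) => k ->.
  rewrite [LHS]data_lshift.
  rewrite [RHS]data_lshift.
  rewrite ed.
  reflexivity.
rewrite [LHS]data_rshift [RHS]data_rshift.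
have : off x k ^+ 2 = off x' k ^+ 2.
  rewrite (chart_square cd k Bx) (chart_square cd k Bx').
  rewrite ep eq ed; reflexivity.
by move/eqP; rewrite eqrXn2 // ?(chart_off_ge0 cd) // => /eqP.
Qed.

Lemma diag_row_open x (W : set E) : B0 x -> nbhs x W ->
  \forall z \near diag_row x, exists x', [/\ B x', W x' & diag_row x' = z].
Proof.
move=> ix Wx; have oB0 := @cut_interior_open _ _ c d.
have sB0 : B0 `<=` dom by move=> y /(cut_interior_sub gd)/Bdom.
have oU : open (W° `&` B0) by apply: openI => //; exact: open_interior.
have Ux : (W° `&` B0) x by split.
have sf : smooth_open (W° `&` B0) diag_row.
  by move=> q; apply: Ck_sub (Ck_diag_row q) => y [_ /sB0].
have inj v : 'D_v diag_row x = 0 -> v = 0.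
  move=> D0; apply: (chart_immersion0 cd ix) => k.
  have [dd _] := Ck_diag_row 1.
  rewrite -(derive_coord k (dd x (sB0 x ix)) D0); congr ('D_v _ x).
  by apply/funext => y; rewrite diag_rowE.
have [T [N [g [[oT Tx _ gP] _ _ _]]]] := inverse_function oU Ux sf inj.
have : \forall z \near diag_row x, T z by apply: open_nbhs_nbhs.
apply: filterS => z /gP[[Wg ig] fg]; exists (g z); split=> //.
  exact: (cut_interior_sub gd).
exact: interior_subset.
Qed.

Lemma sd_interior x w : B0 x -> sd (diag x) w != 0.
Proof.
move=> ix; apply: (@wallo_ind _ _ (fun z => z != 0)) => [|i]; first exact: oner_neq0.
have Bx := cut_interior_sub gd ix.
rewrite subr_eq0 eq_sym (chart_wall cd i Bx) gt_eqF //.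
by case: ix.
Qed.

(** In the interior no denominator vanishes, so the diagonal determines both quotients, and with
    them the off-diagonal entries. *)
Lemma diag_eq_interior x x' : B x -> B0 x' -> diag_row x = diag_row x' ->
  [/\ B0 x & data x = data x'].
Proof.
move=> Bx ix' e; have Bx' := cut_interior_sub gd ix'.
have ed := diag_row_eq e.
have ix : B0 x.
  apply: (chart_cells cd) => // k; rewrite ed.
  exact: (chart_interior cd).
split; first exact: ix.
have v := chart_valid cd Bx; have v' := chart_valid cd Bx'; rewrite ed in v.
have s0 w : sd (diag x') w != 0 by exact: sd_interior.
apply: (data_eq Bx Bx' ed); apply/funext => k.
  by apply: (mulIf (s0 k)); rewrite (valid_P v) (valid_P v').
by apply: (mulIf (s0 k.+1)); rewrite (valid_Q v) (valid_Q v').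
Qed.

Lemma data_locally_injective x0 : B x0 -> exists2 N : set E, open N & N x0 /\
  forall x x', N x -> N x' -> data x = data x' -> x = x'.
Proof.
move=> Bx; have [T [G [N [_ _ oN Nx NP]]]] := data_left_inverse Bx.
exists N; first exact: oN.
split=> [|x x' /NP[_ _ e1] /NP[_ _ e2] e]; first exact: Nx.
by rewrite -e1 -e2 e.
Qed.

Lemma corner0_fiber x : B x -> diag_row x = diag_row corner0 -> x = corner0.
Proof.
move=> Bx e; apply: (chart_corner_fiber cd Bx) => k.
by rewrite (diag_row_eq e) (chart_corner cd).
Qed.

Lemma fiber_neighbourhood x0 (N : set E) : open N -> (forall x, B x -> diag_row x = diag_row x0 -> N x) ->
  \forall z \near diag_row x0, forall x, B x -> diag_row x = z -> N x.
Proof.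
move=> oN H.
have cK : closed (diag_row @` (B `&` ~` N)).
  apply: compact_closed; first exact: norm_hausdorff.
  apply: continuous_compact; last first.
    by apply: compact_closedI; [exact: (cut_cube_compact gd)|exact: open_closedC].
  by apply: continuous_subspaceW diag_row_continuous => x [].
have : \forall z \near diag_row x0, (~` (diag_row @` (B `&` ~` N))) z.
  apply: open_nbhs_nbhs; split; first exact: closed_openC.
  by move=> [x [Bx Nx]] /(H _ Bx).
apply: filterS => z nz x Bx xz; apply: contrapT => nN; apply: nz.
by exists x.
Qed.

(** The fibre over the image of the vertex [corner0] is that vertex, so by compactness nearby fibres
    lie in a neighbourhood where [data] is injective; an interior point nearby serves as a base. *)
Lemma unique_base : exists2 x, B0 x & forall x', B x' -> diag_row x' = diag_row x -> x' = x.
Proof.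
have [N oN [Nx Ninj]] := data_locally_injective corner0B.
have H := @fiber_neighbourhood corner0 N oN.
have {}H : \forall z \near diag_row corner0, forall x, B x -> diag_row x = z -> N x.
  by apply: H => x Bx /corner0_fiber -> //.
have cf := Ck_continuous (Ck_diag_row 0) (Bdom corner0B).
have H2 : \forall y \near corner0, forall x, B x -> diag_row x = diag_row y -> N x.
  exact: (cf _ H).
have [y iy Hy] := cut_interior_dense gd corner0B H2.
exists y => // x' Bx' e; have [ix' ed] := diag_eq_interior Bx' iy e.
have By := cut_interior_sub gd iy.
exact: (Ninj _ _ (Hy _ Bx' e) (Hy _ By erefl) ed).
Qed.

Definition cells0 : set E := [set a | forall k, lft lam k < a 0 k < rgt lam k].

(** [unique_fiber] along the segment from the base value to [a], which stays in the open box by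
    convexity; all preimages over it are interior points. *)
Lemma interior_unique a : cells0 a -> exists2 x, B0 x /\ diag_row x = a &
  forall x', B x' -> diag_row x' = a -> x' = x.
Proof.
move=> ca; have [x1 ix1 ux1] := unique_base.
have Bx1 := cut_interior_sub gd ix1.
pose y (t : R) : E := diag_row x1 + t *: (a - diag_row x1).
have y0 : y 0 = diag_row x1 by rewrite /y scale0r addr0.
have y1 : y 1 = a by rewrite /y scale1r addrC subrK.
have cy : continuous y.
  move=> t; apply: cvgD; first exact: cvg_cst.
  by apply: cvgZ; [exact: cvg_id|exact: cvg_cst].
have yc t : 0 <= t <= 1 -> cells0 (y t).
  move=> /andP[t0 t1] k; rewrite /y !mxE; have /andP[a1 a2] := ca k.
  have /andP[b1 b2] := chart_interior cd k ix1.
  have [->|t0'] := eqVneq t 0; first by rewrite mul0r addr0 b1.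
  have {}t0' : 0 < t by rewrite lt_neqAle eq_sym t0'.
  have h1 : 0 < t * (a 0 k - lft lam k) by rewrite mulr_gt0 // subr_gt0.
  have h2 : 0 < t * (rgt lam k - a 0 k) by rewrite mulr_gt0 // subr_gt0.
  have h3 : 0 <= (1 - t) * (diag x1 k - lft lam k) by rewrite mulr_ge0 // subr_ge0 // ltW.
  have h4 : 0 <= (1 - t) * (rgt lam k - diag x1 k) by rewrite mulr_ge0 // subr_ge0 // ltW.
  by lra.
have int t x : 0 <= t <= 1 -> B x -> diag_row x = y t -> B0 x.
  move=> t01 Bx e; apply: (chart_cells cd) => // k.
  by have := yc t t01 k; rewrite -e diag_rowE.
have [] := @unique_fiber R E E B diag_row y (cut_cube_compact gd) diag_row_continuous cy.
  move=> s x W; rewrite /= in_itv /= => s01 Bx e Wx; rewrite -e.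
  by apply: diag_row_open => //; exact: int s01 Bx e.
  move=> s x; rewrite /= in_itv /= => s01 Bx e.
  have [N oN [Nx Ninj]] := data_locally_injective Bx.
  exists (N `&` B0); first by apply: openI => //; exact: cut_interior_open.
  split; first by split => //; exact: int s01 Bx e.
  move=> x2 x3 [N2 i2] [N3 i3] B2 B3 e23; have [_ e'] := diag_eq_interior B2 i3 e23.
  exact: (Ninj _ _ N2 N3 e').
  by exists x1; rewrite y0.
move=> x [Bx ex] ux; exists x; rewrite -y1 //; split=> //.
by apply: (int 1) => //; rewrite lexx ler01.
Qed.

End bijection.

Section two_charts.
Context {R : realType} {n : nat}.
Variable lam : 'I_n.+1 -> R.
Hypothesis lam_mono : forall i j : 'I_n.+1, (i < j)%N -> lam i < lam j.
Variables (c c' : 'I_n.-1 -> 'rV[R]_n) (d d' : 'I_n.-1 -> R) (l l' : seq 'I_n.-1).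
Variables (diag off wp wq : 'rV[R]_n -> 'I_n -> R) (dom : set 'rV[R]_n).
Variables (diag' off' wp' wq' : 'rV[R]_n -> 'I_n -> R) (dom' : set 'rV[R]_n).
Hypothesis cd : chart_data lam c d l diag off wp wq dom.
Hypothesis cd' : chart_data lam c' d' l' diag' off' wp' wq' dom'.

(** Stated for two charts, possibly of different polytopes: taken twice with the same chart it
    serves injectivity, and with the standard chart it serves the transfer of product structures. *)
Lemma data_eqP x x' : cut_cube c d l x -> cut_cube c' d' l' x' ->
  data diag off x = data diag' off' x' ->
  [/\ diag x = diag' x', wp x = wp' x' & wq x = wq' x'].
Proof.
move=> Bx Bx' e.
have ed : diag x = diag' x' by apply/funext => k; rewrite -(data_lshift diag off) e data_lshift.
have eo k : off x k = off' x' k by rewrite -(data_rshift diag off) e data_rshift.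
have v' := chart_valid cd' Bx'; rewrite -ed in v'.
have PQ k : wp x k * wq x k = wp' x' k * wq' x' k.
  have g1 := Gfactor_gt0 lam_mono k (valid_cells v').
  have g0 : Gfactor lam (diag x) k != 0 by rewrite (gt_eqF g1).
  have h1 := chart_square cd k Bx.
  have h2 := chart_square cd' k Bx'.
  have h3 : off x k ^+ 2 = off' x' k ^+ 2 by rewrite eo.
  by rewrite h1 h2 -ed in h3; exact: (mulIf g0 h3).
have [ep eq] := valid_unique lam_mono (chart_valid cd Bx) v' PQ.
by split; [exact: ed|exact: (funext ep)|exact: (funext eq)].
Qed.

End two_charts.

Section matrix_limits.
Context {R : realType}.

Lemma mx_norm_lt (m p : nat) (A : 'M[R]_(m, p)) (M : R) : 0 < M ->
  (forall i j, `|A i j| < M) -> `|A| < M.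
Proof. by move=> M0 H; rewrite [`|_|]mx_normrE; apply: bigmax_lt => // -[i j] _. Qed.

Lemma mx_entry_le (m p : nat) (A : 'M[R]_(m, p)) i j : `|A i j| <= `|A|.
Proof.
rewrite [`|A|]mx_normrE; exact: (le_bigmax _ (fun ij : 'I_m * 'I_p => `|A ij.1 ij.2|) (i, j)).
Qed.

Lemma cvg_mx (T : Type) (F : set_system T) (FF : Filter F) (m p : nat)
    (f : T -> 'M[R]_(m, p)) (A : 'M[R]_(m, p)) :
  (forall i j, f t i j @[t --> F] --> A i j) -> f @ F --> A.
Proof.
move=> H; apply/cvgrPdist_lt => e e0.
have K : \forall t \near F, forall ij : 'I_m * 'I_p, `|A ij.1 ij.2 - f t ij.1 ij.2| < e.
  apply: filter_forall => -[i j] /=.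
  by have /cvgrPdist_lt/(_ e e0) := H i j.
apply: filterS K => t K; apply: mx_norm_lt => // i j.
by have := K (i, j); rewrite !mxE.
Qed.

(** The number [q] is a weighted mean of [q1] and [q2]. The weights are not normalized, since they
    will be denominators of quotients. *)
Lemma conv_dist (p q q1 q2 w1 w2 e : R) : 0 <= w1 -> 0 <= w2 -> 0 < w1 + w2 ->
  q * (w1 + w2) = q1 * w1 + q2 * w2 -> `|p - q1| < e -> `|p - q2| < e -> `|p - q| < e.
Proof.
move=> w10 w20 w0 qE h1 h2; rewrite -(ltr_pM2r w0) -{1}(gtr0_norm w0) -normrM.
have -> : (p - q) * (w1 + w2) = (p - q1) * w1 + (p - q2) * w2 by rewrite mulrBl qE; ring.
apply: (le_lt_trans (ler_normD _ _)); rewrite !normrM (ger0_norm w10) (ger0_norm w20) mulrDr.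
have [w1z|w1z] := eqVneq w1 0.
  rewrite w1z !mulr0 !add0r ltr_pM2r //; by rewrite w1z add0r in w0.
apply: ltr_leD; last by rewrite ler_wpM2r // ltW.
by rewrite ltr_pM2r // lt_neqAle eq_sym w1z.
Qed.

End matrix_limits.

Section global_inverse.
Context {R : realType} {n : nat}.
Variable lam : 'I_n.+1 -> R.
Hypothesis lam_mono : forall i j : 'I_n.+1, (i < j)%N -> lam i < lam j.
Variables (c : 'I_n.-1 -> 'rV[R]_n) (d : 'I_n.-1 -> R) (l : seq 'I_n.-1).
Hypothesis gd : good_cuts c d l.
Variables (diag off wp wq : 'rV[R]_n -> 'I_n -> R) (dom : set 'rV[R]_n).
Hypothesis cd : chart_data lam c d l diag off wp wq dom.
Local Notation E := 'rV[R]_n.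
Local Notation B := (cut_cube c d l).
Local Notation B0 := (cut_interior c d).
Implicit Types (k m : 'I_n) (x : E).
Local Notation diag_row := (diag_row diag).
Local Notation cells0 := (cells0 lam).

Definition triple (a P Q : 'I_n -> R) : 'M[R]_(3, n) :=
  \matrix_(i, k) (if i == 0 then a k else if i == 1 then P k else Q k).

(** Continuous on the compact polytope, hence with closed image. Unlike the diagonal, it separates
    the points of an interval contracted on a cut facet. *)
Definition psi x := triple (diag x) (wp x) (wq x).

Lemma triple_inj a P Q a' P' Q' : triple a P Q = triple a' P' Q' ->
  [/\ a = a', P = P' & Q = Q'].
Proof.
move=> /matrixP e; split; apply/funext => k.
  by have := e 0 k; rewrite !mxE.
  by have := e 1 k; rewrite !mxE.
by have := e (lift 0 (lift 0 0)) k; rewrite !mxE.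
Qed.

Lemma psi_continuous x : B x -> {for x, continuous psi}.
Proof.
move=> Bx; have dx := chart_dom cd Bx; apply: (@cvg_mx _ _ (nbhs x) _) => i k; rewrite !mxE.
have E0 (f : E -> 'I_n -> R) : (forall k, Ck 0 dom (f^~ k)) -> f y k @[y --> x] --> f x k.
  by move=> H; exact: (Ck_continuous (H k) dx).
have [i0|i0] := eqVneq i 0.
  have -> : (fun t : E => psi t i k) = diag^~ k by apply/funext => t; rewrite mxE i0 eqxx.
  exact: (E0 diag (chart_diag cd 0)).
have [i1|i1] := eqVneq i 1.
  have -> : (fun t : E => psi t i k) = wp^~ k by apply/funext => t; rewrite mxE (negPf i0) i1 eqxx.
  exact: (E0 wp (chart_wp cd)).
have -> : (fun t : E => psi t i k) = wq^~ k by apply/funext => t; rewrite mxE (negPf i0) (negPf i1).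
exact: (E0 wq (chart_wq cd)).
Qed.

Lemma psi_image_closed (K : set E) : closed K -> closed (psi @` (B `&` K)).
Proof.
move=> cK; apply: compact_closed; first exact: norm_hausdorff.
apply: continuous_compact; last first.
  by apply: compact_closedI => //; exact: (cut_cube_compact gd).
by apply: continuous_in_subspaceT => x; rewrite inE => -[Bx _]; exact: psi_continuous.
Qed.

Lemma cells0_open : open cells0.
Proof.
have ck k : continuous (fun z : E => z 0 k) by exact: continuous_x.
apply: (@open_forall _ E _ (fun k => [set a : E | lft lam k < a 0 k < rgt lam k])) => k.
have -> : [set a : E | lft lam k < a 0 k < rgt lam k] =
    [set a : E | lft lam k < a 0 k] `&` [set a : E | a 0 k < rgt lam k].
  by apply/seteqP; split=> t /=; [move/andP|move=> H; apply/andP].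
apply: openI.
  by apply: (@open_comp _ _ (fun x : E => x 0 k) [set t | lft lam k < t]) => //; apply: open_gt.
by apply: (@open_comp _ _ (fun x : E => x 0 k) [set t | t < rgt lam k]) => //; apply: open_lt.
Qed.

Lemma interior_inverse : exists h : E -> E,
  [/\ forall a, cells0 a -> B0 (h a) /\ diag_row (h a) = a,
      forall x, B0 x -> h (diag_row x) = x &
      forall a, cells0 a -> {for a, continuous h}].
Proof.
have ex a : exists x, cells0 a -> [/\ B0 x, diag_row x = a &
    forall x', B x' -> diag_row x' = a -> x' = x].
  have [ca|nca] := pselect (cells0 a); last by exists 0.
  by have [x [ix ex] ux] := interior_unique gd cd ca; exists x.
pose h a := projT1 (cid (ex a)).
have hP a : cells0 a -> [/\ B0 (h a), diag_row (h a) = a &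
    forall x', B x' -> diag_row x' = a -> x' = h a] by rewrite /h; case: cid.
exists h; split.
  by move=> a /hP[].
  move=> x ix; have ca : cells0 (diag_row x).
    by move=> k; rewrite diag_rowE; exact: (chart_interior cd k ix).
  have [_ _ u] := hP _ ca; apply/esym; apply: u => //; exact: (cut_interior_sub gd).
move=> a ca W; have [ia ea u] := hP a ca => Wa.
have := diag_row_open gd cd ia Wa; rewrite ea.
have nc : nbhs a cells0 by apply: open_nbhs_nbhs; split => //; exact: cells0_open.
move=> H; suff : \forall z \near a, W (h z) by [].
near=> z.
have cz : cells0 z by near: z.
have [x' [Bx' Wx' ez]] : exists x', [/\ B x', W x' & diag_row x' = z] by near: z.
by have [_ _ uz] := hP z cz; rewrite -(uz x').
Unshelve. all: by end_near. Qed.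

(** Choose interior points [y1] near [x] and [y2] near [x'] with almost the same triple, and lift
    the segment between their diagonals. The lift crosses a small sphere around [x], although its
    triple stays within [eps] of [psi x]; on that sphere triples are further away, by local
    injectivity and compactness. *)
Lemma psi_injective x x' : B x -> B x' -> psi x = psi x' -> x = x'.
Proof.
move=> Bx Bx' e; apply: contrapT => /eqP xx'.
have [N oN [Nx Ninj]] := data_locally_injective cd Bx.
have /nbhs_ballP[r0 /= r00 r0N] : nbhs x N by apply: open_nbhs_nbhs.
have dx : 0 < `|x - x'| by rewrite normr_gt0 subr_eq0.
(* Small enough for the sphere to lie in the neighbourhood where [data] is injective and to separate
   [x] from [x']. *)
pose rho := Num.min (r0 / 2) (`|x - x'| / 2).
have rho0 : 0 < rho by rewrite lt_min !divr_gt0.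
have rho1 : rho < r0 by apply: (@le_lt_trans _ _ (r0 / 2)); [rewrite ge_min lexx|lra].
have rho2 : rho < `|x - x'|.
  by apply: (@le_lt_trans _ _ (`|x - x'| / 2)); [rewrite ge_min lexx orbT|lra].
have cdist : continuous (fun z : E => `|x - z|).
  move=> z; apply: (@continuous_comp _ _ _ (fun z : E => x - z) (fun z : E => `|z|)).
    by apply: continuousB; [exact: cst_continuous|move=> ?; exact: cvg_id].
  exact: norm_continuous.
have cS : closed [set z : E | `|x - z| = rho].
  by apply: (@preimage_closed _ _ (fun z : E => `|x - z|) [set t | t = rho]) => //; exact: closed_eq.
have cK := psi_image_closed cS.
have nK : (~` (psi @` (B `&` [set z | `|x - z| = rho]))) (psi x).
  move=> [z [Bz /= zr]] /triple_inj[e1 e2 e3].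
  have Nz : N z by apply: r0N; rewrite -ball_normE /ball_ /= zr.
  have xz : z = x by apply: Ninj => //; apply: (data_eq cd Bz Bx).
  by move: zr rho0; rewrite xz subrr normr0 => <-; rewrite ltxx.
have /nbhs_ballP[eps /= eps0 epsK] : nbhs (psi x) (~` (psi @` (B `&` [set z | `|x - z| = rho]))).
  by apply: open_nbhs_nbhs; split => //; exact: closed_openC.
have n1 : \forall y \near x, `|psi x - psi y| < eps /\ `|x - y| < rho.
  have h1 : \forall y \near x, `|psi x - psi y| < eps.
    by have /cvgrPdist_lt/(_ eps eps0) := psi_continuous Bx.
  have rho3 : `|x - x| < rho by rewrite subrr normr0.
  have h2 : \forall y \near x, `|x - y| < rho by exact: (@cvgr_lt _ _ _ _ _ _ (cdist x) _ rho3).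
  by near=> y; split; near: y.
have n2 : \forall y \near x', `|psi x - psi y| < eps /\ rho < `|x - y|.
  have h1 : \forall y \near x', `|psi x - psi y| < eps.
    by rewrite e; have /cvgrPdist_lt/(_ eps eps0) := psi_continuous Bx'.
  have h2 : \forall y \near x', rho < `|x - y| by exact: (@cvgr_gt _ _ _ _ _ _ (cdist x') _ rho2).
  by near=> y; split; near: y.
have [y1 iy1 [py1 xy1]] := cut_interior_dense gd Bx n1.
have [y2 iy2 [py2 xy2]] := cut_interior_dense gd Bx' n2.
have [h [hP hK hc]] := interior_inverse.
pose a s : E := (1 - s) *: diag_row y1 + s *: diag_row y2.
have ak s k : a s 0 k = (1 - s) * diag y1 k + s * diag y2 k by rewrite !mxE.
have ca s : 0 <= s <= 1 -> cells0 (a s).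
  move=> /andP[s0 s1] k; rewrite ak.
  have /andP[a1 a2] := chart_interior cd k iy1; have /andP[b1 b2] := chart_interior cd k iy2.
  have [->|t0'] := eqVneq s 0; first by rewrite mul0r addr0 subr0 mul1r a1.
  have {}t0' : 0 < s by rewrite lt_neqAle eq_sym t0'.
  have h1 : 0 < s * (diag y2 k - lft lam k) by rewrite mulr_gt0 // subr_gt0.
  have h2 : 0 < s * (rgt lam k - diag y2 k) by rewrite mulr_gt0 // subr_gt0.
  have h3 : 0 <= (1 - s) * (diag y1 k - lft lam k) by rewrite mulr_ge0 // subr_ge0 // ltW.
  have h4 : 0 <= (1 - s) * (rgt lam k - diag y1 k) by rewrite mulr_ge0 // subr_ge0 // ltW.
  by lra.
have a0 : a 0 = diag_row y1 by rewrite /a subr0 scale1r scale0r addr0.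
have a1 : a 1 = diag_row y2 by rewrite /a subrr scale1r scale0r add0r.
have cta : continuous a.
  move=> s; apply: cvgD; apply: cvgZ; try exact: cvg_cst; last exact: cvg_id.
  by apply: cvgB; [exact: cvg_cst|exact: cvg_id].
have cg : {within `[0, 1], continuous (fun s => `|x - h (a s)|)}.
  apply: continuous_in_subspaceT => s; rewrite inE /= in_itv /= => s01.
  apply: (@continuous_comp _ _ _ (fun s => h (a s)) (fun z => `|x - z|)); last exact: cdist.
  by apply: (@continuous_comp _ _ _ a h); [exact: cta|exact: hc (ca s s01)].
have [|s] := @IVT R (fun s => `|x - h (a s)|) 0 1 rho ler01 cg.
  rewrite a0 a1 !hK //; apply/andP; split.
    by rewrite ge_min (ltW xy1).
  by rewrite le_max (ltW xy2) orbT.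
rewrite in_itv /= => s01 zr; have [iz ez] := hP (a s) (ca s s01).
set z := h (a s) in zr iz ez.
have Bz := cut_interior_sub gd iz.
apply: (epsK (psi z)); last by exists z.
have dz k : diag z k = (1 - s) * diag y1 k + s * diag y2 k by rewrite -diag_rowE ez ak.
have By1 := cut_interior_sub gd iy1; have By2 := cut_interior_sub gd iy2.
have /andP[s0 s1] := s01; have s1' : 0 <= 1 - s by rewrite subr_ge0.
have v1 := chart_valid cd By1; have v2 := chart_valid cd By2; have vz := chart_valid cd Bz.
have ent (y : E) i k : `|psi x - psi y| < eps -> `|psi x i k - psi y i k| < eps.
  by move=> hy; apply: le_lt_trans hy; have := mx_entry_le (psi x - psi y) i k; rewrite !mxE.
(* Numerators and denominators of the quotients are affine in the diagonal, so each quotient at [z]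
   is the mean of those at [y1] and [y2], weighted by their denominators. *)
have sdz w : sd (diag z) w = (1 - s) * sd (diag y1) w + s * sd (diag y2) w.
  rewrite /sd; case: (@wallP R n w) => [[i ->]|H]; last by rewrite !H; ring.
  by rewrite !walloS !dz; ring.
have sd0 y w : B0 y -> 0 < sd (diag y) w.
  move=> iy; rewrite lt_neqAle eq_sym (sd_interior gd cd) //.
  by rewrite (sd_ge0 lam_mono) //; exact: valid_cells (chart_valid cd (cut_interior_sub gd iy)).
have sw w : 0 < (1 - s) * sd (diag y1) w + s * sd (diag y2) w by rewrite -sdz sd0.
have w1 w : 0 <= (1 - s) * sd (diag y1) w by rewrite mulr_ge0 // ltW // sd0.
have w2 w : 0 <= s * sd (diag y2) w by rewrite mulr_ge0 // ltW // sd0.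
rewrite -ball_normE /ball_ /=; apply: mx_norm_lt => // i k; rewrite !mxE.
have := ent y1 i k py1; have := ent y2 i k py2; rewrite !mxE.
have [_|i0] := eqVneq i 0 => h2 h1.
  apply: (conv_dist (q1 := diag y1 k) (q2 := diag y2 k) (w1 := 1 - s) (w2 := s)) => //.
    by rewrite subrK.
  by rewrite subrK dz; ring.
move: h2 h1; have [_|i1] := eqVneq i 1 => h2 h1.
  apply: (conv_dist (q1 := wp y1 k) (q2 := wp y2 k)
    (w1 := (1 - s) * sd (diag y1) k) (w2 := s * sd (diag y2) k)) => //.
  rewrite -sdz (valid_P vz) dz; have e1 := valid_P v1 k; have e2 := valid_P v2 k.
  have -> : wp y1 k * ((1 - s) * sd (diag y1) k) = (1 - s) * (wp y1 k * sd (diag y1) k) by ring.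
  have -> : wp y2 k * (s * sd (diag y2) k) = s * (wp y2 k * sd (diag y2) k) by ring.
  by rewrite e1 e2; ring.
apply: (conv_dist (q1 := wq y1 k) (q2 := wq y2 k)
  (w1 := (1 - s) * sd (diag y1) k.+1) (w2 := s * sd (diag y2) k.+1)) => //.
rewrite -sdz (valid_Q vz) dz; have e1 := valid_Q v1 k; have e2 := valid_Q v2 k.
have -> : wq y1 k * ((1 - s) * sd (diag y1) k.+1) = (1 - s) * (wq y1 k * sd (diag y1) k.+1) by ring.
have -> : wq y2 k * (s * sd (diag y2) k.+1) = s * (wq y2 k * sd (diag y2) k.+1) by ring.
by rewrite e1 e2; ring.
Unshelve. all: by end_near. Qed.

End global_inverse.

Section surjectivity.
Context {R : realType} {n : nat}.
Variable lam : 'I_n.+1 -> R.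
Hypothesis lam_mono : forall i j : 'I_n.+1, (i < j)%N -> lam i < lam j.
Variables (c : 'I_n.-1 -> 'rV[R]_n) (d : 'I_n.-1 -> R) (l : seq 'I_n.-1).
Hypothesis gd : good_cuts c d l.
Variables (diag off wp wq : 'rV[R]_n -> 'I_n -> R) (dom : set 'rV[R]_n).
Hypothesis cd : chart_data lam c d l diag off wp wq dom.
Local Notation E := 'rV[R]_n.
Local Notation B := (cut_cube c d l).
Local Notation B0 := (cut_interior c d).
Implicit Types (k m : 'I_n) (x : E).
Local Notation cells0 := (cells0 lam).

(* A datum is a limit of data in the open cell: where two consecutive diagonal
   entries collide they are pulled apart in the ratio prescribed by P and Q. *)
Lemma psi_surjective (a P Q : 'I_n -> R) : valid lam a P Q ->
  exists x, [/\ B x, diag x = a, wp x = P & wq x = Q].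
Proof.
move=> v; have ca := valid_cells v.
pose mid k := (lft lam k + rgt lam k) / 2.
(* Since [Q + P = 1] at a collapsed wall, the new gap is [t * (1 + 2 * t)] and the quotients become
   [(Q + t) / (1 + 2 * t)] and [(P + t) / (1 + 2 * t)]. The extra [t] moves both entries even if [P]
   or [Q] is 0. Entries with no collapsed wall move towards the midpoint of their cell. *)
pose at_ k t := if sd a k.+1 == 0 then a k - t * (Q k + t)
  else if sd a k == 0 then a k + t * (P k + t) else a k + t * (mid k - a k).
pose aE t : E := \row_k at_ k t.
pose Pt k t := if sd a k == 0 then (P k + t) / (1 + 2 * t)
  else (at_ k t - lft lam k) / sd (at_^~ t) k.
pose Qt k t := if sd a k.+1 == 0 then (Q k + t) / (1 + 2 * t)
  else (rgt lam k - at_ k t) / sd (at_^~ t) k.+1.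
have cid : continuous (fun t : R => t) by move=> t; exact: cvg_id.
have ccst (r : R) : continuous (fun _ : R => r) by move=> t; exact: cvg_cst.
have cat k : continuous (at_ k).
  rewrite /at_; case: (sd a k.+1 == 0) => [t|].
    by apply: cvgB; [exact: ccst|apply: cvgM; [exact: cid|apply: cvgD; [exact: ccst|exact: cid]]].
  case: (sd a k == 0) => t.
    by apply: cvgD; [exact: ccst|apply: cvgM; [exact: cid|apply: cvgD; [exact: ccst|exact: cid]]].
  by apply: cvgD; [exact: ccst|apply: cvgM; [exact: cid|exact: ccst]].
have at0 k : at_ k 0 = a k by rewrite /at_ !mul0r subr0 !addr0 !if_same.
have csd w : continuous (fun t => sd (at_^~ t) w).
  rewrite /sd => t; case: (@wallP R n w) => [[i ->]|H].
    have -> : (fun t => wallo (fun i => at_ (hi i) t - at_ (lo i) t) 1 i.+1) =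
      (fun t => at_ (hi i) t - at_ (lo i) t) by apply/funext => s; rewrite walloS.
    by apply: cvgB; exact: cat.
  have -> : (fun t => wallo (fun i => at_ (hi i) t - at_ (lo i) t) 1 w) = fun=> 1.
    by apply/funext => s; rewrite H.
  exact: ccst.
have atE : at_^~ 0 = a by apply/funext => k; rewrite at0.
have c12 (r : R) : continuous (fun t : R => r + t) by move=> t; apply: cvgD; [exact: ccst|exact: cid].
have cfrac (r : R) : (r + t) / (1 + 2 * t) @[t --> (0 : R)] --> r.
  have -> : nbhs r = nbhs ((r + 0) / (1 + 2 * 0)) by rewrite mulr0 !addr0 divr1.
  apply: cvgM; first exact: c12.
  apply: cvgV; first by rewrite mulr0 addr0 oner_neq0.
  by apply: cvgD; [exact: ccst|apply: cvgM; [exact: ccst|exact: cid]].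
have cP k : Pt k t @[t --> (0 : R)] --> P k.
  rewrite /Pt; have [_|s0] := eqVneq (sd a k) 0; first exact: cfrac.
  have -> : nbhs (P k) = nbhs ((at_ k 0 - lft lam k) / sd (at_^~ 0) k).
    by rewrite at0 atE -(valid_P v) mulfK.
  apply: cvgM; first by apply: cvgB; [exact: cat|exact: ccst].
  by apply: cvgV; [rewrite atE|exact: csd].
have cQ k : Qt k t @[t --> (0 : R)] --> Q k.
  rewrite /Qt; have [_|s0] := eqVneq (sd a k.+1) 0; first exact: cfrac.
  have -> : nbhs (Q k) = nbhs ((rgt lam k - at_ k 0) / sd (at_^~ 0) k.+1).
    by rewrite at0 atE -(valid_Q v) mulfK.
  apply: cvgM; first by apply: cvgB; [exact: ccst|exact: cat].
  by apply: cvgV; [rewrite atE|exact: csd].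
have ctr : triple (at_^~ t) (Pt^~ t) (Qt^~ t) @[t --> (0 : R)] --> triple a P Q.
  apply: cvg_mx => i k; rewrite mxE.
  have [i0|i0] := eqVneq i 0.
    have -> : (fun t => triple (at_^~ t) (Pt^~ t) (Qt^~ t) i k) = at_ k.
      by apply/funext => t; rewrite mxE i0 eqxx.
    by rewrite -(at0 k); exact: cat.
  have [i1|i1] := eqVneq i 1.
    have -> // : (fun t => triple (at_^~ t) (Pt^~ t) (Qt^~ t) i k) = Pt k.
    by apply/funext => t; rewrite mxE (negPf i0) i1 eqxx.
  have -> // : (fun t => triple (at_^~ t) (Pt^~ t) (Qt^~ t) i k) = Qt k.
  by apply/funext => t; rewrite mxE (negPf i0) (negPf i1).
have {}ctr : triple (at_^~ t) (Pt^~ t) (Qt^~ t) @[t --> 0^'+] --> triple a P Q.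
  exact: cvg_at_right_filter ctr.
have tpos : \forall t \near (0 : R)^'+, 0 < t by exact: nbhs_right_gt.
have tlt1 : \forall t \near (0 : R)^'+, t < 1 by apply: nbhs_right_lt.
have catr k : at_ k t @[t --> 0^'+] --> a k.
  by rewrite -(at0 k); apply: cvg_at_right_filter; exact: cat.
have near_cell : \forall t \near (0 : R)^'+, forall k, lft lam k < at_ k t < rgt lam k.
  apply: filter_forall => k; have /andP[a1 a2] := ca k; rewrite /at_.
  have h := catr k; rewrite /at_ in h; move: h.
  have P0 := valid_P0 v k; have Q0 := valid_Q0 v k; have lr := lft_rgt lam_mono k.
  have [s0|_] := eqVneq (sd a k.+1) 0.
    have [ak _] := sd_right_left lam_mono ca s0; move=> h.
    have al : lft lam k < a k by rewrite ak.
    have H := @cvgr_gt _ _ _ _ _ _ h _ al.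
    near=> t; have t0 : 0 < t by near: t.
    apply/andP; split; first by near: t; exact: H.
    by rewrite ak gtrBl mulr_gt0 // ltr_wpDl.
  have [s0|_] := eqVneq (sd a k) 0.
    have [ak _] := sd_left_right lam_mono ca s0; move=> h.
    have al : a k < rgt lam k by rewrite ak.
    have H := @cvgr_lt _ _ _ _ _ _ h _ al.
    near=> t; have t0 : 0 < t by near: t.
    apply/andP; split; last by near: t; exact: H.
    by rewrite ak ltrDl mulr_gt0 // ltr_wpDl.
  move=> _; near=> t; have t0 : 0 < t by near: t.
  have t1 : t < 1 by near: t.
  rewrite /mid; have h1 : 0 <= (1 - t) * (a k - lft lam k) by rewrite mulr_ge0 ?subr_ge0 ?(ltW t1).
  have h2 : 0 <= (1 - t) * (rgt lam k - a k) by rewrite mulr_ge0 ?subr_ge0 ?(ltW t1).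
  have h3 : 0 < t * (rgt lam k - lft lam k) by rewrite mulr_gt0 // subr_gt0.
  by apply/andP; split; lra.
have exPt t k : 0 < t -> Pt k t * sd (at_^~ t) k = at_ k t - lft lam k \/ sd (at_^~ t) k = 0.
  move=> t0; rewrite /Pt; have [s0|s0] := eqVneq (sd a k) 0; last first.
    by have [->|s1] := eqVneq (sd (at_^~ t) k) 0; [right|left; rewrite divfK].
  left; have t12 : 1 + 2 * t != 0 by rewrite gt_eqF //; lra.
  case: (@leftP R n k) => [[i ki]|[H _]]; last by move: s0; rewrite /sd H => /eqP; rewrite oner_eq0.
  have s0' : sd a (lo i).+1 = 0 by rewrite -s0 ki.
  have [aq s1] := sd_left_right lam_mono ca s0; have [ap _] := sd_right_left lam_mono ca s0'.
  have sE : sd (at_^~ t) k = at_ k t - at_ (lo i) t by rewrite /sd ki wallo_hi.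
  rewrite sE {1 3}/at_ (negPf s1) s0 eqxx {1}/at_ s0' eqxx aq ap ki -rgt_lo.
  have pq : P (hi i) = 1 - Q (lo i) by rewrite -(valid_sum v i); ring.
  by rewrite pq; field.
have exQt t k : 0 < t -> Qt k t * sd (at_^~ t) k.+1 = rgt lam k - at_ k t \/ sd (at_^~ t) k.+1 = 0.
  move=> t0; rewrite /Qt; have [s0|s0] := eqVneq (sd a k.+1) 0; last first.
    by have [->|s1] := eqVneq (sd (at_^~ t) k.+1) 0; [right|left; rewrite divfK].
  left; have t12 : 1 + 2 * t != 0 by rewrite gt_eqF //; lra.
  case: (@rightP R n k) => [[i ki]|[H _]]; last by move: s0; rewrite /sd H => /eqP; rewrite oner_eq0.
  have s0' : sd a (hi i) = 0 by rewrite -s0 ki.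
  have [aq s1] := sd_left_right lam_mono ca s0'; have [ap _] := sd_right_left lam_mono ca s0.
  have sE : sd (at_^~ t) k.+1 = at_ (hi i) t - at_ k t by rewrite /sd ki wallo_lo.
  rewrite sE {2 3}/at_ s0 eqxx {1}/at_ (negPf s1) s0' eqxx aq ap ki -rgt_lo.
  have pq : P (hi i) = 1 - Q (lo i) by rewrite -(valid_sum v i); ring.
  by rewrite pq; field.
have inK : \forall t \near (0 : R)^'+,
    (psi diag wp wq @` (B `&` setT)) (triple (at_^~ t) (Pt^~ t) (Qt^~ t)).
  near=> t; have t0 : 0 < t by near: t.
  have ct : cells0 (aE t).
    by move=> k; rewrite mxE; move: k; near: t.
  have [x [ix ex] _] := interior_unique gd cd ct.
  have Bx := cut_interior_sub gd ix; exists x => //.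
  have ed : diag x = at_^~ t.
    by apply/funext => k; rewrite -(diag_rowE diag) ex mxE.
  have vx := chart_valid cd Bx.
  have sd0 w : sd (at_^~ t) w != 0 by rewrite -ed; exact: (sd_interior gd cd).
  rewrite /psi ed; congr triple; apply/funext => k.
    apply: (mulIf (sd0 k)); have [->|/eqP] := exPt t k t0; last by rewrite (negPf (sd0 k)).
    by have e := valid_P vx k; rewrite ed in e.
  apply: (mulIf (sd0 k.+1)); have [->|/eqP] := exQt t k t0; last by rewrite (negPf (sd0 k.+1)).
  by have e := valid_Q vx k; rewrite ed in e.
have cK : closed (psi diag wp wq @` (B `&` setT)).
  exact: (psi_image_closed gd cd closedT).
have [x [Bx _] /triple_inj[e1 e2 e3]] := closed_cvg _ cK inK _ ctr.
by exists x.
Unshelve. all: by end_near. Qed.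

End surjectivity.

(** * The diffeomorphism onto the preimage of a cube *)

Section diffeomorphism.
Context {R : realType} {n : nat}.
Variable lam : 'I_n.+1 -> R.
Hypothesis lam_mono : forall i j : 'I_n.+1, (i < j)%N -> lam i < lam j.
Variable sigma : 'S_n.
Variables (c : 'I_n.-1 -> 'rV[R]_n) (d : 'I_n.-1 -> R) (l : seq 'I_n.-1).
Hypothesis gd : good_cuts c d l.
Variables (diag off wp wq : 'rV[R]_n -> 'I_n -> R) (dom : set 'rV[R]_n).
Hypothesis cd : chart_data lam c d l diag off wp wq dom.
Local Notation E := 'rV[R]_n.
Local Notation B := (cut_cube c d l).
Local Notation B0 := (cut_interior c d).
Local Notation D := (mu_preimage lam sigma).
Implicit Types (k m : 'I_n) (x : E).

Definition arrow_of x : 'M[R]_n.+1 :=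
  arrow_mx (\sum_j lam j - \sum_k diag x k) (diag x \o sigma) (off x \o sigma).

(** A linear map that reads the coordinates [data] off the matrix, so a local smooth left inverse of
    [data] extends to an open set of matrices. *)
Definition mx_data (A : 'M[R]_n.+1) : 'rV[R]_(n + n) :=
  row_mx (\row_k A (lift ord0 ((sigma^-1)%g k)) (lift ord0 ((sigma^-1)%g k)))
         (\row_k A 0 (lift ord0 ((sigma^-1)%g k))).

Lemma mx_data_arrow_of x : mx_data (arrow_of x) = data diag off x.
Proof.
congr row_mx; apply/rowP => k; rewrite mxE.
  by rewrite arrow_mxSS eqxx /= permKV mxE.
by rewrite arrow_mx0S /= permKV mxE.
Qed.

Lemma mu_arrow_of x k : mu (arrow_of x) 0 k = diag x (sigma k).
Proof. by rewrite mxE arrow_mxSS eqxx. Qed.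

Lemma Ck_mx_data q : Ck q setT mx_data.
Proof.
have C i j : Ck q setT (fun A : 'M[R]_n.+1 => A i j).
  have -> : (fun A : 'M[R]_n.+1 => A i j) = mxcoord i j by [].
  by apply: Ck_linear; exact: linear_mx_continuous.
apply: Ck_mx => [|i j]; first exact: openT.
case: (split_ordP j) => k ->.
  have -> : (fun A => mx_data A i (lshift n k)) = (fun A : 'M[R]_n.+1 =>
     A (lift ord0 ((sigma^-1)%g k)) (lift ord0 ((sigma^-1)%g k))).
    by apply/funext => A; rewrite row_mxEl mxE.
  exact: C.
have -> : (fun A => mx_data A i (rshift n k)) = (fun A : 'M[R]_n.+1 =>
   A 0 (lift ord0 ((sigma^-1)%g k))).
  by apply/funext => A; rewrite row_mxEr mxE.
exact: C.
Qed.

Lemma Ck_arrow_of q : Ck q dom arrow_of.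
Proof.
have od := chart_open cd; apply: Ck_mx => // i j.
case: (lift0P i) => [->|[k ->]]; case: (lift0P j) => [->|[m ->]].
  have -> : (fun x => arrow_of x 0 0) = fun x => \sum_j lam j - \sum_k diag x k.
    by apply/funext => x; rewrite arrow_mx00.
  apply: CkD => //; first exact: Ck_cst.
  by apply: CkN => //; apply: Ck_sum => // k _; exact: (chart_diag cd).
  have -> : (fun x => arrow_of x 0 (lift ord0 m)) = off^~ (sigma m).
    by apply/funext => x; rewrite arrow_mx0S.
  exact: (chart_off cd).
  have -> : (fun x => arrow_of x (lift ord0 k) 0) = off^~ (sigma k).
    by apply/funext => x; rewrite arrow_mxS0.
  exact: (chart_off cd).
have -> : (fun x => arrow_of x (lift ord0 k) (lift ord0 m)) =
    if k == m then diag^~ (sigma k) else fun=> 0.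
  by apply/funext => x; rewrite arrow_mxSS; case: ifP.
by case: ifP => _; [exact: (chart_diag cd)|exact: Ck_cst].
Qed.

Lemma arrow_of_in x : B x -> D (arrow_of x).
Proof.
move=> Bx; split.
  split; last by move=> k; rewrite arrow_mx0S /=; exact: (chart_off_ge0 cd).
  apply/(arrow_mx_M_StR lam_mono).
  exact: (proj1 (@arrow_eq_reindex _ _ lam _ _ _ sigma) (chart_arrow cd Bx)).
by move=> k; rewrite mu_arrow_of; exact: (valid_cells (chart_valid cd Bx)).
Qed.

Lemma arrow_of_onto A : D A -> exists2 x, B x & arrow_of x = A.
Proof.
move=> [[/(M_StRP lam_mono)[sA arr cpA] off0] cubA].
have AE := arrow_mxE sA arr.
set a0 := A 0 0 in AE; set a' := fun k => A _ _ in AE; set b' := fun k => A _ _ in AE.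
have E1 : arrow_eq lam a0 a' b'.
  by apply/(arrow_mx_M_StR lam_mono)/(M_StRP lam_mono); rewrite -AE.
pose a := a' \o (sigma^-1)%g; pose b := b' \o (sigma^-1)%g.
have aK k : a (sigma k) = a' k by rewrite /a /= permK.
have bK k : b (sigma k) = b' k by rewrite /b /= permK.
have E2 : arrow_eq lam a0 a b.
  apply/(@arrow_eq_reindex _ _ lam a0 a b sigma).
  have -> : a \o sigma = a' by apply/funext => k; rewrite /= aK.
  by have -> : b \o sigma = b' by apply/funext => k; rewrite /= bK.
have ca : in_cells lam a.
  by move=> k; have := cubA ((sigma^-1)%g k); rewrite permKV mxE.
have [P [Q [v bsq]]] := arrow_eq_valid lam_mono ca E2.
have [x [Bx ed ep eq]] := psi_surjective lam_mono gd cd v.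
have eo : off x = b.
  apply/funext => k; have b0 : 0 <= b k by exact: off0.
  apply/eqP; rewrite -(@eqrXn2 _ 2) //; last exact: (chart_off_ge0 cd k Bx).
  by rewrite (chart_square cd k Bx) ed ep eq bsq.
exists x => //; rewrite /arrow_of AE ed eo; congr arrow_mx.
  by rewrite (arrow_eq_trace E2).
  by apply/funext => k; exact: aK.
by apply/funext => k; exact: bK.
Qed.

Lemma arrow_of_inj x x' : B x -> B x' -> arrow_of x = arrow_of x' -> x = x'.
Proof.
move=> Bx Bx' e; have : data diag off x = data diag off x' by rewrite -!mx_data_arrow_of e.
move/(data_eqP lam_mono cd cd Bx Bx') => [e1 e2 e3].
by apply: (psi_injective lam_mono gd cd Bx Bx'); rewrite /psi e1 e2 e3.
Qed.

Lemma arrow_of_continuous : {within B, continuous arrow_of}.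
Proof.
apply: continuous_in_subspaceT => x; rewrite inE => Bx.
exact: (Ck_continuous (Ck_arrow_of 0) (chart_dom cd Bx)).
Qed.

Lemma arrow_of_closed (K : set E) : closed K -> closed (arrow_of @` (B `&` K)).
Proof.
move=> cK; apply: compact_closed; first exact: norm_hausdorff.
apply: continuous_compact; last first.
  by apply: compact_closedI => //; exact: (cut_cube_compact gd).
by apply: continuous_subspaceW arrow_of_continuous => x [].
Qed.

Lemma arrow_of_image : arrow_of @` B = D.
Proof.
apply/seteqP; split=> A; first by move=> [x Bx <-]; exact: arrow_of_in.
by move/arrow_of_onto => [x Bx <-]; exists x.
Qed.

Lemma arrow_of_diffeomorphism : diffeomorphism B D arrow_of.
Proof.
split; last 1 first.
  have ex A : exists x, D A -> B x /\ arrow_of x = A.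
    have [DA|nD] := pselect (D A); last by exists 0.
    by have [x Bx e] := arrow_of_onto DA; exists x.
  pose g A := projT1 (cid (ex A)).
  have gP A : D A -> B (g A) /\ arrow_of (g A) = A by rewrite /g; case: cid.
  exists g; split.
    move=> A0 DA0; have [Bx0 e0] := gP _ DA0.
    have [T [G [N [oT sG oN Nx NP]]]] := data_left_inverse cd Bx0.
    (* The local formula for the inverse is valid only if [g A] lies in [N]. Removing the closed
       image of the points outside [N] ensures this, by global injectivity. *)
    have cK := arrow_of_closed (open_closedC oN).
    exists (~` (arrow_of @` (B `&` ~` N)) `&` mx_data @^-1` T), (fun A => G (mx_data A)).
    have oU : open (~` (arrow_of @` (B `&` ~` N)) `&` mx_data @^-1` T).
      apply: openI; first exact: closed_openC.
      apply: open_comp => // A _; exact: (Ck_continuous (Ck_mx_data 0) I).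
    split=> //.
      split.
        move=> [x [Bx Nx'] e]; apply: Nx'.
        by rewrite (arrow_of_inj Bx Bx0) // e e0.
      by rewrite /= -{1}e0 mx_data_arrow_of; have [] := NP _ Nx.
      move=> q; apply: (@Ck_comp_mx _ _ _ _ _ _ _ T) => //; first by move=> A [].
      by apply: Ck_sub (Ck_mx_data q).
    move=> A DA [nK _]; have [Bx e] := gP _ DA.
    have Ng : N (g A) by apply: contrapT => nN; apply: nK; exists (g A).
    by rewrite -{2}e mx_data_arrow_of; have [_ _ ->] := NP _ Ng.
  by move=> x Bx; have [Bx' e] := gP _ (arrow_of_in Bx); apply: arrow_of_inj.
  by move=> A /gP[].
  apply: (smooth_on_open (U := dom)); [exact: chart_open cd|exact: chart_dom cd|].
  by move=> q; exact: Ck_arrow_of.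
exact: arrow_of_image.
Qed.

End diffeomorphism.

(** * Blowing down the cut facets *)

Section standard_facets.
Context {R : realType} {n : nat}.
Variable lam : 'I_n.+1 -> R.
Variable eta : R.
Hypothesis eta0 : 0 < eta.
Hypothesis eta1 : eta <= 1.
Local Notation E := 'rV[R]_n.
Local Notation c := (@std_normal R n).
Local Notation d := (@std_level R n).
Local Notation B := (cut_cube c d (enum 'I_n.-1)).
Local Notation cutw := (wall_cutoff c d eta).
Local Notation nrm := (cell_weight c d eta).
Local Notation wl := (left_part lam c d eta).
Local Notation wr := (right_part lam c d eta).
Local Notation diag := (diag_map lam c d eta).
Local Notation slope := (wall_slope lam c d eta).
Implicit Types (k m : 'I_n) (z : E) (i j : 'I_n.-1).

Lemma std_facet_bounds z i : B z -> ell c d i z = 0 ->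
  [/\ z 0 (lo i) - z 0 (hi i) = 3 / 2, 1 / 2 <= z 0 (lo i) <= 1 & -1 <= z 0 (hi i) <= - (1 / 2)].
Proof.
move=> [cz _]; rewrite std_ell => h; have /andP[a1 a2] := cz (lo i); have /andP[b1 b2] := cz (hi i).
split; [lra|apply/andP; split; lra|apply/andP; split; lra].
Qed.

(** On the standard facet the preceding cut has slack at least 1, and [eta <= 1], so its cutoff is
    constant there. *)
Lemma std_cutw_lo z i : B z -> ell c d i z = 0 -> cutw z (lo i) = 1.
Proof.
move=> Bz h; have [_ /andP[h1 _] _] := std_facet_bounds Bz h.
rewrite /wall_cutoff; case: (@leftP R n (lo i)) => [[j lj]|[-> //]].
rewrite lj wallo_hi cutoff_ge //; apply: (le_trans eta1).
by rewrite std_ell -lj; have [/(_ (lo j))/andP[_ a2] _] := Bz; lra.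
Qed.

Lemma std_cutw_hi z i : B z -> ell c d i z = 0 -> cutw z (hi i).+1 = 1.
Proof.
move=> Bz h; have [_ _ /andP[_ h1]] := std_facet_bounds Bz h.
rewrite /wall_cutoff; case: (@rightP R n (hi i)) => [[j lj]|[-> //]].
rewrite lj wallo_lo cutoff_ge //; apply: (le_trans eta1).
by rewrite std_ell -lj; have [/(_ (hi j))/andP[a1 _] _] := Bz; lra.
Qed.

Lemma std_cutw_mid z i : ell c d i z = 0 -> cutw z (lo i).+1 = 0.
Proof. by move=> h; rewrite /wall_cutoff wallo_lo h cutoff0. Qed.

Lemma std_cutw_agree z z' i w : B z -> B z' -> ell c d i z = 0 -> ell c d i z' = 0 ->
  (forall k, k != lo i -> k != hi i -> z 0 k = z' 0 k) -> cutw z w = cutw z' w.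
Proof.
move=> Bz Bz' h h' agree.
have L := std_cutw_lo Bz h; have L' := std_cutw_lo Bz' h'.
have H := std_cutw_hi Bz h; have H' := std_cutw_hi Bz' h'.
have M := std_cutw_mid h; have M' := std_cutw_mid h'.
case: (@wallP R n w) => [[j wj]|W]; last by rewrite /wall_cutoff !W.
have [wi|wi] := eqVneq w (lo i); first by rewrite wi L L'.
have [wi2|wi2] := eqVneq w (lo i).+1; first by rewrite wi2 M M'.
have [wi3|wi3] := eqVneq w (hi i).+1; first by rewrite wi3 H H'.
rewrite /wall_cutoff wj !walloS !std_ell; congr (cutoff _ (_ - _ + _)).
  by apply: agree; apply/eqP => /(congr1 val) /= e;
     [move/eqP: wi2; rewrite wj e|move/eqP: wi3; rewrite wj e].
by apply: agree; apply/eqP => /(congr1 val) /= e;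
   [move/eqP: wi; rewrite wj e|move/eqP: wi2; rewrite wj; case: e => ->].
Qed.

(** On facet [i] the entries at [lo i] and [hi i] are pinned to the common eigenvalue, and the other
    cutoffs do not see these two coordinates. The diagonal is thus constant along the interval
    factor. *)
Lemma std_diag_agree z z' i : B z -> B z' -> ell c d i z = 0 -> ell c d i z' = 0 ->
  (forall k, nrm z k != 0) -> (forall k, nrm z' k != 0) ->
  (forall k, k != lo i -> k != hi i -> z 0 k = z' 0 k) -> diag z = diag z'.
Proof.
move=> Bz Bz' h h' N0 N0' agree; apply/funext => k.
have M := std_cutw_mid h; have M' := std_cutw_mid h'.
have [->|kl] := eqVneq k (lo i).
  have e := diag_rgt lam (N0 (lo i)); have e' := diag_rgt lam (N0' (lo i)).
  rewrite M mul0r in e; rewrite M' mul0r in e'; lra.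
have [->|kh] := eqVneq k (hi i).
  rewrite /diag_map -[nat_of_ord (hi i)]/((lo i).+1) M M'; ring.
have cE w := std_cutw_agree w Bz Bz' h h' agree.
by rewrite /diag_map /left_part /cell_weight /xl /xr !cE agree.
Qed.

Lemma std_weights_agree z z' i : B z -> B z' -> ell c d i z = 0 -> ell c d i z' = 0 ->
  z 0 (lo i) = z' 0 (lo i) -> z 0 (hi i) = z' 0 (hi i) ->
  wr z (lo i) / slope z (lo i).+1 = wr z' (lo i) / slope z' (lo i).+1 /\
  wl z (hi i) / slope z (hi i) = wl z' (hi i) / slope z' (hi i).
Proof.
move=> Bz Bz' h h' el eh.
have L := std_cutw_lo Bz h; have L' := std_cutw_lo Bz' h'.
have H := std_cutw_hi Bz h; have H' := std_cutw_hi Bz' h'.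
have M := std_cutw_mid h; have M' := std_cutw_mid h'.
have e1 : wr z (lo i) = wr z' (lo i).
  by rewrite /right_part /cell_weight L L' M M' /xl /xr el.
have e2 : wl z (hi i) = wl z' (hi i).
  by rewrite /left_part /cell_weight -[nat_of_ord (hi i)]/((lo i).+1) M M' H H' /xl /xr eh.
by rewrite /wall_slope !wallo_lo ?wallo_hi e1 e2.
Qed.

End standard_facets.

(** On a standard cut facet the coordinates split: the pair at [lo i] and [hi i] governs the
    quotients at the collapsed wall, the remaining ones govern the diagonal. *)
Definition pair_facets {R : realType} {n : nat} (diag wp wq : 'rV[R]_n -> 'I_n -> R) : Prop :=
  forall (z z' : 'rV[R]_n) i,
    cut_cube std_normal std_level (enum 'I_n.-1) z ->
    cut_cube std_normal std_level (enum 'I_n.-1) z' ->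
    ell std_normal std_level i z = 0 -> ell std_normal std_level i z' = 0 ->
    ((forall k, k != lo i -> k != hi i -> z 0 k = z' 0 k) -> diag z = diag z') /\
    (z 0 (lo i) = z' 0 (lo i) -> z 0 (hi i) = z' 0 (hi i) ->
      wq z (lo i) = wq z' (lo i) /\ wp z (hi i) = wp z' (hi i)).

Lemma exists_std_chart {R : realType} {n : nat} (lam : 'I_n.+1 -> R) :
  (forall i j : 'I_n.+1, (i < j)%N -> lam i < lam j) ->
  exists diag off wp wq dom,
    chart_data lam std_normal std_level (enum 'I_n.-1) diag off wp wq dom /\
    pair_facets diag wp wq.
Proof.
move=> lam_mono; have gd := @std_good R n.
have [e e0 [ef ea]] := cut_separation gd.
pose eta := Num.min e 1.
have eta0 : 0 < eta by rewrite lt_min e0 ltr01.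
have eta1 : eta <= 1 by rewrite ge_min lexx orbT.
have etae : eta <= e by rewrite ge_min lexx.
do 5 eexists; split.
  apply: (exists_chart_with lam_mono gd eta0).
    by move=> x i Bx h; apply: ef Bx (lt_le_trans h etae).
  by move=> x i j Bx h1 h2; exact: (ea x i j Bx (lt_le_trans h1 etae) (lt_le_trans h2 etae)).
move=> z z' i Bz Bz' h h'.
have N0 x k : cut_cube std_normal std_level (enum 'I_n.-1) x ->
   cell_weight std_normal std_level eta x k != 0.
  by move=> Bx; rewrite gt_eqF // (nrm_gt0 gd eta0).
split=> [agree|el eh]; last exact: (std_weights_agree lam eta0 eta1 Bz Bz' h h' el eh).
by apply: (std_diag_agree lam eta0 eta1 Bz Bz' h h') => // k; exact: N0.
Qed.

(** The parameter [theta] selects a point of the interval over every collapsed wall; its extreme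
    values select the ends, which lie on cube facets. *)
Lemma valid_exists {R : realType} {n : nat} (lam : 'I_n.+1 -> R) (theta : R) (a : 'I_n -> R) :
  (forall i j : 'I_n.+1, (i < j)%N -> lam i < lam j) -> 0 <= theta <= 1 ->
  in_cells lam a -> exists P Q, [/\ valid lam a P Q,
    forall k : 'I_n, sd a k = 0 -> P k = 1 - theta &
    forall k : 'I_n, sd a k.+1 = 0 -> Q k = theta].
Proof.
move=> lam_mono /andP[t0 t1] ca.
exists (fun k : 'I_n => if sd a k == 0 then 1 - theta else (a k - lft lam k) / sd a k),
  (fun k : 'I_n => if sd a k.+1 == 0 then theta else (rgt lam k - a k) / sd a k.+1).
have sd0 w := sd_ge0 lam_mono w ca.
have al (k : 'I_n) : 0 <= a k - lft lam k by rewrite subr_ge0; case/andP: (ca k).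
have ar (k : 'I_n) : 0 <= rgt lam k - a k by rewrite subr_ge0; case/andP: (ca k).
split; last 2 first.
  by move=> k ->; rewrite eqxx.
  by move=> k ->; rewrite eqxx.
split=> // [k|k|k|k|i].
  by case: ifP => _; [rewrite subr_ge0|apply: divr_ge0].
  by case: ifP => _ //; apply: divr_ge0.
  case: eqP => [s0|/eqP s0]; last by rewrite divfK.
  by rewrite s0 mulr0; have [-> _] := sd_left_right lam_mono ca s0; rewrite subrr.
  case: eqP => [s0|/eqP s0]; last by rewrite divfK.
  by rewrite s0 mulr0; have [-> _] := sd_right_left lam_mono ca s0; rewrite subrr.
rewrite -[nat_of_ord (hi i)]/((lo i).+1).
have [s0|s0] := eqVneq (sd a (lo i).+1) 0; first by rewrite addrC subrK.
have sE : sd a (lo i).+1 = a (hi i) - a (lo i) by rewrite /sd wallo_lo.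
rewrite -mulrDl sE.
have -> : rgt lam (lo i) - a (lo i) + (a (hi i) - lft lam (hi i)) = a (hi i) - a (lo i).
  by rewrite rgt_lo; ring.
by rewrite divff // -sE.
Qed.

Lemma polytope_image {R : realType} {n : nat} (P : set 'rV[R]_n)
    (f : {linear 'rV[R]_n -> 'rV[R]_n}) : polytope P -> polytope (f @` P).
Proof.
move=> [m [v ->]]; exists m, (f \o v); apply/seteqP; split=> y.
  move=> [x [w [w0 w1 ->]] <-]; exists w; split=> //.
  by rewrite linear_sum; apply: eq_bigr => j _; rewrite linearZ.
move=> [w [w0 w1 ->]]; exists (\sum_j w j *: v j); first by exists w.
by rewrite linear_sum; apply: eq_bigr => j _; rewrite linearZ.
Qed.

Section products.
Context {R : realType} {V W Z : normedModType R}.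

Definition pair_left (w : W) : W * Z := (w, 0).
Definition pair_right (z : Z) : W * Z := (0, z).
Definition proj_left (p : W * Z) : W := p.1.
Definition proj_right (p : W * Z) : Z := p.2.

Lemma linear_pair_left : linear pair_left.
Proof. by move=> a u v; congr pair; rewrite /= ?scaler0 ?addr0. Qed.

Lemma linear_pair_right : linear pair_right.
Proof. by move=> a u v; congr pair; rewrite /= ?scaler0 ?addr0. Qed.

Lemma linear_proj_left : linear proj_left. Proof. by []. Qed.
Lemma linear_proj_right : linear proj_right. Proof. by []. Qed.

HB.instance Definition _ := GRing.isLinear.Build R W (W * Z)%type *:%R pair_left linear_pair_left.
HB.instance Definition _ := GRing.isLinear.Build R Z (W * Z)%type *:%R pair_right linear_pair_right.
HB.instance Definition _ := GRing.isLinear.Build R (W * Z)%type W *:%R proj_left linear_proj_left.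
HB.instance Definition _ := GRing.isLinear.Build R (W * Z)%type Z *:%R proj_right linear_proj_right.

Lemma continuous_pair_left : continuous pair_left.
Proof. by move=> w; apply: cvg_pair; [exact: cvg_id|exact: cvg_cst]. Qed.

Lemma continuous_pair_right : continuous pair_right.
Proof. by move=> w; apply: cvg_pair; [exact: cvg_cst|exact: cvg_id]. Qed.

Lemma continuous_proj_left : continuous proj_left.
Proof. by move=> p; exact: cvg_fst. Qed.

Lemma continuous_proj_right : continuous proj_right.
Proof. by move=> p; exact: cvg_snd. Qed.

Lemma Ck_pair k (U : set V) (f : V -> W) (g : V -> Z) : open U ->
  Ck k U f -> Ck k U g -> Ck k U (fun x => (f x, g x)).
Proof.
move=> oU Cf Cg; apply: (Ck_eq (f := fun x => pair_left (f x) + pair_right (g x))) => //.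
  by move=> x _; congr pair; rewrite /= ?addr0 ?add0r.
apply: CkD => //; apply: Ck_linear_comp => //.
  exact: continuous_pair_left.
exact: continuous_pair_right.
Qed.

End products.

Section interval_factors.
Context {R : realType} {n : nat}.
Local Notation E := 'rV[R]_n.
Local Notation c' := (@std_normal R n).
Local Notation d' := (@std_level R n).
Local Notation B' := (cut_cube c' d' (enum 'I_n.-1)).
Implicit Types (k m : 'I_n) (z w g : E) (i j : 'I_n.-1).

Definition forget i : {linear E -> E} :=
  mulmxr (diag_mx (\row_m ((m != lo i) && (m != hi i))%:R)).

Lemma forgetE i z m : forget i z 0 m = if (m != lo i) && (m != hi i) then z 0 m else 0.
Proof. by rewrite /= mul_mx_diag !mxE; case: ifP; rewrite ?mulr1 ?mulr0. Qed.

(** The affine parametrization of the interval factor: as [t.1] runs through [[-1, 1]], coordinate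
    [lo i] runs through [[1/2, 1]] and its difference with coordinate [hi i] stays 3/2. *)
Definition place i (t : R * E) : E := \row_m
  if m == lo i then 3 / 4 + t.1 / 4 else if m == hi i then t.1 / 4 - 3 / 4 else t.2 0 m.

Lemma lo_neq_hi i : hi i != lo i :> 'I_n.
Proof. by apply/eqP => /(congr1 val) /=; lia. Qed.

Lemma place_lo i t : place i t 0 (lo i) = 3 / 4 + t.1 / 4.
Proof. by rewrite mxE eqxx. Qed.

Lemma place_hi i t : place i t 0 (hi i) = t.1 / 4 - 3 / 4.
Proof. by rewrite mxE (negPf (lo_neq_hi i)) eqxx. Qed.

Lemma place_other i t m : m != lo i -> m != hi i -> place i t 0 m = t.2 0 m.
Proof. by move=> ml mh; rewrite mxE (negPf ml) (negPf mh). Qed.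

Lemma std_cubeP z : B' z <-> cube z /\ forall j, z 0 (lo j) - z 0 (hi j) <= 3 / 2.
Proof.
rewrite (cut_cubeP (@std_good R n)); split=> -[cz H]; split=> // j.
  by have := H j; rewrite std_ell; lra.
by have := H j; rewrite std_ell; lra.
Qed.

(* The constraints of the neighbouring cuts do not interact with the interval
   factor of a cut facet of the standard polytope. *)
Lemma std_replace z w i : B' z -> (forall m, m != lo i -> m != hi i -> w 0 m = z 0 m) ->
  1 / 2 <= w 0 (lo i) <= 1 -> w 0 (lo i) - w 0 (hi i) = 3 / 2 ->
  B' w /\ ell c' d' i w = 0.
Proof.
move=> /std_cubeP[cz H] agree /andP[w1 w2] w3; split; last by rewrite std_ell; lra.
have cw : cube w.
  move=> m; have [->|ml] := eqVneq m (lo i); first by apply/andP; split; lra.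
  have [->|mh] := eqVneq m (hi i); first by apply/andP; split; lra.
  by rewrite agree.
apply/std_cubeP; split=> // j.
have /andP[a1 a2] := cw (lo j); have /andP[b1 b2] := cw (hi j).
have [ji|ji] := eqVneq j i; first by rewrite ji w3.
have [e1|e1] := eqVneq (lo j) (hi i); first by rewrite e1 in a1 a2 *; lra.
have [e2|e2] := eqVneq (hi j) (lo i); first by rewrite e2 in b1 b2 *; lra.
by rewrite !agree.
Qed.

Lemma std_place z i (t : R) : B' z -> -1 <= t <= 1 ->
  B' (place i (t, forget i z)) /\ ell c' d' i (place i (t, forget i z)) = 0.
Proof.
move=> Bz /andP[t1 t2]; apply: (std_replace Bz).
  by move=> m ml mh; rewrite place_other //= forgetE ml mh.
  by rewrite place_lo /=; apply/andP; split; lra.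
by rewrite place_lo place_hi /=; lra.
Qed.

Lemma place_facet z i : B' z -> ell c' d' i z = 0 ->
  -1 <= 4 * z 0 (lo i) - 3 <= 1 /\ place i (4 * z 0 (lo i) - 3, forget i z) = z.
Proof.
move=> Bz h; have [h1 /andP[h2 h3] _] := std_facet_bounds Bz h.
split; first by apply/andP; split; lra.
apply/rowP => m; have [->|ml] := eqVneq m (lo i); first by rewrite place_lo /=; lra.
have [->|mh] := eqVneq m (hi i); first by rewrite place_hi /=; lra.
by rewrite place_other //= forgetE ml mh.
Qed.

Lemma Ck_place q i : Ck q setT (place i).
Proof.
have oT := @openT (R * E)%type.
have C1 (a : R) : Ck q (@setT (R * E)%type) (fun t => t.1 / 4 + a).
  apply: CkD => //; last exact: Ck_cst.
  apply: CkM => //; last exact: Ck_cst.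
  by apply: (@Ck_linear _ _ _ _ _ (@proj_left R R E)); exact: continuous_proj_left.
apply: Ck_mx => // j m; rewrite ord1.
have [->|ml] := eqVneq m (lo i).
  have -> : (fun t => place i t 0 (lo i)) = fun t => t.1 / 4 + 3 / 4.
    by apply/funext => t; rewrite place_lo addrC.
  exact: C1.
have [->|mh] := eqVneq m (hi i).
  have -> : (fun t => place i t 0 (hi i)) = fun t => t.1 / 4 - 3 / 4.
    by apply/funext => t; rewrite place_hi.
  exact: C1.
have -> : (fun t => place i t 0 m) = fun t => (proj_right t) 0 m.
  by apply/funext => t; rewrite place_other.
apply: Ck_coord => //; apply: Ck_linear; exact: continuous_proj_right.
Qed.

Definition unplace i z : R * E := (4 * z 0 (lo i) - 3, forget i z).

Lemma Ck_unplace q i : Ck q setT (unplace i).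
Proof.
have oT := @openT E; apply: Ck_pair => //; last first.
  by apply: Ck_linear; exact: linear_mx_continuous.
apply: CkD => //; last exact: Ck_cst.
by apply: CkM => //; [exact: Ck_cst|exact: Ck_x].
Qed.

Lemma std_polytope : polytope B'.
Proof.
rewrite cut_cubeE; apply: (@polyhedron_polytope _ _ _ _ _ 1) => x; rewrite -cut_cubeE.
exact: cut_cube_bounded.
Qed.

End interval_factors.

Lemma cut_facetP {R : realType} {n : nat} (c : 'I_n.-1 -> 'rV[R]_n) d l i x :
  cut_facet c d l i x <-> cut_cube c d l x /\ ell c d i x = 0.
Proof.
split=> -[Bx h]; split=> //; first by rewrite /ell h subrr.
by apply/eqP; rewrite eq_sym -subr_eq0; apply/eqP.
Qed.

(** * The blow-down map and its fibres *)

Section blowing_down.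
Context {R : realType} {n : nat}.
Variable lam : 'I_n.+1 -> R.
Hypothesis lam_mono : forall i j : 'I_n.+1, (i < j)%N -> lam i < lam j.
Variable sigma : 'S_n.
Variables (c : 'I_n.-1 -> 'rV[R]_n) (d : 'I_n.-1 -> R) (l : seq 'I_n.-1).
Hypothesis gd : good_cuts c d l.
Variables (diag off wp wq : 'rV[R]_n -> 'I_n -> R) (dom : set 'rV[R]_n).
Hypothesis cd : chart_data lam c d l diag off wp wq dom.
Local Notation E := 'rV[R]_n.
Local Notation B := (cut_cube c d l).
Local Notation c' := (@std_normal R n).
Local Notation d' := (@std_level R n).
Local Notation B' := (cut_cube c' d' (enum 'I_n.-1)).
Local Notation phi := (arrow_of lam sigma diag off).
Local Notation p := (fun x => cube_chart lam sigma (mu (phi x))).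
Implicit Types (k m : 'I_n) (x y z w g : E) (i j : 'I_n.-1).

Lemma cube_chartE x k : p x 0 k =
  (2 * diag x k - lft lam k - rgt lam k) / (rgt lam k - lft lam k).
Proof. by rewrite mxE mu_arrow_of permKV. Qed.

Lemma gap_neq0 k : rgt lam k - lft lam k != 0.
Proof. by rewrite subr_eq0 gt_eqF // lft_rgt. Qed.

Lemma cube_chart_eq1 x k : (p x 0 k == 1) = (diag x k == rgt lam k).
Proof.
rewrite cube_chartE -(inj_eq (mulIf (gap_neq0 k))) divfK ?gap_neq0 // mul1r.
by apply/eqP/eqP; lra.
Qed.

Lemma cube_chart_eqN1 x k : (p x 0 k == -1) = (diag x k == lft lam k).
Proof.
rewrite cube_chartE -(inj_eq (mulIf (gap_neq0 k))) divfK ?gap_neq0 // mulN1r.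
by apply/eqP/eqP; lra.
Qed.

Lemma cube_chart_inj x y : p x = p y <-> diag x = diag y.
Proof.
split=> [e|e]; last by apply/rowP => k; rewrite !cube_chartE e.
apply/funext => k; have := congr1 (fun r : E => r 0 k) e; rewrite /= !cube_chartE.
by have g := gap_neq0 k; move=> /(mulIf (invr_neq0 g)); lra.
Qed.

Lemma cube_chart_cube x : B x -> cube (p x).
Proof.
move=> Bx k; have /andP[h1 h2] := valid_cells (chart_valid cd Bx) k.
have g := lft_rgt lam_mono k; rewrite cube_chartE.
rewrite ler_pdivlMr ?subr_gt0 // ler_pdivrMr ?subr_gt0 //.
by apply/andP; split; lra.
Qed.

Lemma cube_chart_onto y (theta : R) : cube y -> 0 <= theta <= 1 ->
  exists x, [/\ B x, p x = y, forall k, sd (diag x) k = 0 -> wp x k = 1 - theta &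
    forall k, sd (diag x) k.+1 = 0 -> wq x k = theta].
Proof.
move=> cy t01; pose a k := lft lam k + (y 0 k + 1) / 2 * (rgt lam k - lft lam k).
have ca : in_cells lam a.
  move=> k; have g := lft_rgt lam_mono k; have /andP[y1 y2] := cy k.
  have h1 : 0 <= (y 0 k + 1) * (rgt lam k - lft lam k) by apply: mulr_ge0; lra.
  have h2 : 0 <= (1 - y 0 k) * (rgt lam k - lft lam k) by apply: mulr_ge0; lra.
  by rewrite /a; apply/andP; split; lra.
have [P [Q [v hP hQ]]] := valid_exists lam_mono t01 ca.
have [x [Bx ed ep eq]] := psi_surjective lam_mono gd cd v.
exists x; split=> //; last 2 first.
  by move=> k; rewrite ed ep; exact: hP.
  by move=> k; rewrite ed eq; exact: hQ.
apply/rowP => k; rewrite cube_chartE ed /a.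
by field; exact: gap_neq0.
Qed.

Lemma facet_right x k : B x -> x 0 k = 1 -> diag x k = rgt lam k.
Proof.
move=> Bx xk; have := valid_Q (chart_valid cd Bx) k.
have /eqP -> : wq x k == 0 by rewrite (chart_right cd k Bx) xk.
by rewrite mul0r => /esym/eqP; rewrite subr_eq0 => /eqP.
Qed.

Lemma facet_left x k : B x -> x 0 k = -1 -> diag x k = lft lam k.
Proof.
move=> Bx xk; have := valid_P (chart_valid cd Bx) k.
have /eqP -> : wp x k == 0 by rewrite (chart_left cd k Bx) xk.
by rewrite mul0r => /esym/eqP; rewrite subr_eq0 => /eqP.
Qed.

Lemma cube_chart_facet (delta : R) k : delta = 1 \/ delta = -1 ->
  p @` (B `&` cube_facet delta k) = cube_facet delta k.
Proof.
move=> dl; apply/seteqP; split=> y.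
  move=> [x [Bx [_ xk]] <-]; split; first exact: cube_chart_cube.
  case: dl xk => ->.
    by move=> /(facet_right Bx) e; apply/eqP; rewrite cube_chart_eq1 e.
  by move=> /(facet_left Bx) e; apply/eqP; rewrite cube_chart_eqN1 e.
move=> [cy yk]; case: dl yk => -> yk.
  (* If the wall to the right of [k] is collapsed, the cube point alone does not fix the lift;
     [theta = 0] makes the quotient [Q] vanish and puts the lift on the facet. For the facet -1 the
     choice is [theta = 1]. *)
  have t01 : 0 <= (0 : R) <= 1 by rewrite lexx ler01.
  have [x [Bx xy _ hq]] := cube_chart_onto cy t01.
  exists x => //; split=> //; have [cx _] := Bx; split=> //.
  apply/eqP; rewrite -(chart_right cd k Bx); have [s0|s0] := eqVneq (sd (diag x) k.+1) 0.
    by rewrite hq.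
  apply/eqP; apply: (mulIf s0); rewrite mul0r (valid_Q (chart_valid cd Bx)).
  have /eqP : p x 0 k == 1 by rewrite xy yk.
  by move/eqP; rewrite cube_chart_eq1 => /eqP ->; rewrite subrr.
have t01 : 0 <= (1 : R) <= 1 by rewrite lexx ler01.
have [x [Bx xy hp _]] := cube_chart_onto cy t01.
exists x => //; split=> //; have [cx _] := Bx; split=> //.
apply/eqP; rewrite -(chart_left cd k Bx); have [s0|s0] := eqVneq (sd (diag x) k) 0.
  by rewrite hp // subrr.
apply/eqP; apply: (mulIf s0); rewrite mul0r (valid_P (chart_valid cd Bx)).
have /eqP : p x 0 k == -1 by rewrite xy yk.
by move/eqP; rewrite cube_chart_eqN1 => /eqP ->; rewrite subrr.
Qed.

Lemma cube_chart_cut_facet i : p @` cut_facet c d l i = cube_face i.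
Proof.
apply/seteqP; split=> y.
  move=> [x /cut_facetP[Bx h] <-].
  have /eqP e : diag x (lo i) == diag x (hi i) by rewrite (chart_wall cd i Bx) h.
  have s0 : sd (diag x) i.+1 = 0 by rewrite /sd walloS e subrr.
  have [e1 e2] := sd_eq0 (valid_cells (chart_valid cd Bx)) s0.
  split; (split; first exact: cube_chart_cube); apply/eqP.
    by rewrite cube_chart_eq1 e1.
  by rewrite cube_chart_eqN1 e2.
move=> [[cy y1] [_ y2]].
have t01 : 0 <= (0 : R) <= 1 by rewrite lexx ler01.
have [x [Bx xy _ _]] := cube_chart_onto cy t01.
exists x => //; apply/cut_facetP; split=> //; apply/eqP; rewrite -(chart_wall cd i Bx).
have : p x 0 (lo i) == 1 by rewrite xy y1.
rewrite cube_chart_eq1 => /eqP ->.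
have : p x 0 (hi i) == -1 by rewrite xy y2.
by rewrite cube_chart_eqN1 => /eqP ->; rewrite rgt_lo.
Qed.

Lemma cube_chart_continuous : {within B, continuous p}.
Proof.
apply: continuous_in_subspaceT => x; rewrite inE => Bx.
have od := chart_open cd.
have C : Ck 0 dom p.
  apply: Ck_mx => // i k; rewrite ord1.
  apply: (Ck_eq (f := fun x => (2 * diag x k + (- lft lam k - rgt lam k)) * (rgt lam k - lft lam k)^-1)) => //.
    by move=> y _; rewrite cube_chartE addrA.
  apply: CkM => //; last exact: Ck_cst.
  apply: CkD => //; last exact: Ck_cst.
  by apply: CkM => //; [exact: Ck_cst|exact: (chart_diag cd)].
exact: (Ck_continuous C (chart_dom cd Bx)).
Qed.

Variables (diag' off' wp' wq' : 'rV[R]_n -> 'I_n -> R) (dom' : set 'rV[R]_n).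
Hypothesis cd' : chart_data lam c' d' (enum 'I_n.-1) diag' off' wp' wq' dom'.
Hypothesis pf : pair_facets diag' wp' wq'.
Local Notation phi' := (arrow_of lam sigma diag' off').
Local Notation D := (mu_preimage lam sigma).

(** Both charts are diffeomorphisms onto the same set of matrices. The transition map preserves
    diagonal and quotients, hence matches cut facets with cut facets and cube facets with cube
    facets. *)
Lemma exists_transfer : exists T S : E -> E,
  [/\ smooth_on B' T, smooth_on B S,
      forall z, B' z -> [/\ B (T z), S (T z) = z, diag (T z) = diag' z,
        wp (T z) = wp' z & wq (T z) = wq' z] &
      forall x, B x -> B' (S x) /\ T (S x) = x].
Proof.
have [sphi iphi [g [sg gphi phig]]] := arrow_of_diffeomorphism lam_mono sigma gd cd.
have [sphi' iphi' [g' [sg' gphi' phig']]] :=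
  arrow_of_diffeomorphism lam_mono sigma (@std_good R n) cd'.
have inD x : B x -> D (phi x) by move=> Bx; rewrite -iphi; exists x.
have inD' x : B' x -> D (phi' x) by move=> Bx; rewrite -iphi'; exists x.
have gB A : D A -> B (g A) by rewrite -iphi => -[x Bx <-]; rewrite gphi.
have gB' A : D A -> B' (g' A) by rewrite -iphi' => -[x Bx <-]; rewrite gphi'.
exists (g \o phi'), (g' \o phi); split.
  exact: (smooth_on_comp_mx inD' sphi' sg).
  exact: (smooth_on_comp_mx inD sphi sg').
  move=> z Bz /=; have DA := inD' z Bz; have BT := gB _ DA.
  have e : phi (g (phi' z)) = phi' z by exact: phig.
  have ed : data diag off (g (phi' z)) = data diag' off' z.
    by rewrite -(mx_data_arrow_of lam sigma) e mx_data_arrow_of.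
  have [e1 e2 e3] := data_eqP lam_mono cd cd' BT Bz ed.
  by split=> //; rewrite e gphi'.
move=> x Bx /=; have DA := inD x Bx; split; first exact: gB'.
by rewrite phig' // gphi.
Qed.

(** With equal diagonals only the quotients at collapsed walls could differ, and these depend on the
    pair of coordinates of the facet alone; then [psi_injective] applies. *)
Lemma std_agree z z' : B' z -> B' z' -> diag' z = diag' z' ->
  (forall i, ell c' d' i z = 0 -> z 0 (lo i) = z' 0 (lo i) /\ z 0 (hi i) = z' 0 (hi i)) ->
  z = z'.
Proof.
move=> Bz Bz' ed agree; apply: (psi_injective lam_mono (@std_good R n) cd' Bz Bz').
have v := chart_valid cd' Bz; have v' := chart_valid cd' Bz'; rewrite -ed in v'.
have W i : sd (diag' z) i.+1 = 0 -> wq' z (lo i) = wq' z' (lo i) /\ wp' z (hi i) = wp' z' (hi i).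
  rewrite /sd walloS => /eqP; rewrite subr_eq0 eq_sym => h.
  have h1 : ell c' d' i z = 0 by apply/eqP; rewrite -(chart_wall cd' i Bz).
  have h2 : ell c' d' i z' = 0 by apply/eqP; rewrite -(chart_wall cd' i Bz') -ed.
  have [el eh] := agree i h1.
  by have [_] := pf Bz Bz' h1 h2; apply.
rewrite /psi -ed; congr triple; apply/funext => k.
  have [s0|s0] := eqVneq (sd (diag' z) k) 0; last first.
    by apply: (mulIf s0); rewrite (valid_P v) (valid_P v').
  case: (@leftP R n k) => [[i ki]|[H _]]; last first.
    by move: s0; rewrite /sd H => /eqP; rewrite oner_eq0.
  by move: s0; rewrite ki => /W[].
have [s0|s0] := eqVneq (sd (diag' z) k.+1) 0; last first.
  by apply: (mulIf s0); rewrite (valid_Q v) (valid_Q v').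
case: (@rightP R n k) => [[i ki]|[H _]]; last first.
  by move: s0; rewrite /sd H => /eqP; rewrite oner_eq0.
by move: s0; rewrite ki => /W[].
Qed.

Section with_transfer.
Variables T S : E -> E.
Hypothesis sT : smooth_on B' T.
Hypothesis sS : smooth_on B S.
Hypothesis TP : forall z, B' z -> [/\ B (T z), S (T z) = z, diag (T z) = diag' z,
  wp (T z) = wp' z & wq (T z) = wq' z].
Hypothesis SP : forall x, B x -> B' (S x) /\ T (S x) = x.

(** The other factor of the standard cut facet, with the two forgotten coordinates set to 0. The
    whole polytope may be projected: by [std_place] every point of it gives a point of the facet
    with the same remaining coordinates. *)
Definition face_factor i : set E := forget i @` B'.
Definition face_product i (t : R * E) : E := T (place i t).

Lemma transfer_wall z i : B' z -> (ell c d i (T z) == 0) = (ell c' d' i z == 0).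
Proof.
move=> Bz; have [BT _ e _ _] := TP Bz.
by rewrite -(chart_wall cd i BT) -(chart_wall cd' i Bz) e.
Qed.

Lemma transfer_left z k : B' z -> (T z 0 k == -1) = (z 0 k == -1).
Proof.
move=> Bz; have [BT _ _ e _] := TP Bz.
by rewrite -(chart_left cd k BT) -(chart_left cd' k Bz) e.
Qed.

Lemma transfer_right z k : B' z -> (T z 0 k == 1) = (z 0 k == 1).
Proof.
move=> Bz; have [BT _ _ _ e] := TP Bz.
by rewrite -(chart_right cd k BT) -(chart_right cd' k Bz) e.
Qed.

Lemma face_product_in i t : I1_times (face_factor i) t ->
  B' (place i t) /\ cut_facet c d l i (face_product i t).
Proof.
case: t => s g [s01 /= [z Bz <-]]; have [Bp h] := std_place i Bz s01.
split=> //; have [BT _ _ _ _] := TP Bp.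
by apply/cut_facetP; split=> //; apply/eqP; rewrite transfer_wall // h.
Qed.

Lemma face_product_onto i x : cut_facet c d l i x ->
  [/\ B' (S x), I1_times (face_factor i) (unplace i (S x)) &
      face_product i (unplace i (S x)) = x].
Proof.
move=> /cut_facetP[Bx h]; have [BS TS] := SP Bx.
have h' : ell c' d' i (S x) = 0.
  by apply/eqP; rewrite -transfer_wall // TS h.
have [h1 h2] := place_facet BS h'; split=> //; last by rewrite /face_product h2.
by split=> //=; exists (S x).
Qed.

Lemma unplace_place i t : I1_times (face_factor i) t -> unplace i (place i t) = t.
Proof.
case: t => s g [s01 /= [z Bz <-]]; rewrite /unplace place_lo /=; congr pair.
  by lra.
apply/rowP => m; rewrite !forgetE; case: ifP => // /andP[ml mh].
by rewrite place_other //= forgetE ml mh.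
Qed.

Lemma face_product_interval i : interval_structure c d l i (face_factor i) (face_product i).
Proof.
split.
  by apply: polytope_image; exact: std_polytope.
  split.
    apply: (smooth_on_comp_mx (B := B')) => //.
      by move=> t /face_product_in[].
    apply: (smooth_on_open (U := setT)) => //; first exact: openT.
    by move=> q; exact: Ck_place.
    apply/seteqP; split=> x; first by move=> [t /face_product_in[_ h] <-].
    by move=> /face_product_onto[_ h1 h2]; exists (unplace i (S x)).
  exists (fun x => unplace i (S x)); split.
    apply: (smooth_on_comp_mx (B := setT)) => //.
      by apply: smooth_on_sub sS => x /cut_facetP[].
    apply: (smooth_on_open (U := setT)) => //; first exact: openT.
    by move=> q; exact: Ck_unplace.
    move=> t tI; have [Bp _] := face_product_in tI; have [_ ST _ _ _] := TP Bp.
    by rewrite ST unplace_place.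
  by move=> x /face_product_onto[].
  apply/seteqP; split=> x.
    move=> [[s g] /= [-> Gg] <-].
    have tI : I1_times (face_factor i) (1, g) by split=> //=; lra.
    have [Bp h] := face_product_in tI; split=> //.
    split; first by case: h => -[].
    by apply/eqP; rewrite transfer_right // place_lo /=; apply/eqP; lra.
  move=> [h [_ xl]]; have [BS [h1 h2] h3] := face_product_onto h.
  exists (unplace i (S x)) => //; split=> //=.
  have /eqP e : S x 0 (lo i) == 1.
    by rewrite -transfer_right // ; case/cut_facetP: h => /SP[_ ->] _; rewrite xl.
  by rewrite e; lra.
apply/seteqP; split=> x.
  move=> [[s g] /= [-> Gg] <-].
  have tI : I1_times (face_factor i) (-1, g) by split=> //=; lra.
  have [Bp h] := face_product_in tI; split=> //.
  split; first by case: h => -[].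
  by apply/eqP; rewrite transfer_left // place_hi /=; apply/eqP; lra.
move=> [h [_ xh]]; have [BS [h1 h2] h3] := face_product_onto h.
exists (unplace i (S x)) => //; split=> //=.
have /eqP e : S x 0 (hi i) == -1.
  by rewrite -transfer_left // ; case/cut_facetP: h => /SP[_ ->] _; rewrite xh.
have hS : ell c' d' i (S x) = 0.
  apply/eqP; rewrite -transfer_wall //.
  by case/cut_facetP: h => /SP[_ ->] ->.
by move: hS; rewrite std_ell e; lra.
Qed.

Local Notation related := (clos_refl_sym_trans _ (same_interval face_factor face_product)).

Lemma same_interval_diag x y : same_interval face_factor face_product x y -> diag x = diag y.
Proof.
move=> [i [s [t [g [sI tI -> ->]]]]].
have [Bs hs] := face_product_in sI; have [Bt ht] := face_product_in tI.
have [_ _ es _ _] := TP Bs; have [_ _ et _ _] := TP Bt.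
rewrite /face_product es et.
have hs' : ell c' d' i (place i (s, g)) = 0.
  by case/cut_facetP: hs => _ /eqP; rewrite transfer_wall // => /eqP.
have ht' : ell c' d' i (place i (t, g)) = 0.
  by case/cut_facetP: ht => _ /eqP; rewrite transfer_wall // => /eqP.
by have [h _] := pf Bs Bt hs' ht'; apply: h => k kl kh; rewrite !place_other.
Qed.

(** One cut facet of the list at a time, the pair of coordinates of [z] is replaced by that of [z'].
    Each replacement moves inside one interval factor and leaves the diagonal, hence the set of cut
    facets containing the point, unchanged. *)
Lemma related_std z' (L : seq 'I_n.-1) z : B' z -> B' z' -> diag' z = diag' z' ->
  (forall i, i \in L -> ell c' d' i z = 0) ->
  (forall i, i \notin L -> ell c' d' i z = 0 ->
    z 0 (lo i) = z' 0 (lo i) /\ z 0 (hi i) = z' 0 (hi i)) ->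
  related (T z) (T z').
Proof.
elim: L z => [|i L IH] z Bz Bz' ed hL hN.
  have -> : z = z' by apply: std_agree => // i; exact: hN.
  exact: rst_refl.
have hi0 : ell c' d' i z = 0 by apply: hL; rewrite inE eqxx.
have hi' : ell c' d' i z' = 0.
  by apply/eqP; rewrite -(chart_wall cd' i Bz') -ed (chart_wall cd' i Bz) hi0.
pose w : E := \row_m if (m == lo i) || (m == hi i) then z' 0 m else z 0 m.
have wo m : m != lo i -> m != hi i -> w 0 m = z 0 m.
  by move=> ml mh; rewrite mxE (negPf ml) (negPf mh).
have wl : w 0 (lo i) = z' 0 (lo i) by rewrite mxE eqxx.
have wh : w 0 (hi i) = z' 0 (hi i) by rewrite mxE eqxx orbT.
have [b1 b2 b3] := std_facet_bounds Bz' hi'.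
have [Bw hw] : B' w /\ ell c' d' i w = 0 by apply: (std_replace Bz wo); rewrite wl ?wh.
have edw : diag' w = diag' z by have [h _] := pf Bw Bz hw hi0; apply: h.
apply: (@rst_trans _ _ _ (T w)).
  apply: rst_step; exists i, (4 * z 0 (lo i) - 3), (4 * w 0 (lo i) - 3), (forget i z).
  have fw : forget i w = forget i z.
    by apply/rowP => m; rewrite !forgetE; case: ifP => // /andP[ml mh]; exact: wo.
  have [h1 h2] := place_facet Bz hi0; have [h3 h4] := place_facet Bw hw.
  rewrite fw in h4; split=> //; try by rewrite /face_product ?h2 ?h4.
    by split=> //=; exists z.
  by split=> //=; exists z.
apply: IH => //.
  by rewrite edw.
  move=> j jL; apply/eqP; rewrite -(chart_wall cd' j Bw) edw (chart_wall cd' j Bz).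
  by rewrite hL // inE jL orbT.
move=> j jL hj; have [->|ji] := eqVneq j i; first by rewrite wl wh.
have hjz : ell c' d' j z = 0.
  by apply/eqP; rewrite -(chart_wall cd' j Bz) -edw (chart_wall cd' j Bw) hj.
have [|e1 e2] := hN j _ hjz; first by rewrite inE negb_or ji jL.
by rewrite !mxE e1 e2 !if_same.
Qed.

Lemma relatedP x y : B x -> B y -> p x = p y <-> related x y.
Proof.
move=> Bx By; rewrite cube_chart_inj; split; last first.
  elim=> [u v|u|u v _ e|u v w _ e1 _ e2] //.
  exact: same_interval_diag.
  by rewrite e1.
move=> e; have [BSx TSx] := SP Bx; have [BSy TSy] := SP By.
have [_ _ ex _ _] := TP BSx; have [_ _ ey _ _] := TP BSy.
rewrite TSx in ex; rewrite TSy in ey; rewrite -TSx -TSy.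
apply: (@related_std _ [seq i <- enum 'I_n.-1 | ell c' d' i (S x) == 0]) => //.
  by rewrite -ex -ey.
  by move=> i; rewrite mem_filter => /andP[/eqP].
by move=> i; rewrite mem_filter mem_enum andbT => /negP h e0; case: h; rewrite e0.
Qed.

End with_transfer.

Theorem arrow_of_blows_down : blows_down c d l p.
Proof.
split.
  exact: cube_chart_continuous.
  apply/seteqP; split=> y; first by move=> [x Bx <-]; exact: cube_chart_cube.
  move=> cy; have t01 : 0 <= (0 : R) <= 1 by rewrite lexx ler01.
  by have [x [Bx xy _ _]] := cube_chart_onto cy t01; exists x.
  by move=> delta k; exact: cube_chart_facet.
  exact: cube_chart_cut_facet.
have [T [S [sT sS TP SP]]] := exists_transfer.
exists face_factor, (face_product T); split.
  by move=> i; exact: (face_product_interval sT sS TP SP).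
move=> x y Bx By; have H := relatedP TP SP Bx By; exact: H.
Qed.

End blowing_down.

(** * Fundamental domains *)

(** An increasing map satisfies [k <= s k]; the inverse is increasing too, which gives the other
    inequality. *)
Lemma mono_perm_id n (s : 'S_n) : (forall k m : 'I_n, (k < m)%N -> (s k < s m)%N) ->
  s = 1%g.
Proof.
have ge (r : 'S_n) : (forall k m : 'I_n, (k < m)%N -> (r k < r m)%N) ->
    forall k : 'I_n, (k <= r k)%N.
  move=> H [j jn]; elim: j jn => [//|j IH] jn.
  have jn' : (j < n)%N := ltn_trans (ltnSn j) jn.
  exact: leq_ltn_trans (IH jn') (H (Ordinal jn') (Ordinal jn) (ltnSn j)).
move=> H; apply/permP => k; rewrite perm1; apply: val_inj; apply/eqP.
rewrite eqn_leq (ge s H) andbT.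
have HV (i m : 'I_n) : (i < m)%N -> ((s^-1)%g i < (s^-1)%g m)%N.
  move=> im; rewrite ltnNge; apply/negP; rewrite leq_eqVlt => /orP[/eqP/val_inj/perm_inj e|/H].
    by rewrite e ltnn in im.
  by rewrite !permKV ltnNge (ltnW im).
by have := ge _ HV (s k); rewrite permK.
Qed.

Section arrow_actions.
Context {K : fieldType} {n : nat}.
Implicit Types (A : 'M[K]_n.+1) (tau : 'S_n).

Lemma perm_conj00 tau A : perm_conj tau A 0 0 = A 0 0.
Proof. by rewrite mxE lift_permV lift_perm_id. Qed.

Lemma perm_conj0S tau A k : perm_conj tau A 0 (lift ord0 k) = A 0 (lift ord0 ((tau^-1)%g k)).
Proof. by rewrite mxE lift_permV lift_perm_id lift_perm_lift. Qed.

Lemma perm_conjS0 tau A k : perm_conj tau A (lift ord0 k) 0 = A (lift ord0 ((tau^-1)%g k)) 0.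
Proof. by rewrite mxE lift_permV lift_perm_id lift_perm_lift. Qed.

Lemma perm_conjSS tau A k m : perm_conj tau A (lift ord0 k) (lift ord0 m) =
  A (lift ord0 ((tau^-1)%g k)) (lift ord0 ((tau^-1)%g m)).
Proof. by rewrite mxE lift_permV !lift_perm_lift. Qed.

Lemma perm_conj1 A : perm_conj 1%g A = A.
Proof.
apply/matrixP => i j; rewrite mxE.
by rewrite (_ : lift_perm ord0 ord0 1 = 1)%g ?lift_perm1 // invg1 !perm1.
Qed.

Lemma diag_conjE m (t : 'rV[K]_m) (A : 'M[K]_m) i j : (forall k, t 0 k != 0) ->
  diag_conj t A i j = t 0 i * A i j / t 0 j.
Proof.
move=> t0; have tV : invmx (diag_mx t) = diag_mx (\row_k (t 0 k)^-1).
  have E : diag_mx t *m diag_mx (\row_k (t 0 k)^-1) = 1%:M.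
    rewrite mulmx_diag; apply/matrixP => a b; rewrite !mxE.
    by case: eqP => [->|]; rewrite ?mulr0n // mulfV.
  have u : diag_mx t \in unitmx by apply: (mulmx1_unit E).1.
  by rewrite -[RHS]mul1mx -(mulVmx u) -mulmxA E mulmx1.
by rewrite /diag_conj tV mul_mx_diag mul_diag_mx !mxE.
Qed.

End arrow_actions.

Section real_domains.
Context {R : realType} {n : nat}.
Variable lam : 'I_n.+1 -> R.
Hypothesis lam_mono : forall i j : 'I_n.+1, (i < j)%N -> lam i < lam j.
Variable sigma : 'S_n.
Local Notation D := (mu_preimage lam sigma).
Implicit Types (A : 'M[R]_n.+1) (tau : 'S_n) (k : 'I_n) (i : 'I_n.-1).

Lemma perm_conj_arrow_mx tau a0 a b : perm_conj tau (arrow_mx a0 a b) =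
  arrow_mx a0 (a \o (tau^-1)%g) (b \o (tau^-1)%g) :> 'M[R]_n.+1.
Proof.
apply/matrixP => i j; case: (lift0P i) => [->|[k ->]]; case: (lift0P j) => [->|[m ->]].
  by rewrite perm_conj00 !arrow_mx00.
  by rewrite perm_conj0S !arrow_mx0S.
  by rewrite perm_conjS0 !arrow_mxS0.
by rewrite perm_conjSS !arrow_mxSS (inj_eq perm_inj).
Qed.

Lemma M_StR_arrow A : M_StR lam A ->
  exists a0 a b, A = arrow_mx a0 a b /\ arrow_eq lam a0 a b.
Proof.
move=> MA; have [sA arr _] := proj1 (M_StRP lam_mono A) MA.
exists (A 0 0), (fun k => A (lift ord0 k) (lift ord0 k)), (fun k => A 0 (lift ord0 k)).
have E := arrow_mxE sA arr; split=> //.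
by apply/(arrow_mx_M_StR lam_mono); rewrite -E.
Qed.

Lemma M_StR_perm tau A : M_StR lam A -> M_StR lam (perm_conj tau A).
Proof.
move=> /M_StR_arrow[a0 [a [b [-> E]]]]; rewrite perm_conj_arrow_mx.
apply/(arrow_mx_M_StR lam_mono).
exact: (proj1 (@arrow_eq_reindex _ _ lam _ _ _ (tau^-1)%g) E).
Qed.

Lemma Q_St_perm tau A : Q_St lam A -> Q_St lam (perm_conj tau A).
Proof.
move=> [MA A0]; split; first exact: M_StR_perm.
by move=> k; rewrite perm_conj0S.
Qed.

Lemma muE A k : mu A 0 k = A (lift ord0 k) (lift ord0 k).
Proof. by rewrite /mu mxE. Qed.

Lemma mu_perm tau A k : mu (perm_conj tau A) 0 k = mu A 0 ((tau^-1)%g k).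
Proof. by rewrite !muE perm_conjSS. Qed.

Lemma sort_mu A : M_StR lam A -> exists tau, cube_sigma lam sigma (mu (perm_conj tau A)).
Proof.
move=> /M_StR_arrow[a0 [a [b [-> E]]]]; have [s hs] := sorting_perm a.
exists (sigma * s)^-1%g => k; rewrite perm_conj_arrow_mx muE arrow_mxSS eqxx /= invgK permM.
exact: (interlacing lam_mono E hs).
Qed.

Lemma Sigma_cover A : Q_St lam A -> exists2 A', D A' & Sigma_orbit A A'.
Proof.
move=> QA; have [tau h] := sort_mu QA.1.
exists (perm_conj tau A); last by exists tau.
by split => //; exact: Q_St_perm.
Qed.

Definition sorted_mu A := forall i,
  mu A 0 ((sigma^-1)%g (lo i)) < mu A 0 ((sigma^-1)%g (hi i)).

Lemma mu_cells A : cube_sigma lam sigma (mu A) ->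
  in_cells lam (fun k => mu A 0 ((sigma^-1)%g k)).
Proof. by move=> h k; have := h ((sigma^-1)%g k); rewrite permKV. Qed.

Lemma sorted_mu_perm A A' tau : D A -> D A' -> sorted_mu A -> sorted_mu A' ->
  (forall k, mu A' 0 k = mu (perm_conj tau A) 0 k) -> tau = 1%g.
Proof.
move=> [_ cA] [_ cA'] sA sA' e.
have lt := cells_lt lam_mono (mu_cells cA) sA; have lt' := cells_lt lam_mono (mu_cells cA') sA'.
(* The permutation relating the two diagonals once both are listed in the order of the cells; strict
   monotonicity of both lists makes it increasing. *)
pose r := (sigma^-1 * tau^-1 * sigma)%g.
have rE k : mu A' 0 ((sigma^-1)%g k) = mu A 0 ((sigma^-1)%g (r k)).
  by rewrite e mu_perm /r !permM permK.
have r1 : r = 1%g.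
  apply: mono_perm_id => k m km; rewrite ltnNge; apply/negP.
  have := lt' _ _ km; rewrite !rE => h.
  rewrite leq_eqVlt => /orP[/eqP/val_inj E|/lt]; first by rewrite E ltxx in h.
  by rewrite ltNge (ltW h).
have : (sigma * r * sigma^-1)%g = tau^-1%g by rewrite /r !mulgA mulgV mul1g mulgK.
by rewrite r1 mulg1 mulgV => /(congr1 invg); rewrite invgK invg1.
Qed.

Lemma sorted_Sigma_unique A A' : D A -> D A' -> sorted_mu A -> sorted_mu A' ->
  Sigma_orbit A A' -> A = A'.
Proof.
move=> DA DA' sA sA' [tau E].
have tau1 : tau = 1%g by apply: (sorted_mu_perm DA DA' sA sA') => k; rewrite E.
by rewrite E tau1 perm_conj1.
Qed.

Lemma mu_continuous : continuous (@mu R n).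
Proof.
move=> A; have C : Ck 0 setT (@mu R n).
  apply: Ck_mx => [|i k]; first exact: openT.
  apply: (Ck_eq (f := fun B : 'M[R]_n.+1 => mxcoord (lift ord0 k) (lift ord0 k) B)).
    exact: openT.
    by move=> B _; rewrite /mxcoord !mxE.
  by apply: Ck_linear; exact: linear_mx_continuous.
exact: (Ck_continuous C I).
Qed.

Lemma cube_sigma_closed : closed (cube_sigma lam sigma).
Proof.
have -> : cube_sigma lam sigma = \bigcap_(k in [set: 'I_n])
   ([set x : 'rV[R]_n | lam (widen_ord (leqnSn n) (sigma k)) <= x 0 k] `&`
    [set x : 'rV[R]_n | x 0 k <= lam (lift ord0 (sigma k))]).
  apply/seteqP; split=> x; first by move=> h k _; apply/andP; exact: h.
  by move=> h k; apply/andP; exact: h.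
apply: closed_bigI => k _; have ck : continuous (fun x : 'rV[R]_n => x 0 k) by exact: continuous_x.
apply: closedI.
  by apply: (@preimage_closed _ _ (fun x : 'rV[R]_n => x 0 k) [set t | _ <= t]) => //; exact: closed_ge.
by apply: (@preimage_closed _ _ (fun x : 'rV[R]_n => x 0 k) [set t | t <= _]) => //; exact: closed_le.
Qed.

Lemma mu_closed : closed (@mu R n @^-1` cube_sigma lam sigma).
Proof. by apply: preimage_closed; [move=> A _; exact: mu_continuous|exact: cube_sigma_closed]. Qed.

Lemma off_nonneg_closed : closed [set A : 'M[R]_n.+1 | forall k : 'I_n, 0 <= A 0 (lift ord0 k)].
Proof.
have -> : [set A : 'M[R]_n.+1 | forall k : 'I_n, 0 <= A 0 (lift ord0 k)] =
   \bigcap_(k in [set: 'I_n]) [set A : 'M[R]_n.+1 | 0 <= A 0 (lift ord0 k)].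
  by apply/seteqP; split=> A h k; [move=> _|]; exact: h.
apply: closed_bigI => k _.
apply: (@preimage_closed _ _ (mxcoord 0 (lift ord0 k)) [set t : R | 0 <= t]); last exact: closed_ge.
by move=> A _; exact: linear_mx_continuous.
Qed.

Lemma perm_conj_continuous tau : continuous (@perm_conj R n tau).
Proof.
move=> A; have C : Ck 0 setT (@perm_conj R n tau).
  apply: Ck_mx => [|i k]; first exact: openT.
  apply: (Ck_eq (f := fun B : 'M[R]_n.+1 => mxcoord ((lift_perm ord0 ord0 tau)^-1%g i)
     ((lift_perm ord0 ord0 tau)^-1%g k) B)).
    exact: openT.
    by move=> B _; rewrite /mxcoord !mxE.
  by apply: Ck_linear; exact: linear_mx_continuous.
exact: (Ck_continuous C I).
Qed.

Lemma diag_conj_arrow_mx (t : 'rV[R]_n.+1) a0 a b :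
  (forall j, t 0 j = 1 \/ t 0 j = -1) -> diag_conj t (arrow_mx a0 a b) =
  arrow_mx a0 a (fun k => t 0 0 * t 0 (lift ord0 k) * b k).
Proof.
move=> t1; have t0 j : t 0 j != 0 by case: (t1 j) => ->; rewrite ?oppr_eq0 oner_eq0.
have tt j : (t 0 j)^-1 = t 0 j by case: (t1 j) => ->; rewrite ?invrN1 ?invr1.
have t2 j : t 0 j * t 0 j = 1 by case: (t1 j) => ->; rewrite ?mulrNN mulr1.
apply/matrixP => i j; rewrite diag_conjE // tt.
case: (lift0P i) => [->|[k ->]]; case: (lift0P j) => [->|[m ->]].
  by rewrite !arrow_mx00 mulrAC t2 mul1r.
  by rewrite !arrow_mx0S mulrAC.
  by rewrite !arrow_mxS0 mulrAC [t 0 0 * _]mulrC.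
rewrite !arrow_mxSS; case: eqP => [->|_]; last by rewrite mulr0 mul0r.
by rewrite mulrAC t2 mul1r.
Qed.

Lemma NR_cover A : M_StR lam A -> exists2 A', D A' & NR_orbit A A'.
Proof.
move=> MA; have [tau h] := sort_mu MA.
have [a0 [a [b [E1 E2]]]] := M_StR_arrow (M_StR_perm tau MA).
pose s (x : R) : R := if 0 <= x then 1 else -1.
pose t : 'rV[R]_n.+1 := \row_j (if unlift ord0 j is Some k then s (b k) else 1).
have s1 x : s x = 1 \/ s x = -1 by rewrite /s; case: ifP; [left|right].
have t1 j : t 0 j = 1 \/ t 0 j = -1 by rewrite mxE; case: unlift => [k|]; [exact: s1|left].
have sb x : s x * x = `|x|.
  rewrite /s; case: (lerP 0 x) => [x0|x0]; first by rewrite mul1r ger0_norm.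
  by rewrite mulN1r ltr0_norm.
have E3 : diag_conj t (perm_conj tau A) = arrow_mx a0 a (fun k => `|b k|).
  rewrite E1 diag_conj_arrow_mx //; congr arrow_mx; apply/funext => k.
  by rewrite !mxE unlift_none liftK mul1r sb.
exists (diag_conj t (perm_conj tau A)); last by exists t, tau.
rewrite E3; split.
  split; last by move=> k; rewrite arrow_mx0S.
  apply/(arrow_mx_M_StR lam_mono); move: E2; rewrite /arrow_eq => ->.
  by congr (_ - _); apply: eq_bigr => k _; rewrite real_normK // num_real.
by move=> k; have := h k; rewrite E1 !muE !arrow_mxSS.
Qed.

Lemma NR_sorted_unique A A' : D A -> D A' -> sorted_mu A -> sorted_mu A' ->
  NR_orbit A A' -> A = A'.
Proof.
move=> DA DA' sA sA' [t [tau [t1 E]]].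
have tau1 : tau = 1%g.
  apply: (sorted_mu_perm DA DA' sA sA') => k; rewrite E.
  have [a0 [a [b [-> _]]]] := M_StR_arrow (M_StR_perm tau DA.1.1).
  by rewrite diag_conj_arrow_mx // !muE !arrow_mxSS.
move: E; rewrite tau1 perm_conj1.
have [[MA A0] _] := DA; have [[_ A0'] _] := DA'.
have [a0 [a [b [Ae _]]]] := M_StR_arrow MA.
rewrite Ae diag_conj_arrow_mx // => E; rewrite E; congr arrow_mx; apply/funext => k.
have := A0 k; rewrite Ae arrow_mx0S; have := A0' k; rewrite E arrow_mx0S.
have [-> | ->] : t 0 0 * t 0 (lift ord0 k) = 1 \/ t 0 0 * t 0 (lift ord0 k) = -1.
  by case: (t1 0) => ->; case: (t1 (lift ord0 k)) => ->; [left|right|right|left]; ring.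
  by rewrite mul1r.
rewrite mulN1r; lra.
Qed.

Section with_chart.
Variables (c : 'I_n.-1 -> 'rV[R]_n) (d : 'I_n.-1 -> R) (l : seq 'I_n.-1).
Hypothesis gd : good_cuts c d l.
Variables (diag off wp wq : 'rV[R]_n -> 'I_n -> R) (dom : set 'rV[R]_n).
Hypothesis cd : chart_data lam c d l diag off wp wq dom.
Local Notation B := (cut_cube c d l).
Local Notation phi := (arrow_of lam sigma diag off).

Lemma sorted_arrow_of x : B x -> (forall i, 0 < ell c d i x) -> sorted_mu (phi x).
Proof.
move=> Bx lx i; rewrite !mu_arrow_of !permKV lt_neqAle.
rewrite (chart_wall cd i Bx) gt_eqF //=.
exact: (in_cells_le lam_mono (valid_cells (chart_valid cd Bx))).
Qed.

(** From an interior point with zero slack one could move along the normal [c i] and leave the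
    half-space. If the normal were 0, the slack would be constant, and it is positive at the vertex
    [const_mx 1]. *)
Lemma interior_ell x i : B° x -> 0 < ell c d i x.
Proof.
move=> ix; have Bx := interior_subset ix.
rewrite lt_neqAle (ell_ge0 gd) // andbT eq_sym; apply/eqP => h.
have dp (y : 'rV[R]_n) : dot y y = \sum_k y 0 k ^+ 2.
  by apply: eq_bigr => k _; rewrite expr2.
have := @segment_cvg R n x (x + c i) B ix => /nbhs_ballP[e /= e0 H].
have Bs : B ((1 - e / 2) *: x + (e / 2) *: (x + c i)).
  by apply: H; rewrite /ball /= sub0r normrN gtr0_norm; lra.
have := ell_ge0 gd i Bs; rewrite ell_conv h mulr0 add0r.
have -> : ell c d i (x + c i) = - dot (c i) (c i).
  by move: h; rewrite /ell dotDr; lra.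
rewrite mulrN oppr_ge0 pmulr_rle0 ?divr_gt0 // => c0.
have {}c0 : dot (c i) (c i) = 0.
  apply/eqP; rewrite eq_le c0 dp; apply: sumr_ge0 => k _; exact: sqr_ge0.
have ci : c i = 0.
  apply/rowP => k; move: c0; rewrite dp => /psumr_eq0P H0.
  by rewrite mxE; apply/eqP; rewrite -sqrf_eq0 H0 // => m _; exact: sqr_ge0.
have := good_const gd (or_introl erefl) i.
by move: h; rewrite /ell ci !dot0l subr0 => ->; rewrite ltxx.
Qed.

Lemma sorted_interior_image A : (phi @` B°) A -> D A /\ sorted_mu A.
Proof.
move=> [x ix <-]; have Bx := interior_subset ix; split.
  exact: (arrow_of_in lam_mono sigma cd).
by apply: sorted_arrow_of => // i; exact: interior_ell.
Qed.

(* Near a matrix with two equal diagonal entries there are matrices in which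
   these entries occur in the wrong order: conjugate by the transposition the
   matrices of D close to the conjugate of the given one. *)
Lemma sorted_interior_in A : interior_in (Q_St lam) D A -> D A /\ sorted_mu A.
Proof.
move=> [DA [U [oU UA UD]]]; split=> // i.
have [[MA A0] cA] := DA; have ca := mu_cells cA.
rewrite lt_neqAle (in_cells_le lam_mono ca) // andbT; apply/eqP => e.
pose u := (sigma^-1)%g (lo i); pose v := (sigma^-1)%g (hi i).
have uv : mu A 0 u = mu A 0 v by [].
pose tau : 'S_n := tperm u v.
have tauV : (tau^-1)%g = tau by rewrite tpermV.
have DA2 : D (perm_conj tau A).
  split; first by apply: Q_St_perm; case: DA.
  move=> k; rewrite mu_perm tauV; suff -> : mu A 0 (tau k) = mu A 0 k by exact: cA.
  by rewrite /tau; case: tpermP => [->|->|] //.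
have [x Bx xA] := arrow_of_onto lam_mono gd cd DA2.
have tauK (M : 'M[R]_n.+1) : perm_conj tau (perm_conj tau M) = M.
  apply/matrixP => a b; case: (lift0P a) => [->|[k ->]]; case: (lift0P b) => [->|[m ->]].
    by rewrite !perm_conj00.
    by rewrite !perm_conj0S tauV tpermK.
    by rewrite !perm_conjS0 tauV tpermK.
  by rewrite !perm_conjSS tauV !tpermK.
have cphi : {for x, continuous (fun y => perm_conj tau (phi y))}.
  apply: continuous_comp; last exact: perm_conj_continuous.
  exact: (Ck_continuous (Ck_arrow_of sigma cd 0) (chart_dom cd Bx)).
have nU : nbhs x (fun y => U (perm_conj tau (phi y))).
  by apply: cphi; rewrite xA tauK; apply: open_nbhs_nbhs.
have [y iy Uy] := cut_interior_dense gd Bx nU.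
have By := cut_interior_sub gd iy.
have Dy := arrow_of_in lam_mono sigma cd By.
have [_ cD] : D (perm_conj tau (phi y)).
  by apply: UD; split; [apply: Q_St_perm; exact: Dy.1|exact: Uy].
have := in_cells_le lam_mono (mu_cells cD) (ltnSn i : (lo i < hi i)%N).
rewrite !mu_perm tauV -/u -/v tpermL tpermR !mu_arrow_of !permKV.
rewrite leNgt => /negP; apply; rewrite lt_neqAle (chart_wall cd i By).
have [_ ly] := iy; rewrite gt_eqF //=.
exact: (in_cells_le lam_mono (valid_cells (chart_valid cd By))).
Qed.

Theorem Sigma_domain : fundamental_domain (Q_St lam) Sigma_orbit D (phi @` B°).
Proof.
split.
  by move=> A [].
  by exists (mu @^-1` cube_sigma lam sigma); first exact: mu_closed.
  exact: Sigma_cover.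
have S A : (interior_in (Q_St lam) D `|` phi @` B°) A -> D A /\ sorted_mu A.
  by move=> [/sorted_interior_in|/sorted_interior_image].
by move=> A A' /S[DA sA] /S[DA' sA']; exact: sorted_Sigma_unique.
Qed.

Theorem NR_domain : fundamental_domain (M_StR lam) NR_orbit D (phi @` B°).
Proof.
split.
  by move=> A [[]].
  exists (mu @^-1` cube_sigma lam sigma `&`
          [set A : 'M[R]_n.+1 | forall k : 'I_n, 0 <= A 0 (lift ord0 k)]).
    by apply: closedI; [exact: mu_closed|exact: off_nonneg_closed].
  by apply/seteqP; split=> A; [move=> [[]]|move=> [MA []]].
  exact: NR_cover.
(* Being interior relative to the larger set [M_StR lam] implies being interior relative to
   [Q_St lam]. *)
have S A : (interior_in (M_StR lam) D `|` phi @` B°) A -> D A /\ sorted_mu A.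
  move=> [[DA [U [oU UA UD]]]|/sorted_interior_image//].
  apply: sorted_interior_in; split=> //; exists U; split=> // A' [[MA' _] UA'].
  exact: UD.
by move=> A A' /S[DA sA] /S[DA' sA']; exact: NR_sorted_unique.
Qed.

End with_chart.

End real_domains.

Lemma mx_affine_continuous (K : numFieldType) n (i j : 'I_n) (a b : K) :
  continuous (fun A : 'M[K]_n => a + b * A i j).
Proof.
move=> A; apply: (@cvgD _ _ _ (nbhs A) (nbhs_filter A)); first exact: (@cvg_cst _ _ _ (nbhs A) (nbhs_filter A)).
by apply: (@cvgM _ _ (nbhs A) (nbhs_filter A)); [exact: (@cvg_cst _ _ _ (nbhs A) (nbhs_filter A))|exact: coord_continuous].
Qed.

(** * The complex Hermitian case *)

Section complex_topology.
Context {R : realType}.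
Local Notation C := (R[i])^o.

Lemma real_complex_norm (x : R) : `|real_complex R x| = real_complex R `|x|.
Proof. by rewrite normc_def /= expr0n addr0 sqrtr_sqr. Qed.

Lemma Re_norm (z : R[i]) : real_complex R (complex.Re `|z|) = `|z|.
Proof. exact: (RRe_real (normr_real z)). Qed.

Lemma Re_norm_ge0 (z : R[i]) : 0 <= complex.Re `|z|.
Proof. by rewrite -ler0c (RRe_real (normr_real z)). Qed.

Lemma real_complex_continuous : continuous (real_complex R : R -> C).
Proof.
move=> x; apply/cvgrPdist_lt => e e0.
have eR : e \is Num.real by exact: gtr0_real.
have e1 : 0 < complex.Re e by rewrite -ltcR /= RRe_real.
have : \forall y \near x, `|x - y| < complex.Re e.
  by apply/nbhs_ballP; exists (complex.Re e).
apply: filterS => y h.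
by rewrite -rmorphB real_complex_norm -(RRe_real eR) ltcR.
Qed.

Lemma complexify_continuous n : continuous (@complexify R n : 'M[R]_n -> 'M[C]_n).
Proof.
move=> A P [Q nQ sQ].
have h : nbhs A (fun B : 'M[R]_n => forall ij : 'I_n * 'I_n, Q ij.1 ij.2 (real_complex R (B ij.1 ij.2))).
  apply: (@filter_forall _ _ (fun ij (B : 'M[R]_n) => Q ij.1 ij.2 (real_complex R (B ij.1 ij.2))) (nbhs A) (nbhs_filter A)) => -[i j] /=.
  have ce : {for A, continuous (fun B : 'M[R]_n => real_complex R (B i j) : C)}.
    apply: (@continuous_comp _ _ _ (fun B : 'M[R]_n => B i j) (real_complex R : R -> C)).
      exact: coord_continuous.
    exact: real_complex_continuous.
  by apply: ce; have := nQ i j; rewrite mxE.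
apply: filterS h => B h; apply: sQ => i j.
by rewrite mxE; exact: (h (i, j)).
Qed.

(* In R[i] the relation 0 <= z says that z is real and nonnegative. *)
Lemma complex_ge0_closed : closed [set z : C | 0 <= z].
Proof.
have -> : [set z : C | 0 <= z] = (fun z : C => `|z| - z) @^-1` [set 0].
  apply/seteqP; split=> z /=; first by move=> z0; rewrite ger0_norm // subrr.
  by move/eqP; rewrite subr_eq0 => /eqP <-; exact: normr_ge0.
apply: preimage_closed; last exact: accessible_closed_set1 (hausdorff_accessible (@norm_hausdorff _ _)) _.
by move=> z _; apply: continuousB; [exact: norm_continuous|exact: id].
Qed.

Lemma mx_ge0_closed n (i j : 'I_n) (a b : C) : closed [set A : 'M[C]_n | 0 <= a + b * A i j].
Proof.
apply: (@preimage_closed _ _ (fun A : 'M[C]_n => a + b * A i j : C) [set z | 0 <= z]); last exact: complex_ge0_closed.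
by move=> A _; exact: (@mx_affine_continuous C).
Qed.

End complex_topology.

Section complex_domain.
Context {R : realType} {n : nat}.
Variable lam : 'I_n.+1 -> R.
Hypothesis lam_mono : forall i j : 'I_n.+1, (i < j)%N -> lam i < lam j.
Variable sigma : 'S_n.
Local Notation D := (mu_preimage lam sigma).
Local Notation rc := (real_complex R).
Implicit Types (A : 'M[R[i]]_n.+1) (tau : 'S_n) (k : 'I_n).

Lemma M_St_conj A i j : M_St lam A -> A i j = ((A j i)^*)%C.
Proof.
move=> [/is_hermitianmxP + _ _]; rewrite expr0 scale1r => H.
by rewrite [in LHS]H !mxE.
Qed.

Lemma M_St_diag A i : M_St lam A -> rc (complex.Re (A i i)) = A i i.
Proof.
move=> /(@M_St_conj A i i); case: (A i i) => a b /= [] h.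
by have -> : b = 0 by lra.
Qed.

Lemma M_St_off A i : M_St lam A -> A 0 i * A i 0 = `|A 0 i| ^+ 2.
Proof. by move=> MA; rewrite (M_St_conj i 0 MA) sqr_normc. Qed.

(** The representative of the torus orbit: the characteristic polynomial depends on each
    off-diagonal entry only through its modulus. *)
Definition re_arrow A : 'M[R]_n.+1 :=
  arrow_mx (complex.Re (A 0 0)) (fun k => complex.Re (A (lift ord0 k) (lift ord0 k)))
    (fun k => complex.Re `|A 0 (lift ord0 k)|).

Lemma complexifyE m (B : 'M[R]_m) i j : complexify B i j = rc (B i j).
Proof. by rewrite mxE. Qed.

Lemma re_arrow_Q A : M_St lam A -> Q_St lam (re_arrow A).
Proof.
move=> MA; split; last by move=> k; rewrite arrow_mx0S; exact: Re_norm_ge0.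
have [_ arr sp] := MA.
apply/(arrow_mx_M_StR lam_mono); rewrite /arrow_eq -arrow_mx_char_poly.
apply: (@map_poly_inj _ _ rc); rewrite map_char_poly.
have -> : map_poly rc (lam_poly lam) = char_poly A.
  move/(spectrumP lam_mono rc): sp => ->; rewrite rmorph_prod.
  by apply: eq_bigr => j _; rewrite rmorphB /= map_polyX map_polyC.
have arr' : arrow_matrix (map_mx rc (re_arrow A)).
  by move=> i j i0 j0 ij; rewrite mxE arrow_mx_arrow.
rewrite !char_poly_arrow // !complexifyE arrow_mx00 M_St_diag //; congr (_ * _ - _).
  by apply: eq_bigr => k _; rewrite complexifyE arrow_mxSS eqxx M_St_diag.
apply: eq_bigr => k _; congr (_ * _).
  by rewrite !complexifyE arrow_mx0S arrow_mxS0 Re_norm M_St_off // expr2.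
by apply: eq_bigr => j _; rewrite !complexifyE arrow_mxSS eqxx M_St_diag.
Qed.

Lemma N_cover A : M_St lam A -> exists2 A', (complexify @` D) A' & N_orbit A A'.
Proof.
move=> MA; have QB := re_arrow_Q MA; set B := re_arrow A in QB *.
have [tau h] := sort_mu lam_mono sigma QB.1.
exists (complexify (perm_conj tau B)).
  by exists (perm_conj tau B); [split; [exact: Q_St_perm|exact: h]|].
(* The phase of [z], set to 1 at [z = 0]. Conjugating with 1 in position 0 and these phases
   elsewhere divides each entry of row 0 by its phase. *)
pose ph (z : R[i]) := if z == 0 then 1 else z / `|z|.
have ph1 z : `|ph z| = 1.
  rewrite /ph; case: eqP => [_|/eqP z0]; first by rewrite normr1.
  by rewrite normrM normfV normr_id divff // normr_eq0.
have ph0 z : ph z != 0 by rewrite -normr_eq0 ph1 oner_eq0.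
have phz z : z / ph z = `|z|.
  rewrite /ph; case: eqP => [->|/eqP z0]; first by rewrite mul0r normr0.
  by rewrite invf_div mulrCA divff ?mulr1.
have phc z : ph z * (z^*)%C = `|z|.
  rewrite /ph; case: eqP => [->|/eqP z0]; first by rewrite rmorph0 mulr0 normr0.
  by rewrite mulrAC -sqr_normc expr2 mulfK // normr_eq0.
pose t : 'rV[R[i]]_n.+1 := \row_j (if unlift ord0 j is Some k then ph (perm_conj tau A 0 (lift ord0 k)) else 1).
have t1 j : `|t 0 j| = 1 by rewrite mxE; case: unlift => [k|]; rewrite ?normr1.
have t0 : t 0 0 = 1 by rewrite mxE unlift_none.
have tS k : t 0 (lift ord0 k) = ph (perm_conj tau A 0 (lift ord0 k)) by rewrite mxE liftK.
exists t, tau; split=> //; apply/matrixP => i j.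
rewrite complexifyE diag_conjE; last by move=> k; rewrite -normr_eq0 t1 oner_eq0.
have [_ arr _] := MA.
case: (lift0P i) => [->|[k ->]]; case: (lift0P j) => [->|[m ->]]; rewrite ?t0 ?tS.
  by rewrite !perm_conj00 arrow_mx00 M_St_diag // mul1r divr1.
  by rewrite mul1r phz !perm_conj0S arrow_mx0S Re_norm.
  by rewrite divr1 perm_conjS0 (M_St_conj _ _ MA) !perm_conjS0 perm_conj0S phc arrow_mxS0 Re_norm.
rewrite !perm_conjSS arrow_mxSS (inj_eq perm_inj); have [->|km] := eqVneq k m.
  by rewrite M_St_diag // mulrAC divff ?mul1r.
by rewrite arr ?mulr0 ?mul0r ?rmorph0 // (inj_eq lift_inj) (inj_eq perm_inj).
Qed.

(** Positivity in [R[i]] forces row 0 to be real; being Hermitian and of arrow shape does the rest,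
    so closed inequalities on finitely many entries cut out the real section. *)
Lemma N_domain_closed : exists2 E : set 'M[(R[i])^o]_n.+1, closed E &
  complexify @` D = M_St lam `&` E.
Proof.
pose lo k := rc (lam (widen_ord (leqnSn n) (sigma k))).
pose hi k := rc (lam (lift ord0 (sigma k))).
pose E : set 'M[(R[i])^o]_n.+1 := \bigcap_(k in [set: 'I_n])
  ([set A : 'M[(R[i])^o]_n.+1 | 0 <= 0 + 1 * A 0 (lift ord0 k)] `&`
   ([set A : 'M[(R[i])^o]_n.+1 | 0 <= - lo k + 1 * A (lift ord0 k) (lift ord0 k)] `&`
    [set A : 'M[(R[i])^o]_n.+1 | 0 <= hi k + (-1) * A (lift ord0 k) (lift ord0 k)])).
have EP (A : 'M[R[i]]_n.+1) : E A <-> forall k, [/\ 0 <= A 0 (lift ord0 k),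
    lo k <= A (lift ord0 k) (lift ord0 k) & A (lift ord0 k) (lift ord0 k) <= hi k].
  split=> [h k|h k _]; first have [/= h1 [h2 h3]] := h k I; last have [h1 h2 h3] := h k.
    by move: h1 h2 h3; rewrite mul1r mulN1r add0r mul1r addrC !subr_ge0.
  by rewrite /= mul1r mulN1r add0r mul1r addrC !subr_ge0.
exists E.
  apply: closed_bigI => k _.
  by apply: closedI; [|apply: closedI]; exact: mx_ge0_closed.
apply/seteqP; split=> [_ [B [[MB B0] cB] <-]|A [MA /EP EA]].
  split=> //; apply/EP => k; rewrite !complexifyE ler0c !lecR.
  by split=> //; have := cB k; rewrite muE => /andP[].
have QB := re_arrow_Q MA; exists (re_arrow A).
  split=> // k; have [_ h1 h2] := EA k.
  by rewrite muE arrow_mxSS eqxx -!lecR M_St_diag // h1.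
have [_ arr _] := MA.
apply/matrixP => i j; rewrite complexifyE.
case: (lift0P i) => [->|[k ->]]; case: (lift0P j) => [->|[m ->]].
  by rewrite arrow_mx00 M_St_diag.
  by have [h _ _] := EA m; rewrite arrow_mx0S Re_norm ger0_norm.
  have [h _ _] := EA k; rewrite arrow_mxS0 Re_norm (M_St_conj _ 0 MA).
  by rewrite ger0_norm //; move: h; case: (A 0 _) => a b /ger0_Im /= ->; rewrite oppr0.
rewrite arrow_mxSS; have [->|km] := eqVneq k m; first by rewrite M_St_diag.
by rewrite rmorph0 arr // (inj_eq lift_inj).
Qed.

(** Phases cancel on the diagonal and do not change moduli, and both rows 0 consist of nonnegative
    reals off the diagonal. So once the permutation is trivial nothing can change. *)
Lemma N_sorted_unique (B B' : 'M[R]_n.+1) : D B -> D B' -> sorted_mu sigma B -> sorted_mu sigma B' ->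
  N_orbit (complexify B) (complexify B') -> B = B'.
Proof.
move=> DB DB' sB sB' [t [tau [t1 E]]].
have t0 j : t 0 j != 0 by rewrite -normr_eq0 t1 oner_eq0.
have Ee i j : rc (B' i j) = t 0 i * rc (perm_conj tau B i j) / t 0 j.
  by rewrite -complexifyE E diag_conjE // !mxE.
have Ed i : B' i i = perm_conj tau B i i.
  by apply: (@complexI R); rewrite Ee mulrAC divff ?mul1r.
have tau1 : tau = 1%g.
  by apply: (sorted_mu_perm lam_mono DB DB' sB sB') => k; rewrite !muE Ed.
have [[MB B0] _] := DB; have [[MB' B0'] _] := DB'.
have Eo k : B' 0 (lift ord0 k) = B 0 (lift ord0 k).
  apply: (@complexI R).
  have -> : rc (B 0 (lift ord0 k)) = `|rc (B 0 (lift ord0 k))| by rewrite ger0_norm ?ler0c.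
  have -> : rc (B' 0 (lift ord0 k)) = `|rc (B' 0 (lift ord0 k))| by rewrite ger0_norm ?ler0c.
  by rewrite Ee tau1 perm_conj1 !normrM normfV !t1 invr1 mul1r mulr1.
move: Ed Eo; rewrite tau1 perm_conj1.
have [a0 [a [b [-> _]]]] := M_StR_arrow lam_mono MB.
have [a0' [a' [b' [-> _]]]] := M_StR_arrow lam_mono MB'.
move=> Ed Eo; have := Ed 0; rewrite !arrow_mx00 => ->; congr arrow_mx; apply/funext => k.
  by have := Ed (lift ord0 k); rewrite !arrow_mxSS eqxx.
by have := Eo k; rewrite !arrow_mx0S.
Qed.

Variables (c : 'I_n.-1 -> 'rV[R]_n) (d : 'I_n.-1 -> R) (l : seq 'I_n.-1).
Hypothesis gd : good_cuts c d l.
Variables (diag off wp wq : 'rV[R]_n -> 'I_n -> R) (dom : set 'rV[R]_n).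
Hypothesis cd : chart_data lam c d l diag off wp wq dom.
Local Notation B := (cut_cube c d l).
Local Notation phi := (arrow_of lam sigma diag off).

Theorem N_domain : @fundamental_domain 'M[(R[i])^o]_n.+1 (M_St lam) N_orbit
  (complexify @` D) (complexify @` (phi @` B°)).
Proof.
split.
  by move=> _ [A [[MA _] _] <-].
  exact: N_domain_closed.
  exact: N_cover.
have S (A : 'M[(R[i])^o]_n.+1) :
    (@interior_in 'M[(R[i])^o]_n.+1 (M_St lam) (complexify @` D) `|` complexify @` (phi @` B°)) A ->
    exists A' : 'M[R]_n.+1, [/\ A = complexify A', D A' & sorted_mu sigma A'].
  move=> [[[A' DA' eA] [U [oU UA UD]]]|[A' /(sorted_interior_image lam_mono gd cd)[DA sA] <-]].
    exists A'; rewrite -eA; suff [] : D A' /\ sorted_mu sigma A' by [].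
    apply: (sorted_interior_in lam_mono gd cd); split=> //.
    (* An open set of complex matrices is pulled back to real ones, where [sorted_interior_in] has
       already treated the interior. *)
    exists (@complexify R n.+1 @^-1` U); split.
      by apply: (@open_comp _ _ (@complexify R n.+1 : _ -> 'M[(R[i])^o]_n.+1)) => // ? _; exact: complexify_continuous.
      by rewrite /= eA.
    move=> M [[MM _] UM]; have [M' DM' e] : (complexify @` D) (complexify M) by apply: UD.
    suff <- : M' = M by [].
    by apply/matrixP => i j; apply: (@complexI R); rewrite -!complexifyE e.
  by exists A'.
move=> _ _ /S[A [-> DA sA]] /S[A' [-> DA' sA']] E.
by rewrite (N_sorted_unique DA DA' sA sA' E).
Qed.

End complex_domain.

Theorem proposition5p6 (R : realType) (n : nat) (hn : (1 <= n)%N)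
    (lam : 'I_n.+1 -> R)
    (hlam : forall i j : 'I_n.+1, (i < j)%N -> lam i < lam j)
    (sigma : 'S_n)
    (c : 'I_n.-1 -> 'rV[R]_n) (d : 'I_n.-1 -> R) (l : seq 'I_n.-1)
    (hB : cut_sequence c d l) :
  let B := cut_cube c d l in
  let D := mu_preimage lam sigma in
  exists phi : 'rV[R]_n -> 'M[R]_n.+1,
    [/\ diffeomorphism B D phi,
        blows_down c d l (fun x => cube_chart lam sigma (mu (phi x))),
        fundamental_domain (Q_St lam) Sigma_orbit D (phi @` B^°),
        @fundamental_domain 'M[(R[i])^o]_n.+1 (M_St lam) N_orbit
          (complexify @` D) (complexify @` (phi @` B^°)) &
        fundamental_domain (M_StR lam) NR_orbit D (phi @` B^°)].
Proof.
have gd := cut_sequence_good hB.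
have [diag [off [wp [wq [dom cd]]]]] := exists_chart hlam gd.
(* The chart of the standard polytope enters the blow-down only, where its literal product facets
   are transported to the given cuts. *)
have [diag' [off' [wp' [wq' [dom' [cd' pf]]]]]] := exists_std_chart hlam.
move=> B D; exists (arrow_of lam sigma diag off); split.
  exact: (arrow_of_diffeomorphism hlam sigma gd cd).
  exact: (arrow_of_blows_down hlam sigma gd cd cd' pf).
  exact: (Sigma_domain hlam sigma gd cd).
  exact: (N_domain hlam sigma gd cd).
exact: (NR_domain hlam sigma gd cd).
Qed.
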